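(* Let $G=SL(3,\mathbf R)$, $K=SO(3)$, $i\in\{1,2\}$, $\nu_i\in\mathbf C$, $k\ge2$ an integer, $\sigma_i=D_k$, and let $\pi_{(\nu_i,\sigma_i)}$ be the corresponding $P_i$-principal series representation (all notation as in the context). Let $-2\le m\le2$ and let $l\in\mathbf Z_{\ge0}$ be such that $l\ge 0$, $l+m\ge0$, $d(\sigma_i;l)>0$ and $d(\sigma_i;l+m)>0$. Then $$\mathfrak C_{l,m}\mathbf T_i(\sigma_i;l)=\mathbf T_i(\sigma_i;l+m)\cdot R(\Gamma^i_{l,m}),$$ where $R(\Gamma^i_{l,m})$ is the $d(\sigma_i;l+m)\times d(\sigma_i;l)$ complex matrix representing $\Gamma^i_{l,m}$ with respect to the induced bases $\{T_i(l;p)\mid0\le p\le l-k,\ p\equiv l-k\bmod2\}$ and $\{T_i(l+m;p)\mid0\le p\le l+m-k,\ p\equiv l+m-k\bmod2\}$ (ordered by increasing $p$), and it is given explicitly by $$\begin{pmatrix} O_{n,d} \\ R(\Gamma^i_{l,m}) \end{pmatrix}=\begin{pmatrix} D_{-1}(d-1) \\ O_{1,d} \end{pmatrix}+\begin{pmatrix} O_{1,d} \\ D_0(d-1) \end{pmatrix}+\begin{pmatrix} O_{2,d-1}&O_{2,1} \\ D_1(d-2)&O_{d-1,1} \end{pmatrix}.$$ Here $d=d(\sigma_i;l)$, $\delta\in\{0,1\}$ with $\delta\equiv l-k\bmod2$, $O_{a,b}$ is the $a\times b$ zero matrix (blocks with $a=0$ or $b=0$ are omitted), $D_j(c)=\mathrm{diag}(\gamma_{\delta,j},\gamma_{2+\delta,j},\dots,\gamma_{2c+\delta,j})$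 (diagonal of size $c+1$, empty if $c=-1$), $$\gamma_{p,1}=(-1)^{i+1}(k-l+p)A_{[2l,2m;2l-p+m-2,0]},$$ $$\gamma_{p,0}=\frac{(-1)^i}3\Big(\nu_i+\rho_i+lm-3+\frac{m(m+1)}2\Big)A_{[2l,2m;2l-p+m,2]},$$ $$\gamma_{p,-1}=(-1)^{i+1}(k+l-p)A_{[2l,2m;2l-p+m+2,4]},$$ with $\rho_i=3$ and $A_{[2l,2m;q,j]}=0$ for $q<0$ or $q>2(l+m)$, and $$n=\begin{cases}(2-m)/2&\text{if }m\in\{0,\pm2\},\\ (3-m)/2&\text{if }m=\pm1,\ l-k\text{ even},\\ (1-m)/2&\text{if }m=\pm1,\ l-k\text{ odd}.\end{cases}$$
   Context: **Representations of $K$.** $V_l$ ($l\in\mathbf{Z}_{\ge0}$) is the space of homogeneous polynomials of degree $l$ in $\mathbf{C}[x,y]$; $g\in SU(2)$ with $g^{-1}=\begin{pmatrix} a&b \\ -\bar b&\bar a \end{pmatrix}$ acts by $\tau_l(g)f(x,y)=f(ax+by,-\bar bx+\bar ay)$. Standard basis: $v^{(l)}_q=x^qy^{l-q}$ ($0\le q\le l$); $v^{(l)}_q=0$ for other $q$. The double covering $\varphi:SU(2)\to SO(3)=K$ is $$\varphi\begin{pmatrix} p+\sqrt{-1}q&r+\sqrt{-1}s \\ -r+\sqrt{-1}s&p-\sqrt{-1}q \end{pmatrix}=\begin{pmatrix} p^2+q^2-r^2-s^2&-2(ps-qr)&2(pr+qs) \\ 2(ps+qr)&p^2-q^2+r^2-s^2&-2(pq-rs)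 \\ -2(pr-qs)&2(pq+rs)&p^2-q^2-r^2+s^2 \end{pmatrix},$$ and $\tau_{2l}$ descends via $\varphi$ to an irreducible representation of $K$, still denoted $(\tau_{2l},V_{2l})$. Two bases of $V_{2l}$ are used: $v^{(2l)}_{1,q}=v^{(2l)}_q$ and $v^{(2l)}_{2,q}=\tau_{2l}(u_c)v^{(2l)}_{1,q}=2^{-l}(x+y)^q(-x+y)^{2l-q}$, where $u_c=\begin{pmatrix} 0&0&-1 \\ 0&1&0 \\ 1&0&0 \end{pmatrix}$; $v^{(2l)*}_{1,q}$ and $v^{(2l)*}_{2,q}$ are the respective dual bases of $V_{2l}^*$, and $\langle\,,\rangle$ is the canonical pairing. **$\mathfrak p_{\mathbf C}$.** $\mathfrak p$ = symmetric matrices in $\mathfrak{sl}(3,\mathbf R)$, with $K$ acting by $\mathrm{Ad}$. Basis of $\mathfrak p_{\mathbf C}$: $X_0=\begin{pmatrix} 0&0&0 \\ 0&1&-\sqrt{-1} \\ 0&-\sqrt{-1}&-1 \end{pmatrix}$, $X_1=-\frac12\begin{pmatrix} 0&\sqrt{-1}&1 \\ \sqrt{-1}&0&0 \\ 1&0&0 \end{pmatrix}$, $X_2=-\frac13\mathrm{diag}(2,-1,-1)$, $X_3=-\frac12\begin{pmatrix} 0&\sqrt{-1}&-1 \\ \sqrt{-1}&0&0 \\ -1&0&0 \end{pmatrix}$, $X_4=\begin{pmatrix} 0&0&0 \\ 0&1&\sqrt{-1} \\ 0&\sqrt{-1}&-1 \end{pmatrix}$. The map $v^{(4)}_j\mapsto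 X_j$ is a $K$-isomorphism $V_4\cong\mathfrak p_{\mathbf C}$, used to identify the two. **Coefficients.** $A_{[l,2m;k,i]}=a(l,2m;k,i)/d(l,2m)$ ($0\le i\le4$, $0\le k\le l+2m$; here $k,i$ are just indices), where the lists $a(\cdot;k,0),\dots,a(\cdot;k,4)$ are: - $m=2$: $(l+4-k)(l+3-k)(l+2-k)(l+1-k)$; $4(l+4-k)(l+3-k)(l+2-k)k$; $6(l+4-k)(l+3-k)k(k-1)$; $4(l+4-k)k(k-1)(k-2)$; $k(k-1)(k-2)(k-3)$; $d(l,4)=(l+4)(l+3)(l+2)(l+1)$. - $m=1$: $(l+2-k)(l+1-k)(l-k)$; $-(l+2-k)(l+1-k)(l-4k)$; $-3(l+2-k)(l-2k+2)k$; $-(3l-4k+8)k(k-1)$; $-k(k-1)(k-2)$; $d(l,2)=(l+2)(l+1)l$. - $m=0$: $(l-k)(l-1-k)$; $-2(l-k)(l-2k-1)$; $l^2-6kl+6k^2-l$; $2(l-2k+1)k$; $k(k-1)$; $d(l,0)=l(l-1)$. - $m=-1$: $l-k-2$; $-(3l-4k-6)$; $3(l-2k-2)$; $-(l-4k-2)$; $-k$; $d(l,-2)=l-2$. - $m=-2$: $1;-4;6;-4;1$; $d(l,-4)=1$. (In the claim these are used with $l$ replaced by $2l$.) The map $I^{2l}_{2m}:V_{2(l+m)}\to V_{2l}\otimes\mathfrak p_{\mathbf C}$, $I^{2l}_{2m}(v^{(2(l+m))}_q)=\sum_{j=0}^4A_{[2l,2m;q,j]}\,v^{(2l)}_{q+2-m-j}\otimes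 X_j$, is an injective $K$-homomorphism whenever $V_{2(l+m)}$ occurs in $V_{2l}\otimes V_4$. **Discrete series $D_k$ of $SL^\pm(2,\mathbf R)=\{g\in GL(2,\mathbf R)\mid\det g=\pm1\}$.** $D_k=\mathrm{Ind}_{SL(2,\mathbf R)}^{SL^\pm(2,\mathbf R)}(D_k^+)$, with $D_k^+$ the discrete series of $SL(2,\mathbf R)$ of Blattner parameter $k\ge2$. It is realized on a Hilbert space $V_{D_k}$ whose $O(2)$-finite vectors have basis $\chi_p$, $p\in\{\pm(k+2\alpha)\mid\alpha\in\mathbf Z_{\ge0}\}$ (mutually orthogonal), with $D_k(\kappa_t)\chi_p=e^{\sqrt{-1}pt}\chi_p$ for $\kappa_t=\begin{pmatrix} \cos t&\sin t \\ -\sin t&\cos t \end{pmatrix}$, $D_k(\mathrm{diag}(1,-1))\chi_p=\chi_{-p}$, and, for the differential, $D_k(x_\pm)\chi_p=(k\pm p)\chi_{p\pm2}$, where $x_\pm=\begin{pmatrix} 1&\pm\sqrt{-1} \\ \pm\sqrt{-1}&-1 \end{pmatrix}$. **$P_i$-principal series.** $P_1$ (resp. $P_2$) is the standard block upper triangular parabolic subgroup of $G$ with blocks of sizes $(1,2)$ (resp. $(2,1)$), $N_i$ its unipotent radical, $A_i=\exp(\mathbf RH^{(i)})$ with $H^{(1)}=\mathrm{diag}(2,-1,-1)$, $H^{(2)}=\mathrm{diag}(1,1,-2)$, $M_i=m_i(SL^\pm(2,\mathbf R))$ with $m_1(h)=\mathrm{diag}(\det(h)^{-1},h)$, $m_2(h)=\mathrm{diag}(h,\det(h)^{-1})$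 (block diagonal). $D_k$ is regarded as a representation of $M_i$ via $m_i$. $\nu_i\in\mathrm{Hom}_{\mathbf R}(\mathbf RH^{(i)},\mathbf C)$ is identified with $\nu_i(H^{(i)})\in\mathbf C$; $\rho_i=3$; $e^{\nu_i+\rho_i}(\exp(sH^{(i)}))=e^{s(\nu_i+\rho_i)}$. $\pi_{(\nu_i,\sigma_i)}$ is the right regular representation of $G$ on $H_{(\nu_i,\sigma_i)}$, the completion, for $\|f\|^2=\int_K\|f(x)\|^2dx$, of the space of smooth $f:G\to V_{D_k}$ with $f(namx)=e^{\nu_i+\rho_i}(a)\sigma_i(m)f(x)$ ($n\in N_i$, $a\in A_i$, $m\in M_i$, $x\in G$). $H_{(\nu_i,\sigma_i),K}$ is its space of $K$-finite vectors; the differential is denoted by the same symbol $\pi_{(\nu_i,\sigma_i)}$. **Elementary functions.** For $0\le p\le l-k$, $p\equiv l-k\bmod2$, $0\le q\le2l$, $t_i(l;p,q)\in H_{(\nu_i,\sigma_i),K}$ is the element whose restriction to $K$ is $$x\mapsto\langle v^{(2l)*}_{i,2l-p},\tau_{2l}(x)v^{(2l)}_{1,q}\rangle\otimes\chi_{l-p}+c_i\langle v^{(2l)*}_{i,p},\tau_{2l}(x)v^{(2l)}_{1,q}\rangle\otimes\chi_{p-l},\qquad c_1=(-1)^p,\ c_2=(-1)^l.$$ $T_i(l;p)={}^t(t_i(l;p,0),\dots,t_i(l;p,2l))$, identified with the $K$-homomorphism $V_{2l}\to H_{(\nu_i,\sigma_i),K}$, $v^{(2l)}_{1,q}\mapsto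 t_i(l;p,q)$; these form a basis (the induced basis) of $\mathrm{Hom}_K(V_{2l},H_{(\nu_i,\sigma_i),K})$. $d(\sigma_i;l)$ is the number of integers $p$ with $0\le p\le l-k$, $p\equiv l-k\bmod2$. $\mathbf T_i(\sigma_i;l)$ is the $(2l+1)\times d(\sigma_i;l)$ matrix with columns $T_i(l;p)$ in increasing order of $p$. **The operators.** For $\eta\in\mathrm{Hom}_K(V_{2l},H_{(\nu_i,\sigma_i),K})$ let $\tilde\eta(v\otimes X)=\pi_{(\nu_i,\sigma_i)}(X)\eta(v)$ and $\Gamma^i_{l,m}(\eta)=\tilde\eta\circ I^{2l}_{2m}\in\mathrm{Hom}_K(V_{2(l+m)},H_{(\nu_i,\sigma_i),K})$. For a column vector $\mathbf v={}^t(v_0,\dots,v_{2l})$ with entries in $H_{(\nu_i,\sigma_i),K}$, $\mathfrak C_{l,m}\mathbf v$ is the column vector of length $2(l+m)+1$ whose $(q+1)$-th entry ($0\le q\le2(l+m)$) is $\sum_{j=0}^4A_{[2l,2m;q,j]}\pi_{(\nu_i,\sigma_i)}(X_j)v_{q+2-m-j}$ (with $v_r=0$ for $r<0$ or $r>2l$); $\mathfrak C_{l,m}$ acts on a matrix column by column. *)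

(* Defs.v *)
From HB Require Import structures.
From mathcomp Require Import all_boot all_order all_algebra.
From mathcomp Require Import complex.
From mathcomp Require Import all_classical all_reals all_analysis.
From mathcomp Require Import -(notations) mpoly.

Set Implicit Arguments.
Unset Strict Implicit.
Unset Printing Implicit Defensive.

Import Order.TTheory GRing.Theory Num.Theory numFieldNormedType.Exports.
Local Open Scope classical_set_scope.
Local Open Scope ring_scope.
Local Open Scope complex_scope.

Definition mx_of_rows (T : nmodType) (m n : nat) (s : seq (seq T)) : 'M[T]_(m, n) :=
  \matrix_(a, b) nth 0 (nth [::] s a) b.

Definition SL3 (R : realType) : set 'M[R]_3 := [set g | \det g = 1].
Definition SO3 (R : realType) : set 'M[R]_3 :=
  [set x | x *m x^T = 1%:M /\ \det x = 1].
Definition SLpm (R : realType) : set 'M[R]_2 :=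
  [set h | \det h = 1 \/ \det h = -1].
Definition O2 (R : realType) : set 'M[R]_2 := [set h | h *m h^T = 1%:M].
Definition SU2 (R : realType) : set 'M[R[i]]_2 :=
  [set g | g *m (map_mx Num.conj g)^T = 1%:M /\ \det g = 1].

Definition mexp (R : realType) (n : nat) (X : 'M[R]_n.+1) : 'M[R]_n.+1 :=
  lim (series (fun j => (j`!%:R)^-1 *: X ^+ j) @ \oo).

Definition cexp (R : realType) (z : R[i]) : R[i] :=
  (expR (complex.Re z))%:C * (cos (complex.Im z) +i* sin (complex.Im z)).

(* Difference quotient at [t = 0] of a curve [c : R -> V]; the scalars of [V]
   are complex while the parameter is real, hence the cast. *)
Definition diffquot (R : realType) (V : normedModType R[i]) (c : R -> V) : R -> V :=
  fun t => (t^-1)%:C *: (c t - c 0).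

Definition orbit_curve (R : realType) (n : nat) (V : normedModType R[i])
    (act : 'M[R]_n.+1 -> V -> V) (X : 'M[R]_n.+1) (v : V) : R -> V :=
  fun t => act (mexp (t *: X)) v.

Definition dact (R : realType) (n : nat) (V : normedModType R[i])
    (act : 'M[R]_n.+1 -> V -> V) (X : 'M[R]_n.+1) (v : V) : V :=
  lim (diffquot (orbit_curve act X v) @ 0^').

(* Complex-linear extension of the differential to the complexified Lie
   algebra. *)
Definition cdact (R : realType) (n : nat) (V : normedModType R[i])
    (act : 'M[R]_n.+1 -> V -> V) (Z : 'M[R[i]]_n.+1) (v : V) : V :=
  dact act (map_mx (@complex.Re R) Z) v
  + 'i%C *: dact act (map_mx (@complex.Im R) Z) v.

Definition finite_vector (R : realType) (n : nat) (V : lmodType R[i])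
    (L : set 'M[R]_n) (act : 'M[R]_n -> V -> V) (v : V) : Prop :=
  exists (N : nat) (b : 'I_N -> V), forall x, L x ->
    exists c : 'I_N -> R[i], act x v = \sum_j c j *: b j.

(* [V_l]: homogeneous polynomials of degree [l] in [C[x, y]]. *)
Definition hpoly (R : realType) (l : nat) := dhomog 2 R[i] l.

Definition poly_X (R : realType) : mpoly 2 R[i] := mpolyX _ (mnm1 (0 : 'I_2)).
Definition poly_Y (R : realType) : mpoly 2 R[i] := mpolyX _ (mnm1 (1 : 'I_2)).

(* [v^{(l)}_q = x^q y^(l - q)] for [0 <= q <= l] and [0] for the other integers;
   [indhomog] is the retraction of [C[x, y]] onto [V_l] sending a polynomial
   that is not homogeneous of degree [l] to [0]. *)
Definition vq (R : realType) (l : nat) (q : int) : hpoly R l :=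
  if (0 <= q <= l%:Z)%R then indhomog l (poly_X R ^+ absz q * poly_Y R ^+ (l - absz q))
  else 0.

Definition tau (R : realType) (l : nat) (g : 'M[R[i]]_2) (f : hpoly R l) : hpoly R l :=
  let h := invmx g in
  indhomog l (comp_mpoly [tuple h 0 0 *: poly_X R + h 0 1 *: poly_Y R;
                                h 1 0 *: poly_X R + h 1 1 *: poly_Y R] f).

Definition phi (R : realType) (g : 'M[R[i]]_2) : 'M[R]_3 :=
  let p := complex.Re (g 0 0) in let q := complex.Im (g 0 0) in
  let r := complex.Re (g 0 1) in let s := complex.Im (g 0 1) in
  mx_of_rows 3 3
   [:: [:: p ^+ 2 + q ^+ 2 - r ^+ 2 - s ^+ 2; - (2 * (p * s - q * r)); 2 * (p * r + q * s)];
       [:: 2 * (p * s + q * r); p ^+ 2 - q ^+ 2 + r ^+ 2 - s ^+ 2; - (2 * (p * q - r * s))];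
       [:: - (2 * (p * r - q * s)); 2 * (p * q + r * s); p ^+ 2 - q ^+ 2 - r ^+ 2 + s ^+ 2]].

(* [tau_{2l}] descended to [SO(3)]: apply [tau_{2l}] to any [SU(2)]-lift. *)
Definition tauK (R : realType) (l : nat) (x : 'M[R]_3) : hpoly R (2 * l) -> hpoly R (2 * l) :=
  tau (xget 1%:M [set g | SU2 g /\ phi g = x]).

Definition uc (R : realType) : 'M[R]_3 :=
  mx_of_rows 3 3 [:: [:: 0; 0; -1]; [:: 0; 1; 0]; [:: 1; 0; 0]].

Inductive parabolic := P1 | P2.
Definition pnum (i : parabolic) : nat := if i is P1 then 1 else 2.

Definition vbasis_K (R : realType) (i : parabolic) (l : nat) :
    (2 * l).+1.-tuple (hpoly R (2 * l)) :=
  [tuple (if i is P1 then vq R (2 * l) q%:Z else tauK (uc R) (vq R (2 * l) q%:Z))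
     | q < (2 * l).+1].

(* [< v^{(2l)*}_{i,r}, f >]. *)
Definition vdual (R : realType) (i : parabolic) (l r : nat) (f : hpoly R (2 * l)) : R[i] :=
  coord (vbasis_K R i l) (inord r) f.

Definition Xp (R : realType) (j : nat) : 'M[R[i]]_3 :=
  nth 0
   [:: mx_of_rows 3 3 [:: [:: 0; 0; 0]; [:: 0; 1; - 'i%C]; [:: 0; - 'i%C; -1]];
       - 2^-1 *: mx_of_rows 3 3 [:: [:: 0; 'i%C; 1]; [:: 'i%C; 0; 0]; [:: 1; 0; 0]];
       - 3^-1 *: mx_of_rows 3 3 [:: [:: 2; 0; 0]; [:: 0; -1; 0]; [:: 0; 0; -1]];
       - 2^-1 *: mx_of_rows 3 3 [:: [:: 0; 'i%C; -1]; [:: 'i%C; 0; 0]; [:: -1; 0; 0]];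
       mx_of_rows 3 3 [:: [:: 0; 0; 0]; [:: 0; 1; 'i%C]; [:: 0; 'i%C; -1]]] j.

Definition acoef (l m k : int) : seq int :=
  if m == 2 then
    [:: (l + 4 - k) * (l + 3 - k) * (l + 2 - k) * (l + 1 - k);
        4 * (l + 4 - k) * (l + 3 - k) * (l + 2 - k) * k;
        6 * (l + 4 - k) * (l + 3 - k) * k * (k - 1);
        4 * (l + 4 - k) * k * (k - 1) * (k - 2);
        k * (k - 1) * (k - 2) * (k - 3)]
  else if m == 1 then
    [:: (l + 2 - k) * (l + 1 - k) * (l - k);
        - (l + 2 - k) * (l + 1 - k) * (l - 4 * k);
        - 3 * (l + 2 - k) * (l - 2 * k + 2) * k;
        - (3 * l - 4 * k + 8) * k * (k - 1);
        - k * (k - 1) * (k - 2)]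
  else if m == 0 then
    [:: (l - k) * (l - 1 - k);
        - 2 * (l - k) * (l - 2 * k - 1);
        l ^+ 2 - 6 * k * l + 6 * k ^+ 2 - l;
        2 * (l - 2 * k + 1) * k;
        k * (k - 1)]
  else if m == -1 then
    [:: l - k - 2;
        - (3 * l - 4 * k - 6);
        3 * (l - 2 * k - 2);
        - (l - 4 * k - 2);
        - k]
  else if m == -2 then [:: 1; -4; 6; -4; 1]
  else [::].

Definition dcoef (l m : int) : int :=
  if m == 2 then (l + 4) * (l + 3) * (l + 2) * (l + 1)
  else if m == 1 then (l + 2) * (l + 1) * l
  else if m == 0 then l * (l - 1)
  else if m == -1 then l - 2
  else 1.

(* [A_{[l,2m;k,j]}], equal to [0] for [k < 0] or [k > l + 2m]. *)
Definition Acoef (R : realType) (l m k : int) (j : nat) : R[i] :=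
  if (0 <= k <= l + 2 * m)%R then
    (nth 0 (acoef l m k) j)%:~R / (dcoef l m)%:~R
  else 0.

Definition lplus (l : nat) (m : int) : nat := absz (l%:Z + m).

(* [I^{2l}_{2m} : V_{2(l+m)} -> V_{2l} (x) p_C].  As [X_0, ..., X_4] is a basis
   of [p_C], the tensor [\sum_j w_j (x) X_j] is encoded by the family [w]. *)
Definition Imap (R : realType) (l : nat) (m : int) (w : hpoly R (2 * lplus l m)) :
    {ffun 'I_5 -> hpoly R (2 * l)} :=
  [ffun j : 'I_5 => \sum_(q < (2 * lplus l m).+1)
     vdual P1 q w *: (Acoef R (2 * l)%:Z m q%:Z j
                      *: vq R (2 * l) (q%:Z + 2 - m - j%:Z))].

Definition chi_index (k : nat) : set int :=
  [set p | exists a : nat, p = (k + 2 * a)%:Z \/ p = - (k + 2 * a)%:Z].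

Definition kappa (R : realType) (t : R) : 'M[R]_2 :=
  mx_of_rows 2 2 [:: [:: cos t; sin t]; [:: - sin t; cos t]].

Definition refl2 (R : realType) : 'M[R]_2 :=
  mx_of_rows 2 2 [:: [:: 1; 0]; [:: 0; -1]].

Definition x_plus (R : realType) : 'M[R[i]]_2 :=
  mx_of_rows 2 2 [:: [:: 1; 'i%C]; [:: 'i%C; -1]].
Definition x_minus (R : realType) : 'M[R[i]]_2 :=
  mx_of_rows 2 2 [:: [:: 1; - 'i%C]; [:: - 'i%C; -1]].

(* A realization of the discrete series [D_k] of [SL^{+-}(2, R)]: a unitary
   representation on a Hilbert space, strongly continuous, with an orthogonal
   basis [chi_p] of its [O(2)]-finite vectors on which [O(2)] and the
   differential act by the standard formulas.  These data determine the
   underlying (Lie algebra, [O(2)])-module, hence [D_k] up to unitary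
   equivalence.  [ds_chi p] is meaningful for [p \in chi_index k] only; the
   coefficient [k +- p] vanishes when [p +- 2] leaves this set. *)
Record discrete_series (R : realType) (k : nat) := DiscreteSeries {
  ds_space :> completeNormedModType R[i];
  ds_dot : {dot ds_space for @Num.conj R[i]};
  ds_dotE : forall v : ds_space, `|v| ^+ 2 = ds_dot v v;
  ds_act : 'M[R]_2 -> ds_space -> ds_space;
  ds_linear : forall h, SLpm h -> linear (ds_act h);
  ds_act1 : forall v, ds_act 1%:M v = v;
  ds_actM : forall g h v, SLpm g -> SLpm h ->
    ds_act (g *m h) v = ds_act g (ds_act h v);
  ds_unitary : forall h u v, SLpm h ->
    ds_dot (ds_act h u) (ds_act h v) = ds_dot u v;
  ds_continuous : forall v, {within @SLpm R, continuous (fun h => ds_act h v)};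
  ds_chi : int -> ds_space;
  ds_chi_neq0 : forall p, chi_index k p -> ds_chi p != 0;
  ds_chi_ortho : forall p q, chi_index k p -> chi_index k q -> p != q ->
    ds_dot (ds_chi p) (ds_chi q) = 0;
  ds_chi_span : forall v, finite_vector (@O2 R) ds_act v <->
    exists (N : nat) (e : 'I_N -> int) (c : 'I_N -> R[i]),
      (forall j, chi_index k (e j)) /\ v = \sum_j c j *: ds_chi (e j);
  ds_kappa : forall p t, chi_index k p ->
    ds_act (kappa t) (ds_chi p) = cexp ('i%C * p%:~R * t%:C) *: ds_chi p;
  ds_refl : forall p, chi_index k p -> ds_act (refl2 R) (ds_chi p) = ds_chi (- p);
  ds_derivable : forall p (X : 'M[R]_2), chi_index k p -> \tr X = 0 ->
    cvg (diffquot (orbit_curve ds_act X (ds_chi p)) @ 0^');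
  ds_xplus : forall p, chi_index k p ->
    cdact ds_act (x_plus R) (ds_chi p) = (k%:Z + p)%:~R *: ds_chi (p + 2);
  ds_xminus : forall p, chi_index k p ->
    cdact ds_act (x_minus R) (ds_chi p) = (k%:Z - p)%:~R *: ds_chi (p - 2)
}.

Arguments ds_act {R k} _ _ _.
Arguments ds_chi {R k} _ _.

Definition Nrad (R : realType) (i : parabolic) : set 'M[R]_3 :=
  match i with
  | P1 => [set n | exists u : 'M[R]_(1, 2),
             n = block_mx (1%:M : 'M[R]_1) u 0 (1%:M : 'M[R]_2) :> 'M[R]_(1 + 2)]
  | P2 => [set n | exists u : 'M[R]_(2, 1),
             n = block_mx (1%:M : 'M[R]_2) u 0 (1%:M : 'M[R]_1) :> 'M[R]_(2 + 1)]
  end.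

Definition Hmx (R : realType) (i : parabolic) : 'M[R]_3 :=
  match i with
  | P1 => mx_of_rows 3 3 [:: [:: 2; 0; 0]; [:: 0; -1; 0]; [:: 0; 0; -1]]
  | P2 => mx_of_rows 3 3 [:: [:: 1; 0; 0]; [:: 0; 1; 0]; [:: 0; 0; -2]]
  end.

Definition m_emb (R : realType) (i : parabolic) (h : 'M[R]_2) : 'M[R]_3 :=
  match i with
  | P1 => block_mx ((\det h)^-1%:M : 'M[R]_1) 0 0 h : 'M[R]_(1 + 2)
  | P2 => block_mx h 0 0 ((\det h)^-1%:M : 'M[R]_1) : 'M[R]_(2 + 1)
  end.

Definition rho (R : realType) : R[i] := 3.

(* Smoothness on [SL(3, R)], tested on left-invariant vector fields: all the
   iterated derivatives along them exist and are continuous.  Only the values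
   of [f] on [SL(3, R)] matter. *)
Fixpoint C_n (R : realType) (V : normedModType R[i]) (n : nat) (f : 'M[R]_3 -> V) : Prop :=
  {within @SL3 R, continuous f} /\
  if n is n'.+1 then
    forall X : 'M[R]_3, \tr X = 0 -> exists f' : 'M[R]_3 -> V,
      (forall g, SL3 g -> diffquot (fun t => f (g *m mexp (t *: X))) @ 0^' --> f' g)
      /\ C_n n' f'
  else True.

Definition smooth (R : realType) (V : normedModType R[i]) (f : 'M[R]_3 -> V) : Prop :=
  forall n, C_n n f.

Definition smooth_induced (R : realType) (i : parabolic) (nu : R[i]) (k : nat)
    (sigma : discrete_series R k) : set ('M[R]_3 -> sigma) :=
  [set f | smooth f /\
     forall n s h x, Nrad i n -> SLpm h -> SL3 x ->
       f (n *m mexp (s *: Hmx R i) *m m_emb i h *m x)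
       = cexp (s%:C * (nu + rho R)) *: ds_act sigma h (f x)].

Definition borel_M3 (R : realType) := g_sigma_algebraType (@open 'M[R]_3).

(* A Haar measure of [K = SO(3)], given as a Borel measure on [3 x 3] matrices
   of which only the values on subsets of [K] matter. *)
Record haar_SO3 (R : realType) := HaarSO3 {
  haar :> {measure set (borel_M3 R) -> \bar R};
  haar_gt0 : (0 < haar (@SO3 R))%E;
  haar_fin : (haar (@SO3 R) < +oo)%E;
  haar_inv : forall (x : 'M[R]_3) (A : set (borel_M3 R)),
    SO3 x -> measurable A -> A `<=` @SO3 R ->
    haar [set y | exists2 z : 'M[R]_3, A z & y = x *m z] = haar A
}.

(* [H_(nu_i, sigma_i)] with [pi_(nu_i, sigma_i)]: a completion of the smooth
   functions for the [L^2(K)]-norm, i.e. a complete space with an isometric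
   linear map [ps_incl] of dense image, and the continuous extension [ps_act] of
   right translation. *)
Record principal_series (R : realType) (i : parabolic) (nu : R[i]) (k : nat)
    (sigma : discrete_series R k) (mu : haar_SO3 R) := PrincipalSeries {
  ps_space :> completeNormedModType R[i];
  ps_incl : ('M[R]_3 -> sigma) -> ps_space;
  ps_incl_linear : forall (a : R[i]) (f g : 'M[R]_3 -> sigma),
    smooth_induced i nu f -> smooth_induced i nu g ->
    ps_incl (fun x => a *: f x + g x) = a *: ps_incl f + ps_incl g;
  ps_incl_norm : forall f : 'M[R]_3 -> sigma, smooth_induced i nu f ->
    (((complex.Re `|ps_incl f|) ^+ 2)%:E
     = \int[mu]_(x in @SO3 R) ((complex.Re `|f x|) ^+ 2)%:E)%E;
  ps_incl_dense : closure (ps_incl @` @smooth_induced R i nu k sigma) = setT;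
  ps_act : 'M[R]_3 -> ps_space -> ps_space;
  ps_act_linear : forall g, SL3 g -> linear (ps_act g);
  ps_act_continuous : forall g, SL3 g -> continuous (ps_act g);
  ps_act_incl : forall (g : 'M[R]_3) (f : 'M[R]_3 -> sigma),
    SL3 g -> smooth_induced i nu f ->
    ps_act g (ps_incl f) = ps_incl (fun x => f (x *m g))
}.

Arguments ps_incl {R i nu k sigma mu} _ _.
Arguments ps_act {R i nu k sigma mu} _ _ _.

(* The [p] with [0 <= p <= l - k] and [p = l - k mod 2], in increasing order;
   truncated subtraction makes the list empty when [l < k]. *)
Definition plist (k l : nat) : seq nat :=
  [seq p <- iota 0 (l.+1 - k) | odd p == odd (l - k)].

Definition dsig (k l : nat) : nat := size (plist k l).

Definition pval (k l : nat) (a : nat) : nat := nth 0%N (plist k l) a.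

Definition csign (R : realType) (i : parabolic) (l p : nat) : R[i] :=
  if i is P1 then (-1) ^+ p else (-1) ^+ l.

Definition t_K (R : realType) (i : parabolic) (k : nat) (sigma : discrete_series R k)
    (l p q : nat) (x : 'M[R]_3) : sigma :=
  vdual i (2 * l - p) (tauK x (vq R (2 * l) q%:Z)) *: ds_chi sigma (l%:Z - p%:Z)
  + (csign R i l p * vdual i p (tauK x (vq R (2 * l) q%:Z)))
    *: ds_chi sigma (p%:Z - l%:Z).

(* [t_i(l;p,q)] as a function on the group: the [K]-finite element of the
   smooth induced space with the prescribed restriction to [K]. *)
Definition t_fun (R : realType) (i : parabolic) (nu : R[i]) (k : nat)
    (sigma : discrete_series R k) (mu : haar_SO3 R)
    (pi : principal_series i nu sigma mu) (l p q : nat) : 'M[R]_3 -> sigma :=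
  xget (fun=> 0) [set f : 'M[R]_3 -> sigma |
    [/\ smooth_induced i nu f,
        finite_vector (@SO3 R) (ps_act pi) (ps_incl pi f) &
        forall x, SO3 x -> f x = t_K i sigma l p q x]].

Definition t_el (R : realType) (i : parabolic) (nu : R[i]) (k : nat)
    (sigma : discrete_series R k) (mu : haar_SO3 R)
    (pi : principal_series i nu sigma mu) (l p q : nat) : pi :=
  ps_incl pi (t_fun pi l p q).

(* [T_i(l;p)], i.e. [v^{(2l)}_{1,q} |-> t_i(l;p,q)] extended linearly. *)
Definition T_hom (R : realType) (i : parabolic) (nu : R[i]) (k : nat)
    (sigma : discrete_series R k) (mu : haar_SO3 R)
    (pi : principal_series i nu sigma mu) (l p : nat) (f : hpoly R (2 * l)) : pi :=
  \sum_(q < (2 * l).+1) vdual P1 q f *: t_el pi l p q.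

Definition T_mx (R : realType) (i : parabolic) (nu : R[i]) (k : nat)
    (sigma : discrete_series R k) (mu : haar_SO3 R)
    (pi : principal_series i nu sigma mu) (l : nat) :
    'M[ps_space pi]_((2 * l).+1, dsig k l) :=
  \matrix_(q, a) t_el pi l (pval k l a) q.

Definition mulmx_scal (C : pzRingType) (V : lmodType C) (a b c : nat)
    (T : 'M[V]_(a, b)) (A : 'M[C]_(b, c)) : 'M[V]_(a, c) :=
  \matrix_(q, j) \sum_e A e j *: T q e.

(* [eta~ (\sum_j w_j (x) X_j) = \sum_j pi(X_j) (eta w_j)]. *)
Definition eta_tilde (R : realType) (i : parabolic) (nu : R[i]) (k : nat)
    (sigma : discrete_series R k) (mu : haar_SO3 R)
    (pi : principal_series i nu sigma mu) (l : nat)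
    (eta : hpoly R (2 * l) -> pi) (w : {ffun 'I_5 -> hpoly R (2 * l)}) : pi :=
  \sum_(j < 5) cdact (ps_act pi) (Xp R j) (eta (w j)).

Definition Gam (R : realType) (i : parabolic) (nu : R[i]) (k : nat)
    (sigma : discrete_series R k) (mu : haar_SO3 R)
    (pi : principal_series i nu sigma mu) (l : nat) (m : int)
    (eta : hpoly R (2 * l) -> pi) : hpoly R (2 * lplus l m) -> pi :=
  fun w => eta_tilde eta (Imap w).

Definition represents_Gam (R : realType) (i : parabolic) (nu : R[i]) (k : nat)
    (sigma : discrete_series R k) (mu : haar_SO3 R)
    (pi : principal_series i nu sigma mu) (l : nat) (m : int)
    (A : 'M[R[i]]_(dsig k (lplus l m), dsig k l)) : Prop :=
  forall (b : 'I_(dsig k l)) (w : hpoly R (2 * lplus l m)),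
    Gam (T_hom pi (pval k l b)) w
    = \sum_a A a b *: T_hom pi (pval k (lplus l m) a) w.

Definition entry (V : nmodType) (n : nat) (v : 'cV[V]_n) (r : int) : V :=
  if r is Posz r' then (if insub r' is Some r'' then v r'' 0 else 0) else 0.

Definition C_op (R : realType) (i : parabolic) (nu : R[i]) (k : nat)
    (sigma : discrete_series R k) (mu : haar_SO3 R)
    (pi : principal_series i nu sigma mu) (l : nat) (m : int)
    (v : 'cV[ps_space pi]_((2 * l).+1)) : 'cV[ps_space pi]_((2 * lplus l m).+1) :=
  \col_q \sum_(j < 5) Acoef R (2 * l)%:Z m q%:Z j *:
     cdact (ps_act pi) (Xp R j) (entry v (q%:Z + 2 - m - j%:Z)).

Definition C_op_mx (R : realType) (i : parabolic) (nu : R[i]) (k : nat)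
    (sigma : discrete_series R k) (mu : haar_SO3 R)
    (pi : principal_series i nu sigma mu) (l : nat) (m : int) (c : nat)
    (M : 'M[ps_space pi]_((2 * l).+1, c)) : 'M[ps_space pi]_((2 * lplus l m).+1, c) :=
  \matrix_(q, a) C_op m (col a M) q 0.

Definition gam1 (R : realType) (i : parabolic) (k l : nat) (m : int) (p : nat) : R[i] :=
  (-1) ^+ (pnum i).+1 * (k%:Z - l%:Z + p%:Z)%:~R
  * Acoef R (2 * l)%:Z m (2 * l%:Z - p%:Z + m - 2) 0.

Definition gam0 (R : realType) (i : parabolic) (nu : R[i]) (l : nat) (m : int) (p : nat) : R[i] :=
  (-1) ^+ (pnum i) / 3
  * (nu + rho R + (l%:Z * m)%:~R - 3 + (m * (m + 1))%:~R / 2)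
  * Acoef R (2 * l)%:Z m (2 * l%:Z - p%:Z + m) 2.

Definition gamN1 (R : realType) (i : parabolic) (k l : nat) (m : int) (p : nat) : R[i] :=
  (-1) ^+ (pnum i).+1 * (k%:Z + l%:Z - p%:Z)%:~R
  * Acoef R (2 * l)%:Z m (2 * l%:Z - p%:Z + m + 2) 4.

(* [diag(g_delta, g_(2 + delta), ..., g_(2(s - 1) + delta))], of size [s]. *)
Definition Dmx (R : realType) (g : nat -> R[i]) (delta s : nat) : 'M[R[i]]_s :=
  diag_mx (\row_(a < s) g (2 * a + delta)%N).

Definition nzero (k l : nat) (m : int) : nat :=
  if ~~ odd (absz m) then absz (((2 - m) %/ 2)%Z)
  else if ~~ odd (l - k) then absz (((3 - m) %/ 2)%Z)
  else absz (((1 - m) %/ 2)%Z).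

(* [(O_(2,d-1), O_(2,1) ; D (d-1 x d-1), O_(d-1,1))] as a [(d+1) x d] matrix. *)
Definition lower_block (R : realType) (D : forall s, 'M[R[i]]_s) (d : nat) :
    'M[R[i]]_(d.+1, d) :=
  if d is d'.+1 then
    castmx (erefl, addn1 d') (block_mx (0 : 'M[R[i]]_(2, d')) (0 : 'M[R[i]]_(2, 1))
                                       (D d') (0 : 'M[R[i]]_(d', 1)))
  else 0.

Definition explicit_mx (R : realType) (i : parabolic) (nu : R[i]) (k l : nat) (m : int) :
    'M[R[i]]_((dsig k l).+1, dsig k l) :=
  let d := dsig k l in
  let delta := nat_of_bool (odd (l - k)) in
  castmx (addn1 d, erefl)
    (col_mx (Dmx (gamN1 R i k l m) delta d) (0 : 'M[R[i]]_(1, d)))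
  + col_mx (0 : 'M[R[i]]_(1, d)) (Dmx (gam0 i nu l m) delta d)
  + lower_block (Dmx (gam1 R i k l m) delta) d.

(* Main.v *)
(* By equivariance a function of the principal series is determined by its values on
   [K], and its derivative along [X] at [x] in [K] is read off from
   [x exp(tX) = exp(t x X x^-1) x] by decomposing [exp(t x X x^-1)] to first order as
   [n a m k].  A function whose restriction to [K] is a sum of matrix coefficients
   times vectors [chi_p] therefore has derivatives of the same kind; the difference
   quotients converge uniformly on [K], hence for the [L^2]-norm.  The case of [P_2]
   follows from that of [P_1] through the inverse transpose.

   On [p_C], [x X_j x^-1] is the sum of the [X_r] with the matrix coefficients of [V_4],
   so an entry of the shifted vector is a sum of products of matrix coefficients of
   [V_2l] and [V_4].  The map with coefficients [A] is equivariant, being a multiple of the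
   polarization [f |-> det(v, v')^(2-m) [s^(2+m)] f(v + s v')], so each such sum
   collapses to one matrix coefficient of [V_2(l+m)] times a value of [A].  The vectors
   [X_0], [X_2] and [X_4] shift [chi_p] by [-2], [0] and [2] and give the three diagonals;
   [X_1] and [X_3] act through [K] and contribute to the middle one by a linear relation
   between the [A].  The matrix is unique since the elementary functions are linearly
   independent. *)

From HB Require Import structures.
From mathcomp Require Import all_boot all_order all_algebra.
From mathcomp Require Import complex.
From mathcomp Require Import all_classical all_reals all_analysis.
From mathcomp Require Import -(notations) mpoly.
From mathcomp Require Import measurable_realfun ring lra zify.
Require Import Defs.

Set Implicit Arguments.
Unset Strict Implicit.
Unset Printing Implicit Defensive.

Import Order.TTheory GRing.Theory Num.Theory numFieldNormedType.Exports.
Local Open Scope classical_set_scope.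
Local Open Scope ring_scope.
Local Open Scope complex_scope.

(** The difficulty is analytic. [t_fun] is a choice, so a smooth function with the given values on K
    must be exhibited, with values in an infinite-dimensional space; and [dact] is a limit in an
    abstract completion, meaningful only where it exists. One device serves both: an inductive class
    of functions on K that is stable under derivation, together with first-order expansions whose
    error is uniform over K ([bigO], [isExp], [lo]). As M and K meet in the image of O(2), the
    factors of n a m k are not unique; m is therefore restricted to the slice exp (a H) exp (b E),
    with H = [dgH] and E = [EF], on which the Gram matrix of the last two rows determines
    everything. The slice also suits the discrete series, whose derivatives are given along
    one-parameter groups only. Matrix coefficients are treated throughout as coefficients of
    products (a X + b)^q (c X + d)^(2 l - q): bounds, first-order terms and the Clebsch-Gordan
    identities all come from this form. *)

Lemma cvg_bigsum (K : numFieldType) (V : normedModType K) (T : Type)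
    (F : set_system T) (FF : Filter F) (J : Type) (r : seq J)
    (f : J -> T -> V) (y : J -> V) :
  (forall j, f j @ F --> y j) ->
  (fun t => \sum_(j <- r) f j t) @ F --> \sum_(j <- r) y j.
Proof.
move=> h; elim: r => [|j r IH].
  by rewrite big_nil; under eq_fun do rewrite big_nil; exact: cvg_cst.
by rewrite big_cons; under eq_fun do rewrite big_cons; exact: cvgD.
Qed.

(** * Matrix exponential *)

Section MatrixExponential.
Variable R : realType.

Lemma cvg_mxP (T : Type) (F : set_system T) (FF : Filter F) m n
    (f : T -> 'M[R]_(m, n)) (M : 'M[R]_(m, n)) :
  (forall a b, (fun t => f t a b) @ F --> M a b) -> f @ F --> M.
Proof.
move=> h; apply/cvg_ballP => e e0; rewrite near_simpl /=.
suff : \forall t \near F, forall a b, ball (M a b) e (f t a b).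
  by apply: filterS => t ht; split.
have H (ab : 'I_m * 'I_n) : \forall t \near F, ball (M ab.1 ab.2) e (f t ab.1 ab.2).
  by have /cvg_ballP/(_ e e0) := h ab.1 ab.2; rewrite near_simpl.
have := @filter_forall T _ _ F FF H.
by apply: filterS => t ht a b; exact: (ht (a, b)).
Qed.

Lemma mx_pow_bound n (X : 'M[R]_n.+1) (c : R) : (forall a b, `|X a b| <= c) ->
  forall j a b, `|(X ^+ j) a b| <= (n.+1%:R * c) ^+ j.
Proof.
move=> hX; have c0 : 0 <= c by apply: le_trans (hX 0 0).
elim=> [|j IH] a b.
  by rewrite !expr0 mxE; case: eqP => _; rewrite ?normr1// normr0.
rewrite !exprS mxE (le_trans (ler_norm_sum _ _ _))//.
apply: (@le_trans _ _ (\sum_(d < n.+1) (c * (n.+1%:R * c) ^+ j))).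
  by apply: ler_sum => d _; rewrite normrM ler_pM.
by rewrite sumr_const card_ord -[leLHS]mulr_natl mulrA.
Qed.

Lemma mx_bound m n (X : 'M[R]_(m, n)) : exists2 c : R, 0 <= c & forall a b, `|X a b| <= c.
Proof.
exists (\sum_a \sum_b `|X a b|); first by do 2 apply: sumr_ge0 => ? _.
move=> a b; rewrite (bigD1 a)//= (bigD1 b)//= -addrA ler_wpDr// addr_ge0//.
  by apply: sumr_ge0.
by apply: sumr_ge0 => ? _; apply: sumr_ge0.
Qed.

(** The coefficients of one entry of exp (t X) as a real power series in t. Entry by entry, termwise
    differentiation of real power series applies. *)
Definition ecoef n (X : 'M[R]_n.+1) a b (j : nat) : R := (j`!%:R)^-1 * (X ^+ j) a b.

Lemma is_cvg_ecoef n (X : 'M[R]_n.+1) a b (t : R) : cvgn (pseries (ecoef X a b) t).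
Proof.
have [c c0 hX] := mx_bound X.
apply: normed_cvg; rewrite /normed_series_of /=.
apply: (series_le_cvg _ _ _ (is_cvg_series_exp_coeff (n.+1%:R * c * `|t|))) => j //=.
  by rewrite /exp_coeff divr_ge0// exprn_ge0// !mulr_ge0.
rewrite /ecoef /exp_coeff /= !normrM normrX exprMn normfV normr_nat -mulrA mulrC.
by rewrite ler_wpM2r// ler_wpM2r ?exprn_ge0//; exact: mx_pow_bound.
Qed.

Lemma pseries_diffs_ecoef n (X : 'M[R]_n.+1) a b :
  pseries_diffs (ecoef X a b) = fun j => (j`!%:R)^-1 * (X ^+ j.+1) a b.
Proof.
apply/funext => j; rewrite /pseries_diffs /ecoef mulrA; congr (_ * _).
by rewrite factS natrM invfM mulVKf.
Qed.

(** X^(j+1) = X X^j, so the derived series is a linear combination of the original ones: this is the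
    equation E' = X E. Used once more, it gives the convergence of the second derived series. *)
Lemma diffs_ecoef_sum n (X : 'M[R]_n.+1) a b :
  pseries_diffs (ecoef X a b) = \sum_d (fun j => X a d * ecoef X d b j).
Proof.
rewrite pseries_diffs_ecoef; apply/funext => j; rewrite exprS mxE fct_sumE mulr_sumr.
by apply: eq_bigr => d _; rewrite /ecoef mulrCA.
Qed.

Lemma mexp_entry n (X : 'M[R]_n.+1) t a b :
  mexp (t *: X) a b = limn (pseries (ecoef X a b) t).
Proof.
suff h : series (fun j => (j`!%:R)^-1 *: (t *: X) ^+ j) @ \oo -->
    (\matrix_(a, b) limn (pseries (ecoef X a b) t) : 'M[R]_n.+1).
  by rewrite /mexp (cvg_lim _ h)// mxE.
apply: cvg_mxP => a' b'; rewrite mxE.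
suff -> : (fun N => series (fun j => (j`!%:R)^-1 *: (t *: X) ^+ j) N a' b') =
   pseries (ecoef X a' b') t by exact: is_cvg_ecoef.
apply/funext => N; rewrite /series /pseries /= summxE; apply: eq_bigr => j _.
by rewrite mxE exprZn mxE /ecoef mulrCA mulrC.
Qed.

Lemma limn_pseries_sum n (X : 'M[R]_n.+1) a b t :
  (pseries (pseries_diffs (ecoef X a b)) t @ \oo -->
     \sum_d X a d * limn (pseries (ecoef X d b) t)).
Proof.
have -> : pseries (pseries_diffs (ecoef X a b)) t =
   (fun N => \sum_d X a d * pseries (ecoef X d b) t N).
  apply/funext => N; rewrite diffs_ecoef_sum /pseries /series /=.
  under [RHS]eq_bigr do rewrite mulr_sumr.
  rewrite exchange_big /=; apply: eq_bigr => j _.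
  by rewrite fct_sumE mulr_suml; apply: eq_bigr => d _; rewrite mulrA.
apply: (@cvg_bigsum _ _ _ _ _ _ _ (fun d N => X a d * pseries (ecoef X d b) t N)) => d.
by apply: cvgMr; exact: is_cvg_ecoef.
Qed.

Lemma is_derive_mexp n (X : 'M[R]_n.+1) a b (t : R) :
  is_derive t 1 (fun s => mexp (s *: X) a b) (\sum_d X a d * mexp (t *: X) d b).
Proof.
under eq_fun do rewrite mexp_entry.
under eq_bigr do rewrite mexp_entry.
rewrite -(cvg_lim _ (limn_pseries_sum (a := a) (b := b) (X := X) (t := t)))//.
have c1 a' b' K : cvgn (pseries (pseries_diffs (ecoef X a' b')) K).
  by apply/cvg_ex; eexists; exact: limn_pseries_sum.
(* Differentiation at t asks for the convergence of the series and of its first two derived series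
   at a point of larger absolute value; |t| + 1 will do. *)
apply: (@pseries_snd_diffs _ _ (`|t| + 1)) => //.
- exact: is_cvg_ecoef.
- have -> : pseries_diffs (pseries_diffs (ecoef X a b)) =
     fun j => \sum_d X a d * pseries_diffs (ecoef X d b) j.
    rewrite {1}diffs_ecoef_sum; apply/funext => j.
    rewrite /pseries_diffs fct_sumE mulr_sumr; apply: eq_bigr => d _.
    by rewrite mulrCA.
  have -> : pseries (fun j => \sum_d X a d * pseries_diffs (ecoef X d b) j) (`|t| + 1) =
     (fun N => \sum_d X a d * pseries (pseries_diffs (ecoef X d b)) (`|t| + 1) N).
    apply/funext => N; rewrite /pseries /series /=.
    under [RHS]eq_bigr do rewrite mulr_sumr.
    rewrite exchange_big /=; apply: eq_bigr => j _.
    by rewrite mulr_suml; apply: eq_bigr => d _; rewrite mulrA.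
  apply/cvg_ex; exists (\sum_d X a d * limn (pseries (pseries_diffs (ecoef X d b)) (`|t| + 1))).
  apply: (@cvg_bigsum _ _ _ _ _ _ _ (fun d N => X a d * pseries (pseries_diffs (ecoef X d b)) (`|t| + 1) N)) => d.
  by apply: cvgMr; exact: c1.
- by rewrite [ltRHS]ger0_norm ?ltrDl// addr_ge0.
Qed.

Lemma mexp0 n : mexp (0 : 'M[R]_n.+1) = 1.
Proof.
have h : series (fun j => (j`!%:R)^-1 *: (0 : 'M[R]_n.+1) ^+ j) @ \oo --> (1 : 'M[R]_n.+1).
  have e : forall N, series (fun j => (j`!%:R)^-1 *: (0 : 'M[R]_n.+1) ^+ j) N.+1 = 1.
    move=> N; rewrite /series /= big_nat_recl// fact0 invr1 scale1r expr0 big1 ?addr0//.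
    by move=> j _; rewrite expr0n /= scaler0.
  rewrite -cvg_shiftS; under eq_fun do rewrite e; exact: cvg_cst.
by rewrite /mexp; exact/cvg_lim.
Qed.

(* A curve [D] with [D' = - D X] and [D 0 = 1] is the inverse of [exp (t X)],
   since [(D E)' = 0]. *)
Lemma mexp_unique n (X : 'M[R]_n.+1) (D : R -> 'M[R]_n.+1) :
  (forall (t : R) a b, is_derive t 1 (fun s => D s a b) (- (\sum_d D t a d * X d b))) ->
  D 0 = 1 -> forall t, D t *m mexp (t *: X) = 1.
Proof.
move=> hD D0 t; apply/matrixP => a b.
have hd (s : R) : is_derive s 1 (fun s => (D s *m mexp (s *: X)) a b) 0.
  under eq_fun do rewrite mxE.
  have hs d : is_derive s 1 (fun s => D s a d * mexp (s *: X) d b)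
     (D s a d *: (\sum_e X d e * mexp (s *: X) e b) +
      mexp (s *: X) d b *: (- (\sum_e D s a e * X e d))).
    exact: (is_deriveM (hD s a d) (is_derive_mexp X d b s)).
  have e0 : \sum_d (D s a d *: (\sum_e X d e * mexp (s *: X) e b) +
      mexp (s *: X) d b *: (- (\sum_e D s a e * X e d))) = 0.
    rewrite big_split /=.
    rewrite (eq_bigr (fun d => \sum_e D s a d * X d e * mexp (s *: X) e b)); last first.
      by move=> d _; rewrite scaler_sumr; apply: eq_bigr => e _; rewrite -mulrA.
    rewrite [X in _ + X](eq_bigr (fun d => - \sum_e D s a e * X e d * mexp (s *: X) d b)); last first.
      move=> d _; rewrite scalerN; congr (- _); rewrite scaler_sumr.
      by apply: eq_bigr => e _; rewrite [LHS]mulrC.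
    by rewrite sumrN exchange_big /= subrr.
  have := is_derive_sum hs; rewrite e0.
  by congr is_derive; apply/funext => u; rewrite fct_sumE.
have /= := is_derive_0_is_cst t 0 hd.
by rewrite scale0r mexp0 D0 mulmx1 => ->.
Qed.

Notation i0 := (@Ordinal 3 0 isT).
Notation i1 := (@Ordinal 3 1 isT).
Notation i2 := (@Ordinal 3 2 isT).
Notation j0 := (@Ordinal 2 0 isT).
Notation j1 := (@Ordinal 2 1 isT).

Lemma sum3 (V : nmodType) (F : 'I_3 -> V) : \sum_a F a = F i0 + F i1 + F i2.
Proof.
rewrite !big_ord_recl big_ord0 addr0 addrA.
by congr (F _ + F _ + F _); apply: val_inj.
Qed.

Lemma sum2 (V : nmodType) (F : 'I_2 -> V) : \sum_a F a = F j0 + F j1.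
Proof.
rewrite !big_ord_recl big_ord0 addr0.
by congr (F _ + F _); apply: val_inj.
Qed.

Lemma mx2P (T : Type) (A B : 'M[T]_2) :
  A j0 j0 = B j0 j0 -> A j0 j1 = B j0 j1 -> A j1 j0 = B j1 j0 -> A j1 j1 = B j1 j1 -> A = B.
Proof.
move=> h1 h2 h3 h4; apply/matrixP.
by case=> [[|[|a]]] ha //; case=> [[|[|b]]] hb //;
  rewrite (bool_irrelevance ha isT) (bool_irrelevance hb isT).
Qed.

Lemma mx3P (T : Type) (A B : 'M[T]_3) :
  A i0 i0 = B i0 i0 -> A i0 i1 = B i0 i1 -> A i0 i2 = B i0 i2 ->
  A i1 i0 = B i1 i0 -> A i1 i1 = B i1 i1 -> A i1 i2 = B i1 i2 ->
  A i2 i0 = B i2 i0 -> A i2 i1 = B i2 i1 -> A i2 i2 = B i2 i2 -> A = B.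
Proof.
move=> h1 h2 h3 h4 h5 h6 h7 h8 h9; apply/matrixP.
by case=> [[|[|[|a]]]] ha //; case=> [[|[|[|b]]]] hb //;
  rewrite (bool_irrelevance ha isT) (bool_irrelevance hb isT).
Qed.

Lemma det2 (K : comPzRingType) (A : 'M[K]_2) :
  \det A = A j0 j0 * A j1 j1 - A j0 j1 * A j1 j0.
Proof.
rewrite (expand_det_row _ j0) sum2 /cofactor !det_mx11 !mxE /= expr0 expr1 !mul1r mulN1r mulrN.
by congr (_ * A _ _ - _ * A _ _); apply: val_inj.
Qed.

Lemma det3 (K : comPzRingType) (A : 'M[K]_3) :
  \det A = A i0 i0 * (A i1 i1 * A i2 i2 - A i1 i2 * A i2 i1)
          - A i0 i1 * (A i1 i0 * A i2 i2 - A i1 i2 * A i2 i0)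
          + A i0 i2 * (A i1 i0 * A i2 i1 - A i1 i1 * A i2 i0).
Proof.
rewrite (expand_det_row _ i0) sum3 /cofactor !det2 !mxE /= /bump /= !addn0 !addn1.
rewrite expr0 expr1 sqrrN expr1n !mul1r mulN1r mulrN.
by congr (_ * (A _ _ * A _ _ - A _ _ * A _ _) - _ * (A _ _ * A _ _ - A _ _ * A _ _) + _ * (A _ _ * A _ _ - A _ _ * A _ _)); apply: val_inj.
Qed.

(** Liouville's formula: the derivative of det exp (t X) is tr X times det exp (t X), which is 0, so
    the determinant keeps its value at t = 0. *)
Lemma det_mexp3 (X : 'M[R]_3) : \tr X = 0 -> forall t, \det (mexp (t *: X)) = 1.
Proof.
move=> trX t.
pose e a b (s : R) := mexp (s *: X) a b : R.
have he a b (s : R) : is_derive s 1 (e a b) (\sum_d X a d * e d b s) by exact: is_derive_mexp.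
pose D : R -> R := e i0 i0 * (e i1 i1 * e i2 i2 - e i1 i2 * e i2 i1)
          - e i0 i1 * (e i1 i0 * e i2 i2 - e i1 i2 * e i2 i0)
          + e i0 i2 * (e i1 i0 * e i2 i1 - e i1 i1 * e i2 i0).
have hD (s : R) : is_derive s 1 D 0.
  have hM a b c d := is_deriveM (he a b s) (he c d s).
  have hT a b c d f g m n u v := is_deriveM (he a b s) (is_deriveB (hM c d f g) (hM m n u v)).
  have := is_deriveD (is_deriveB (hT i0 i0 i1 i1 i2 i2 i1 i2 i2 i1)
    (hT i0 i1 i1 i0 i2 i2 i1 i2 i2 i0)) (hT i0 i2 i1 i0 i2 i1 i1 i1 i2 i0).
  congr is_derive; rewrite !sum3 /= !fctE /GRing.scale /=.
  have -> : X i2 i2 = - X i0 i0 - X i1 i1 by move: trX; rewrite /mxtrace sum3; lra.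
  ring.
have := is_derive_0_is_cst t 0 hD.
rewrite det3 => E; rewrite (_ : _ - _ + _ = D t)// E.
by rewrite /D /e !fctE scale0r mexp0 !mxE /=; ring.
Qed.

Lemma det_mexp2 (X : 'M[R]_2) : \tr X = 0 -> forall t, \det (mexp (t *: X)) = 1.
Proof.
move=> trX t.
pose e a b (s : R) := mexp (s *: X) a b : R.
have he a b (s : R) : is_derive s 1 (e a b) (\sum_d X a d * e d b s) by exact: is_derive_mexp.
pose D : R -> R := e j0 j0 * e j1 j1 - e j0 j1 * e j1 j0.
have hD (s : R) : is_derive s 1 D 0.
  have := is_deriveB (is_deriveM (he j0 j0 s) (he j1 j1 s)) (is_deriveM (he j0 j1 s) (he j1 j0 s)).
  congr is_derive; rewrite !sum2 /GRing.scale /=.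
  have -> : X j1 j1 = - X j0 j0 by move: trX; rewrite /mxtrace sum2; lra.
  ring.
have := is_derive_0_is_cst t 0 hD.
rewrite det2 => E; rewrite (_ : _ - _ = D t)// E.
by rewrite /D /e !fctE scale0r mexp0 !mxE /=; ring.
Qed.

Lemma mexp_diag n (d : 'rV[R]_n.+1) (t : R) :
  mexp (t *: diag_mx d) = diag_mx (\row_a expR (t * d 0 a)).
Proof.
pose D (s : R) : 'M[R]_n.+1 := diag_mx (\row_a expR (- (s * d 0 a))).
have h : D t *m mexp (t *: diag_mx d) = 1.
  apply: mexp_unique => [s a b|].
    have -> : \sum_e D s a e * diag_mx d e b = D s a b * d 0 b.
      rewrite (bigD1 b)//= big1 ?addr0; first by rewrite [diag_mx d b b]mxE eqxx.
      by move=> e /negPf eb; rewrite [diag_mx d e b]mxE eb mulr0.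
    rewrite /D !mxE; under eq_fun do rewrite !mxE.
    have [->|ab] := eqVneq a b; last first.
      by rewrite !mulr0n mul0r oppr0; exact: is_derive_cst.
    under eq_fun do rewrite mulr1n.
    apply: is_derive_eq; rewrite /GRing.scale /= !mulr0 mulr1n; ring.
  apply/matrixP => a b; rewrite /D !mxE mul0r oppr0 expR0.
  by case: eqP.
have h2 : diag_mx (\row_a expR (t * d 0 a)) *m D t = 1.
  rewrite /D mulmx_diag; apply/matrixP => a b; rewrite !mxE -expRD subrr expR0.
  by case: eqP.
by rewrite -[LHS]mul1mx -[X in X *m _]h2 -mulmxA h mulmx1.
Qed.

Definition ch (t : R) : R := (expR t + expR (- t)) / 2.
Definition sh (t : R) : R := (expR t - expR (- t)) / 2.

Lemma ch2sh2 t : ch t ^+ 2 - sh t ^+ 2 = 1.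
Proof.
have : expR t * expR (- t) = 1 by rewrite -expRD subrr expR0.
by rewrite /ch /sh => h; rewrite -[RHS]h; field.
Qed.

Definition EF : 'M[R]_2 := \matrix_(a, b) (a != b)%:R.
Definition hyprot (t : R) : 'M[R]_2 := \matrix_(a, b) if a == b then ch t else sh t.

Lemma mexp_EF (t : R) : mexp (t *: EF) = hyprot t.
Proof.
have chN s : ch (- s) = ch s by rewrite /ch opprK addrC.
have shN s : sh (- s) = - sh s by rewrite /sh opprK -mulNr opprB.
have h : hyprot (- t) *m mexp (t *: EF) = 1.
  apply: (@mexp_unique _ _ (fun s => hyprot (- s))) => [s a b|]; last first.
    by apply/matrixP => a b; rewrite !mxE oppr0 /ch /sh !(oppr0, expR0) subrr mul0r;
       case: eqP => // _; rewrite mulr1n; field.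
  have hc : is_derive s (1 : R) (fun s => ch (- s)) (sh s).
    by rewrite /ch; apply: is_derive_eq; rewrite /GRing.scale /= /sh !opprK; field.
  have hs : is_derive s (1 : R) (fun s => sh (- s)) (- ch s).
    by rewrite /sh; apply: is_derive_eq; rewrite /GRing.scale /= /ch !opprK; field.
  have -> : (fun s => hyprot (- s) a b) = if a == b then (fun s => ch (- s)) else (fun s => sh (- s)).
    by apply/funext => u; rewrite mxE; case: eqP.
  rewrite sum2 !mxE chN shN.
  by case: a => [[|[|a]]] ha //; case: b => [[|[|b]]] hb //=; rewrite -?val_eqE /=;
    apply: is_derive_eq; rewrite ?mulr0 ?mulr1 ?addr0 ?add0r ?opprK.
have h2 : hyprot t *m hyprot (- t) = 1.
  have := ch2sh2 t.
  by move=> e; apply: mx2P; rewrite !mxE !sum2 !mxE /= chN shN; lra.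
by rewrite -[LHS]mul1mx -[X in X *m _]h2 -mulmxA h mulmx1.
Qed.

End MatrixExponential.

Notation i0 := (@Ordinal 3 0 isT).
Notation i1 := (@Ordinal 3 1 isT).
Notation i2 := (@Ordinal 3 2 isT).
Notation j0 := (@Ordinal 2 0 isT).
Notation j1 := (@Ordinal 2 1 isT).

(** * Block matrices and the factors N, A, M *)

Section BlockEntries.
Variable R : realType.

(** With these identifications [block_mx] can be evaluated at concrete indices; the matrix
    identities below are all checked on entries. *)
Let l0 : i0 = lshift 2 (ord0 : 'I_1) :> 'I_(1 + 2). Proof. exact: val_inj. Qed.
Let r1 : i1 = rshift 1 j0 :> 'I_(1 + 2). Proof. exact: val_inj. Qed.
Let r2 : i2 = rshift 1 j1 :> 'I_(1 + 2). Proof. exact: val_inj. Qed.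
Let l0' : i0 = lshift 1 j0 :> 'I_(2 + 1). Proof. exact: val_inj. Qed.
Let l1' : i1 = lshift 1 j1 :> 'I_(2 + 1). Proof. exact: val_inj. Qed.
Let r2' : i2 = rshift 2 (ord0 : 'I_1) :> 'I_(2 + 1). Proof. exact: val_inj. Qed.

Definition e12 := (@block_mxEul R 1 2 1 2, @block_mxEur R 1 2 1 2, @block_mxEdl R 1 2 1 2, @block_mxEdr R 1 2 1 2).
Definition e21 := (@block_mxEul R 2 1 2 1, @block_mxEur R 2 1 2 1, @block_mxEdl R 2 1 2 1, @block_mxEdr R 2 1 2 1).

Lemma Nrad1P (n : 'M[R]_3) : Nrad P1 n <->
  exists u v, n = mx_of_rows 3 3 [:: [:: 1; u; v]; [:: 0; 1; 0]; [:: 0; 0; 1]].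
Proof.
split=> [[u ->]|[u [v ->]]].
  exists (u 0 j0), (u 0 j1).
  apply: mx3P; rewrite ?l0 ?r1 ?r2 ?e12 !mxE //=.
exists (\row_a if val a == 0%N then u else v).
by apply: mx3P; rewrite {1}/mx_of_rows ?l0 ?r1 ?r2 ?e12 !mxE //=.
Qed.

Lemma Nrad2P (n : 'M[R]_3) : Nrad P2 n <->
  exists u v, n = mx_of_rows 3 3 [:: [:: 1; 0; u]; [:: 0; 1; v]; [:: 0; 0; 1]].
Proof.
split=> [[u ->]|[u [v ->]]].
  exists (u j0 0), (u j1 0).
  by apply: mx3P; rewrite ?l0' ?l1' ?r2' ?e21 !mxE //=.
exists (\col_a if val a == 0%N then u else v).
by apply: mx3P; rewrite {1}/mx_of_rows ?l0' ?l1' ?r2' ?e21 !mxE //=.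
Qed.

Lemma m_emb1E (h : 'M[R]_2) : m_emb P1 h =
  mx_of_rows 3 3 [:: [:: (\det h)^-1; 0; 0]; [:: 0; h j0 j0; h j0 j1]; [:: 0; h j1 j0; h j1 j1]].
Proof. by apply: mx3P; rewrite ?l0 ?r1 ?r2 ?e12 !mxE //=. Qed.

Lemma m_emb2E (h : 'M[R]_2) : m_emb P2 h =
  mx_of_rows 3 3 [:: [:: h j0 j0; h j0 j1; 0]; [:: h j1 j0; h j1 j1; 0]; [:: 0; 0; (\det h)^-1]].
Proof. by apply: mx3P; rewrite ?l0' ?l1' ?r2' ?e21 !mxE //=. Qed.

Lemma mexp_H1 (s : R) : mexp (s *: Hmx R P1) =
  mx_of_rows 3 3 [:: [:: expR (2 * s); 0; 0]; [:: 0; expR (- s); 0]; [:: 0; 0; expR (- s)]].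
Proof.
have -> : Hmx R P1 = diag_mx (\row_a nth 0 [:: 2; -1; -1] a).
  by apply: mx3P; rewrite !mxE.
rewrite mexp_diag; apply: mx3P; rewrite !mxE //= ?mulr1n; by congr expR; ring.
Qed.

Lemma mexp_H2 (s : R) : mexp (s *: Hmx R P2) =
  mx_of_rows 3 3 [:: [:: expR s; 0; 0]; [:: 0; expR s; 0]; [:: 0; 0; expR (- (2 * s))]].
Proof.
have -> : Hmx R P2 = diag_mx (\row_a nth 0 [:: 1; 1; -2] a).
  by apply: mx3P; rewrite !mxE.
rewrite mexp_diag; apply: mx3P; rewrite !mxE //= ?mulr1n; by congr expR; ring.
Qed.

(** [x_plus] and [x_minus] are [dgH] + i [EF] and [dgH] - i [EF]. The two matrices span the
    symmetric part of sl(2), the directions of M that remain when those of O(2) are put into K. *)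
Definition dgH : 'M[R]_2 := mx_of_rows 2 2 [:: [:: 1; 0]; [:: 0; -1]].

Lemma mexp_dgH (s : R) : mexp (s *: dgH) =
  mx_of_rows 2 2 [:: [:: expR s; 0]; [:: 0; expR (- s)]].
Proof.
have -> : dgH = diag_mx (\row_a nth 0 [:: 1; -1] a).
  by apply: mx2P; rewrite !mxE.
by rewrite mexp_diag; apply: mx2P; rewrite !mxE //= mulr1n ?mulr1 ?mulrN1.
Qed.

Lemma trdgH : \tr dgH = 0. Proof. by rewrite /mxtrace sum2 !mxE /= subrr. Qed.
Lemma trEF : \tr (EF R) = 0. Proof. by rewrite /mxtrace sum2 !mxE /= addr0. Qed.

(** A slice for SL(2) modulo SO(2). In n a m k the factor m is determined only up to O(2), which
    lies in K as well; asking for m = exp (a H) exp (b E) removes the ambiguity, and gives m in the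
    form in which the discrete series is expanded in [ds_second_kind]. *)
Definition mpart (a b : R) : 'M[R]_2 := mexp (a *: dgH) *m mexp (b *: EF R).

Lemma mpartE a b : mpart a b = mx_of_rows 2 2
  [:: [:: expR a * ch b; expR a * sh b]; [:: expR (- a) * sh b; expR (- a) * ch b]].
Proof.
by rewrite /mpart mexp_dgH mexp_EF; apply: mx2P; rewrite !mxE !sum2 !mxE //=; ring.
Qed.

Lemma det_mpart a b : \det (mpart a b) = 1.
Proof. by rewrite det_mulmx !det_mexp2 ?trdgH ?trEF// mulr1. Qed.

Definition pdec1 (s a b : R) : 'M[R]_3 := mexp (s *: Hmx R P1) *m m_emb P1 (mpart a b).

Lemma pdec1E s a b : pdec1 s a b = mx_of_rows 3 3
  [:: [:: expR (2 * s); 0; 0];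
      [:: 0; expR (- s) * expR a * ch b; expR (- s) * expR a * sh b];
      [:: 0; expR (- s) * expR (- a) * sh b; expR (- s) * expR (- a) * ch b]].
Proof.
rewrite /pdec1 mexp_H1 m_emb1E det_mpart invr1 mpartE.
by apply: mx3P; rewrite !mxE !sum3 !mxE /=; ring.
Qed.

Definition pdec1i (s a b : R) : 'M[R]_3 := mx_of_rows 3 3
  [:: [:: expR (- (2 * s)); 0; 0];
      [:: 0; expR s * expR (- a) * ch b; - (expR s * expR a * sh b)];
      [:: 0; - (expR s * expR (- a) * sh b); expR s * expR a * ch b]].

Lemma expRNK (x : R) : expR (- x) * expR x = 1.
Proof. by rewrite -expRD addNr expR0. Qed.

Lemma pdec1K s a b : pdec1i s a b *m pdec1 s a b = 1.
Proof.
have hs := expRNK s; have ha := expRNK a; have h2 := expRNK (2 * s); have hb := ch2sh2 b.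
rewrite pdec1E; apply: mx3P; rewrite !mxE !sum3 !mxE /= ?(mulr0, mul0r, addr0, add0r)//.
- transitivity ((expR (- s) * expR s) * (expR (- a) * expR a) * (ch b ^+ 2 - sh b ^+ 2)); first ring.
  by rewrite hs ha hb !mulr1.
- ring.
- ring.
- transitivity ((expR (- s) * expR s) * (expR (- a) * expR a) * (ch b ^+ 2 - sh b ^+ 2)); first ring.
  by rewrite hs ha hb !mulr1.
Qed.

Lemma det_pdec1 s a b : \det (pdec1 s a b) = 1.
Proof.
have hs := expRNK s; have ha := expRNK a; have hb := ch2sh2 b.
have h2 : expR (2 * s) = expR s ^+ 2 by rewrite -expRM_natl.
rewrite pdec1E det3 !mxE /= h2.
transitivity ((expR (- s) * expR s) ^+ 2 * (expR (- a) * expR a) * (ch b ^+ 2 - sh b ^+ 2)); first by ring.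
by rewrite hs ha hb; ring.
Qed.

Lemma pdec1Kr s a b : pdec1 s a b *m pdec1i s a b = 1.
Proof. exact/mulmx1C/pdec1K. Qed.

End BlockEntries.

(** * SO(3) and the decomposition n a m k *)

Section Orthogonal.
Variable R : realType.
Implicit Types x y : 'M[R]_3.

Lemma SO3_1 : SO3 (1%:M : 'M[R]_3).
Proof. by split; rewrite ?trmx1 ?mulmx1 ?det1. Qed.

Lemma SO3_M x y : SO3 x -> SO3 y -> SO3 (x *m y).
Proof.
move=> [h1 d1] [h2 d2]; split; last by rewrite det_mulmx d1 d2 mulr1.
by rewrite trmx_mul mulmxA -(mulmxA x) h2 mulmx1.
Qed.

Lemma SO3_Tm x : SO3 x -> x^T *m x = 1%:M.
Proof. by move=> [h1 _]; apply: mulmx1C. Qed.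

Lemma SO3_T x : SO3 x -> SO3 x^T.
Proof. by move=> h; split; rewrite ?trmxK ?SO3_Tm// det_tr; case: h. Qed.

Lemma SO3_SL3 x : SO3 x -> SL3 x.
Proof. by case. Qed.

Lemma SO3_sq x : SO3 x -> forall a, \sum_b x a b ^+ 2 = 1.
Proof.
move=> [h _] a; have /matrixP/(_ a a) := h; rewrite !mxE eqxx mulr1n => <-.
by apply: eq_bigr => b _; rewrite mxE expr2.
Qed.

Lemma SO3_le1 x a b : SO3 x -> `|x a b| <= 1.
Proof.
move=> /SO3_sq/(_ a); rewrite (bigD1 b)//= => h.
rewrite -(@expr_le1 _ 2)// real_normK ?num_real// -h lerDl.
by apply: sumr_ge0 => ? _; rewrite sqr_ge0.
Qed.

(** The adjugate of a rotation is its transpose, so the first row is the cross product of the other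
    two. This recovers the row that left multiplication by N disturbs. *)
Lemma SO3_row1 x : SO3 x ->
  [/\ x i0 i0 = x i1 i1 * x i2 i2 - x i1 i2 * x i2 i1,
      x i0 i1 = - (x i1 i0 * x i2 i2 - x i1 i2 * x i2 i0)
    & x i0 i2 = x i1 i0 * x i2 i1 - x i1 i1 * x i2 i0].
Proof.
move=> h; have [hx dx] := h.
have h3 : x *m \adj x = 1%:M by rewrite mul_mx_adj dx.
have e : \adj x = x^T.
  by rewrite -[LHS]mul1mx -(SO3_Tm h) -mulmxA h3 mulmx1.
have /matrixP e' := e.
have := e' i0 i0; have := e' i1 i0; have := e' i2 i0.
rewrite !mxE /cofactor !det2 !mxE /= => <- <- <-; split.
- rewrite mul1r; by congr (x _ _ * x _ _ - x _ _ * x _ _); apply: val_inj.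
- by rewrite expr1 mulN1r; congr (- (x _ _ * x _ _ - x _ _ * x _ _)); apply: val_inj.
- by rewrite sqrrN expr1n mul1r; congr (x _ _ * x _ _ - x _ _ * x _ _); apply: val_inj.
Qed.

Lemma SO3_of_rows (p q : 'I_3 -> R) :
  p i0 ^+ 2 + p i1 ^+ 2 + p i2 ^+ 2 = 1 -> q i0 ^+ 2 + q i1 ^+ 2 + q i2 ^+ 2 = 1 ->
  p i0 * q i0 + p i1 * q i1 + p i2 * q i2 = 0 ->
  SO3 (mx_of_rows 3 3 [:: [:: p i1 * q i2 - p i2 * q i1; p i2 * q i0 - p i0 * q i2; p i0 * q i1 - p i1 * q i0];
    [:: p i0; p i1; p i2]; [:: q i0; q i1; q i2]]).
Proof.
set a := p i0; set b := p i1; set c := p i2; set d := q i0; set e := q i1; set f := q i2.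
move=> hp hq hpq.
(* Lagrange's identity for the squared length of a cross product. *)
have hd : (b * f - c * e) ^+ 2 + (c * d - a * f) ^+ 2 + (a * e - b * d) ^+ 2 = 1.
  transitivity ((a ^+ 2 + b ^+ 2 + c ^+ 2) * (d ^+ 2 + e ^+ 2 + f ^+ 2) - (a * d + b * e + c * f) ^+ 2); first ring.
  by rewrite hp hq hpq; ring.
split; last by rewrite det3 !mxE /= -hd; ring.
apply: mx3P; rewrite !mxE !sum3 !mxE /=; try ring.
- by rewrite -[RHS]hd; ring.
- by rewrite -[RHS]hp; ring.
- by rewrite -[RHS]hpq; ring.
- by rewrite -[RHS]hpq; ring.
- by rewrite -[RHS]hq; ring.
Qed.

(** Left multiplication by N changes the first row only. The other factors are therefore read off
    the last two rows p, q of g: their Gram matrix is exp (-2 s) m m^T, and k is what is left after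
    removing a and m. *)
Lemma dec1_exists (g : 'M[R]_3) : SL3 g -> exists n s a b k,
  [/\ Nrad P1 n, SO3 k & g = n *m pdec1 s a b *m k].
Proof.
rewrite /SL3 /= => dg.
pose p j := g i1 j; pose q j := g i2 j.
pose q22 := p i0 ^+ 2 + p i1 ^+ 2 + p i2 ^+ 2.
pose q33 := q i0 ^+ 2 + q i1 ^+ 2 + q i2 ^+ 2.
pose q23 := p i0 * q i0 + p i1 * q i1 + p i2 * q i2.
pose D := q22 * q33 - q23 ^+ 2.
pose c0 := p i1 * q i2 - p i2 * q i1; pose c1 := p i2 * q i0 - p i0 * q i2.
pose c2 := p i0 * q i1 - p i1 * q i0.
have eD : D = c0 ^+ 2 + c1 ^+ 2 + c2 ^+ 2.
  by rewrite /D /q22 /q33 /q23 /c0 /c1 /c2; ring.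
have dg' : g i0 i0 * c0 + g i0 i1 * c1 + g i0 i2 * c2 = 1.
  by rewrite -dg det3 /c0 /c1 /c2 /p /q; ring.
have D0 : 0 < D.
  rewrite lt_neqAle eD !addr_ge0 ?sqr_ge0// andbT eq_sym.
  apply/eqP => h.
  have [h0 h1 h2] : [/\ c0 = 0, c1 = 0 & c2 = 0].
    move/eqP: h; rewrite !paddr_eq0 ?addr_ge0 ?sqr_ge0//.
    by rewrite !sqrf_eq0 => /andP[/andP[/eqP -> /eqP ->] /eqP ->].
  by move/eqP: dg'; rewrite h0 h1 h2 !mulr0 !addr0 eq_sym oner_eq0.
have q220 : 0 <= q22 by rewrite !addr_ge0 ?sqr_ge0.
have q330 : 0 <= q33 by rewrite !addr_ge0 ?sqr_ge0.
have qq : 0 < q22 * q33 by apply: lt_le_trans D0 _; rewrite /D gerBl sqr_ge0.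
have {}q220 : 0 < q22 by rewrite lt_neqAle q220 andbT eq_sym; apply/eqP => h; move: qq; rewrite h mul0r ltxx.
have {}q330 : 0 < q33 by rewrite lt_neqAle q330 andbT eq_sym; apply/eqP => h; move: qq; rewrite h mulr0 ltxx.
(* The determinant of the Gram matrix is exp (-4 s), and the quotient of its diagonal entries is exp
   (4 a). *)
pose s := - (ln D / 4); pose a := ln (q22 / q33) / 4.
pose E := expR s; pose A := expR a.
have E0 : 0 < E by exact: expR_gt0.
have A0 : 0 < A by exact: expR_gt0.
have hE : E ^+ 4 * D = 1.
  rewrite -expRM_natl /s -[X in _ * X](lnK D0) -expRD -[RHS]expR0; congr expR.
  by field.
have hA : A ^+ 4 * q33 = q22.
  have -> : A ^+ 4 = q22 / q33.
    rewrite -expRM_natl -[RHS]lnK ?posrE ?divr_gt0//; congr expR.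
    by rewrite /a; field.
  by rewrite divfK// gt_eqF.
(* The off-diagonal entry is exp (-2 s) sinh (2 b): y stands for sinh (2 b), w for cosh (2 b), and b
   is half the inverse hyperbolic sine of y. *)
pose y := q23 * E ^+ 2.
have yy : 0 < 1 + y ^+ 2 by rewrite ltr_wpDr ?sqr_ge0.
pose w : R := Num.sqrt (1 + y ^+ 2).
have w2 : w ^+ 2 = 1 + y ^+ 2 by rewrite sqr_sqrtr// ltW.
have w0 : 0 < w by rewrite sqrtr_gt0.
have yw : 0 < y + w by clear -w0 w2; nra.
pose b := ln (y + w) / 2.
have hb : expR b ^+ 2 = y + w.
  rewrite -expRM_natl -[RHS]lnK ?posrE//; congr expR.
  by rewrite /b; field.
have hb' : expR (- b) ^+ 2 = w - y.
  have h := expRNK b.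
  have : expR (- b) ^+ 2 * expR b ^+ 2 = (w - y) * (y + w).
    by rewrite -exprMn h expr1n; transitivity (w ^+ 2 - y ^+ 2); [rewrite w2|]; ring.
  by rewrite hb => /mulIf; apply; rewrite gt_eqF.
pose C := ch b; pose S := sh b.
have hCS : C ^+ 2 - S ^+ 2 = 1 by exact: ch2sh2.
have hC2 : C ^+ 2 + S ^+ 2 = w.
  rewrite /C /S /ch /sh; transitivity ((expR b ^+ 2 + expR (- b) ^+ 2) / 2); first by field.
  by rewrite hb hb'; field.
have hS2 : 2 * C * S = y.
  rewrite /C /S /ch /sh; transitivity ((expR b ^+ 2 - expR (- b) ^+ 2) / 2); first by field.
  by rewrite hb hb'; field.
have hw : w ^+ 2 = E ^+ 4 * (q22 * q33).
  rewrite w2 -hE /y /D; ring.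
have e22 : A ^+ 2 * w = E ^+ 2 * q22.
  have : (A ^+ 2 * w) ^+ 2 = (E ^+ 2 * q22) ^+ 2.
    by transitivity (E ^+ 4 * q22 * (A ^+ 4 * q33)); [rewrite exprMn hw | rewrite hA]; ring.
  by move/eqP; rewrite eqrXn2 ?mulr_ge0 ?exprn_ge0 ?ltW// => /eqP.
have e33 : w = E ^+ 2 * q33 * A ^+ 2.
  have A2 : A ^+ 2 != 0 by rewrite expf_neq0// gt_eqF.
  apply: (mulfI A2); rewrite e22.
  by transitivity (E ^+ 2 * (A ^+ 4 * q33)); [rewrite hA | ring].
pose Ai := expR (- a).
have hAi : Ai * A = 1 by exact: expRNK.
have e22' : E ^+ 2 * Ai ^+ 2 * q22 = w.
  by rewrite mulrAC -e22 mulrAC -exprMn [A * _]mulrC hAi expr1n mul1r.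
(* The last two rows of k: the rows p, q multiplied by exp (s) and the inverse of m. They are
   orthonormal by the choice of s, a and b. *)
pose k2 j := E * (C * Ai * p j - S * A * q j).
pose k3 j := E * (C * A * q j - S * Ai * p j).
have n2 : k2 i0 ^+ 2 + k2 i1 ^+ 2 + k2 i2 ^+ 2 = 1.
  transitivity (C ^+ 2 * (E ^+ 2 * Ai ^+ 2 * q22) - 2 * C * S * (Ai * A) * (q23 * E ^+ 2) + S ^+ 2 * (E ^+ 2 * q33 * A ^+ 2)).
    by rewrite /k2 /q22 /q33 /q23; ring.
  by rewrite e22' -e33 hAi -/y hS2; transitivity (w * (C ^+ 2 + S ^+ 2) - y ^+ 2); [ring | rewrite hC2 -expr2 w2; ring].
have n3 : k3 i0 ^+ 2 + k3 i1 ^+ 2 + k3 i2 ^+ 2 = 1.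
  transitivity (S ^+ 2 * (E ^+ 2 * Ai ^+ 2 * q22) - 2 * C * S * (Ai * A) * (q23 * E ^+ 2) + C ^+ 2 * (E ^+ 2 * q33 * A ^+ 2)).
    by rewrite /k3 /q22 /q33 /q23; ring.
  by rewrite e22' -e33 hAi -/y hS2; transitivity (w * (C ^+ 2 + S ^+ 2) - y ^+ 2); [ring | rewrite hC2 -expr2 w2; ring].
have n23 : k2 i0 * k3 i0 + k2 i1 * k3 i1 + k2 i2 * k3 i2 = 0.
  transitivity ((C ^+ 2 + S ^+ 2) * (Ai * A) * (q23 * E ^+ 2) - C * S * (E ^+ 2 * Ai ^+ 2 * q22) - C * S * (E ^+ 2 * q33 * A ^+ 2)).
    by rewrite /k2 /k3 /q22 /q33 /q23; ring.
  by rewrite e22' -e33 hAi -/y hC2 -hS2; ring.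
have := SO3_of_rows n2 n3 n23; set k := mx_of_rows _ _ _ => hk.
exists (g *m k^T *m pdec1i s a b), s, a, b, k; split => //; last first.
  by rewrite -(mulmxA (g *m k^T)) pdec1K mulmx1 -mulmxA SO3_Tm// mulmx1.
have Es : expR (2 * s) = E ^+ 2 by rewrite -expRM_natl.
have Esi : expR (- (2 * s)) * E ^+ 2 = 1 by rewrite -Es expRNK.
have g2 j : E ^+ 0 * p j = expR (- s) * (A * C * k2 j + A * S * k3 j).
  have := expRNK s; rewrite -/E => h.
  transitivity ((expR (- s) * E) * (Ai * A) * (C ^+ 2 - S ^+ 2) * p j); first by rewrite h hAi hCS; ring.
  by rewrite /k2 /k3; ring.
have g3 j : E ^+ 0 * q j = expR (- s) * (Ai * S * k2 j + Ai * C * k3 j).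
  have := expRNK s; rewrite -/E => h.
  transitivity ((expR (- s) * E) * (Ai * A) * (C ^+ 2 - S ^+ 2) * q j); first by rewrite h hAi hCS; ring.
  by rewrite /k2 /k3; ring.
pose M := g *m k^T *m pdec1i s a b.
have eg : g = M *m pdec1 s a b *m k.
  by rewrite /M -(mulmxA (g *m k^T)) pdec1K mulmx1 -mulmxA SO3_Tm// mulmx1.
have hkT : k *m k^T = 1 by case: hk.
(* The remaining factor agrees with the identity on its last two rows; the determinant then forces
   its corner entry to be 1, and it lies in N. *)
have rows (j : 'I_3) : j != i0 -> forall c, M j c = (j == c)%:R.
  move=> hj.
  suff hrow : row j g = row j (pdec1 s a b *m k).
    move=> c; have -> : M j c = row j M 0 c by rewrite [RHS]mxE.
    rewrite /M row_mul row_mul hrow -row_mul -row_mul -mulmxA.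
    by rewrite -(mulmxA (pdec1 s a b)) (mulmxA k) hkT mul1mx pdec1Kr !mxE.
  apply/rowP => c; rewrite !mxE sum3 pdec1E !mxE.
  move: (g2 c) (g3 c); rewrite !expr0 !mul1r /p /q => h2 h3.
  have kc (f : 'I_3 -> R) : [:: f i0; f i1; f i2]`_c = f c.
    by case: c {h2 h3} => [[|[|[|c]]]] hc //=; congr f; apply: val_inj.
  case: j hj h2 h3 => [[|[|[|j]]]] hj // _ h2 h3.
    by rewrite (bool_irrelevance hj isT) h2 /= !kc /A /C /S; ring.
  by rewrite (bool_irrelevance hj isT) h3 /= !kc /Ai /C /S; ring.
apply/Nrad1P; exists (M i0 i1), (M i0 i2).
have hdet : \det M = 1.
  move: (congr1 determinant eg); rewrite (det_mulmx _ k) (det_mulmx M) det_pdec1 dg mulr1.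
  by case: hk => _ ->; rewrite mulr1.
have h00 : M i0 i0 = 1.
  by move: hdet; rewrite det3 !(rows i1)// !(rows i2)//= => <-; ring.
rewrite -/M; clearbody M; apply: mx3P; rewrite [RHS]mxE /= ?(rows i1) ?(rows i2) //.
Qed.

Lemma NAM1E (u v s : R) (h : 'M[R]_2) :
  mx_of_rows 3 3 [:: [:: 1; u; v]; [:: 0; 1; 0]; [:: 0; 0; 1]] *m mexp (s *: Hmx R P1) *m m_emb P1 h =
  mx_of_rows 3 3 [:: [:: expR (2 * s) / \det h; expR (- s) * (u * h j0 j0 + v * h j1 j0);
       expR (- s) * (u * h j0 j1 + v * h j1 j1)];
    [:: 0; expR (- s) * h j0 j0; expR (- s) * h j0 j1];
    [:: 0; expR (- s) * h j1 j0; expR (- s) * h j1 j1]].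
Proof.
rewrite mexp_H1 m_emb1E -[LHS]mulmxA.
set B := (X in _ *m X = _).
have -> : B = mx_of_rows 3 3 [:: [:: expR (2 * s) / \det h; 0; 0];
    [:: 0; expR (- s) * h j0 j0; expR (- s) * h j0 j1];
    [:: 0; expR (- s) * h j1 j0; expR (- s) * h j1 j1]].
  by apply: mx3P; rewrite /B !mxE sum3 !mxE /= ?(mul0r, mulr0, add0r, addr0).
by apply: mx3P; rewrite !mxE sum3 !mxE /= ?(mul0r, mulr0, add0r, addr0, mul1r) //; ring.
Qed.

(** k' k^-1 lies in P_1 and in K. Its first column vanishes below the diagonal, hence, the rows and
    columns being unit vectors, so does its first row off the diagonal: it is the image of an
    element of O(2). *)
Lemma dec1_unique (n n' k k' : 'M[R]_3) (h h' : 'M[R]_2) s s' :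
  Nrad P1 n -> Nrad P1 n' -> SO3 k -> SO3 k' -> SLpm h -> SLpm h' ->
  n *m mexp (s *: Hmx R P1) *m m_emb P1 h *m k =
  n' *m mexp (s' *: Hmx R P1) *m m_emb P1 h' *m k' ->
  s = s' /\ exists o, [/\ O2 o, k' = m_emb P1 o *m k & h = h' *m o].
Proof.
move=> /Nrad1P[u [v hn]] /Nrad1P[u' [v' hn']] hk hk' hh hh' e.
have [q [hq eq' {}e]] : exists q, [/\ SO3 q, k' = q *m k &
    n *m mexp (s *: Hmx R P1) *m m_emb P1 h =
    n' *m mexp (s' *: Hmx R P1) *m m_emb P1 h' *m q].
  have kT : k *m k^T = 1%:M by case: hk.
  exists (k' *m k^T); split; first exact: SO3_M hk' (SO3_T hk).
    by rewrite -mulmxA SO3_Tm// mulmx1.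
  by rewrite mulmxA -e -[RHS]mulmxA kT mulmx1.
have hd' : \det h' != 0 by case: hh' => ->; rewrite ?oppr_eq0 oner_eq0.
have ss := expR_gt0 (- s); have ss' := expR_gt0 (- s').
move: e; rewrite hn hn' !NAM1E => /matrixP e.
have e10 := e i1 i0; have e11 := e i1 i1; have e12 := e i1 i2.
have e20 := e i2 i0; have e21 := e i2 i1; have e22 := e i2 i2.
move: e10 e11 e12 e20 e21 e22 {e}.
rewrite !mxE !sum3 !mxE /= !(mul0r, mulr0, add0r, addr0).
set E := expR (- s) in ss *; set E' := expR (- s') in ss' *.
move=> e10 e11 e12 e20 e21 e22.
have D := det2 h'; have hE : E' * \det h' != 0 by rewrite mulf_neq0// gt_eqF.
have q1 : q i1 i0 = 0.
  apply: (mulfI hE); rewrite mulr0 D.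
  transitivity (h' j1 j1 * (E' * h' j0 j0 * q i1 i0 + E' * h' j0 j1 * q i2 i0)
     - h' j0 j1 * (E' * h' j1 j0 * q i1 i0 + E' * h' j1 j1 * q i2 i0)); first by ring.
  by rewrite -e10 -e20; ring.
have q2 : q i2 i0 = 0.
  apply: (mulfI hE); rewrite mulr0 D.
  transitivity (h' j0 j0 * (E' * h' j1 j0 * q i1 i0 + E' * h' j1 j1 * q i2 i0)
     - h' j1 j0 * (E' * h' j0 j0 * q i1 i0 + E' * h' j0 j1 * q i2 i0)); first by ring.
  by rewrite -e10 -e20; ring.
have := SO3_sq (SO3_T hq) i0; rewrite sum3 !mxE q1 q2 expr0n !addr0 => q00.
have := SO3_sq hq i0; rewrite sum3 q00 => q0.
have {q0}[q01 q02] : q i0 i1 = 0 /\ q i0 i2 = 0.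
  have : q i0 i1 ^+ 2 + q i0 i2 ^+ 2 == 0 by apply/eqP; lra.
  by rewrite paddr_eq0 ?sqr_ge0// !sqrf_eq0 => /andP[/eqP -> /eqP ->].
pose o : 'M[R]_2 := mx_of_rows 2 2 [:: [:: q i1 i1; q i1 i2]; [:: q i2 i1; q i2 i2]].
have [hq1 hq2] := hq.
have ho : O2 o.
  have /matrixP hqm := hq1.
  move: (hqm i1 i1) (hqm i1 i2) (hqm i2 i1) (hqm i2 i2).
  rewrite !mxE !sum3 !mxE q1 q2 !mul0r !add0r => a1 a2 a3 a4.
  by apply: mx2P; rewrite !mxE !sum2 !mxE.
have dto : q i0 i0 * \det o = 1.
  by rewrite -hq2 det3 det2 !mxE /= q1 q2 q01 q02; ring.
have do2 : \det o ^+ 2 = 1.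
  by rewrite -[LHS]mul1r -q00 -exprMn dto expr1n.
have eq : q = m_emb P1 o.
  rewrite m_emb1E; apply: mx3P; rewrite !mxE //=.
  by rewrite -[RHS]mul1r -dto mulfK// -sqrf_eq0 do2 oner_eq0.
have eo : E *: h = E' *: (h' *m o).
  by apply: mx2P; rewrite !mxE !sum2 !mxE /= ?e11 ?e12 ?e21 ?e22; ring.
(* h, h' and o have determinant 1 or -1, so the squared determinants compare the factors in A. *)
have EE : E ^+ 4 = E' ^+ 4.
  have : (\det (E *: h)) ^+ 2 = (\det (E' *: (h' *m o))) ^+ 2 by rewrite eo.
  rewrite !detZ det_mulmx !exprMn do2.
  have -> : \det h ^+ 2 = 1 by case: hh => ->; rewrite ?sqrrN expr1n.
  have -> : \det h' ^+ 2 = 1 by case: hh' => ->; rewrite ?sqrrN expr1n.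
  by rewrite !mulr1 -!exprD.
have EE' : E = E' by apply/eqP; rewrite -(eqrXn2 (n := 4)) ?ltW// EE.
split; first by apply: oppr_inj; apply: expR_inj.
exists o; split=> //; first by rewrite eq' eq.
by move: eo; rewrite EE'; apply: scalerI; rewrite gt_eqF.
Qed.

End Orthogonal.

Lemma sum8_bound (R : realFieldType) (C1 C2 C3 C4 C5 C6 C7 C8 : R) : 0 <= C1 -> 0 <= C2 -> 0 <= C3 -> 0 <= C4 ->
  0 <= C5 -> 0 <= C6 -> 0 <= C7 -> 0 <= C8 -> let C := C1 + C2 + C3 + C4 + C5 + C6 + C7 + C8 in
  [/\ C1 <= C, C2 <= C, C3 <= C & C4 <= C] /\ [/\ C5 <= C, C6 <= C, C7 <= C & C8 <= C].
Proof. by move=> h1 h2 h3 h4 h5 h6 h7 h8 C; split; rewrite /C; split; lra. Qed.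

(** * First-order expansion of the decomposition [n a m k] *)

(** This and the next lemmas are the numerical estimates behind [bnd4], the entries of B - 1 being
    at most 1/100 in absolute value; that bound keeps all exponentials within 1/2 of 1. *)
Lemma bnd3 (R : realFieldType) (x y z x' y' z' : R) :
  `|x| <= 100^-1 -> `|y| <= 100^-1 -> `|z| <= 100^-1 ->
  `|x'| <= 100^-1 -> `|y'| <= 100^-1 -> `|z'| <= 100^-1 ->
  `|x * x' + y * y' + z * z'| <= 3 / 1000.
Proof.
move=> h1 h2 h3 h4 h5 h6.
have P (u v : R) : `|u| <= 100^-1 -> `|v| <= 100^-1 -> `|u * v| <= 1000^-1.
  move=> hu hv; rewrite normrM; apply: (@le_trans _ _ (100^-1 * 100^-1)); last by lra.
  exact: ler_pM.
have := P _ _ h1 h4; have := P _ _ h2 h5; have := P _ _ h3 h6.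
have := ler_normD (x * x' + y * y') (z * z'); have := ler_normD (x * x') (y * y').
lra.
Qed.

Lemma bnd_sq (R : realFieldType) (x y : R) : `|x| <= 100^-1 -> `|y| <= 3 / 1000 -> `|1 + 2 * x + y - 1| <= 40^-1.
Proof. by rewrite !ler_norml => /andP[? ?] /andP[? ?]; apply/andP; split; lra. Qed.

Lemma bnd_dot (R : realFieldType) (x x' y : R) :
  `|x| <= 100^-1 -> `|x'| <= 100^-1 -> `|y| <= 3 / 1000 -> `|x + x' + y| <= 40^-1.
Proof. by rewrite !ler_norml => /andP[? ?] /andP[? ?] /andP[? ?]; apply/andP; split; lra. Qed.

Lemma bnd_det (R : realFieldType) (x y z : R) : `|x - 1| <= 40^-1 ->
  `|y - 1| <= 40^-1 -> `|z| <= 40^-1 -> `|x * y - z ^+ 2 - 1| <= 2^-1.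
Proof. by rewrite !ler_norml => /andP[? ?] /andP[? ?] /andP[? ?]; apply/andP; split; nra. Qed.

Lemma bnd_quot (R : realFieldType) (x y e : R) : e * y = x -> `|x - 1| <= 40^-1 ->
  `|y - 1| <= 40^-1 -> `|e - 1| <= 2^-1.
Proof. by rewrite !ler_norml => ? /andP[? ?] /andP[? ?]; apply/andP; split; nra. Qed.

Section BigO.
Variables (R : realType) (T : Type) (dom : T -> Prop) (eta : T -> R).
Hypothesis eta01 : forall t, dom t -> 0 <= eta t <= 1.
Implicit Types f g : T -> R.

(** One constant serves the whole domain. When T is the type of all tuples (B, k, s, a, b, h), such
    a bound holds uniformly over all decompositions of matrices B whose entries are within h of
    those of the identity. *)
Definition bigO (n : nat) f := exists C, forall t, dom t -> `|f t| <= C * eta t ^+ n.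

Lemma bigO_pos n f : bigO n f -> exists2 C, 0 <= C & forall t, dom t -> `|f t| <= C * eta t ^+ n.
Proof.
move=> [C h]; exists `|C| => // t ht; apply: le_trans (h t ht) _.
by rewrite ler_wpM2r ?ler_norm// exprn_ge0//; case/andP: (eta01 ht).
Qed.

Lemma bigO_dom n f g : (forall t, dom t -> `|f t| <= `|g t|) -> bigO n g -> bigO n f.
Proof. by move=> h [C hC]; exists C => t ht; apply: le_trans (h t ht) (hC t ht). Qed.

Lemma bigO_ext n f g : (forall t, dom t -> f t = g t) -> bigO n g -> bigO n f.
Proof. by move=> h; apply: bigO_dom => t ht; rewrite h. Qed.

Lemma bigOD n f g : bigO n f -> bigO n g -> bigO n (fun t => f t + g t).
Proof.
move=> [C hC] [D hD]; exists (C + D) => t ht; rewrite mulrDl.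
by apply: le_trans (ler_normD _ _) _; apply: lerD; [exact: hC|exact: hD].
Qed.

Lemma bigON n f : bigO n f -> bigO n (fun t => - f t).
Proof. by move=> [C hC]; exists C => t ht; rewrite normrN; exact: hC. Qed.

Lemma bigOB n f g : bigO n f -> bigO n g -> bigO n (fun t => f t - g t).
Proof. by move=> hf hg; exact: bigOD hf (bigON hg). Qed.

Lemma bigOM n m f g : bigO n f -> bigO m g -> bigO (n + m) (fun t => f t * g t).
Proof.
move=> /bigO_pos[C C0 hC] /bigO_pos[D D0 hD]; exists (C * D) => t ht.
by rewrite normrM exprD mulrACA ler_pM// ?hC ?hD.
Qed.

Lemma bigO_cst c : bigO 0 (fun=> c).
Proof. by exists `|c| => t _; rewrite expr0 mulr1. Qed.

Lemma bigO_weak n m f : (m <= n)%N -> bigO n f -> bigO m f.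
Proof.
move=> mn /bigO_pos[C C0 hC]; exists C => t ht; apply: le_trans (hC t ht) _.
by rewrite ler_wpM2l// ler_wiXn2l//; case/andP: (eta01 ht).
Qed.

Lemma bigOZ n c f : bigO n f -> bigO n (fun t => c * f t).
Proof. by move=> h; have := bigOM (bigO_cst c) h; rewrite add0n. Qed.

Lemma bigO11 f g : bigO 1 f -> bigO 1 g -> bigO 2 (fun t => f t * g t).
Proof. exact: bigOM. Qed.

(** Only exp (x) >= 1 + x and exp (-x) >= 1 - x are used. The second alternative is what [bigO_log]
    has to exclude, and the reason why B is kept close to 1. *)
Lemma expR_sub1_le (x : R) : `|x| <= 2 * `|expR x - 1| \/ `|expR x - 1| > 2^-1.
Proof.
have h1 := expR_ge1Dx x; have h2 := expR_ge1Dx (- x).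
have h := expRN x; have h0 := expR_gt0 x.
have hh : expR x * expR (- x) = 1 by rewrite -expRD subrr expR0.
have [hs|hs] := leP `|expR x - 1| 2^-1; last by right.
left; have [x0|x0] := leP 0 x.
  rewrite ger0_norm// ger0_norm; last by lra.
  by lra.
rewrite ltr0_norm// ler0_norm; last by rewrite subr_le0 -expR0 ler_expR ltW.
move: hs; rewrite ler_norml => /andP[hs1 hs2].
have : expR x * (1 - x) <= 1 by rewrite -[leRHS]hh ler_wpM2l// ltW.
move: (expR x) hs1 => e; nra.
Qed.

(** exp (x) >= 1 + x and exp (-x) >= 1 - x give 0 <= exp (x) - 1 - x <= x (exp (x) - 1): the Taylor
    error is a product of two first-order quantities. *)
Lemma expR_taylor (x : R) : `|expR x - 1 - x| <= `|x * (expR x - 1)|.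
Proof.
have h1 := expR_ge1Dx x; have h2 := expR_ge1Dx (- x); have h0 := expR_gt0 x.
have hh : expR x * expR (- x) = 1 by rewrite -expRD subrr expR0.
have h3 : expR x * (1 - x) <= 1 by rewrite -[leRHS]hh ler_wpM2l// ltW.
rewrite ger0_norm; last by lra.
apply: le_trans (ler_norm _); move: h3; rewrite mulrBr mulrBr; lra.
Qed.

Lemma expR_sub1_bound (x : R) : `|expR x - 1| <= `|x| * (1 + expR `|x|).
Proof.
have h1 := expR_ge1Dx x; have h2 := expR_ge1Dx (- x); have h0 := expR_gt0 x.
have hh : expR x * expR (- x) = 1 by rewrite -expRD subrr expR0.
have h3 : expR x * (1 - x) <= 1 by rewrite -[leRHS]hh ler_wpM2l// ltW.
have [x0|x0] := leP 0 x.
  rewrite (ger0_norm x0) ger0_norm; last by lra.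
  by move: h3; rewrite mulrBr mulr1 mulrDr mulr1 [expR x * x]mulrC; lra.
rewrite (ltr0_norm x0) ler0_norm; last by rewrite subr_le0 -expR0 ler_expR ltW.
rewrite mulrDr mulr1.
have : 0 <= - x * expR (- x) by rewrite mulr_ge0 ?expR_ge0// oppr_ge0 ltW.
by lra.
Qed.

Lemma bigO_exp1 f : bigO 1 f -> bigO 1 (fun t => expR (f t) - 1).
Proof.
move=> /bigO_pos[C C0 hC]; exists (C * (1 + expR C)) => t ht.
have /andP[e0 e1] := eta01 ht; have := hC t ht; rewrite expr1 => hf.
apply: le_trans (expR_sub1_bound _) _; rewrite mulrAC.
apply: ler_pM => //; rewrite ?addr_ge0 ?expR_ge0//.
by rewrite lerD2l ler_expR; apply: le_trans hf _; rewrite ler_piMr.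
Qed.

Lemma bigO_exp2 f : bigO 1 f -> bigO 2 (fun t => expR (f t) - 1 - f t).
Proof.
move=> hf; apply: (@bigO_dom _ _ (fun t => f t * (expR (f t) - 1))) => [t _|].
  exact: expR_taylor.
exact: bigO11 hf (bigO_exp1 hf).
Qed.

Lemma bigO_log f : (forall t, dom t -> `|expR (f t) - 1| <= 2^-1) ->
  bigO 1 (fun t => expR (f t) - 1) -> bigO 1 f.
Proof.
move=> hs /(bigOZ 2); apply: bigO_dom => t ht.
rewrite normrM (ger0_norm (_ : 0 <= 2 :> R))//.
by case: (expR_sub1_le (f t)) => // h; have := hs t ht; rewrite leNgt h.
Qed.

Lemma bigO_expbd f : bigO 1 f -> bigO 0 (fun t => expR (f t)).
Proof.
move=> /bigO_exp1/(bigO_weak (leq0n 1)) h.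
by apply: bigO_ext (bigOD h (bigO_cst 1)) => t _; rewrite subrK.
Qed.

Section FirstOrder.
Variables (B k : T -> 'M[R]_3) (s a b : T -> R).
Hypothesis hk : forall t, dom t -> SO3 (k t).
Hypothesis hdec : forall t, dom t -> exists2 n, Nrad P1 n & B t = n *m pdec1 (s t) (a t) (b t) *m k t.
Hypothesis hB : forall t, dom t -> forall c d, `|B t c d - (c == d)%:R| <= eta t.
Hypothesis eta_small : forall t, dom t -> eta t <= 100^-1.

Let H c d t := B t c d - (c == d)%:R.
Let hH c d : bigO 1 (H c d).
Proof. by exists 1 => t ht; rewrite mul1r expr1; exact: hB. Qed.

Let detB t : dom t -> \det (B t) = 1.
Proof.
move=> ht; have [n /Nrad1P[u [v ->]] ->] := hdec ht.
rewrite (det_mulmx _ (k t)) (det_mulmx _ (pdec1 _ _ _)) det_pdec1 (_ : \det (k t) = 1); last by case: (hk ht).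
by rewrite det3 !mxE /=; ring.
Qed.

(** The Gram matrix of the last two rows of B, on which the factor n has no effect. It equals exp
    (-2 s) m m^T, so that q22 / q33 = exp (4 a), q23 = exp (-2 s) sinh (2 b), and its determinant is
    exp (-4 s). *)
Let q22 t := B t i1 i0 ^+ 2 + B t i1 i1 ^+ 2 + B t i1 i2 ^+ 2.
Let q33 t := B t i2 i0 ^+ 2 + B t i2 i1 ^+ 2 + B t i2 i2 ^+ 2.
Let q23 t := B t i1 i0 * B t i2 i0 + B t i1 i1 * B t i2 i1 + B t i1 i2 * B t i2 i2.

Let rowsB t : dom t -> forall c,
  B t i1 c = expR (- s t) * expR (a t) * (ch (b t) * k t i1 c + sh (b t) * k t i2 c) /\
  B t i2 c = expR (- s t) * expR (- a t) * (sh (b t) * k t i1 c + ch (b t) * k t i2 c).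
Proof.
move=> ht c; have [n /Nrad1P[u [v ->]] ->] := hdec ht.
set N := mx_of_rows _ _ _.
have -> : N *m pdec1 (s t) (a t) (b t) *m k t = N *m (pdec1 (s t) (a t) (b t) *m k t) by rewrite mulmxA.
by rewrite pdec1E !mxE !sum3 !mxE !sum3 !mxE /=; split; ring.
Qed.

Let ss t : expR (- s t) * expR (s t) = 1. Proof. exact: expRNK. Qed.
Let aa t : expR (- a t) * expR (a t) = 1. Proof. exact: expRNK. Qed.
Let bb t := ch2sh2 (b t).

Let orthk t : dom t ->
  [/\ k t i1 i0 ^+ 2 + k t i1 i1 ^+ 2 + k t i1 i2 ^+ 2 = 1,
      k t i2 i0 ^+ 2 + k t i2 i1 ^+ 2 + k t i2 i2 ^+ 2 = 1 &
      k t i1 i0 * k t i2 i0 + k t i1 i1 * k t i2 i1 + k t i1 i2 * k t i2 i2 = 0].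
Proof.
move=> ht; have h := hk ht; split.
- by have := SO3_sq h i1; rewrite sum3.
- by have := SO3_sq h i2; rewrite sum3.
- by have [/matrixP/(_ i1 i2) h1 _] := h; move: h1; rewrite !mxE sum3 !mxE.
Qed.

Let q22E t : dom t -> q22 t = (expR (- s t) * expR (a t)) ^+ 2 * (ch (b t) ^+ 2 + sh (b t) ^+ 2).
Proof.
move=> ht; have [h1 h2 h3] := orthk ht; rewrite /q22.
have [-> _] := rowsB ht i0; have [-> _] := rowsB ht i1; have [-> _] := rowsB ht i2.
transitivity ((expR (- s t) * expR (a t)) ^+ 2 * (ch (b t) ^+ 2 * (k t i1 i0 ^+ 2 + k t i1 i1 ^+ 2 + k t i1 i2 ^+ 2) + 2 * ch (b t) * sh (b t) * (k t i1 i0 * k t i2 i0 + k t i1 i1 * k t i2 i1 + k t i1 i2 * k t i2 i2) + sh (b t) ^+ 2 * (k t i2 i0 ^+ 2 + k t i2 i1 ^+ 2 + k t i2 i2 ^+ 2))); first by ring.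
by rewrite h1 h2 h3; ring.
Qed.

Let q33E t : dom t -> q33 t = (expR (- s t) * expR (- a t)) ^+ 2 * (ch (b t) ^+ 2 + sh (b t) ^+ 2).
Proof.
move=> ht; have [h1 h2 h3] := orthk ht; rewrite /q33.
have [_ ->] := rowsB ht i0; have [_ ->] := rowsB ht i1; have [_ ->] := rowsB ht i2.
transitivity ((expR (- s t) * expR (- a t)) ^+ 2 * (sh (b t) ^+ 2 * (k t i1 i0 ^+ 2 + k t i1 i1 ^+ 2 + k t i1 i2 ^+ 2) + 2 * ch (b t) * sh (b t) * (k t i1 i0 * k t i2 i0 + k t i1 i1 * k t i2 i1 + k t i1 i2 * k t i2 i2) + ch (b t) ^+ 2 * (k t i2 i0 ^+ 2 + k t i2 i1 ^+ 2 + k t i2 i2 ^+ 2))); first by ring.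
by rewrite h1 h2 h3; ring.
Qed.

Let q23E t : dom t -> q23 t = expR (- s t) ^+ 2 * (2 * ch (b t) * sh (b t)).
Proof.
move=> ht; have [h1 h2 h3] := orthk ht; rewrite /q23.
have [-> ->] := rowsB ht i0; have [-> ->] := rowsB ht i1; have [-> ->] := rowsB ht i2.
transitivity (expR (- s t) ^+ 2 * (expR (- a t) * expR (a t)) * (ch (b t) * sh (b t) * (k t i1 i0 ^+ 2 + k t i1 i1 ^+ 2 + k t i1 i2 ^+ 2) + (ch (b t) ^+ 2 + sh (b t) ^+ 2) * (k t i1 i0 * k t i2 i0 + k t i1 i1 * k t i2 i1 + k t i1 i2 * k t i2 i2) + ch (b t) * sh (b t) * (k t i2 i0 ^+ 2 + k t i2 i1 ^+ 2 + k t i2 i2 ^+ 2))); first by ring.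
by rewrite h1 h2 h3 aa; ring.
Qed.

Let expMn (x : R) n : expR (n%:R * x) = expR x ^+ n. Proof. exact: expRM_natl. Qed.

Let deltaE t : dom t -> q22 t * q33 t - q23 t ^+ 2 = expR (- (4 * s t)).
Proof.
move=> ht; rewrite q22E// q33E// q23E// (_ : - (4 * s t) = 4%:R * (- s t)); last by ring.
rewrite expMn; transitivity (expR (- s t) ^+ 4 * ((expR (- a t) * expR (a t)) ^+ 2 * ((ch (b t) ^+ 2 + sh (b t) ^+ 2) ^+ 2) - 4 * (ch (b t) * sh (b t)) ^+ 2)); first by ring.
by rewrite aa; transitivity (expR (- s t) ^+ 4 * (ch (b t) ^+ 2 - sh (b t) ^+ 2) ^+ 2); [ring | rewrite bb; ring].
Qed.

Let hHs t : dom t -> forall c d, - 100^-1 <= H c d t <= 100^-1.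
Proof.
by move=> ht c d; rewrite -ler_norml; apply: le_trans (hB ht c d) (eta_small ht).
Qed.

Let BH t c d : B t c d = H c d t + (c == d)%:R. Proof. by rewrite /H subrK. Qed.

Let q22H t : q22 t = 1 + 2 * H i1 i1 t + (H i1 i0 t * H i1 i0 t + H i1 i1 t * H i1 i1 t + H i1 i2 t * H i1 i2 t).
Proof. by rewrite /q22 !BH /=; ring. Qed.
Let q33H t : q33 t = 1 + 2 * H i2 i2 t + (H i2 i0 t * H i2 i0 t + H i2 i1 t * H i2 i1 t + H i2 i2 t * H i2 i2 t).
Proof. by rewrite /q33 !BH /=; ring. Qed.
Let q23H t : q23 t = (H i1 i2 t + H i2 i1 t) + (H i1 i0 t * H i2 i0 t + H i1 i1 t * H i2 i1 t + H i1 i2 t * H i2 i2 t).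
Proof. by rewrite /q23 !BH /=; ring. Qed.

Let o2HH c d c' d' : bigO 2 (fun t => H c d t * H c' d' t).
Proof. exact: bigO11. Qed.

Let o2q22 : bigO 2 (fun t => q22 t - 1 - 2 * H i1 i1 t).
Proof.
apply: (bigO_ext (g := fun t => H i1 i0 t * H i1 i0 t + H i1 i1 t * H i1 i1 t + H i1 i2 t * H i1 i2 t)).
  by move=> t _; rewrite q22H; ring.
by do 2?apply: bigOD.
Qed.
Let o2q33 : bigO 2 (fun t => q33 t - 1 - 2 * H i2 i2 t).
Proof.
apply: (bigO_ext (g := fun t => H i2 i0 t * H i2 i0 t + H i2 i1 t * H i2 i1 t + H i2 i2 t * H i2 i2 t)).
  by move=> t _; rewrite q33H; ring.
by do 2?apply: bigOD.
Qed.
Let o2q23 : bigO 2 (fun t => q23 t - (H i1 i2 t + H i2 i1 t)).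
Proof.
apply: (bigO_ext (g := fun t => H i1 i0 t * H i2 i0 t + H i1 i1 t * H i2 i1 t + H i1 i2 t * H i2 i2 t)).
  by move=> t _; rewrite q23H; ring.
by do 2?apply: bigOD.
Qed.

Let o1_of f g : bigO 2 (fun t => f t - g t) -> bigO 1 g -> bigO 1 f.
Proof.
move=> /(bigO_weak (isT : (1 <= 2)%N)) h1 h2.
by apply: bigO_ext (bigOD h1 h2) => t _; rewrite subrK.
Qed.

Let o1q22 : bigO 1 (fun t => q22 t - 1).
Proof. exact: o1_of o2q22 (bigOZ 2 (hH _ _)). Qed.
Let o1q33 : bigO 1 (fun t => q33 t - 1).
Proof. exact: o1_of o2q33 (bigOZ 2 (hH _ _)). Qed.
Let o1q23 : bigO 1 q23.
Proof. exact: o1_of o2q23 (bigOD (hH _ _) (hH _ _)). Qed.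

Let o2s4 : bigO 2 (fun t => expR (- (4 * s t)) - 1 - (2 * H i1 i1 t + 2 * H i2 i2 t)).
Proof.
have h := bigOB (bigOD (bigOD o2q22 o2q33) (bigO11 o1q22 o1q33)) (bigO11 o1q23 o1q23).
by apply: bigO_ext h => t ht; rewrite -deltaE//; ring.
Qed.

Let o1s4 : bigO 1 (fun t => expR (- (4 * s t)) - 1).
Proof. by apply: o1_of o2s4 _; apply: bigOD; apply: bigOZ. Qed.

Let bnd4 t : dom t -> [/\ `|q22 t - 1| <= 40^-1, `|q33 t - 1| <= 40^-1 & `|q23 t| <= 40^-1].
Proof.
move=> ht; have hH' c d : `|H c d t| <= 100^-1 by rewrite ler_norml hHs.
rewrite q22H q33H q23H; split; [apply: bnd_sq | apply: bnd_sq | apply: bnd_dot] => //; exact: bnd3.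
Qed.

Let o1s : bigO 1 s.
Proof.
have h : bigO 1 (fun t => - (4 * s t)).
  apply: bigO_log o1s4 => t ht; rewrite -deltaE//.
  by have [h1 h2 h3] := bnd4 ht; exact: bnd_det.
by apply: bigO_ext (bigOZ (- 4^-1) h) => t _; field.
Qed.

(** In det B = 1 the terms of degree one in H = B - 1 form the trace; all the others are of degree
    two or three. *)
Let o2tr : bigO 2 (fun t => H i0 i0 t + H i1 i1 t + H i2 i2 t).
Proof.
have M c1 d1 c2 d2 c3 d3 : bigO 2 (fun t => H c1 d1 t * H c2 d2 t * H c3 d3 t).
  apply: bigO_weak (isT : (2 <= 3)%N) _.
  by apply: (bigOM (n := 2) (m := 1)) => //.
have W := bigOD (bigOD (bigOB (o2HH i0 i1 i1 i0) (o2HH i0 i0 i1 i1)) (bigOB (o2HH i0 i2 i2 i0) (o2HH i0 i0 i2 i2))) (bigOB (o2HH i1 i2 i2 i1) (o2HH i1 i1 i2 i2)).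
have W2 := bigOD (bigOB (bigOB (M i0 i1 i1 i0 i2 i2) (M i0 i1 i1 i2 i2 i0)) (bigOB (M i0 i2 i1 i0 i2 i1) (M i0 i2 i1 i1 i2 i0))) (bigOB (M i0 i0 i1 i2 i2 i1) (M i0 i0 i1 i1 i2 i2)).
apply: bigO_ext (bigOD W W2) => t ht.
by rewrite -[LHS]subr0 -[X in _ - X](subrr 1) -{1}(detB ht) det3 !BH /=; ring.
Qed.

(** The Gram determinant exp (-4 s) is 1 + 2 (H11 + H22) up to second order, and H11 + H22 is - H00
    up to second order by [o2tr]. *)
Lemma first_order_s : bigO 1 s /\ bigO 2 (fun t => s t - H i0 i0 t / 2).
Proof.
split=> //.
have h4 : bigO 1 (fun t => - (4 * s t)).
  by apply: bigO_ext (bigOZ (- 4) o1s) => t _; ring.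
have h := bigOB (bigOD (bigO_exp2 h4) (bigON o2s4)) (bigOZ 2 o2tr).
by apply: bigO_ext (bigOZ (4^-1) h) => t ht; field.
Qed.

Let o1y : bigO 1 (fun t => 2 * ch (b t) * sh (b t)).
Proof.
have h : bigO 1 (fun t => 2 * s t) by apply: bigOZ.
have h2 := bigOM (bigO_expbd h) o1q23; rewrite add0n in h2.
apply: bigO_ext h2 => t ht; rewrite q23E// expMn.
transitivity ((expR (- s t) * expR (s t)) ^+ 2 * (2 * ch (b t) * sh (b t))); last by ring.
by rewrite ss expr1n mul1r.
Qed.

(** 2 ch x sh x = sinh (2 x), so the first-order bound on it passes to b. *)
Let sh_lower (x : R) : `|x| <= `|2 * ch x * sh x|.
Proof.
have e : 2 * ch x * sh x = (expR (2 * x) - expR (- (2 * x))) / 2.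
  have e1 : expR (2 * x) = expR x ^+ 2 by exact: expMn.
  have e2 : expR (- (2 * x)) = expR (- x) ^+ 2.
    by rewrite -expMn; congr expR; ring.
  by rewrite e1 e2 /ch /sh; field.
rewrite e; have [x0|x0] := leP 0 x.
  have h1 := expR_ge1Dx (2 * x).
  have h2 : expR (- (2 * x)) <= 1 by rewrite -expR0 ler_expR oppr_le0 mulr_ge0.
  rewrite ger0_norm// ger0_norm; lra.
have h1 := expR_ge1Dx (- (2 * x)).
have h2 : expR (2 * x) <= 1 by rewrite -[leRHS]expR0 ler_expR pmulr_rle0// ltW.
rewrite ltr0_norm// ler0_norm; lra.
Qed.

Let o1b : bigO 1 b.
Proof. by apply: bigO_dom o1y => t _; exact: sh_lower. Qed.

Let o2sh : bigO 2 (fun t => sh (b t) - b t).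
Proof.
have h := bigOB (bigO_exp2 o1b) (bigO_exp2 (bigON o1b)).
by apply: bigO_ext (bigOZ (2^-1) h) => t _; rewrite /sh; field.
Qed.

Let o2ch : bigO 2 (fun t => ch (b t) - 1).
Proof.
have h := bigOD (bigO_exp2 o1b) (bigO_exp2 (bigON o1b)).
by apply: bigO_ext (bigOZ (2^-1) h) => t _; rewrite /ch; field.
Qed.

Let o1sh : bigO 1 (fun t => sh (b t)).
Proof. exact: o1_of o2sh o1b. Qed.

Let w2 f : bigO 2 f -> bigO 1 f. Proof. exact: bigO_weak. Qed.

(** q23 = exp (-2 s) sinh (2 b) is itself of first order, so the factor exp (-2 s) matters only at
    second order. *)
Lemma first_order_b : bigO 1 b /\ bigO 2 (fun t => b t - (H i1 i2 t + H i2 i1 t) / 2).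
Proof.
split=> //.
have e2 : bigO 1 (fun t => expR (2 * s t) - 1) by apply: bigO_exp1; apply: bigOZ.
have h1 := bigO11 o1q23 e2.
have h2 := bigO11 (w2 o2ch) o1sh.
have h := bigOB (bigOD (bigOZ (2^-1) h1) (bigOZ (2^-1) o2q23)) (bigOD h2 o2sh).
apply: bigO_ext h => t ht; rewrite q23E// expMn.
have -> : expR (- s t) ^+ 2 * (2 * ch (b t) * sh (b t)) * (expR (s t) ^+ 2 - 1) =
   ((expR (- s t) * expR (s t)) ^+ 2 - expR (- s t) ^+ 2) * (2 * ch (b t) * sh (b t)) by ring.
by rewrite ss; field.
Qed.

Let e4a t : dom t -> expR (4 * a t) * q33 t = q22 t.
Proof.
move=> ht; rewrite q22E// q33E// expMn.
transitivity ((expR (- a t) * expR (a t)) ^+ 2 * (expR (- s t) * expR (a t)) ^+ 2 * (ch (b t) ^+ 2 + sh (b t) ^+ 2)); first by ring.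
by rewrite aa; ring.
Qed.

Let o1a4 : bigO 1 (fun t => expR (4 * a t) - 1).
Proof.
apply: (bigO_dom (g := fun t => 2 * ((q22 t - 1) - (q33 t - 1)))); last first.
  by apply: bigOZ; apply: bigOB.
move=> t ht; have [_ h3 _] := bnd4 ht; move: h3; rewrite ler_norml => /andP[h3 _].
have q0 : 2^-1 <= `|q33 t| by apply: le_trans (ler_norm _); lra.
have -> : 2 * (q22 t - 1 - (q33 t - 1)) = 2 * (q33 t * (expR (4 * a t) - 1)).
  by rewrite -e4a//; ring.
rewrite !normrM (ger0_norm (_ : 0 <= 2 :> R))// mulrA ler_peMl//; lra.
Qed.

Let o1a : bigO 1 a.
Proof.
have h : bigO 1 (fun t => 4 * a t).
  apply: bigO_log o1a4 => t ht.
  by have [h1 h2 h3] := bnd4 ht; exact: bnd_quot (e4a ht) h1 h2.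
by apply: bigO_ext (bigOZ (4^-1) h) => t _; field.
Qed.

Lemma first_order_a : bigO 1 a /\ bigO 2 (fun t => a t - (H i1 i1 t - H i2 i2 t) / 2).
Proof.
split=> //.
have h4 : bigO 1 (fun t => 4 * a t) by apply: bigOZ.
have h := bigOB (bigOB o2q22 o2q33) (bigOD (bigO11 o1a4 o1q33) (bigO_exp2 h4)).
by apply: bigO_ext (bigOZ (4^-1) h) => t ht; rewrite -(e4a ht); field.
Qed.

Let kE t : dom t -> forall c,
  k t i1 c = expR (s t) * (ch (b t) * expR (- a t) * B t i1 c - sh (b t) * expR (a t) * B t i2 c) /\
  k t i2 c = expR (s t) * (ch (b t) * expR (a t) * B t i2 c - sh (b t) * expR (- a t) * B t i1 c).
Proof.
move=> ht c; have [-> ->] := rowsB ht c; split.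
  transitivity ((expR (- s t) * expR (s t)) * (expR (- a t) * expR (a t)) * (ch (b t) ^+ 2 - sh (b t) ^+ 2) * k t i1 c).
    by rewrite ss aa bb; ring.
  by ring.
transitivity ((expR (- s t) * expR (s t)) * (expR (- a t) * expR (a t)) * (ch (b t) ^+ 2 - sh (b t) ^+ 2) * k t i2 c).
  by rewrite ss aa bb; ring.
by ring.
Qed.

Let o2prod F f u G g : bigO 1 f -> bigO 1 g -> bigO 2 (fun t => F t - 1 - f t) ->
  bigO 2 (fun t => G t - u - g t) -> bigO 2 (fun t => F t * G t - u - (u * f t + g t)).
Proof.
move=> hf hg hF hG.
have h1 : bigO 0 (fun t => G t).
  have h := bigOD (bigOD (bigO_weak (leq0n 2) hG) (bigO_weak (leq0n 1) hg)) (bigO_cst u).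
  by apply: bigO_ext h => t _; ring.
have h2 := bigOM hF h1; rewrite addn0 in h2.
have h3 : bigO 2 (fun t => f t * (G t - u)).
  apply: bigO11 => //; apply: bigO_ext (bigOD (w2 hG) hg) => t _; ring.
by apply: bigO_ext (bigOD (bigOD h2 h3) hG) => t _; ring.
Qed.

Let cha : bigO 2 (fun t => expR (s t) * (ch (b t) * expR (- a t)) - 1 - (s t - a t)).
Proof.
have h0 : bigO 1 (fun=> 0) by exists 0 => t _; rewrite normr0 mul0r.
have h1 : bigO 2 (fun t => ch (b t) - 1 - 0) by apply: bigO_ext o2ch => t _; ring.
have h := o2prod h0 (bigON o1a) h1 (bigO_exp2 (bigON o1a)).
have h' : bigO 1 (fun t => 1 * 0 - a t) by apply: bigO_ext (bigON o1a) => t _; ring.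
apply: bigO_ext (o2prod o1s h' (bigO_exp2 o1s) h) => t _; ring.
Qed.

Let chd : bigO 2 (fun t => expR (s t) * (ch (b t) * expR (a t)) - 1 - (s t + a t)).
Proof.
have h0 : bigO 1 (fun=> 0) by exists 0 => t _; rewrite normr0 mul0r.
have h1 : bigO 2 (fun t => ch (b t) - 1 - 0) by apply: bigO_ext o2ch => t _; ring.
have h := o2prod h0 o1a h1 (bigO_exp2 o1a).
have h' : bigO 1 (fun t => 1 * 0 + a t) by apply: bigO_ext o1a => t _; ring.
apply: bigO_ext (o2prod o1s h' (bigO_exp2 o1s) h) => t _; ring.
Qed.

Let she f : bigO 1 f -> bigO 2 (fun t => expR (s t) * (expR (f t) * sh (b t)) - b t).
Proof.
move=> hf.
have h1 : bigO 2 (fun t => sh (b t) - 0 - b t) by apply: bigO_ext o2sh => t _; ring.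
have h := o2prod hf o1b (bigO_exp2 hf) h1.
have h' : bigO 1 (fun t => 0 * f t + b t) by apply: bigO_ext o1b => t _; ring.
apply: bigO_ext (o2prod o1s h' (bigO_exp2 o1s) h) => t _; ring.
Qed.

Let o2k (F f G g : T -> R) u w c d : bigO 1 f -> bigO 1 g ->
  bigO 2 (fun t => F t - 1 - f t) -> bigO 2 (fun t => G t - g t) ->
  u = (c == d)%:R :> R ->
  forall c', w = (c' == d)%:R :> R ->
  bigO 2 (fun t => (F t * B t c d - G t * B t c' d) - u - (u * f t + H c d t - w * g t)).
Proof.
move=> hf hg hF hG hu c' hw.
have h1 : bigO 2 (fun t => B t c d - u - H c d t).
  by exists 0 => t _; rewrite mul0r /H hu (_ : _ - _ = 0) ?normr0//; ring.
have h2 := o2prod hf (hH c d) hF h1.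
have h3 : bigO 2 (fun t => g t * (B t c' d - w)).
  by apply: bigO11 => //; apply: bigO_ext (hH c' d) => t _; rewrite /H hw.
have h4 : bigO 0 (fun t => B t c' d).
  apply: bigO_ext (bigOD (bigO_weak (leq0n 1) (hH c' d)) (bigO_cst w)) => t _.
  by rewrite /H hw; ring.
have h5 := bigOM hG h4; rewrite addn0 in h5.
by apply: bigO_ext (bigOB h2 (bigOD h3 h5)) => t _; ring.
Qed.

Let k1 d := o2k (bigOB o1s o1a) o1b cha (she o1a) (erefl ((i1 == d)%:R)) (erefl ((i2 == d)%:R)).
Let k2 d := o2k (bigOD o1s o1a) o1b chd (she (bigON o1a)) (erefl ((i2 == d)%:R)) (erefl ((i1 == d)%:R)).

(** The component along so(3) when sl(3) is split into n, a, the span of H and E in m, and so(3):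
    the first column fixes two entries, and the third is the antisymmetric part of the lower
    block. *)
Definition Spart (M : 'M[R]_3) : 'M[R]_3 := mx_of_rows 3 3
  [:: [:: 0; - M i1 i0; - M i2 i0];
      [:: M i1 i0; 0; (M i1 i2 - M i2 i1) / 2];
      [:: M i2 i0; (M i2 i1 - M i1 i2) / 2; 0]].

Let Kd c d t := k t c d - (c == d)%:R - Spart (B t) c d.

Let k10 : bigO 2 (Kd i1 i0).
Proof.
apply: bigO_ext (k1 i0) => t ht; have [e _] := kE ht i0.
by rewrite /Kd !mxE e /H /=; ring.
Qed.
Let k20 : bigO 2 (Kd i2 i0).
Proof.
apply: bigO_ext (k2 i0) => t ht; have [_ e] := kE ht i0.
by rewrite /Kd !mxE e /H /=; ring.
Qed.
Let k11 : bigO 2 (Kd i1 i1).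
Proof.
have [_ hs] := first_order_s; have [_ ha] := first_order_a.
(* On the diagonal the first-order terms cancel: s - a + H11 is half the trace of H up to second
   order. *)
have h := bigOD (k1 i1) (bigOB (bigOB hs ha) (bigOZ (- 2^-1) o2tr)).
apply: bigO_ext h => t ht; have [e _] := kE ht i1.
by rewrite /Kd !mxE e /H /=; field.
Qed.
Let k22 : bigO 2 (Kd i2 i2).
Proof.
have [_ hs] := first_order_s; have [_ ha] := first_order_a.
have h := bigOD (k2 i2) (bigOD (bigOD hs ha) (bigOZ (2^-1) o2tr)).
apply: bigO_ext h => t ht; have [_ e] := kE ht i2.
by rewrite /Kd !mxE e /H /=; field.
Qed.
Let k12 : bigO 2 (Kd i1 i2).
Proof.
have [_ hb] := first_order_b.
apply: bigO_ext (bigOB (k1 i2) hb) => t ht; have [e _] := kE ht i2.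
by rewrite /Kd !mxE e /H /=; field.
Qed.
Let k21 : bigO 2 (Kd i2 i1).
Proof.
have [_ hb] := first_order_b.
apply: bigO_ext (bigOB (k2 i1) hb) => t ht; have [_ e] := kE ht i1.
by rewrite /Kd !mxE e /H /=; field.
Qed.

Let oS c d : bigO 1 (fun t => Spart (B t) c d).
Proof.
have h0 : bigO 1 (fun=> 0) by exists 0 => t _; rewrite normr0 mul0r.
have hB1 c' d' : c' != d' -> bigO 1 (fun t => B t c' d').
  move=> /negPf h; apply: bigO_ext (hH c' d') => t _; by rewrite /H h subr0.
have h10 := hB1 i1 i0 isT; have h20 := hB1 i2 i0 isT.
have h12 := hB1 i1 i2 isT; have h21 := hB1 i2 i1 isT.
have hd1 := bigOZ (2^-1) (bigOB h12 h21); have hd2 := bigOZ (2^-1) (bigOB h21 h12).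
case: c => [[|[|[|c]]]] hc //; case: d => [[|[|[|d]]]] hd //;
 [apply: bigO_ext h0 | apply: bigO_ext (bigON h10) | apply: bigO_ext (bigON h20)
 |apply: bigO_ext h10 | apply: bigO_ext h0 | apply: bigO_ext hd1
 |apply: bigO_ext h20 | apply: bigO_ext hd2 | apply: bigO_ext h0] => t _; rewrite mxE //= mulrC //.
Qed.

Lemma first_order_k c d : bigO 1 (fun t => k t c d - (c == d)%:R) /\
  bigO 2 (fun t => k t c d - (c == d)%:R - Spart (B t) c d).
Proof.
suff h2 : bigO 2 (Kd c d).
  by split=> //; apply: bigO_ext (bigOD (w2 h2) (oS c d)) => t _; rewrite /Kd subrK.
have o1K c' d' : bigO 2 (Kd c' d') -> bigO 1 (fun t => k t c' d' - (c' == d')%:R).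
  by move=> h; apply: bigO_ext (bigOD (w2 h) (oS c' d')) => t _; rewrite /Kd subrK.
have o10 := o1K _ _ k10; have o11 := o1K _ _ k11; have o12 := o1K _ _ k12.
have o20 := o1K _ _ k20; have o21 := o1K _ _ k21; have o22 := o1K _ _ k22.
case: c => [[|[|[|c]]]] hc //; case: d => [[|[|[|d]]]] hd //;
  rewrite (bool_irrelevance hc isT) (bool_irrelevance hd isT) //.
(* The first row of B involves n and gives no direct hold on k; it is recovered as the cross product
   of the other two rows. *)
- apply: bigO_ext (bigOD (bigOD k11 k22) (bigOB (bigO11 o11 o22) (bigO11 o12 o21))) => t ht.
  by have [e _ _] := SO3_row1 (hk ht); rewrite /Kd e !mxE /=; ring.
- apply: bigO_ext (bigOB (bigOB (bigO11 o12 o20) (bigO11 o10 o22)) k10) => t ht.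
  by have [_ e _] := SO3_row1 (hk ht); rewrite /Kd e !mxE /=; ring.
- apply: bigO_ext (bigOB (bigOB (bigO11 o10 o21) (bigO11 o11 o20)) k20) => t ht.
  by have [_ _ e] := SO3_row1 (hk ht); rewrite /Kd e !mxE /=; ring.
Qed.

End FirstOrder.

End BigO.

Lemma bigO_fin (R : realType) (T : Type) (dom : T -> Prop) (eta : T -> R) (I : finType) n
    (f : I -> T -> R) :
  (forall t, dom t -> 0 <= eta t <= 1) -> (forall j, bigO dom eta n (f j)) ->
  exists2 C, 0 <= C & forall t, dom t -> forall j, `|f j t| <= C * eta t ^+ n.
Proof.
move=> e01 h.
have /choice[C hC] : forall j, exists C, 0 <= C /\ forall t, dom t -> `|f j t| <= C * eta t ^+ n.
  by move=> j; have [C C0 hC] := bigO_pos e01 (h j); exists C.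
exists (\sum_j C j); first by apply: sumr_ge0 => j _; have [] := hC j.
move=> t ht j; have [_ h2] := hC j; apply: le_trans (h2 t ht) _.
rewrite ler_wpM2r ?exprn_ge0//; first by case/andP: (e01 t ht).
rewrite (bigD1 j)//= lerDl; apply: sumr_ge0 => j' _; by have [] := hC j'.
Qed.

(** The abstract estimates applied to the type of all decompositions: a single C then serves every
    B, which is what uniformity over K requires after conjugation by x. *)
Lemma dec1_first_order (R : realType) : exists2 C : R, 0 <= C &
  forall (B n k : 'M[R]_3) s a b h, Nrad P1 n -> SO3 k -> B = n *m pdec1 s a b *m k ->
  0 <= h <= 100^-1 -> (forall c d, `|B c d - (c == d)%:R| <= h) ->
  [/\ `|s| <= C * h /\ `|s - (B i0 i0 - 1) / 2| <= C * h ^+ 2,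
      `|a| <= C * h /\ `|a - (B i1 i1 - B i2 i2) / 2| <= C * h ^+ 2,
      `|b| <= C * h /\ `|b - (B i1 i2 + B i2 i1) / 2| <= C * h ^+ 2
    & forall c d, `|k c d - (c == d)%:R| <= C * h /\
        `|k c d - (c == d)%:R - Spart B c d| <= C * h ^+ 2].
Proof.
pose T := ('M[R]_3 * 'M[R]_3 * (R * R * R) * R)%type.
pose B (t : T) := t.1.1.1; pose k (t : T) := t.1.1.2.
pose s (t : T) := t.1.2.1.1; pose a (t : T) := t.1.2.1.2; pose b (t : T) := t.1.2.2.
pose eta (t : T) := t.2.
pose dom t := [/\ SO3 (k t),
  exists2 n, Nrad P1 n & B t = n *m pdec1 (s t) (a t) (b t) *m k t,
  forall c d, `|B t c d - (c == d)%:R| <= eta t & 0 <= eta t <= 100^-1].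
have e01 t : dom t -> 0 <= eta t <= 1.
  by case=> _ _ _ /andP[-> h] /=; apply: le_trans h _; lra.
have hk t : dom t -> SO3 (k t) by case.
have hd t : dom t -> exists2 n, Nrad P1 n & B t = n *m pdec1 (s t) (a t) (b t) *m k t by case.
have hB t : dom t -> forall c d, `|B t c d - (c == d)%:R| <= eta t by case.
have he t : dom t -> eta t <= 100^-1 by case=> _ _ _ /andP[].
have [s1 s2] := first_order_s e01 hk hd hB he.
have [a1 a2] := first_order_a e01 hk hd hB he.
have [b1 b2] := first_order_b e01 hk hd hB he.
have hK := first_order_k e01 hk hd hB he.
have [C1 C10 hC1] := bigO_pos e01 s1; have [C2 C20 hC2] := bigO_pos e01 s2.
have [C3 C30 hC3] := bigO_pos e01 a1; have [C4 C40 hC4] := bigO_pos e01 a2.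
have [C5 C50 hC5] := bigO_pos e01 b1; have [C6 C60 hC6] := bigO_pos e01 b2.
have [C7 C70 hC7] := bigO_fin e01 (fun j : 'I_3 * 'I_3 => (hK j.1 j.2).1).
have [C8 C80 hC8] := bigO_fin e01 (fun j : 'I_3 * 'I_3 => (hK j.1 j.2).2).
pose C := C1 + C2 + C3 + C4 + C5 + C6 + C7 + C8.
have [[l1 l2 l3 l4] [l5 l6 l7 l8]] := sum8_bound C10 C20 C30 C40 C50 C60 C70 C80.
exists C; first exact: le_trans C10 l1.
move=> B0 n k0 s0 a0 b0 h hn hk0 hB0 h0 hb0.
have ht : dom (B0, k0, (s0, a0, b0), h) by split=> //=; exists n.
have [h00 _] := andP h0; have h20 : 0 <= h ^+ 2 by rewrite exprn_ge0.
have W D x (e : R) : 0 <= e -> D <= C -> x <= D * e -> x <= C * e.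
  by move=> e0 DC hx; apply: le_trans hx _; rewrite ler_wpM2r.
split.
- split; first by apply: (W C1) => //; have := hC1 _ ht; rewrite expr1.
  by apply: (W C2) => //; exact: (hC2 _ ht).
- split; first by apply: (W C3) => //; have := hC3 _ ht; rewrite expr1.
  apply: (W C4) => //; have := hC4 _ ht => /=; rewrite /a /B /eta /=.
  by rewrite (_ : B0 i1 i1 - 1 - (B0 i2 i2 - 1) = B0 i1 i1 - B0 i2 i2)//; ring.
- split; first by apply: (W C5) => //; have := hC5 _ ht; rewrite expr1.
  by apply: (W C6) => //; have := hC6 _ ht; rewrite /b /B /eta /= !subr0.
- move=> c d; split; first by apply: (W C7) => //; have := hC7 _ ht (c, d); rewrite expr1.
  by apply: (W C8) => //; exact: (hC8 _ ht (c, d)).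
Qed.

(** * Real-valued norms and derivatives of curves *)

Section RealNorm.
Variable R : realType.

(* The norms take their values in [R[i]]; [nr] is the corresponding real number. *)
Definition nr (V : normedZmodType R[i]) (v : V) : R := complex.Re `|v|.

Lemma nrE (V : normedZmodType R[i]) (v : V) : `|v| = (nr v)%:C.
Proof.
have : 0 <= `|v| by [].
by rewrite /nr; case: `|v| => x y; rewrite lecE /= => /andP[/eqP -> _].
Qed.

Lemma lecR' (x y : R) : (x%:C <= y%:C) = (x <= y).
Proof. by rewrite lecE /= eqxx. Qed.

Lemma nr_ge0 (V : normedZmodType R[i]) (v : V) : 0 <= nr v.
Proof. by rewrite -lecR' -nrE; exact: normr_ge0. Qed.

Lemma nrD (V : normedZmodType R[i]) (v w : V) : nr (v + w) <= nr v + nr w.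
Proof. by rewrite -lecR' rmorphD /= -!nrE ler_normD. Qed.

Lemma nrN (V : normedZmodType R[i]) (v : V) : nr (- v) = nr v.
Proof. by rewrite /nr normrN. Qed.

Lemma nr0 (V : normedZmodType R[i]) : nr (0 : V) = 0.
Proof. by rewrite /nr normr0. Qed.

Lemma nr_eq0 (V : normedZmodType R[i]) (v : V) : nr v = 0 -> v = 0.
Proof. by move=> h; apply/normr0_eq0; rewrite nrE h. Qed.

Lemma nrB (V : normedZmodType R[i]) (v w : V) : nr (v - w) <= nr v + nr w.
Proof. by apply: le_trans (nrD _ _) _; rewrite nrN. Qed.

Lemma nrBC (V : normedZmodType R[i]) (v w : V) : nr (v - w) = nr (w - v).
Proof. by rewrite -opprB nrN. Qed.

Lemma nr_sum (V : normedZmodType R[i]) (I : Type) (r : seq I) (f : I -> V) :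
  nr (\sum_(j <- r) f j) <= \sum_(j <- r) nr (f j).
Proof.
elim: r => [|j r IH]; first by rewrite !big_nil nr0.
by rewrite !big_cons; apply: le_trans (nrD _ _) _; rewrite lerD2l.
Qed.

Lemma nrZ (V : normedModType R[i]) (c : R[i]) (v : V) : nr (c *: v) = nr c * nr v.
Proof.
apply: complexI; rewrite rmorphM /= -!nrE normrZ //.
Qed.

Lemma nrM (c d : R[i]) : nr (c * d) = nr c * nr d.
Proof. by apply: complexI; rewrite rmorphM /= -!nrE normrM. Qed.

Lemma nr_real (x : R) : nr (x%:C : R[i]) = `|x|.
Proof. by apply: complexI; rewrite -nrE normc_def /= expr0n /= addr0 sqrtr_sqr. Qed.

Lemma cvg_nrP (V : normedModType R[i]) (T : Type) (F : set_system T) (FF : Filter F)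
    (f : T -> V) (l : V) :
  f @ F --> l <-> forall e : R, 0 < e -> \forall t \near F, nr (l - f t) <= e.
Proof.
split=> [/cvgrPdist_le h e e0|h].
  have e0' : (0 : R[i]) < e%:C by rewrite ltcR.
  by have := h _ e0'; apply: filterS => t; rewrite nrE lecR'.
apply/cvgrPdist_le => e e0.
have ee : e = (complex.Re e)%:C.
  by move: e0; case: e => x y; rewrite ltcE /= => /andP[/eqP -> _].
have e0' : 0 < complex.Re e by move: e0; rewrite {1}ee ltcR.
by have := h _ e0'; apply: filterS => t; rewrite nrE ee lecR'.
Qed.

Lemma near0P (P : R -> Prop) :
  (\forall t \near (0 : R)^', P t) <-> exists2 d : R, 0 < d & forall t, `|t| <= d -> t != 0 -> P t.
Proof.
split.
  rewrite near_withinE => /nbhs_ballP[d /= d0 h].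
  exists (d / 2); first by rewrite divr_gt0.
  move=> t td t0; apply: h => //; rewrite /ball /= sub0r normrN.
  by apply: le_lt_trans td _; rewrite ltr_pdivrMr// ltr_pMr// ltr1n.
move=> [d d0 h]; rewrite near_withinE; apply/nbhs_ballP; exists d => //= t.
by rewrite /ball /= sub0r normrN => td t0; apply: h => //; exact: ltW.
Qed.

(** The form in which derivatives are handled from here on: no division, and no exception at t =
    0. *)
Lemma diffquot_cvgP (V : normedModType R[i]) (c : R -> V) (l : V) :
  diffquot c @ 0^' --> l <->
  forall e : R, 0 < e -> exists2 d : R, 0 < d &
    forall t, `|t| <= d -> nr (c t - c 0 - t%:C *: l) <= e * `|t|.
Proof.
have E t : t != 0 -> l - diffquot c t = - ((t^-1)%:C *: (c t - c 0 - t%:C *: l)).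
  move=> t0; rewrite /diffquot [in RHS]scalerBr scalerA -rmorphM /= mulVf// scale1r.
  by rewrite opprB.
split=> [/cvg_nrP h e e0|h].
  have /near0P[d d0 hd] := h e e0; exists d => // t td.
  have [->|t0] := eqVneq t 0; first by rewrite subrr scale0r subr0 nr0 normr0 mulr0.
  have := hd t td t0; rewrite E// nrN nrZ nr_real normfV.
  by rewrite mulrC ler_pdivrMr// normr_gt0.
apply/cvg_nrP => e e0; have [d d0 hd] := h e e0.
apply/near0P; exists d => // t td t0; rewrite E// nrN nrZ nr_real normfV.
by rewrite mulrC ler_pdivrMr ?normr_gt0//; exact: hd.
Qed.

Lemma half_sum (V : lmodType R[i]) (a w : V) : 2^-1 *: (a + w + (a - w)) = a.
Proof.
have h : (2 : R[i])^-1 * 2 = 1 by rewrite mulVf// pnatr_eq0.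
have -> : a + w + (a - w) = 2 *: a by rewrite addrACA subrr addr0 scaler_nat mulr2n.
by rewrite scalerA h scale1r.
Qed.

Lemma half_diff (V : lmodType R[i]) (a w : V) (c : R[i]) : c != 0 ->
  (2 * c)^-1 *: (a + c *: w - (a - c *: w)) = w.
Proof.
move=> c0; have h : (2 * c)^-1 * (2 * c) = 1 by rewrite mulVf// mulf_neq0// pnatr_eq0.
have -> : a + c *: w - (a - c *: w) = (2 * c) *: w.
  by rewrite opprB addrC addrA subrK -mulr2n -scaler_nat scalerA.
by rewrite scalerA h scale1r.
Qed.

Lemma telescope3 (V : zmodType) (A B C D E v : V) :
  A - v - (D + E) = (A - B - C) + (B - v - D) + (C - E).
Proof.
rewrite opprD !addrA [A - B - C]addrAC subrK.
by rewrite (addrAC _ (- D) C) (addrAC _ (- v) C) subrK.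
Qed.

End RealNorm.

(** * First-order behaviour of the discrete series *)

Section DiscreteSeries.
Variables (R : realType) (k : nat) (sigma : discrete_series R k).

Lemma ds_isometry (h : 'M[R]_2) (v : sigma) : SLpm h -> nr (ds_act sigma h v) = nr v.
Proof.
move=> hh; have e : `|ds_act sigma h v| ^+ 2 = `|v| ^+ 2 by rewrite !ds_dotE ds_unitary.
by rewrite /nr; congr complex.Re; apply/eqP; rewrite -(eqrXn2 (n := 2))// e.
Qed.

Lemma ds_act0 (h : 'M[R]_2) : SLpm h -> ds_act sigma h 0 = 0.
Proof. by move=> hh; apply: nr_eq0; rewrite ds_isometry// nr0. Qed.

Lemma ds_actZD (h : 'M[R]_2) c (u v : sigma) : SLpm h ->
  ds_act sigma h (c *: u + v) = c *: ds_act sigma h u + ds_act sigma h v.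
Proof. by move=> hh; exact: ds_linear. Qed.

Lemma ds_actD (h : 'M[R]_2) (u v : sigma) : SLpm h ->
  ds_act sigma h (u + v) = ds_act sigma h u + ds_act sigma h v.
Proof. by move=> hh; rewrite -[u]scale1r ds_actZD// !scale1r. Qed.

Lemma ds_actZ (h : 'M[R]_2) c (u : sigma) : SLpm h ->
  ds_act sigma h (c *: u) = c *: ds_act sigma h u.
Proof. by move=> hh; rewrite -[c *: u]addr0 ds_actZD// ds_act0// addr0. Qed.

Lemma ds_actN (h : 'M[R]_2) (u : sigma) : SLpm h ->
  ds_act sigma h (- u) = - ds_act sigma h u.
Proof. by move=> hh; rewrite -scaleN1r ds_actZ// scaleN1r. Qed.

Lemma ds_actB (h : 'M[R]_2) (u v : sigma) : SLpm h ->
  ds_act sigma h (u - v) = ds_act sigma h u - ds_act sigma h v.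
Proof. by move=> hh; rewrite ds_actD// ds_actN. Qed.

Lemma ds_act_sum (h : 'M[R]_2) (I : Type) (r : seq I) (f : I -> sigma) : SLpm h ->
  ds_act sigma h (\sum_(j <- r) f j) = \sum_(j <- r) ds_act sigma h (f j).
Proof.
move=> hh; elim: r => [|j r IH]; first by rewrite !big_nil ds_act0.
by rewrite !big_cons ds_actD// IH.
Qed.

Lemma SLpm_mexp (X : 'M[R]_2) (t : R) : \tr X = 0 -> SLpm (mexp (t *: X)).
Proof. by move=> h; left; rewrite det_mexp2. Qed.

Definition ds_diff (X : 'M[R]_2) (v w : sigma) := diffquot (orbit_curve (ds_act sigma) X v) @ 0^' --> w.

Lemma ds_diffP (X : 'M[R]_2) (v w : sigma) : ds_diff X v w <->
  forall e : R, 0 < e -> exists2 d : R, 0 < d &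
    forall t, `|t| <= d -> nr (ds_act sigma (mexp (t *: X)) v - v - t%:C *: w) <= e * `|t|.
Proof.
rewrite /ds_diff; split=> [/diffquot_cvgP h e e0|h].
  have [d d0 hd] := h e e0; exists d => // t td; have := hd t td.
  by rewrite /orbit_curve scale0r mexp0 ds_act1.
apply/diffquot_cvgP => e e0; have [d d0 hd] := h e e0; exists d => // t td; have := hd t td.
by rewrite /orbit_curve scale0r mexp0 ds_act1.
Qed.

Lemma ds_diffD (X : 'M[R]_2) (c : R[i]) (v w v' w' : sigma) : \tr X = 0 ->
  ds_diff X v w -> ds_diff X v' w' -> ds_diff X (c *: v + v') (c *: w + w').
Proof.
move=> hX h h'.
have E : diffquot (orbit_curve (ds_act sigma) X (c *: v + v')) =
  fun t => c *: diffquot (orbit_curve (ds_act sigma) X v) t + diffquot (orbit_curve (ds_act sigma) X v') t.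
  apply/funext => t; rewrite /diffquot /orbit_curve !ds_actZD; last 2 first.
  - exact: SLpm_mexp.
  - exact: SLpm_mexp.
  rewrite scalerA mulrC -scalerA -scalerDr; congr (_ *: _).
  by rewrite scalerBr opprD addrACA.
rewrite /ds_diff E; apply: cvgD => //; exact: cvgZr.
Qed.

Lemma ds_diff_chi (X : 'M[R]_2) p : chi_index k p -> \tr X = 0 ->
  ds_diff X (ds_chi sigma p) (dact (ds_act sigma) X (ds_chi sigma p)).
Proof. by move=> hp hX; exact: ds_derivable. Qed.

(** [dact] is a limit, known only where the quotients converge; [ds_derivable] provides the
    convergence, and t is replaced by -t. *)
Lemma dact_opp (X : 'M[R]_2) p : chi_index k p -> \tr X = 0 ->
  dact (ds_act sigma) (- X) (ds_chi sigma p) = - dact (ds_act sigma) X (ds_chi sigma p).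
Proof.
move=> hp hX; apply: cvg_lim => //.
have /ds_diffP h := ds_diff_chi hp hX.
apply/ds_diffP => e e0; have [d d0 hd] := h e e0; exists d => // t td.
have := hd (- t); rewrite normrN => /(_ td).
by rewrite scalerN -scaleNr rmorphN /= scalerN -scaleNr.
Qed.

(** [dgH] = (x_+ + x_-) / 2 and [EF] = (x_+ - x_-) / (2 i); [chiH] and [chiE] are their images of
    chi_p computed from the given actions of x_+ and x_-. *)
Definition chiH p : sigma :=
  2^-1 *: ((k%:Z + p)%:~R *: ds_chi sigma (p + 2) + (k%:Z - p)%:~R *: ds_chi sigma (p - 2)).
Definition chiE p : sigma :=
  (2 * 'i%C)^-1 *: ((k%:Z + p)%:~R *: ds_chi sigma (p + 2) - (k%:Z - p)%:~R *: ds_chi sigma (p - 2)).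

Lemma dact_HE p : chi_index k p ->
  dact (ds_act sigma) (dgH R) (ds_chi sigma p) = chiH p /\
  dact (ds_act sigma) (EF R) (ds_chi sigma p) = chiE p.
Proof.
move=> hp; have h1 := ds_xplus sigma hp; have h2 := ds_xminus sigma hp.
have e1 : map_mx (@complex.Re R) (x_plus R) = dgH R by apply: mx2P; rewrite !mxE.
have e2 : map_mx (@complex.Im R) (x_plus R) = EF R by apply: mx2P; rewrite !mxE //= ?oppr0.
have e3 : map_mx (@complex.Re R) (x_minus R) = dgH R by apply: mx2P; rewrite !mxE //= ?oppr0.
have e4 : map_mx (@complex.Im R) (x_minus R) = - EF R by apply: mx2P; rewrite !mxE //= ?oppr0.
move: h1 h2; rewrite /cdact e1 e2 e3 e4 dact_opp// ?trEF//.
set a := dact _ _ _; set b := dact _ _ _ => h1 h2.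
by rewrite /chiH /chiE -h1 -h2 scalerN half_sum half_diff ?neq0Ci.
Qed.

Lemma ds_diff_chiH p : chi_index k p -> ds_diff (dgH R) (ds_chi sigma p) (chiH p).
Proof. by move=> hp; have [<- _] := dact_HE hp; apply: ds_diff_chi; rewrite ?trdgH. Qed.

Lemma ds_diff_chiE p : chi_index k p -> ds_diff (EF R) (ds_chi sigma p) (chiE p).
Proof. by move=> hp; have [_ <-] := dact_HE hp; apply: ds_diff_chi; rewrite ?trEF. Qed.

(** [ds_chi] is unconstrained outside its index set. Where p + 2 or p - 2 leaves the set the
    coefficient vanishes, so both terms can be kept in all formulas. *)
Lemma chi_indexP p : chi_index k p -> (k%:Z + p = 0 \/ chi_index k (p + 2)) /\
  (k%:Z - p = 0 \/ chi_index k (p - 2)).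
Proof.
move=> [a []] ->; split.
- by right; exists a.+1; left; lia.
- case: a => [|a]; first by left; lia.
  by right; exists a; left; lia.
- case: a => [|a]; first by left; lia.
  by right; exists a; right; lia.
- by right; exists a.+1; right; lia.
Qed.

Lemma ds_diff0 X : \tr X = 0 -> ds_diff X 0 0.
Proof.
move=> hX; apply/ds_diffP => e e0; exists 1 => // t _.
have hS : SLpm (mexp (t *: X)) by exact: SLpm_mexp.
by rewrite ds_act0// scaler0 !subr0 nr0 mulr_ge0// ltW.
Qed.

Lemma ds_diffable_chi2 X p (c d : R[i]) : \tr X = 0 -> chi_index k p ->
  exists w, ds_diff X (c *: ((k%:Z + p)%:~R *: ds_chi sigma (p + 2) + d *: ((k%:Z - p)%:~R *: ds_chi sigma (p - 2)))) w.
Proof.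
move=> hX /chi_indexP[h1 h2].
have A q (n : int) : n = 0 \/ chi_index k q -> exists w, ds_diff X (n%:~R *: ds_chi sigma q) w.
  case=> [->|hq]; first by exists 0; rewrite scale0r; exact: ds_diff0.
  have := @ds_diffD X n%:~R _ _ _ _ hX (ds_diff_chi hq hX) (ds_diff0 hX); rewrite !addr0.
  by move=> h; eexists; exact: h.
have [w1 hw1] := A _ _ h1; have [w2 hw2] := A _ _ h2.
have h3 := @ds_diffD X d _ _ _ _ hX hw2 hw1; rewrite addrC in h3.
have h4 := @ds_diffD X c _ _ _ _ hX h3 (ds_diff0 hX); rewrite addr0 in h4.
by eexists; exact: h4.
Qed.

Lemma ds_diff_cont X v w (e : R) : ds_diff X v w -> 0 < e -> exists2 d : R, 0 < d &
  forall t, `|t| <= d -> nr (ds_act sigma (mexp (t *: X)) v - v) <= e.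
Proof.
move=> /ds_diffP/(_ 1 ltr01)[d d0 hd] e0.
pose C := 1 + nr w; have C0 : 0 < C by rewrite ltr_wpDr// nr_ge0.
exists (Num.min d (e / C)); first by rewrite lt_min d0 divr_gt0.
move=> t; rewrite le_min => /andP[td te].
have -> : ds_act sigma (mexp (t *: X)) v - v = (ds_act sigma (mexp (t *: X)) v - v - t%:C *: w) + t%:C *: w.
  by rewrite subrK.
apply: le_trans (nrD _ _) _; apply: (@le_trans _ _ (1 * `|t| + nr (t%:C *: w))).
  by rewrite lerD2r hd.
rewrite nrZ nr_real mul1r -{1}[`|t|]mulr1 -mulrDr -/C.
by rewrite -ler_pdivlMr.
Qed.

(** Coordinates of the second kind. In sigma (g) sigma (h) v with g = exp (a H), h = exp (b E), the
    error of the inner factor is carried along by the isometry sigma (g); the cross term b (sigma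
    (g) - 1) E v is small because the orbit of E v along H is continuous at 0, E v being again a
    combination of vectors chi. *)
Lemma ds_second_kind p (e : R) : chi_index k p -> 0 < e -> exists2 d : R, 0 < d &
  forall a b, `|a| <= d -> `|b| <= d ->
    nr (ds_act sigma (mpart a b) (ds_chi sigma p) - ds_chi sigma p
        - (a%:C *: chiH p + b%:C *: chiE p)) <= e * (`|a| + `|b|).
Proof.
move=> hp e0; set v := ds_chi sigma p.
have e20 : 0 < e / 2 by rewrite divr_gt0.
have /ds_diffP/(_ _ e20)[d1 d10 h1] := ds_diff_chiH hp.
have /ds_diffP/(_ _ e20)[d2 d20 h2] := ds_diff_chiE hp.
have [w hw] : exists w, ds_diff (dgH R) (chiE p) w.
  have [w] := ds_diffable_chi2 (2 * 'i%C)^-1 (-1) (trdgH R) hp.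
  by rewrite scaleN1r => hw; exists w.
have [d3 d30 h3] := ds_diff_cont hw e20.
exists (Num.min d1 (Num.min d2 d3)); first by rewrite !lt_min d10 d20.
move=> a b; rewrite !le_min => /and3P[a1 a2 a3] /and3P[b1 b2 b3].
set g := mexp (a *: dgH R); set h := mexp (b *: EF R).
have hg : SLpm g by apply: SLpm_mexp; rewrite trdgH.
have hh : SLpm h by apply: SLpm_mexp; rewrite trEF.
rewrite /mpart -/g -/h ds_actM//.
have -> : ds_act sigma g (ds_act sigma h v) - v - (a%:C *: chiH p + b%:C *: chiE p) =
   ds_act sigma g (ds_act sigma h v - v - b%:C *: chiE p) + (ds_act sigma g v - v - a%:C *: chiH p)
   + b%:C *: (ds_act sigma g (chiE p) - chiE p).
  rewrite !ds_actB// ds_actZ// scalerBr.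
  exact: telescope3.
apply: le_trans (nrD _ _) _; rewrite mulrDr.
have ea : 0 <= e * `|a| by rewrite mulr_ge0// ltW.
apply: (@le_trans _ _ (e / 2 * `|b| + e / 2 * `|a| + `|b| * (e / 2))); last by lra.
apply: lerD; last by rewrite nrZ nr_real ler_wpM2l// h3.
apply: le_trans (nrD _ _) _; apply: lerD; last exact: h1.
by rewrite ds_isometry// h2.
Qed.

End DiscreteSeries.

(** * SU(2), SO(3) and matrix coefficients *)

Section Quaternions.
Variable R : realType.
Implicit Types p q r s : R.

(** SU(2) as the group of unit quaternions: statements on [phi] become polynomial identities in four
    real variables with p^2 + q^2 + r^2 + s^2 = 1. *)
Definition qmx p q r s : 'M[R[i]]_2 :=
  mx_of_rows 2 2 [:: [:: Complex p q; Complex r s]; [:: Complex (- r) s; Complex p (- q)]].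

Lemma SU2P (g : 'M[R[i]]_2) : SU2 g <->
  exists p q r s, p ^+ 2 + q ^+ 2 + r ^+ 2 + s ^+ 2 = 1 /\ g = qmx p q r s.
Proof.
split=> [[h d]|[p [q [r [s [e ->]]]]]]; last first.
  split; last first.
    by rewrite det2 !mxE /=; apply/eqP; rewrite eq_complex /=; apply/andP; split; apply/eqP; rewrite -?e; ring.
  apply: mx2P; rewrite !mxE !sum2 !mxE /=; apply/eqP; rewrite eq_complex /=; apply/andP; split; apply/eqP; rewrite -?e; ring.
have e : g *m \adj g = 1%:M by rewrite mul_mx_adj d.
have e2 : \adj g = (map_mx Num.conj g)^T.
  have h' := mulmx1C h.
  by rewrite -[LHS]mul1mx -h' -mulmxA e mulmx1.
move/matrixP: e2 => e2; have := e2 j0 j0; have := e2 j0 j1.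
rewrite !mxE /cofactor !det_mx11 !mxE /= => a1 a2.
pose p := complex.Re (g j0 j0); pose q := complex.Im (g j0 j0).
pose r := complex.Re (g j0 j1); pose s := complex.Im (g j0 j1).
have g00 : g j0 j0 = Complex p q by rewrite /p /q; case: (g j0 j0).
have g01 : g j0 j1 = Complex r s by rewrite /r /s; case: (g j0 j1).
have g11 : g j1 j1 = Complex p (- q).
  have -> : g j1 j1 = Num.conj (g j0 j0); last by rewrite g00.
  by rewrite -a2 expr0 mul1r; congr (g _ _); apply: val_inj.
have g10 : g j1 j0 = Complex (- r) s.
  have -> : g j1 j0 = - Num.conj (g j0 j1).
    have := e2 j1 j0; rewrite !mxE /cofactor !det_mx11 !mxE /= expr1 mulN1r => <-.
    by rewrite opprK; congr (g _ _); apply: val_inj.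
  by rewrite g01; apply/eqP; rewrite eq_complex /= opprK !eqxx.
exists p, q, r, s; split; last by apply: mx2P; rewrite !mxE.
move: d; rewrite det2 g00 g01 g10 g11 => /eqP; rewrite eq_complex /= => /andP[/eqP <- _]; ring.
Qed.

Lemma phi_qmx p q r s : phi (qmx p q r s) = mx_of_rows 3 3
   [:: [:: p ^+ 2 + q ^+ 2 - r ^+ 2 - s ^+ 2; - (2 * (p * s - q * r)); 2 * (p * r + q * s)];
       [:: 2 * (p * s + q * r); p ^+ 2 - q ^+ 2 + r ^+ 2 - s ^+ 2; - (2 * (p * q - r * s))];
       [:: - (2 * (p * r - q * s)); 2 * (p * q + r * s); p ^+ 2 - q ^+ 2 - r ^+ 2 + s ^+ 2]].
Proof.
have e00 : qmx p q r s 0 0 = Complex p q by rewrite mxE.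
have e01 : qmx p q r s 0 1 = Complex r s by rewrite mxE.
by rewrite /phi e00 e01.
Qed.

Lemma qmxM p q r s p' q' r' s' : qmx p q r s *m qmx p' q' r' s' =
  qmx (p * p' - q * q' - r * r' - s * s') (p * q' + q * p' + r * s' - s * r')
      (p * r' - q * s' + r * p' + s * q') (p * s' + q * r' - r * q' + s * p').
Proof.
by apply: mx2P; rewrite !mxE !sum2 !mxE /=; apply/eqP; rewrite eq_complex /=; apply/andP; split; apply/eqP; ring.
Qed.

Lemma phiM (g h : 'M[R[i]]_2) : SU2 g -> SU2 h -> phi (g *m h) = phi g *m phi h.
Proof.
move=> /SU2P[p [q [r [s [_ ->]]]]] /SU2P[p' [q' [r' [s' [_ ->]]]]].
by rewrite qmxM !phi_qmx; apply: mx3P; rewrite !mxE !sum3 !mxE /=; ring.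
Qed.

Lemma SU2_M (g h : 'M[R[i]]_2) : SU2 g -> SU2 h -> SU2 (g *m h).
Proof.
move=> /SU2P[p [q [r [s [e ->]]]]] /SU2P[p' [q' [r' [s' [e' ->]]]]].
rewrite qmxM; apply/SU2P; do 4 eexists; split; last reflexivity.
transitivity ((p ^+ 2 + q ^+ 2 + r ^+ 2 + s ^+ 2) * (p' ^+ 2 + q' ^+ 2 + r' ^+ 2 + s' ^+ 2)); first by ring.
by rewrite e e' mulr1.
Qed.

Lemma phi_SO3 (g : 'M[R[i]]_2) : SU2 g -> SO3 (phi g).
Proof.
move=> /SU2P[p [q [r [s [e ->]]]]]; rewrite phi_qmx.
have e2 : (p ^+ 2 + q ^+ 2 + r ^+ 2 + s ^+ 2) ^+ 2 = 1 by rewrite e expr1n.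
have e3 : (p ^+ 2 + q ^+ 2 + r ^+ 2 + s ^+ 2) ^+ 3 = 1 by rewrite e expr1n.
split; last by rewrite det3 !mxE /= -[RHS]e3; ring.
by apply: mx3P; rewrite !mxE !sum3 !mxE /=; rewrite -1?[RHS]e2; ring.
Qed.

Definition adj3 (x : 'M[R]_3) : 'M[R]_3 := mx_of_rows 3 3
  [:: [:: x i1 i1 * x i2 i2 - x i1 i2 * x i2 i1; - (x i0 i1 * x i2 i2 - x i0 i2 * x i2 i1); x i0 i1 * x i1 i2 - x i0 i2 * x i1 i1];
      [:: - (x i1 i0 * x i2 i2 - x i1 i2 * x i2 i0); x i0 i0 * x i2 i2 - x i0 i2 * x i2 i0; - (x i0 i0 * x i1 i2 - x i0 i2 * x i1 i0)];
      [:: x i1 i0 * x i2 i1 - x i1 i1 * x i2 i0; - (x i0 i0 * x i2 i1 - x i0 i1 * x i2 i0); x i0 i0 * x i1 i1 - x i0 i1 * x i1 i0]].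

Lemma SO3_adj (x : 'M[R]_3) : SO3 x -> adj3 x = x^T.
Proof.
move=> h; have [_ dx] := h.
have h3 : x *m adj3 x = 1%:M.
  apply: mx3P; rewrite mxE sum3 /adj3 !mxE /= ?mulr1n ?mulr0n; rewrite -1?dx ?det3; ring.
by rewrite -[LHS]mul1mx -(SO3_Tm h) -mulmxA h3 mulmx1.
Qed.

(** A lift satisfies 4 p^2 = 1 + tr x, 4 p q = x21 - x12, and so on; where 1 + tr x > 0 these
    equations can be solved for p, q, r, s. *)
Lemma phi_lift_pos (x : 'M[R]_3) : SO3 x -> 0 < 1 + \tr x -> exists2 g, SU2 g & phi g = x.
Proof.
move=> hx; rewrite /mxtrace sum3 => t0.
have /matrixP ha := SO3_adj hx.
have := ha i0 i0; have := ha i0 i1; have := ha i0 i2.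
have := ha i1 i0; have := ha i1 i1; have := ha i1 i2.
have := ha i2 i0; have := ha i2 i1; have := ha i2 i2.
rewrite !mxE /= => c22 c12 c02 c21 c11 c01 c20 c10 c00 {ha}.
have [/matrixP hr _] := hx; have /matrixP hc := SO3_Tm hx.
have := hr i0 i0; have := hr i1 i1; have := hr i2 i2.
have := hr i0 i1; have := hr i0 i2; have := hr i1 i2.
have := hc i0 i0; have := hc i1 i1; have := hc i2 i2.
have := hc i0 i1; have := hc i0 i2; have := hc i1 i2.
rewrite !mxE !sum3 !mxE /= ?mulr1n ?mulr0n => C12 C02 C01 C22 C11 C00 R12 R02 R01 R22 R11 R00 {hr hc}.
move: c00 c01 c02 c10 c11 c12 c20 c21 c22 t0 C12 C02 C01 C22 C11 C00 R12 R02 R01 R22 R11 R00.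
set k00 := x i0 i0; set k01 := x i0 i1; set k02 := x i0 i2.
set k10 := x i1 i0; set k11 := x i1 i1; set k12 := x i1 i2.
set k20 := x i2 i0; set k21 := x i2 i1; set k22 := x i2 i2.
move=> c00 c01 c02 c10 c11 c12 c20 c21 c22 t0 C12 C02 C01 C22 C11 C00 R12 R02 R01 R22 R11 R00.
(* For a lift, t = 4 p^2 and 1 + k00 - k11 - k22 = 4 q^2, so the six relations below express the
   products of q, r, s. They are linear consequences of the orthogonality and adjugate relations. *)
pose t := 1 + (k00 + k11 + k22).
have qq : t * (1 + k00 - k11 - k22) = (k21 - k12) ^+ 2 by rewrite /t; lra.
have rr : t * (1 - k00 + k11 - k22) = (k02 - k20) ^+ 2 by rewrite /t; lra.
have ss : t * (1 - k00 - k11 + k22) = (k10 - k01) ^+ 2 by rewrite /t; lra.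
have qr : t * (k01 + k10) = (k21 - k12) * (k02 - k20) by rewrite /t; lra.
have qs : t * (k02 + k20) = (k21 - k12) * (k10 - k01) by rewrite /t; lra.
have rs : t * (k12 + k21) = (k02 - k20) * (k10 - k01) by rewrite /t; lra.
pose p := Num.sqrt t / 2.
have p2 : 4 * p ^+ 2 = t.
  by rewrite /p expr_div_n sqr_sqrtr ?ltW//; field.
have p0 : p != 0 by apply: contraTneq t0 => p0; rewrite -/t -p2 p0 expr0n mulr0 ltxx.
have t0' : t != 0 by rewrite gt_eqF.
pose q := (k21 - k12) / (4 * p); pose r := (k02 - k20) / (4 * p); pose s := (k10 - k01) / (4 * p).
have P a b m : t * m = a * b -> (a / (4 * p)) * (b / (4 * p)) = m / 4.
  move=> h; transitivity ((a * b) / (4 * (4 * p ^+ 2))); first by field.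
  by rewrite -h p2; field.
have Pp a : p * (a / (4 * p)) = a / 4 by field.
have eqq := P _ _ _ qq; have err := P _ _ _ rr; have ess := P _ _ _ ss.
have eqr := P _ _ _ qr; have eqs := P _ _ _ qs; have ers := P _ _ _ rs.
have epq := Pp (k21 - k12); have epr := Pp (k02 - k20); have eps := Pp (k10 - k01).
rewrite -/q -/r -/s in eqq err ess eqr eqs ers epq epr eps.
have epp : p * p = t / 4 by rewrite -p2; field.
exists (qmx p q r s).
  apply/SU2P; exists p, q, r, s; split=> //.
  by rewrite !expr2 epp eqq err ess /t; field.
rewrite phi_qmx; apply: mx3P; rewrite !mxE /= ?expr2 ?epp ?eqq ?err ?ess ?eqr ?eqs ?ers ?epq ?epr ?eps /t
  -/k00 -/k01 -/k02 -/k10 -/k11 -/k12 -/k20 -/k21 -/k22; try by field.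
all: by rewrite ?[r * q]mulrC ?eqr; field.
Qed.

(** 1 + tr x and the three quantities obtained from it by changing the signs of two diagonal entries
    add up to 4, so one of them is positive. A half-turn about a coordinate axis brings it to the
    place of 1 + tr x. *)
Lemma phi_lift (x : 'M[R]_3) : SO3 x -> exists2 g, SU2 g & phi g = x.
Proof.
move=> hx.
have step q r s : q ^+ 2 + r ^+ 2 + s ^+ 2 = 1 ->
    0 < 1 + \tr (x *m phi (qmx 0 q r s)) -> exists2 g, SU2 g & phi g = x.
  move=> e h; set j := qmx 0 q r s in h.
  have hj : SU2 j by apply/SU2P; exists 0, q, r, s; split=> //; rewrite -e; ring.
  have [g hg eg] := phi_lift_pos (SO3_M hx (phi_SO3 hj)) h.
  (* j j = -1, so if g lifts x phi (j), then - g j lifts x. *)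
  exists (- (g *m j)).
    have /SU2P[a [b [c [d [e' ->]]]]] := SU2_M hg hj.
    apply/SU2P; exists (- a), (- b), (- c), (- d); split; first by rewrite !sqrrN.
    by apply: mx2P; rewrite !mxE /=; apply/eqP; rewrite eq_complex /= ?opprK !eqxx.
  have hN (g' : 'M[R[i]]_2) : SU2 g' -> phi (- g') = phi g'.
    move=> /SU2P[a [b [c [d [_ ->]]]]].
    have -> : - qmx a b c d = qmx (- a) (- b) (- c) (- d).
      by apply: mx2P; rewrite !mxE /=; apply/eqP; rewrite eq_complex /= ?opprK !eqxx.
    by rewrite !phi_qmx; apply: mx3P; rewrite !mxE /=; ring.
  rewrite hN ?phiM//; last exact: SU2_M.
  rewrite eg -mulmxA -phiM//.
  have -> : j *m j = - qmx 1 0 0 0.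
    by rewrite /j qmxM; apply: mx2P; rewrite !mxE /=; apply/eqP; rewrite eq_complex /=; apply/andP; split; apply/eqP; rewrite ?oppr0 -?e; ring.
  have h1 : SU2 (qmx 1 0 0 0) by apply/SU2P; exists 1, 0, 0, 0; split=> //; ring.
  rewrite hN// phi_qmx (_ : mx_of_rows _ _ _ = 1%:M) ?mulmx1//.
  by apply: mx3P; rewrite !mxE /=; ring.
have [h|h0] := ltP 0 (1 + \tr x); first exact: phi_lift_pos.
have tr q r s : \tr (x *m phi (qmx 0 q r s)) = x i0 i0 * (q ^+ 2 - r ^+ 2 - s ^+ 2)
   + x i1 i1 * (- q ^+ 2 + r ^+ 2 - s ^+ 2) + x i2 i2 * (- q ^+ 2 - r ^+ 2 + s ^+ 2)
   + 2 * (x i0 i1 + x i1 i0) * (q * r) + 2 * (x i0 i2 + x i2 i0) * (q * s) + 2 * (x i1 i2 + x i2 i1) * (r * s).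
  by rewrite phi_qmx /mxtrace sum3 !mxE !sum3 !mxE /=; ring.
have := step 1 0 0; have := step 0 1 0; have := step 0 0 1; rewrite !tr => h1 h2 h3.
move: h0; rewrite /mxtrace sum3 => h0.
have [h|h4] := ltP 0 (1 + x i0 i0 - x i1 i1 - x i2 i2).
  by apply: h3; [ring|lra].
have [h|h5] := ltP 0 (1 - x i0 i0 + x i1 i1 - x i2 i2).
  by apply: h2; [ring|lra].
by apply: h1; [ring|lra].
Qed.

(** The entries of [phi] determine all products of two of the coordinates p, q, r, s. Hence the
    inner product d of the two quaternions satisfies d^2 = 1, and g = d h. *)
Lemma phi_inj (g h : 'M[R[i]]_2) : SU2 g -> SU2 h -> phi g = phi h -> g = h \/ g = - h.
Proof.
move=> /SU2P[p [q [r [s [e ->]]]]] /SU2P[p' [q' [r' [s' [e' ->]]]]].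
rewrite !phi_qmx => /matrixP E.
have := E i0 i0; have := E i1 i1; have := E i2 i2.
have := E i0 i1; have := E i1 i0; have := E i0 i2; have := E i2 i0; have := E i1 i2; have := E i2 i1.
rewrite !mxE /= => E21 E12 E20 E02 E10 E01 E22 E11 E00 {E}.
have pp : p * p = p' * p' by lra.
have qq : q * q = q' * q' by lra.
have rr : r * r = r' * r' by lra.
have ss : s * s = s' * s' by lra.
have pq : p * q = p' * q' by lra.
have pr : p * r = p' * r' by lra.
have ps : p * s = p' * s' by lra.
have qr : q * r = q' * r' by lra.
have qs : q * s = q' * s' by lra.
have rs : r * s = r' * s' by lra.
pose d := p * p' + q * q' + r * r' + s * s'.
have dd : d ^+ 2 = 1.
  transitivity ((p * p) * (p' * p') + (q * q) * (q' * q') + (r * r) * (r' * r') + (s * s) * (s' * s') +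
    2 * ((p * q) * (p' * q') + (p * r) * (p' * r') + (p * s) * (p' * s') + (q * r) * (q' * r') + (q * s) * (q' * s') + (r * s) * (r' * s'))); first by rewrite /d; ring.
  rewrite pp qq rr ss pq pr ps qr qs rs.
  transitivity ((p' ^+ 2 + q' ^+ 2 + r' ^+ 2 + s' ^+ 2) ^+ 2); first by ring.
  by rewrite e' expr1n.
have hp : p = d * p'.
  transitivity (p * (p' ^+ 2 + q' ^+ 2 + r' ^+ 2 + s' ^+ 2)); first by rewrite e' mulr1.
  transitivity (p * (p' * p') + p * (q' * q') + p * (r' * r') + p * (s' * s')); first by ring.
  rewrite -pp -qq -rr -ss.
  transitivity (p * (p * p) + q * (p * q) + r * (p * r) + s * (p * s)); first by ring.
  by rewrite pp pq pr ps /d; ring.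
have hq : q = d * q'.
  transitivity (q * (p' ^+ 2 + q' ^+ 2 + r' ^+ 2 + s' ^+ 2)); first by rewrite e' mulr1.
  transitivity (q * (p' * p') + q * (q' * q') + q * (r' * r') + q * (s' * s')); first by ring.
  rewrite -pp -qq -rr -ss.
  transitivity (p * (p * q) + q * (q * q) + r * (q * r) + s * (q * s)); first by ring.
  by rewrite qq pq qr qs /d; ring.
have hr : r = d * r'.
  transitivity (r * (p' ^+ 2 + q' ^+ 2 + r' ^+ 2 + s' ^+ 2)); first by rewrite e' mulr1.
  transitivity (r * (p' * p') + r * (q' * q') + r * (r' * r') + r * (s' * s')); first by ring.
  rewrite -pp -qq -rr -ss.
  transitivity (p * (p * r) + q * (q * r) + r * (r * r) + s * (r * s)); first by ring.
  by rewrite rr pr qr rs /d; ring.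
have hs : s = d * s'.
  transitivity (s * (p' ^+ 2 + q' ^+ 2 + r' ^+ 2 + s' ^+ 2)); first by rewrite e' mulr1.
  transitivity (s * (p' * p') + s * (q' * q') + s * (r' * r') + s * (s' * s')); first by ring.
  rewrite -pp -qq -rr -ss.
  transitivity (p * (p * s) + q * (q * s) + r * (r * s) + s * (s * s)); first by ring.
  by rewrite ss ps qs rs /d; ring.
have : (d == 1) || (d == -1) by rewrite -sqrf_eq1 dd.
case/orP => /eqP hd; [left|right]; rewrite hp hq hr hs hd ?mul1r ?mulN1r//.
by apply: mx2P; rewrite !mxE /=; apply/eqP; rewrite eq_complex /= ?opprK !eqxx.
Qed.

Lemma qmx1 : qmx 1 0 0 0 = 1%:M.
Proof. by apply: mx2P; rewrite !mxE //=; apply/eqP; rewrite eq_complex /= ?oppr0 !eqxx. Qed.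

Lemma SU2_1 : SU2 (1%:M : 'M[R[i]]_2).
Proof. by rewrite -qmx1; apply/SU2P; exists 1, 0, 0, 0; split=> //; ring. Qed.

Lemma phi1 : phi (1%:M : 'M[R[i]]_2) = 1%:M.
Proof. by rewrite -qmx1 phi_qmx; apply: mx3P; rewrite !mxE /=; ring. Qed.

Lemma invmx_SU2 p q r s : p ^+ 2 + q ^+ 2 + r ^+ 2 + s ^+ 2 = 1 ->
  invmx (qmx p q r s) = qmx p (- q) (- r) (- s).
Proof.
move=> e; have h : qmx p (- q) (- r) (- s) *m qmx p q r s = 1%:M.
  by rewrite qmxM -qmx1; congr qmx; rewrite -?e; ring.
have u : qmx p q r s \in unitmx by case/mulmx1_unit: h.
by rewrite -[RHS]mulmx1 -(mulmxV u) mulmxA h mul1mx.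
Qed.

Lemma SU2_unit (g : 'M[R[i]]_2) : SU2 g -> g \in unitmx.
Proof. by move=> [_ d]; rewrite unitmxE d unitr1. Qed.

End Quaternions.

(** * Homogeneous polynomials through their values *)

Section HomogeneousPolynomials.
Variable R : realType.
Implicit Types L : nat.

Let C := R[i].

Lemma poly_eq0_of_horner (p : {poly C}) : (forall t, p.[t] = 0) -> p = 0.
Proof.
move=> h; apply/eqP/negPn/negP => p0.
have := @max_poly_roots _ p [seq n%:R | n <- iota 0 (size p)] p0.
have -> : all (root p) [seq n%:R | n <- iota 0 (size p)].
  by apply/allP => t _; rewrite /root h.
have -> : uniq [seq n%:R : C | n <- iota 0 (size p)].
  by rewrite map_inj_uniq ?iota_uniq// => a b /eqP; rewrite eqr_nat => /eqP.
by rewrite size_map size_iota ltnn => /(_ isT isT).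
Qed.

(** Identities in V_L are checked on values, which suffices by [ev_inj]; the substitution in [tau]
    then becomes a linear change of the point (a, b). *)
Definition ev L (f : hpoly R L) (a b : C) : C :=
  meval (fun j : 'I_2 => if val j == 0%N then a else b) f.

Lemma evD L (f g : hpoly R L) a b : ev (f + g) a b = ev f a b + ev g a b.
Proof. by rewrite /ev -mevalD. Qed.

Lemma evZ L c (f : hpoly R L) a b : ev (c *: f) a b = c * ev f a b.
Proof. by rewrite /ev -mevalZ. Qed.

Lemma ev0 L a b : ev (0 : hpoly R L) a b = 0.
Proof. by rewrite /ev (meval0 (R := C)). Qed.

Lemma ev_sum L (I : Type) (r : seq I) (F : I -> hpoly R L) a b :
  ev (\sum_(j <- r) F j) a b = \sum_(j <- r) ev (F j) a b.
Proof.
elim: r => [|j r IH]; first by rewrite !big_nil ev0.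
by rewrite !big_cons evD IH.
Qed.

Lemma val_indhomog L (p : mpoly 2 C) : p \is ishomog1 L mdeg -> mpoly_of_dhomog (indhomog L p) = p.
Proof. by move=> h; rewrite /indhomog -[LHS]/(val _) insubdK. Qed.

Lemma homog_XY L q (u v : mpoly 2 C) : (q <= L)%N -> u \is ishomog1 1 mdeg -> v \is ishomog1 1 mdeg ->
  u ^+ q * v ^+ (L - q) \is ishomog1 L mdeg.
Proof.
move=> qL hu hv; have := dhomogM (dhomogMn q hu) (dhomogMn (L - q) hv).
by rewrite !mul1n subnKC.
Qed.

Lemma homog_X1 : poly_X R \is ishomog1 1 mdeg.
Proof. by rewrite /poly_X dhomogX; apply/eqP; exact: mdeg1. Qed.
Lemma homog_Y1 : poly_Y R \is ishomog1 1 mdeg.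
Proof. by rewrite /poly_Y dhomogX; apply/eqP; exact: mdeg1. Qed.

Lemma vq_val L (q : nat) : (q <= L)%N ->
  mpoly_of_dhomog (vq R L q%:Z) = poly_X R ^+ q * poly_Y R ^+ (L - q).
Proof.
move=> qL; rewrite /vq; have -> : (0 <= q%:Z <= L%:Z)%R by lia.
by rewrite val_indhomog// homog_XY ?homog_X1 ?homog_Y1.
Qed.

Lemma vq_out L (q : int) : ~~ (0 <= q <= L%:Z) -> vq R L q = 0.
Proof. by rewrite /vq => /negPf ->. Qed.

Lemma meval_X (v : 'I_2 -> C) : meval v (poly_X R) = v 0.
Proof. by rewrite /poly_X mevalXU. Qed.
Lemma meval_Y (v : 'I_2 -> C) : meval v (poly_Y R) = v 1.
Proof. by rewrite /poly_Y mevalXU. Qed.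

Lemma ev_vq L (q : nat) a b : (q <= L)%N -> ev (vq R L q%:Z) a b = a ^+ q * b ^+ (L - q).
Proof. by move=> qL; rewrite /ev vq_val// mevalM !rmorphXn /= meval_X meval_Y. Qed.

Lemma val_lincomb L (I : Type) (r : seq I) (c : I -> C) (F : I -> hpoly R L) :
  mpoly_of_dhomog (\sum_(j <- r) c j *: F j) = \sum_(j <- r) c j *: mpoly_of_dhomog (F j).
Proof. by elim: r => [|j r IH]; rewrite ?big_nil ?big_cons// -IH. Qed.

Lemma hpoly_span L (f : hpoly R L) : exists c : 'I_L.+1 -> C, f = \sum_q c q *: vq R L (val q)%:Z.
Proof.
have hf := dhomog_is_dhomog f.
pose z0 : 'I_2 := 0; pose z1 : 'I_2 := 1.
pose mon (q : nat) : multinom 2 := mnm_add (mnm_muln (mnm1 z0) q) (mnm_muln (mnm1 z1) (L - q)).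
have vqX (q : nat) : (q <= L)%N -> mpoly_of_dhomog (vq R L q%:Z) = mpolyX _ (mon q).
  by move=> qL; rewrite vq_val// /poly_X /poly_Y !mpolyXn -mpolyXD.
exists (fun q => mcoeff (mon q) f).
apply/val_inj/mpolyP => m.
have -> : val (\sum_(q < L.+1) mcoeff (mon q) f *: vq R L q) =
   \sum_(q < L.+1) mcoeff (mon q) f *: mpolyX _ (mon q).
  rewrite -[LHS]/(mpoly_of_dhomog _) val_lincomb; apply: eq_bigr => q _.
  by rewrite vqX//; exact: (ltn_ord q).
rewrite raddf_sum /=.
have [hm|hm] := eqVneq (mdeg m) L; last first.
  rewrite (dhomog_nemf_coeff hf hm) big1// => q _.
  rewrite mcoeffZ mcoeffX; case: eqP => [e|]; last by rewrite mulr0.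
  case/negP: hm; rewrite -e /mon mdegD !mdegMn !mdeg1 !mul1n subnKC//; exact: (ltn_ord q).
have m0 : (m z0 < L.+1)%N.
  by rewrite ltnS -hm mdegE (bigD1 z0)//= leq_addr.
have em : mon (m z0) = m.
  apply/mnmP => j; rewrite /mon mnmDE !mulmnE !mnm1E.
  have hL : L = (m z0 + m z1)%N.
    by rewrite -hm mdegE !big_ord_recl big_ord0 addn0; congr (m _ + m _)%N; apply: val_inj.
  case: j => [[|[|j]]] hj //=.
    by rewrite mul1n mul0n addn0; congr (m _); apply: val_inj.
  rewrite mul0n mul1n add0n hL addKn; congr (m _); exact: val_inj.
rewrite (bigD1 (Ordinal m0))//= mcoeffZ mcoeffX em eqxx mulr1 big1 ?addr0// => q hq.
rewrite mcoeffZ mcoeffX; case: eqP => [e|]; last by rewrite mulr0.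
case/negP: hq; rewrite -val_eqE /= -e /mon mnmDE !mulmnE !mnm1E /=.
by rewrite mul1n mul0n addn0.
Qed.

Lemma vq_free L (c : 'I_L.+1 -> C) : \sum_q c q *: vq R L (val q)%:Z = 0 -> forall q, c q = 0.
Proof.
move=> h q.
pose p : {poly C} := \poly_(j < L.+1) c (inord j).
have p0 : p = 0.
  apply: poly_eq0_of_horner => t; rewrite horner_poly.
  transitivity (ev (\sum_q c q *: vq R L (val q)%:Z) t 1); last by rewrite h ev0.
  rewrite ev_sum; apply: eq_bigr => j _; rewrite evZ ev_vq; last exact: (ltn_ord j).
  by rewrite expr1n mulr1 inord_val.
have := coef_poly L.+1 (fun j => c (inord j)) q; rewrite -/p p0 coef0 ltn_ord.
by rewrite inord_val => <-.
Qed.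

(** The values at the points (t, 1) already determine the coefficients, as for polynomials in one
    variable over an infinite field. *)
Lemma ev_inj L (f g : hpoly R L) : (forall a b, ev f a b = ev g a b) -> f = g.
Proof.
move=> h; apply/eqP; rewrite -subr_eq0; apply/eqP.
have [c hc] := hpoly_span (f - g); rewrite hc.
suff c0 : forall q, c q = 0 by rewrite big1// => q _; rewrite c0 scale0r.
move=> q.
pose p : {poly C} := \poly_(j < L.+1) c (inord j).
have p0 : p = 0.
  apply: poly_eq0_of_horner => t; rewrite horner_poly.
  transitivity (ev (\sum_q c q *: vq R L (val q)%:Z) t 1); last first.
    by rewrite -hc -scaleN1r addrC evD evZ h mulN1r addNr.
  rewrite ev_sum; apply: eq_bigr => j _; rewrite evZ ev_vq; last exact: (ltn_ord j).
  by rewrite expr1n mulr1 inord_val.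
have := coef_poly L.+1 (fun j => c (inord j)) q; rewrite -/p p0 coef0 ltn_ord.
by rewrite inord_val => <-.
Qed.

Lemma vdual1_coef l (f : hpoly R (2 * l)) (c : 'I_(2 * l).+1 -> C) :
  f = \sum_q c q *: vq R (2 * l) (val q)%:Z ->
  forall r : 'I_(2 * l).+1, vdual P1 r f = c r.
Proof.
move=> hf r; rewrite /vdual inord_val.
have nthX j : (vbasis_K R P1 l)`_j = (if (j < (2 * l).+1)%N then vq R (2 * l) j%:Z else 0).
  case: ltnP => hj; last by rewrite nth_default// size_tuple.
  by rewrite -(tnth_nth _ _ (Ordinal hj)) tnth_mktuple.
have fr : free (vbasis_K R P1 l).
  apply/freeP => k hk j; apply: vq_free; rewrite -[RHS]hk.
  by apply: eq_bigr => j' _; rewrite nthX ltn_ord.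
have -> : f = \sum_(q < (2 * l).+1) c q *: (vbasis_K R P1 l)`_q.
  by rewrite hf; apply: eq_bigr => j _; rewrite nthX ltn_ord.
by rewrite coord_sum_free.
Qed.

Lemma vdual1_lin l (r : 'I_(2 * l).+1) a (f g : hpoly R (2 * l)) :
  vdual P1 r (a *: f + g) = a * vdual P1 r f + vdual P1 r g.
Proof. by rewrite /vdual linearP. Qed.

Lemma vdual1_expand l (f : hpoly R (2 * l)) :
  f = \sum_(q < (2 * l).+1) vdual P1 q f *: vq R (2 * l) (val q)%:Z.
Proof.
have [c hc] := hpoly_span f; rewrite {1}hc; apply: eq_bigr => q _.
by rewrite (vdual1_coef hc).
Qed.

Lemma vdual1_vq l (r : 'I_(2 * l).+1) (q : nat) : (q <= 2 * l)%N ->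
  vdual P1 r (vq R (2 * l) q%:Z) = (r == q :> nat)%:R.
Proof.
move=> qL; apply: (vdual1_coef (c := fun j => (j == q :> nat)%:R)).
have q' : (q < (2 * l).+1)%N by [].
rewrite (bigD1 (Ordinal q'))//= eqxx scale1r big1 ?addr0// => j.
by rewrite -val_eqE /= => /negPf ->; rewrite scale0r.
Qed.

Lemma ev_tau L (g : 'M[C]_2) (f : hpoly R L) a b :
  ev (tau g f) a b = ev f (invmx g 0 0 * a + invmx g 0 1 * b) (invmx g 1 0 * a + invmx g 1 1 * b).
Proof.
rewrite /tau; set h := invmx g; set t := [tuple _; _].
have hlin (u v : C) : u *: poly_X R + v *: poly_Y R \is ishomog1 1 mdeg.
  by apply: dhomogD; apply: dhomogZ; rewrite ?homog_X1 ?homog_Y1.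
(* [tau] ends with the retraction [indhomog], which kills what is not homogeneous of degree L; it
   acts as the identity only once the substituted polynomial is known to be homogeneous. *)
have hc : comp_mpoly t f \is ishomog1 L mdeg.
  have [c hc] := hpoly_span f.
  have -> : mpoly_of_dhomog f = \sum_(q < L.+1) c q *: (poly_X R ^+ q * poly_Y R ^+ (L - q)).
    rewrite {1}hc val_lincomb; apply: eq_bigr => q _.
    by rewrite vq_val//; exact: (ltn_ord q).
  rewrite raddf_sum /=; apply: rpred_sum => q _.
  rewrite comp_mpolyZ; apply: dhomogZ; rewrite rmorphM /= !rmorphXn /=.
  by rewrite /poly_X /poly_Y !comp_mpolyXU; apply: homog_XY; rewrite ?hlin//; exact: (ltn_ord q).
rewrite /ev val_indhomog// comp_mpoly_meval; apply: meval_eq => j.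
by case: j => [[|[|j]]] hj //=; rewrite (tnth_nth 0) /= mevalD !mevalZ meval_X meval_Y.
Qed.

End HomogeneousPolynomials.

(** * The representation of SO(3) and its matrix coefficients *)

Section TauK.
Variable R : realType.
Implicit Types L : nat.
Let C := R[i].

Lemma tauD L (g : 'M[C]_2) a (f f' : hpoly R L) : tau g (a *: f + f') = a *: tau g f + tau g f'.
Proof. apply: ev_inj => x y.
have h1 := ev_tau g f x y; have h2 := ev_tau g f' x y; have h3 := ev_tau g (a *: f + f') x y.
move: (tau g f) (tau g f') (tau g (a *: f + f')) h1 h2 h3 => u v w h1 h2 h3.
rewrite h3.
rewrite (evD (a *: u)).
rewrite (evZ a u).
rewrite h1 h2.
rewrite evD.
by rewrite evZ. Qed.

Lemma tau1 L (f : hpoly R L) : tau 1%:M f = f.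
Proof.
apply: ev_inj => x y; apply: etrans (ev_tau 1%:M f x y) _; rewrite invmx1 !mxE /=.
by rewrite !(mulr1n, mulr0n, mul1r, mul0r, addr0, add0r).
Qed.

Lemma tauM L (g h : 'M[C]_2) (f : hpoly R L) : g \in unitmx -> h \in unitmx ->
  tau (g *m h) f = tau g (tau h f).
Proof.
move=> ug uh; apply: ev_inj => x y.
apply: etrans (ev_tau (g *m h) f x y) (etrans _ (esym (ev_tau g (tau h f) x y))).
apply: etrans _ (esym (ev_tau h f _ _)).
have -> : invmx (g *m h) = invmx h *m invmx g.
  have u : g *m h \in unitmx by rewrite unitmx_mul ug.
  by rewrite -[RHS]mulmx1 -(mulmxV u) !mulmxA mulmxKV// mulVmx// mul1mx.
rewrite !mxE !sum2 (_ : j0 = 0) 1?(_ : j1 = 1); try exact: val_inj.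
by congr ev; ring.
Qed.

(** The degree 2 l is even, so -1 acts trivially: this is why the representation descends to
    SO(3). *)
Lemma tauN l (g : 'M[C]_2) (f : hpoly R (2 * l)) : g \in unitmx -> tau (- g) f = tau g f.
Proof.
move=> ug; apply: ev_inj => x y.
apply: etrans (ev_tau (- g) f x y) (etrans _ (esym (ev_tau g f x y))).
have -> : invmx (- g) = - invmx g.
  have u : - g \in unitmx by rewrite -scaleN1r unitmxZ ?unitrN1.
  by rewrite -[RHS]mulmx1 -(mulmxV u) mulmxA mulNmx mulmxN opprK mulVmx// mul1mx.
have hN a b : ev f (- a) (- b) = ev f a b.
  rewrite (vdual1_expand f) !ev_sum; apply: eq_bigr => q _; rewrite !evZ !ev_vq; try exact: (ltn_ord q).
  rewrite [(- a) ^+ _]exprNn [(- b) ^+ _]exprNn mulrACA -exprD subnKC; last exact: (ltn_ord q).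
  by rewrite [(-1) ^+ (2 * l)]exprM sqrrN !expr1n mul1r.
by rewrite -hN !mxE !mulNr !opprD !opprK.
Qed.

(** [tauK] uses a chosen lift; by [phi_inj] any other lift differs from it by a sign. *)
Lemma tauK_phi l (g : 'M[C]_2) (f : hpoly R (2 * l)) : SU2 g -> tauK (phi g) f = tau g f.
Proof.
move=> hg; rewrite /tauK.
have : [set h | SU2 h /\ phi h = phi g] (xget 1%:M [set h | SU2 h /\ phi h = phi g]).
  by apply: xgetPex; exists g.
set h := xget _ _ => -[hh e].
by have [->|->] := phi_inj hh hg e; rewrite ?tauN// SU2_unit.
Qed.

Lemma tauKM l (x y : 'M[R]_3) (f : hpoly R (2 * l)) : SO3 x -> SO3 y ->
  tauK (x *m y) f = tauK x (tauK y f).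
Proof.
move=> /phi_lift[g hg <-] /phi_lift[h hh <-].
apply: etrans (congr1 (fun z => tauK z f) (esym (phiM hg hh))) _.
apply: etrans (tauK_phi f (SU2_M hg hh)) _.
apply: etrans (tauM f (SU2_unit hg) (SU2_unit hh)) _.
apply: etrans _ (esym (tauK_phi _ hg)).
exact: (congr1 (@tau R (2 * l) g) (esym (tauK_phi f hh))).
Qed.

Lemma tauK1 l (f : hpoly R (2 * l)) : tauK 1%:M f = f.
Proof.
apply: etrans (congr1 (fun x => tauK x f) (esym (phi1 R))) _.
exact: etrans (tauK_phi f (SU2_1 R)) (tau1 f).
Qed.

Lemma tauKD l (x : 'M[R]_3) a (f f' : hpoly R (2 * l)) : SO3 x ->
  tauK x (a *: f + f') = a *: tauK x f + tauK x f'.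
Proof.
move=> /phi_lift[g hg <-]; apply: (etrans (tauK_phi (a *: f + f') hg)); apply: (etrans (tauD g a f f')).
have e1 := tauK_phi f hg; have e2 := tauK_phi f' hg.
move: (tauK (phi g) f) (tauK (phi g) f') e1 e2 => u v e1 e2.
by subst u v.
Qed.

Lemma tauK0 l (x : 'M[R]_3) : SO3 x -> tauK x (0 : hpoly R (2 * l)) = 0.
Proof.
move=> hx; have := @tauKD l x (-1) 0 0 hx.
rewrite scaler0 addr0; move: (tauK x 0) => z e.
by rewrite e scaleN1r addNr.
Qed.

Lemma tauK_sum l (x : 'M[R]_3) (I : Type) (r : seq I) (c : I -> C) (F : I -> hpoly R (2 * l)) : SO3 x ->
  tauK x (\sum_(j <- r) c j *: F j) = \sum_(j <- r) c j *: tauK x (F j).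
Proof.
move=> hx; elim: r => [|j r IH]; first by rewrite !big_nil tauK0.
rewrite !big_cons; apply: etrans (tauKD _ _ _ hx) _.
move: (tauK x (\sum_(j <- r) c j *: F j)) IH => z IH.
by subst z.
Qed.

Lemma vdual1_sum l (q : 'I_(2 * l).+1) (I : Type) (r : seq I) (c : I -> C) (F : I -> hpoly R (2 * l)) :
  vdual P1 q (\sum_(j <- r) c j *: F j) = \sum_(j <- r) c j * vdual P1 q (F j).
Proof.
rewrite /vdual linear_sum; apply: eq_bigr => j _; exact: linearZ.
Qed.

Definition Mc l (r q : nat) (x : 'M[R]_3) : C := vdual P1 r (tauK x (vq R (2 * l) q%:Z)).

Lemma McM l (x y : 'M[R]_3) (r : 'I_(2 * l).+1) q : SO3 x -> SO3 y ->
  Mc l r q (x *m y) = \sum_(e < (2 * l).+1) Mc l r e x * Mc l e q y.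
Proof.
move=> hx hy; rewrite /Mc; apply: etrans (congr1 _ (tauKM _ hx hy)) _.
have h := vdual1_expand (tauK y (vq R (2 * l) q%:Z)).
apply: etrans (congr1 (fun f => vdual P1 r (tauK x f)) h) _.
apply: etrans (congr1 _ (tauK_sum _ _ _ hx)) _.
apply: etrans (vdual1_sum _ _ _ _) _; apply: eq_bigr => e _; exact: mulrC.
Qed.

Lemma Mc1 l (r : 'I_(2 * l).+1) (q : nat) : (q <= 2 * l)%N -> Mc l r q 1%:M = (r == q :> nat)%:R.
Proof.
by move=> hq; apply: etrans (congr1 _ (tauK1 _)) _; rewrite vdual1_vq.
Qed.

Lemma SO3_uc : SO3 (uc R).
Proof.
split; last by rewrite det3 !mxE /=; ring.
by apply: mx3P; rewrite !mxE !sum3 !mxE /=; ring.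
Qed.

(** The second basis is the image of the first under u_c, so that the u_c in front of x cancels: the
    matrix coefficients for P_2 become those for P_1. *)
Lemma vdual2E l (r : 'I_(2 * l).+1) (x : 'M[R]_3) (f : hpoly R (2 * l)) : SO3 x ->
  vdual P2 r (tauK (uc R *m x) f) = vdual P1 r (tauK x f).
Proof.
move=> hx; have hu := SO3_uc.
apply: etrans (congr1 _ (tauKM _ hu hx)) _.
move: (tauK x f) => g.
apply: etrans (congr1 (fun f => vdual P2 r (tauK (uc R) f)) (vdual1_expand g)) _.
apply: etrans (congr1 _ (tauK_sum _ _ _ hu)) _.
rewrite /vdual inord_val.
have nthX j : (vbasis_K R P2 l)`_j = (if (j < (2 * l).+1)%N then tauK (uc R) (vq R (2 * l) j%:Z) else 0).
  case: ltnP => hj; last by rewrite nth_default// size_tuple.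
  by rewrite -(tnth_nth _ _ (Ordinal hj)) tnth_mktuple.
have fr : free (vbasis_K R P2 l).
  apply/freeP => k hk j; apply: vq_free.
  have h0 : tauK (uc R) (\sum_q k q *: vq R (2 * l) (val q)%:Z) = 0.
    apply: etrans (tauK_sum _ _ _ hu) _; rewrite -[RHS]hk.
    by apply: eq_bigr => j' _; rewrite nthX ltn_ord.
  have hT := SO3_T hu.
  apply: etrans (esym (tauK1 _)) _.
  apply: etrans (congr1 (fun y => tauK y _) (esym (SO3_Tm hu))) _.
  apply: etrans (tauKM _ hT hu) _.
  exact: etrans (congr1 (tauK (uc R)^T) h0) (tauK0 l hT).
have -> : \sum_(j < (2 * l).+1) coord (vbasis_K R P1 l) (inord j) g *: tauK (uc R) (vq R (2 * l) (\val j)%:Z) =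
   \sum_(q < (2 * l).+1) coord (vbasis_K R P1 l) q g *: (vbasis_K R P2 l)`_q.
  by apply: eq_bigr => j _; rewrite nthX ltn_ord inord_val.
by rewrite coord_sum_free.
Qed.

End TauK.

(** * First-order expansion of the matrix coefficients at the identity *)

Section CoefficientExpansion.
Variable R : realType.
Let C := R[i].

(** The image of x^n y^m under a linear substitution, read at x = X and y = 1. Its coefficients form
    a column of the matrix of tau, and products of linear factors are open to induction on their
    number. *)
Definition lprod (a b c d : C) n m : {poly C} := (a *: 'X + b%:P) ^+ n * (c *: 'X + d%:P) ^+ m.

Lemma lin_coef (P : {poly C}) a b r : (P * (a *: 'X + b%:P))`_r = (if r is r'.+1 then P`_r' else 0) * a + P`_r * b.
Proof.
rewrite mulrDr coefD coefMC -mul_polyC mulrCA coefCM coefMX; case: r => [|r] /=; last by rewrite mulrC.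
by rewrite mulr0 mul0r.
Qed.

Lemma lprodSl a b c d n m : lprod a b c d n.+1 m = lprod a b c d n m * (a *: 'X + b%:P).
Proof. by rewrite /lprod exprSr mulrAC. Qed.

Lemma lprodSr a b c d n m : lprod a b c d n m.+1 = lprod a b c d n m * (c *: 'X + d%:P).
Proof. by rewrite /lprod exprSr mulrA. Qed.

(** By [lin_coef] each linear factor with coefficients of modulus at most 1 at most doubles the
    bound. *)
Lemma lprod_bound a b c d n m r : nr a <= 1 -> nr b <= 1 -> nr c <= 1 -> nr d <= 1 ->
  nr (lprod a b c d n m)`_r <= 2 ^+ (n + m).
Proof.
move=> ha hb hc hd.
have step (P : {poly C}) a' b' (B : R) : 0 <= B -> nr a' <= 1 -> nr b' <= 1 ->
    (forall r, nr P`_r <= B) -> forall r, nr (P * (a' *: 'X + b'%:P))`_r <= 2 * B.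
  move=> B0 ha' hb' hP r'; rewrite lin_coef; apply: le_trans (nrD _ _) _.
  rewrite mulr2n mulrDl !mul1r; apply: lerD; rewrite nrM -[leRHS]mulr1; apply: ler_pM; rewrite ?nr_ge0//.
  by case: r' => // ; rewrite nr0.
elim: n r => [|n IH] r; last by rewrite lprodSl addSn exprS; apply: step => //; rewrite exprn_ge0.
elim: m r => [|m IH] r; last by rewrite lprodSr addnS exprS; apply: step => //; rewrite exprn_ge0.
rewrite /lprod !expr0 mulr1 coef1; case: r => [|r] /=; rewrite ?mulr0n ?nr0//.
by rewrite mulr1n -(rmorph1 (real_complex R)) nr_real normr1.
Qed.

(* First-order part of the coefficient of [X ^ r] in
   [((1 + a) X + b) ^ n * (c X + (1 + d)) ^ m]. *)
Definition lfirst (n m r : nat) (a b c d : C) : C :=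
  (n%:R * a + m%:R * d) * (r == n)%:R + n%:R * b * (r.+1 == n)%:R + m%:R * c * (r == n.+1)%:R.

Lemma nrD4 (u v w z : C) : nr (u + v + w + z) <= nr u + nr v + nr w + nr z.
Proof. by do !(apply: le_trans (nrD _ _) _; apply: lerD). Qed.

Lemma nr_nat (n : nat) : nr (n%:R : C) = n%:R.
Proof. by rewrite -(rmorph_nat (real_complex R)) nr_real ger0_norm. Qed.

Lemma nr_bool (b : bool) : nr (b%:R : C) <= 1.
Proof. by rewrite nr_nat; case: b. Qed.

Lemma lfirst_bound n m r a b c d (h : R) : nr a <= h -> nr b <= h -> nr c <= h -> nr d <= h ->
  nr (lfirst n m r a b c d) <= (2 * n + 2 * m)%:R * h.
Proof.
move=> ha hb hc hd; have h0 : 0 <= h by apply: le_trans ha; exact: nr_ge0.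
have T (k : nat) u (e : bool) : nr u <= h -> nr (k%:R * u * e%:R) <= k%:R * h.
  move=> hu; rewrite !nrM nr_nat -[leRHS]mulr1; apply: ler_pM; rewrite ?nr_bool ?mulr_ge0 ?nr_ge0//.
  by rewrite ler_wpM2l.
rewrite /lfirst mulrDl.
apply: (@le_trans _ _ ((n%:R * h + m%:R * h) + n%:R * h + m%:R * h)).
  by do !(apply: le_trans (nrD _ _) _; apply: lerD); exact: T.
by rewrite natrD !natrM; lra.
Qed.

Lemma lprod_first_order n m : exists2 K : R, 0 <= K & forall a b c d (h : R), h <= 1 ->
  nr a <= h -> nr b <= h -> nr c <= h -> nr d <= h ->
  forall r, nr ((lprod (1 + a) b c (1 + d) n m)`_r - (r == n)%:R - lfirst n m r a b c d) <= K * h ^+ 2.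
Proof.
elim: n => [|n [K K0 IH]].
  elim: m => [|m [K K0 IH]].
    exists 0 => // a b c d h _ _ _ _ _ r.
    rewrite [X in nr X](_ : _ = 0) ?nr0 ?mul0r//.
    by rewrite /lfirst /lprod !expr0 mulr1 coef1; ring.
  exists (2 * K + K + 2 * (2 * 0 + 2 * m)%:R); first by rewrite !addr_ge0// mulr_ge0.
  move=> a b c d h h1 ha hb hc hd r.
  have h0 : 0 <= h by apply: le_trans ha; exact: nr_ge0.
  have {}IH := IH a b c d h h1 ha hb hc hd.
  have hF q := @lfirst_bound 0 m q a b c d h ha hb hc hd.
  rewrite lprodSr lin_coef.
  set P := lprod _ _ _ _ _ _ in IH *.
  have hd2 : nr (1 + d) <= 2.
    apply: le_trans (nrD _ _) _; rewrite -(rmorph1 (real_complex R)) nr_real normr1.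
    by have := le_trans hd h1; lra.
  pose Er q := P`_q - (q == 0%N)%:R - lfirst 0 m q a b c d.
  have eP q : P`_q = Er q + (q == 0%N)%:R + lfirst 0 m q a b c d by rewrite /Er; ring.
  have hE q : nr (Er q) <= K * h ^+ 2 := IH q.
  have Z : 0 <= K * h ^+ 2 by rewrite mulr_ge0// exprn_ge0.
  have Z2 : 0 <= (2 * 0 + 2 * m)%:R * h * h by rewrite !mulr_ge0.
  rewrite [leRHS](_ : _ = K * h ^+ 2 * 1 + K * h ^+ 2 * 2 + (2 * 0 + 2 * m)%:R * h * h + (2 * 0 + 2 * m)%:R * h * h); last by ring.
  have B1 u v x y : nr u <= x -> nr v <= y -> nr (u * v) <= x * y :> R.
    by move=> hu hv; rewrite nrM; apply: ler_pM => //; exact: nr_ge0.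
  case: r => [|r].
    rewrite [X in nr X](_ : _ = Er 0%N * (1 + d) + lfirst 0 m 0 a b c d * d).
      apply: le_trans (nrD _ _) _.
      have := B1 _ _ _ _ (hE 0%N) hd2; have := B1 _ _ _ _ (hF 0%N) hd; lra.
    by rewrite mul0r add0r eP /lfirst /= !mulr0 !mul0r; ring.
  rewrite [X in nr X](_ : _ = Er r * c + Er r.+1 * (1 + d) + lfirst 0 m r a b c d * c + lfirst 0 m r.+1 a b c d * d).
    apply: le_trans (nrD4 _ _ _ _) _.
    have := B1 _ _ _ _ (hE r) (le_trans hc h1); have := B1 _ _ _ _ (hE r.+1) hd2.
    by have := B1 _ _ _ _ (hF r) hc; have := B1 _ _ _ _ (hF r.+1) hd; lra.
  by rewrite !eP /lfirst /= !eqSS; case: (r == 0)%N; ring.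
exists (2 * K + K + 2 * (2 * n + 2 * m)%:R); first by rewrite !addr_ge0// mulr_ge0.
move=> a b c d h h1 ha hb hc hd r.
have h0 : 0 <= h by apply: le_trans ha; exact: nr_ge0.
have {}IH := IH a b c d h h1 ha hb hc hd.
have hF q := @lfirst_bound n m q a b c d h ha hb hc hd.
rewrite lprodSl lin_coef.
set P := lprod _ _ _ _ _ _ in IH *.
have ha2 : nr (1 + a) <= 2.
  apply: le_trans (nrD _ _) _; rewrite -(rmorph1 (real_complex R)) nr_real normr1.
  by have := le_trans ha h1; lra.
pose Er q := P`_q - (q == n)%:R - lfirst n m q a b c d.
have eP q : P`_q = Er q + (q == n)%:R + lfirst n m q a b c d by rewrite /Er; ring.
have hE q : nr (Er q) <= K * h ^+ 2 := IH q.
have Z : 0 <= K * h ^+ 2 by rewrite mulr_ge0// exprn_ge0.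
have Z2 : 0 <= (2 * n + 2 * m)%:R * h * h by rewrite !mulr_ge0.
rewrite [leRHS](_ : _ = K * h ^+ 2 * 1 + K * h ^+ 2 * 2 + (2 * n + 2 * m)%:R * h * h + (2 * n + 2 * m)%:R * h * h); last by ring.
have B1 u v x y : nr u <= x -> nr v <= y -> nr (u * v) <= x * y :> R.
  by move=> hu hv; rewrite nrM; apply: ler_pM => //; exact: nr_ge0.
case: r => [|r].
  rewrite [X in nr X](_ : _ = Er 0%N * b + lfirst n m 0 a b c d * b).
    apply: le_trans (nrD _ _) _.
    have := B1 _ _ _ _ (hE 0%N) (le_trans hb h1); have := B1 _ _ _ _ (hF 0%N) hb; lra.
  rewrite mul0r add0r eP /lfirst /= -[n.+1%:R]natr1 !eqSS.
  by move: (Er 0%N) => E0; clear; case: n => [|n] /=; ring.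
rewrite [X in nr X](_ : _ = Er r * (1 + a) + Er r.+1 * b + lfirst n m r a b c d * a + lfirst n m r.+1 a b c d * b).
  apply: le_trans (nrD4 _ _ _ _) _.
  have := B1 _ _ _ _ (hE r) ha2; have := B1 _ _ _ _ (hE r.+1) (le_trans hb h1).
  by have := B1 _ _ _ _ (hF r) ha; have := B1 _ _ _ _ (hF r.+1) hb; lra.
by rewrite !eP /lfirst /= !eqSS -[n.+1%:R]natr1; ring.
Qed.

(** Evaluating tau (g) v_k at (t, 1) gives the polynomial [lprod] in t, and a polynomial is
    determined by its values. *)
Lemma Mc_coef l (r : 'I_(2 * l).+1) (k : nat) (g : 'M[C]_2) : (k <= 2 * l)%N -> SU2 g ->
  Mc l r k (phi g) = (lprod (invmx g 0 0) (invmx g 0 1) (invmx g 1 0) (invmx g 1 1) k (2 * l - k))`_r.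
Proof.
move=> hk hg; rewrite /Mc; apply: (etrans (congr1 _ (tauK_phi _ hg))).
set P := lprod _ _ _ _ _ _.
set f := tau g _.
have hev t : ev f t 1 = P.[t].
  apply: (etrans (ev_tau g _ t 1)); rewrite ev_vq// /P /lprod hornerM !horner_exp.
  by rewrite !hornerD !hornerZ !hornerX !hornerC !mulr1.
clearbody f.
pose Q : {poly C} := \poly_(j < (2 * l).+1) vdual P1 j f.
have e : Q - P = 0.
  apply: poly_eq0_of_horner => t; rewrite hornerD hornerN -hev {1}(vdual1_expand f).
  rewrite ev_sum horner_poly; apply/eqP; rewrite subr_eq0; apply/eqP.
  apply: eq_bigr => j _; rewrite evZ ev_vq; last exact: (ltn_ord j).
  by rewrite expr1n mulr1.
have -> : P = Q by apply/eqP; rewrite -subr_eq0 -opprB e oppr0.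
by rewrite coef_poly ltn_ord.
Qed.

Lemma invmx_qmxE (p q r s : R) : p ^+ 2 + q ^+ 2 + r ^+ 2 + s ^+ 2 = 1 ->
  let h := invmx (qmx p q r s) in
  [/\ h 0 0 = Complex p (- q), h 0 1 = Complex (- r) (- s), h 1 0 = Complex r (- s) & h 1 1 = Complex p q].
Proof. by move=> e /=; rewrite invmx_SU2// !mxE /= !opprK. Qed.

Lemma nr_complex_le (x y : R) : nr (Complex x y) <= `|x| + `|y|.
Proof.
have -> : Complex x y = x%:C + 'i%C * y%:C.
  by apply/eqP; rewrite eq_complex /=; apply/andP; split; apply/eqP; ring.
apply: le_trans (nrD _ _) _; rewrite nrM !nr_real.
have -> : nr ('i%C : C) = 1 by rewrite /nr normc_def /= expr0n expr1n add0r sqrtr1.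
by rewrite mul1r.
Qed.

Lemma nr_complex_le1 (x y : R) : x ^+ 2 + y ^+ 2 <= 1 -> nr (Complex x y) <= 1.
Proof. by move=> h; rewrite /nr normc_def /= -sqrtr1 ler_sqrt. Qed.

Lemma Mc_bound l (r : 'I_(2 * l).+1) (k : nat) (x : 'M[R]_3) : (k <= 2 * l)%N -> SO3 x ->
  nr (Mc l r k x) <= 2 ^+ (2 * l).
Proof.
move=> hk /phi_lift[g hg <-]; rewrite Mc_coef//.
rewrite -[X in 2 ^+ X](subnKC hk).
have /SU2P[p [q [u [s [e eg]]]]] := hg.
have [e1 e2 e3 e4] := invmx_qmxE e; rewrite eg e1 e2 e3 e4.
have := sqr_ge0 p; have := sqr_ge0 q; have := sqr_ge0 u; have := sqr_ge0 s.
by move=> *; apply: lprod_bound; apply: nr_complex_le1; rewrite ?sqrrN; lra.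
Qed.

(* The differential of the matrix coefficients at the identity, [X] being the
   antisymmetric matrix of the tangent direction. *)
Definition dMc l (r k : nat) (X : 'M[C]_3) : C :=
  let q := (X i2 i1 - X i1 i2) / 4 in
  let u := (X i0 i2 - X i2 i0) / 4 in
  let s := (X i1 i0 - X i0 i1) / 4 in
  lfirst k (2 * l - k) r (- ('i%C * q)) (- (u + 'i%C * s)) (u - 'i%C * s) ('i%C * q).

(** 4 p^2 = 4 + t puts p near 1; then 4 p q = A and its analogues make q, r, s first-order
    quantities, equal to A / 4, B / 4, D / 4 up to second order. The norm condition improves the
    estimate of p - 1 to second order. *)
Lemma lift_est (p q r s A B D t h : R) : 0 <= p -> 4 * p ^+ 2 = 4 + t -> `|t| <= 3 * h -> h <= 10^-1 ->
  p ^+ 2 + q ^+ 2 + r ^+ 2 + s ^+ 2 = 1 ->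
  4 * (p * q) = A -> 4 * (p * r) = B -> 4 * (p * s) = D -> `|A| <= 2 * h -> `|B| <= 2 * h -> `|D| <= 2 * h ->
  [/\ `|p - 1| <= 3 * h ^+ 2, `|p - 1| <= h, [/\ `|q| <= h, `|r| <= h & `|s| <= h] &
    [/\ `|q - A / 4| <= h ^+ 2, `|r - B / 4| <= h ^+ 2 & `|s - D / 4| <= h ^+ 2]].
Proof.
move=> p0 pt th hh e pq pr ps hA hB hD.
have h0 : 0 <= h by have := le_trans (normr_ge0 _) th; lra.
have p1 : `|p - 1| <= h.
  move: th; rewrite !ler_norml => /andP[? ?]; apply/andP; split; nra.
have p3 : 9 / 10 <= p by move: p1; rewrite ler_norml => /andP[? ?]; lra.
have bnd x y : 4 * (p * x) = y -> `|y| <= 2 * h -> `|x| <= h.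
  move=> <-; rewrite !normrM (ger0_norm p0) (ger0_norm (_ : 0 <= 4 :> R))//.
  have := normr_ge0 x; nra.
have bq := bnd _ _ pq hA; have br := bnd _ _ pr hB; have bs := bnd _ _ ps hD.
have sq x : `|x| <= h -> x ^+ 2 <= h ^+ 2.
  by move=> hx; rewrite -(@real_normK _ x) ?num_real// lerXn2r// ?nnegrE.
have sec x y : 4 * (p * x) = y -> `|x| <= h -> `|x - y / 4| <= h ^+ 2.
  move=> <- hx; have -> : x - 4 * (p * x) / 4 = - (x * (p - 1)) by field.
  by rewrite normrN normrM expr2; apply: ler_pM.
split=> //; last by split; exact: sec.
have := sq _ bq; have := sq _ br; have := sq _ bs => s1 s2 s3.
have := sqr_ge0 q; have := sqr_ge0 r; have := sqr_ge0 s => s4 s5 s6.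
rewrite ler_norml; apply/andP; split; nra.
Qed.

Lemma sub_le2 (x y h : R) : `|x| <= h -> `|y| <= h -> `|x - y| <= 2 * h.
Proof. by move=> hx hy; apply: le_trans (ler_normB _ _) _; lra. Qed.

Lemma add_le3 (x y z h : R) : `|x| <= h -> `|y| <= h -> `|z| <= h -> `|x + y + z| <= 3 * h.
Proof. by move=> hx hy hz; have := ler_normD (x + y) z; have := ler_normD x y; lra. Qed.

(** Of the two lifts of x, the one with p >= 0 is close to the identity. *)
Lemma near1_lift (x : 'M[R]_3) (h : R) : SO3 x -> h <= 10^-1 ->
  (forall a b, `|x a b - (a == b)%:R| <= h) ->
  exists p q r s, [/\ p ^+ 2 + q ^+ 2 + r ^+ 2 + s ^+ 2 = 1, phi (qmx p q r s) = x,
    `|p - 1| <= 3 * h ^+ 2 /\ `|p - 1| <= h,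
    [/\ `|q| <= h, `|r| <= h & `|s| <= h] &
    [/\ `|q - (x i2 i1 - x i1 i2) / 4| <= h ^+ 2, `|r - (x i0 i2 - x i2 i0) / 4| <= h ^+ 2 &
        `|s - (x i1 i0 - x i0 i1) / 4| <= h ^+ 2]].
Proof.
move=> hx hh hxh.
have [g hg eg] := phi_lift hx.
have [p [q [r [s [e ep p0]]]]] : exists p q r s, [/\ p ^+ 2 + q ^+ 2 + r ^+ 2 + s ^+ 2 = 1, phi (qmx p q r s) = x & 0 <= p].
  have /SU2P[p [q [r [s [e eg']]]]] := hg.
  have [p0|p0] := leP 0 p; first by exists p, q, r, s; rewrite -eg'.
  exists (- p), (- q), (- r), (- s); split; rewrite ?sqrrN//; last by rewrite oppr_ge0 ltW.
  rewrite -eg eg' !phi_qmx; apply: mx3P; rewrite !mxE /=; ring.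
exists p, q, r, s.
suff H : [/\ `|p - 1| <= 3 * h ^+ 2, `|p - 1| <= h, [/\ `|q| <= h, `|r| <= h & `|s| <= h] &
    [/\ `|q - (x i2 i1 - x i1 i2) / 4| <= h ^+ 2, `|r - (x i0 i2 - x i2 i0) / 4| <= h ^+ 2 &
        `|s - (x i1 i0 - x i0 i1) / 4| <= h ^+ 2]].
  by case: H => *; split.
have off (a b : 'I_3) : a != b -> `|x a b| <= h.
  by move=> ab; have := hxh a b; rewrite (negPf ab) subr0.
have diag (a : 'I_3) : `|x a a - 1| <= h by have := hxh a a; rewrite eqxx.
move: ep; rewrite phi_qmx => /matrixP ep.
have E21 := ep i2 i1; have E12 := ep i1 i2; have E02 := ep i0 i2; have E20 := ep i2 i0.
have E10 := ep i1 i0; have E01 := ep i0 i1.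
have E00 := ep i0 i0; have E11 := ep i1 i1; have E22 := ep i2 i2.
move: E21 E12 E02 E20 E10 E01 E00 E11 E22; rewrite !mxE /= => E21 E12 E02 E20 E10 E01 E00 E11 E22.
apply: (@lift_est p q r s _ _ _ ((x i0 i0 - 1) + (x i1 i1 - 1) + (x i2 i2 - 1)) h) => //;
  try (by apply: sub_le2; apply: off); try (by apply: add_le3; apply: diag).
- by rewrite -E00 -E11 -E22; lra.
- by rewrite -E21 -E12; ring.
- by rewrite -E02 -E20; ring.
- by rewrite -E10 -E01; ring.
Qed.

Lemma lfirstB n m r a b c d a' b' c' d' (h : R) :
  nr (a - a') <= h -> nr (b - b') <= h -> nr (c - c') <= h -> nr (d - d') <= h ->
  nr (lfirst n m r a b c d - lfirst n m r a' b' c' d') <= (2 * n + 2 * m)%:R * h.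
Proof.
move=> h1 h2 h3 h4.
have -> : lfirst n m r a b c d - lfirst n m r a' b' c' d' = lfirst n m r (a - a') (b - b') (c - c') (d - d').
  by rewrite /lfirst; ring.
exact: lfirst_bound.
Qed.

Lemma Mc_first_order l : exists2 K : R, 0 <= K & forall (x : 'M[R]_3) (h : R), SO3 x -> h <= 10^-1 ->
  (forall a b, `|x a b - (a == b)%:R| <= h) ->
  forall (r k : 'I_(2 * l).+1),
    nr (Mc l r k x - (r == k :> nat)%:R - dMc l r k (map_mx (real_complex R) x)) <= K * h ^+ 2.
Proof.
have /choice[K hK] : forall k : 'I_(2 * l).+1, exists K : R, 0 <= K /\ forall a b c d (h : R), h <= 1 ->
  nr a <= h -> nr b <= h -> nr c <= h -> nr d <= h ->
  forall r, nr ((lprod (1 + a) b c (1 + d) k (2 * l - k))`_r - (r == k)%:R - lfirst k (2 * l - k) r a b c d) <= K * h ^+ 2.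
  by move=> k; have [K K0 h] := lprod_first_order k (2 * l - k); exists K.
pose KK := \sum_k K k.
have KK0 k : K k <= KK by rewrite /KK (bigD1 k)//= lerDl; apply: sumr_ge0 => j _; have [] := hK j.
have K0 k : 0 <= K k by have [] := hK k.
exists (KK * 4 + (2 * (2 * l))%:R * 4).
  by rewrite addr_ge0 ?mulr_ge0//; apply: sumr_ge0.
move=> x h hx hh hxh r k.
have h0 : 0 <= h by apply: le_trans (hxh i0 i0).
have [p [q [u [s [e ep [P2 P1] [Q1 R1 S1] [Q2 R2 S2]]]]]] := near1_lift hx hh hxh.
have hg : SU2 (qmx p q u s) by apply/SU2P; exists p, q, u, s.
have hk : (k <= 2 * l)%N by rewrite -ltnS.
rewrite -{1}ep (Mc_coef _ hk hg).
have [-> -> -> ->] := invmx_qmxE e.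
have [_ hKk] := hK k.
have E1 y : Complex p y = 1 + Complex (p - 1) y.
  by apply/eqP; rewrite eq_complex /=; apply/andP; split; apply/eqP; ring.
rewrite !E1.
have B (y z : R) : `|y| <= h -> `|z| <= h -> nr (Complex y z) <= 2 * h.
  by move=> hy hz; apply: le_trans (nr_complex_le _ _) _; lra.
(* The entries of the lift have modulus at most 2 h, whence the condition on h and the factor 4 in
   front of the quadratic error. *)
have h2 : 2 * h <= 1 by lra.
have := hKk _ _ _ _ _ h2 (B _ (- q) P1 _) (B (- u) (- s) _ _) (B u (- s) _ _) (B _ q P1 _) r.
rewrite !normrN => /(_ Q1 R1 S1 R1 S1 Q1) H1.
have := @lfirstB k (2 * l - k) r (Complex (p - 1) (- q)) (Complex (- u) (- s)) (Complex u (- s)) (Complex (p - 1) q)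
  (- ('i%C * ((x i2 i1 - x i1 i2) / 4)%:C)) (- (((x i0 i2 - x i2 i0) / 4)%:C + 'i%C * ((x i1 i0 - x i0 i1) / 4)%:C))
  (((x i0 i2 - x i2 i0) / 4)%:C - 'i%C * ((x i1 i0 - x i0 i1) / 4)%:C) ('i%C * ((x i2 i1 - x i1 i2) / 4)%:C) (4 * h ^+ 2).
have CC (y z y' z' : R) (w : C) : w = Complex y' z' -> `|y - y'| <= 3 * h ^+ 2 -> `|z - z'| <= h ^+ 2 ->
    nr (Complex y z - w) <= 4 * h ^+ 2.
  move=> -> hy hz; have -> : Complex y z - Complex y' z' = Complex (y - y') (z - z') by [].
  by apply: le_trans (nr_complex_le _ _) _; lra.
have h22 : 0 <= h ^+ 2 by rewrite exprn_ge0.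
set q' := (x i2 i1 - x i1 i2) / 4 in Q2 *; set u' := (x i0 i2 - x i2 i0) / 4 in R2 *.
set s' := (x i1 i0 - x i0 i1) / 4 in S2 *.
have N (y z : R) : `|- y - - z| = `|y - z| by rewrite -opprD normrN.
move=> /(_ _ _ _ _) H2.
have {}H2 := H2 (CC _ _ 0 (- q') _ _ _ _) (CC _ _ (- u') (- s') _ _ _ _) (CC _ _ u' (- s') _ _ _ _) (CC _ _ 0 q' _ _ _ _).
have CE (y z : R) : y%:C + 'i%C * z%:C = Complex y z.
  by apply/eqP; rewrite eq_complex /=; apply/andP; split; apply/eqP; ring.
have CE2 (z : R) : 'i%C * z%:C = Complex 0 z.
  by apply/eqP; rewrite eq_complex /=; apply/andP; split; apply/eqP; ring.
move: H2; rewrite !N !subr0 !CE !CE2.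
have CN (y z : R) : - Complex y z = Complex (- y) (- z) by [].
have CB (y z : R) : y%:C - Complex 0 z = Complex y (- z).
  by apply/eqP; rewrite eq_complex /=; apply/andP; split; apply/eqP; ring.
rewrite !CN CB oppr0.
have W : `|u - u'| <= 3 * h ^+ 2 by lra.
move=> /(_ erefl P2 Q2 erefl W S2 erefl W S2 erefl P2 Q2) H2.
have -> : dMc l r k (map_mx (real_complex R) x) = lfirst k (2 * l - k) r (Complex 0 (- q'))
   (Complex (- u') (- s')) (Complex u' (- s')) (Complex 0 q').
  rewrite /dMc !mxE -!rmorphB /=.
  have F y : y%:C / 4 = (y / 4)%:C :> C by rewrite rmorphM fmorphV rmorph_nat.
  by rewrite !F CE !CE2 !CN CB oppr0.
set G := lprod _ _ _ _ _ _ in H1 *; set F1 := lfirst _ _ _ _ _ _ _ in H1 H2; set F2 := lfirst _ _ _ _ _ _ _ in H2 *.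
rewrite (_ : _ - _ = (G`_r - (r == k :> nat)%:R - F1) + (F1 - F2)); last by ring.
apply: le_trans (nrD _ _) _; rewrite mulrDl; apply: lerD.
  apply: le_trans H1 _; rewrite exprMn mulrA ler_wpM2r//.
  by rewrite (_ : 2 ^+ 2 = 4 :> R) ?ler_wpM2r//; ring.
by apply: le_trans H2 _; rewrite -mulnDr (subnKC hk) mulrA.
Qed.

End CoefficientExpansion.

(** * Functions on K with a uniform first-order expansion *)

Section RegularFunctions.
Variable R : realType.
Let C := R[i].

Definition cmx (X : 'M[R]_3) : 'M[R[i]]_3 := map_mx (real_complex R) X.
Definition mxsz (X : 'M[R[i]]_3) : R := \sum_a \sum_b nr (X a b).
Definition close1 (x : 'M[R]_3) (h : R) := forall a b, `|x a b - (a == b)%:R| <= h.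

Lemma close1_ge0 x h : close1 x h -> 0 <= h.
Proof. by move=> hx; apply: le_trans (hx i0 i0). Qed.

Lemma mxsz_ge0 X : 0 <= mxsz X.
Proof. by do 2 (apply: sumr_ge0 => ? _); exact: nr_ge0. Qed.

Lemma mxsz_entry (X : 'M[R[i]]_3) a b : nr (X a b) <= mxsz X.
Proof.
rewrite /mxsz (bigD1 a)//= (bigD1 b)//= -addrA lerDl addr_ge0//.
  by apply: sumr_ge0 => *; exact: nr_ge0.
by do 2 (apply: sumr_ge0 => ? _); exact: nr_ge0.
Qed.

Lemma mxsz_le (X : 'M[R[i]]_3) (h : R) : (forall a b, nr (X a b) <= h) -> mxsz X <= 9 * h.
Proof.
move=> hX; rewrite /mxsz !sum3.
have := (hX i0 i0, hX i0 i1, hX i0 i2); have := (hX i1 i0, hX i1 i1, hX i1 i2).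
have := (hX i2 i0, hX i2 i1, hX i2 i2).
by move=> [[? ?] ?] [[? ?] ?] [[? ?] ?]; lra.
Qed.

Lemma mxsz_close x h : close1 x h -> mxsz (cmx x - 1%:M) <= 9 * h.
Proof.
move=> hx; apply: mxsz_le => a b; rewrite !mxE -(rmorph_nat (real_complex R)).
by rewrite -rmorphB nr_real; exact: hx.
Qed.

(* [f (k x) = f x + D (k - 1) x + o(k - 1)] as [k -> 1] in [K], uniformly in [x]. *)
Record isExp (f : 'M[R]_3 -> R[i]) (D : 'M[R[i]]_3 -> 'M[R]_3 -> R[i]) : Prop := IsExp {
  ie_bd : exists2 K, 0 <= K & forall x, SO3 x -> nr (f x) <= K;
  ie_Dbd : exists2 K, 0 <= K & forall x X, SO3 x -> nr (D X x) <= K * mxsz X;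
  ie_lin : forall x a X Y, SO3 x -> D (a *: X + Y) x = a * D X x + D Y x;
  ie_exp : forall e, 0 < e -> exists2 d, 0 < d & forall k h, SO3 k -> close1 k h -> h <= d ->
    forall x, SO3 x -> nr (f (k *m x) - f x - D (cmx k - 1%:M) x) <= e * h }.

Lemma isExp_ext f g D : (forall x, SO3 x -> f x = g x) -> isExp f D -> isExp g D.
Proof.
move=> E [[K K0 h1] h2 h3 h4]; split=> //.
- by exists K => // x hx; rewrite -E// h1.
- move=> e e0; have [d d0 hd] := h4 e e0; exists d => // k h hk kh hh x hx.
  by rewrite -!E//; [exact: hd | exact: SO3_M].
Qed.

Lemma isExp_cst c : isExp (fun=> c) (fun _ _ => 0).
Proof.
split.
- by exists (nr c) => //; exact: nr_ge0.
- by exists 0 => // x X _; rewrite nr0 mul0r.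
- by move=> x a X Y _; rewrite mulr0 addr0.
- move=> e e0; exists 1 => // k h _ kh _ x _; rewrite subrr subr0 nr0.
  by rewrite mulr_ge0 ?(close1_ge0 kh)// ltW.
Qed.

Lemma isExp_entry a b : isExp (fun x => (x a b)%:C) (fun X x => \sum_c X a c * (x c b)%:C).
Proof.
split.
- by exists 1 => // x hx; rewrite nr_real SO3_le1.
- exists 3 => // x X hx; apply: le_trans (nr_sum _ _) _.
  apply: (@le_trans _ _ (\sum_(c < 3) mxsz X)); last by rewrite sum3; lra.
  apply: ler_sum => c _; rewrite nrM nr_real -[leRHS]mulr1; apply: ler_pM; rewrite ?nr_ge0//.
    exact: mxsz_entry.
  exact: SO3_le1.
- move=> x c X Y _; rewrite mulr_sumr -big_split /=; apply: eq_bigr => d _.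
  by rewrite !mxE; ring.
- move=> e e0; exists 1 => // k h _ kh _ x _.
  rewrite [X in nr X](_ : _ = 0) ?nr0; first by rewrite mulr_ge0 ?(close1_ge0 kh)// ltW.
  rewrite mxE rmorph_sum /=; apply/eqP; rewrite subr_eq0 subr_eq; apply/eqP.
  transitivity (\sum_c (cmx k - 1%:M) a c * (x c b)%:C + \sum_c ((a == c)%:R * (x c b)%:C)).
    by rewrite -big_split /=; apply: eq_bigr => c _; rewrite !mxE rmorphM /=; ring.
  congr (_ + _); rewrite (bigD1 a)//= eqxx mul1r big1 ?addr0// => c.
  by rewrite eq_sym => /negPf ->; rewrite mul0r.
Qed.

Lemma isExpD f g D E : isExp f D -> isExp g E -> isExp (fun x => f x + g x) (fun X x => D X x + E X x).
Proof.
move=> [[K1 K10 h1] [K2 K20 h2] h3 h4] [[K3 K30 h5] [K4 K40 h6] h7 h8]; split.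
- exists (K1 + K3); first by rewrite addr_ge0.
  by move=> x hx; apply: le_trans (nrD _ _) _; apply: lerD; [exact: h1|exact: h5].
- exists (K2 + K4); first by rewrite addr_ge0.
  by move=> x X hx; apply: le_trans (nrD _ _) _; rewrite mulrDl; apply: lerD; [exact: h2|exact: h6].
- by move=> x a X Y hx; rewrite h3// h7//; ring.
- move=> e e0; have e20 : 0 < e / 2 by rewrite divr_gt0.
  have [d d0 hd] := h4 _ e20; have [d' d'0 hd'] := h8 _ e20.
  exists (Num.min d d'); first by rewrite lt_min d0.
  move=> k h hk kh; rewrite le_min => /andP[hd1 hd2] x hx.
  rewrite [X in nr X](_ : _ = (f (k *m x) - f x - D (cmx k - 1%:M) x) + (g (k *m x) - g x - E (cmx k - 1%:M) x)); last by ring.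
  apply: le_trans (nrD _ _) _; have := hd k h hk kh hd1 x hx; have := hd' k h hk kh hd2 x hx; lra.
Qed.

Lemma isExpM f g D E : isExp f D -> isExp g E ->
  isExp (fun x => f x * g x) (fun X x => D X x * g x + f x * E X x).
Proof.
move=> [[K1 K10 h1] [K2 K20 h2] h3 h4] [[K3 K30 h5] [K4 K40 h6] h7 h8]; split.
- exists (K1 * K3); first by rewrite mulr_ge0.
  by move=> x hx; rewrite nrM; apply: ler_pM; rewrite ?nr_ge0 ?h1 ?h5.
- exists (K2 * K3 + K1 * K4); first by rewrite addr_ge0// mulr_ge0.
  move=> x X hx; apply: le_trans (nrD _ _) _; rewrite mulrDl !nrM; apply: lerD.
    rewrite mulrAC; apply: ler_pM; rewrite ?nr_ge0 ?h5 ?h2//.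
  by rewrite -mulrA; apply: ler_pM; rewrite ?nr_ge0 ?h1 ?h6.
- by move=> x a X Y hx; rewrite h3// h7//; ring.
- move=> e e0.
  (* The three parts of the error carry the factors K1 + 9 K2, K3 and 81 K2 K4, the nines coming
     from [mxsz_close]; for the last part one factor h is at most e / W. *)
  pose W := K1 + K3 + 9 * K2 + 81 * K2 * K4 + 1.
  have W0 : 0 < W.
    rewrite /W; have : 0 <= K2 * K4 by rewrite mulr_ge0.
    by move=> ?; rewrite ltr_wpDl//; lra.
  have eW : 0 < e / W by rewrite divr_gt0.
  have [d d0 hd] := h4 _ eW; have [d' d'0 hd'] := h8 _ eW.
  exists (Num.min (Num.min d d') (Num.min 1 (e / W))); first by rewrite !lt_min d0 d'0 eW ltr01.
  move=> k h hk kh; rewrite !le_min => /andP[/andP[hd1 hd2] /andP[hd3 hd4]] x hx.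
  have h0 := close1_ge0 kh.
  set Df := D (cmx k - 1%:M) x; set Dg := E (cmx k - 1%:M) x.
  have hkx : SO3 (k *m x) by exact: SO3_M.
  have r1 := hd k h hk kh hd1 x hx; have r2 := hd' k h hk kh hd2 x hx.
  have bD : nr Df <= 9 * K2 * h.
    apply: le_trans (h2 _ _ hx) _; rewrite [9 * K2]mulrC -mulrA ler_wpM2l//; exact: mxsz_close.
  have bE : nr Dg <= 9 * K4 * h.
    apply: le_trans (h6 _ _ hx) _; rewrite [9 * K4]mulrC -mulrA ler_wpM2l//; exact: mxsz_close.
  set rf := f (k *m x) - f x - Df in r1; set rg := g (k *m x) - g x - Dg in r2.
  rewrite [X in nr X](_ : _ = (f x + Df) * rg + rf * g (k *m x) + Df * Dg); last by rewrite /rf /rg; ring.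
  apply: le_trans (nrD _ _) _.
  have b1 : nr ((f x + Df) * rg) <= (K1 + 9 * K2) * (e / W * h).
    rewrite nrM; apply: ler_pM; rewrite ?nr_ge0//.
    apply: le_trans (nrD _ _) _; apply: lerD; first exact: h1.
    by apply: le_trans bD _; rewrite -[leRHS]mulr1 ler_wpM2l// mulr_ge0.
  have b2 : nr (rf * g (k *m x)) <= (e / W * h) * K3.
    by rewrite nrM; apply: ler_pM; rewrite ?nr_ge0// h5.
  have b3 : nr (Df * Dg) <= 81 * K2 * K4 * (e / W * h).
    rewrite nrM; apply: (@le_trans _ _ ((9 * K2 * h) * (9 * K4 * h))).
      by apply: ler_pM; rewrite ?nr_ge0.
    rewrite (_ : _ * _ = 81 * K2 * K4 * (h * h)); last by ring.
    by rewrite ler_wpM2l ?mulr_ge0// ler_wpM2r.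
  have -> : e * h = W * (e / W * h) by field; rewrite gt_eqF.
  apply: le_trans (lerD (le_trans (nrD _ _) (lerD b1 b2)) b3) _.
  have : 0 <= e / W * h by rewrite mulr_ge0// ltW.
  by rewrite /W; nra.
Qed.

(** Mc (k x) is the sum of the products of Mc (k) and Mc (x). The expansion at the identity, with
    the boundedness on K, thus gives an expansion at every x with the same error. *)
Lemma isExp_Mc l (r q : 'I_(2 * l).+1) :
  isExp (Mc l r q) (fun X x => \sum_(e < (2 * l).+1) dMc l r e X * Mc l e q x).
Proof.
have hq : (q <= 2 * l)%N by rewrite -ltnS.
pose B : R := 2 ^+ (2 * l); have B0 : 0 <= B by rewrite exprn_ge0.
have dB (e : 'I_(2 * l).+1) X : nr (dMc l r e X) <= (2 * (2 * l))%:R * mxsz X.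
  have he : (e <= 2 * l)%N by rewrite -ltnS.
  have S a b : nr ((X a b - X b a) / 4) <= mxsz X / 2.
    rewrite nrM; have -> : nr (4^-1 : C) = 4^-1.
      by rewrite -(rmorph_nat (real_complex R)) -fmorphV nr_real ger0_norm.
    have := mxsz_entry X a b; have := mxsz_entry X b a; have := nrB (X a b) (X b a); lra.
  have I (z : C) : nr ('i%C * z) = nr z.
    by rewrite nrM (_ : nr ('i%C : C) = 1) ?mul1r// /nr normc_def /= expr0n expr1n add0r sqrtr1.
  have Z := mxsz_ge0 X.
  rewrite /dMc; apply: le_trans (@lfirst_bound _ _ _ _ _ _ _ _ (mxsz X) _ _ _ _) _.
  - by rewrite nrN I; apply: le_trans (S _ _) _; lra.
  - rewrite nrN; apply: le_trans (nrD _ _) _; rewrite I; have := S i0 i2; have := S i1 i0; lra.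
  - apply: le_trans (nrB _ _) _; rewrite I; have := S i0 i2; have := S i1 i0; lra.
  - by rewrite I; apply: le_trans (S _ _) _; lra.
  - by rewrite -mulnDr subnKC.
have dL e a X Y : dMc l r e (a *: X + Y) = a * dMc l r e X + dMc l r e Y.
  by rewrite /dMc /lfirst !mxE; field.
split.
- by exists B => // x hx; exact: Mc_bound.
- exists ((2 * l).+1%:R * ((2 * (2 * l))%:R * B)); first by rewrite !mulr_ge0.
  move=> x X hx; apply: le_trans (nr_sum _ _) _.
  apply: (@le_trans _ _ (\sum_(e < (2 * l).+1) ((2 * (2 * l))%:R * mxsz X * B))).
    apply: ler_sum => e _; rewrite nrM; apply: ler_pM; rewrite ?nr_ge0//; exact: Mc_bound.
  by rewrite sumr_const card_ord -[leLHS]mulr_natl -!mulrA [mxsz X * B]mulrC.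
- move=> x a X Y _; rewrite mulr_sumr -big_split /=; apply: eq_bigr => e _.
  by rewrite dL mulrDl mulrA.
- have [K K0 hK] := Mc_first_order R l.
  move=> e e0; pose W := (2 * l).+1%:R * (K * B) + 1.
  have W0 : 0 < W by rewrite ltr_wpDl// !mulr_ge0.
  have eW : 0 < e / W by rewrite divr_gt0.
  exists (Num.min (10^-1) (e / W)); first by rewrite lt_min eW andbT.
  move=> k h hk kh; rewrite le_min => /andP[h10 hW] x hx; have h0 := close1_ge0 kh.
  (* Only the antisymmetric part enters [dMc], so subtracting the identity changes nothing. *)
  have E1 (e' : 'I_(2 * l).+1) : dMc l r e' (cmx k - 1%:M) = dMc l r e' (cmx k).
    by rewrite /dMc !mxE /= ?mulr0n !subr0.
  rewrite McM//.
  have -> : Mc l r q x = \sum_(e < (2 * l).+1) (r == e :> nat)%:R * Mc l e q x.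
    rewrite (bigD1 r)//= eqxx mul1r big1 ?addr0// => j; rewrite -val_eqE /= eq_sym => /negPf ->.
    by rewrite mul0r.
  rewrite -!sumrB; apply: le_trans (nr_sum _ _) _.
  apply: (@le_trans _ _ (\sum_(e' < (2 * l).+1) (K * h ^+ 2 * B))).
    apply: ler_sum => e' _; rewrite E1 -!mulrBl nrM; apply: ler_pM; rewrite ?nr_ge0//; last exact: Mc_bound.
    exact: hK.
  rewrite sumr_const card_ord -[leLHS]mulr_natl.
  have -> : (2 * l).+1%:R * (K * h ^+ 2 * B) = ((2 * l).+1%:R * (K * B)) * h * h by ring.
  have P0 : 0 <= (2 * l).+1%:R * (K * B) by rewrite !mulr_ge0.
  rewrite ler_wpM2r//; apply: (@le_trans _ _ (W * (e / W))); last by rewrite mulrC divfK// gt_eqF.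
  by apply: ler_pM => //; rewrite /W lerDl.
Qed.

(** The entries of x are included because a derivative along X at x involves x X x^-1. Together with
    the matrix coefficients they generate an algebra stable under derivation, see [reg_isExp]. *)
Inductive reg : ('M[R]_3 -> R[i]) -> Prop :=
| reg_Mc l (r q : 'I_(2 * l).+1) : reg (Mc l r q)
| reg_entry a b : reg (fun x => (x a b)%:C)
| reg_cst c : reg (fun=> c)
| regD f g : reg f -> reg g -> reg (fun x => f x + g x)
| regM f g : reg f -> reg g -> reg (fun x => f x * g x)
| reg_ext f g : (forall x, SO3 x -> f x = g x) -> reg f -> reg g.

Lemma reg_sum (I : Type) (r : seq I) (f : I -> 'M[R]_3 -> R[i]) :
  (forall j, reg (f j)) -> reg (fun x => \sum_(j <- r) f j x).
Proof.
move=> h; elim: r => [|j r IH].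
  by apply: reg_ext (reg_cst 0) => x _; rewrite big_nil.
by apply: reg_ext (regD (h j) IH) => x _; rewrite big_cons.
Qed.

Lemma reg_isExp f : reg f -> exists2 D, isExp f D & forall X, reg (D X).
Proof.
elim=> [l r q|a b|c|g1 g2 _ [D1 h1 r1] _ [D2 h2 r2]|g1 g2 rg1 [D1 h1 r1] rg2 [D2 h2 r2]|g1 g2 E _ [D1 h1 r1]].
- eexists; first exact: isExp_Mc.
  by move=> X; apply: reg_sum => e; apply: regM; [exact: reg_cst | exact: reg_Mc].
- eexists; first exact: isExp_entry.
  by move=> X; apply: reg_sum => e; apply: regM; [exact: reg_cst | exact: reg_entry].
- by eexists; [exact: isExp_cst | move=> X; exact: reg_cst].
- by eexists; [exact: isExpD h1 h2 | move=> X; exact: regD].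
- by eexists; [exact: isExpM h1 h2 | move=> X; apply: regD; apply: regM].
- by exists D1 => //; exact: isExp_ext h1.
Qed.

End RegularFunctions.

(** * Derivatives of equivariant functions *)

Section LittleO.
Variables (R : realType) (T : Type) (dom : T -> Prop) (eta : T -> R).
Hypothesis eta01 : forall t, dom t -> 0 <= eta t <= 1.

(** Families of vectors that are o(eta), O(eta) or O(1), uniformly on [dom]. Scalar families are
    regarded as families in the regular module, so that one notion covers both. *)
Definition lo (V : normedModType R[i]) (u : T -> V) :=
  forall e : R, 0 < e -> exists2 d, 0 < d & forall t, dom t -> eta t <= d -> nr (u t) <= e * eta t.
Definition b1 (V : normedModType R[i]) (u : T -> V) :=
  exists2 K : R, 0 <= K & forall t, dom t -> nr (u t) <= K * eta t.
Definition b0 (V : normedModType R[i]) (u : T -> V) :=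
  exists2 K : R, 0 <= K & forall t, dom t -> nr (u t) <= K.

Let C := GRing.regular R[i].

Lemma lo_ext (V : normedModType R[i]) (u v : T -> V) : (forall t, dom t -> u t = v t) -> lo v -> lo u.
Proof.
move=> E h e e0; have [d d0 hd] := h e e0; exists d => // t ht te.
by rewrite E// hd.
Qed.

Lemma lo0 (V : normedModType R[i]) : lo (fun=> 0 : V).
Proof.
move=> e e0; exists 1 => // t ht _; have /andP[h _] := eta01 ht.
by rewrite nr0 mulr_ge0// ltW.
Qed.

Lemma loD (V : normedModType R[i]) (u v : T -> V) : lo u -> lo v -> lo (fun t => u t + v t).
Proof.
move=> h1 h2 e e0; have e20 : 0 < e / 2 by rewrite divr_gt0.
have [d d0 hd] := h1 _ e20; have [d' d'0 hd'] := h2 _ e20.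
exists (Num.min d d'); first by rewrite lt_min d0.
move=> t ht; rewrite le_min => /andP[t1 t2]; apply: le_trans (nrD _ _) _.
by have := hd t ht t1; have := hd' t ht t2; lra.
Qed.

Lemma lo_sum (V : normedModType R[i]) (I : Type) (r : seq I) (u : I -> T -> V) :
  (forall j, lo (u j)) -> lo (fun t => \sum_(j <- r) u j t).
Proof.
move=> h; elim: r => [|j r IH]; first by apply: lo_ext (lo0 V) => t _; rewrite big_nil.
by apply: lo_ext (loD (h j) IH) => t _; rewrite big_cons.
Qed.

Lemma b1_b0 (V : normedModType R[i]) (u : T -> V) : b1 u -> b0 u.
Proof.
move=> [K K0 h]; exists K => // t ht; apply: le_trans (h t ht) _.
by rewrite ler_piMr//; case/andP: (eta01 ht).
Qed.

Lemma b1D (V : normedModType R[i]) (u v : T -> V) : b1 u -> b1 v -> b1 (fun t => u t + v t).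
Proof.
move=> [K K0 h] [K' K'0 h']; exists (K + K'); first by rewrite addr_ge0.
by move=> t ht; apply: le_trans (nrD _ _) _; rewrite mulrDl; apply: lerD; [exact: h|exact: h'].
Qed.

Lemma b0_cst (V : normedModType R[i]) (v : V) : b0 (fun=> v).
Proof. by exists (nr v) => //; exact: nr_ge0. Qed.

Lemma b0Z (V : normedModType R[i]) (c : T -> R[i]) (u : T -> V) :
  b0 (c : T -> C) -> b0 u -> b0 (fun t => c t *: u t).
Proof.
move=> [K K0 h] [K' K'0 h']; exists (K * K'); first by rewrite mulr_ge0.
by move=> t ht; rewrite nrZ; apply: ler_pM; rewrite ?nr_ge0//; [exact: h|exact: h'].
Qed.

Lemma b01Z (V : normedModType R[i]) (c : T -> R[i]) (u : T -> V) :
  b0 (c : T -> C) -> b1 u -> b1 (fun t => c t *: u t).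
Proof.
move=> [K K0 h] [K' K'0 h']; exists (K * K'); first by rewrite mulr_ge0.
by move=> t ht; rewrite nrZ -mulrA; apply: ler_pM; rewrite ?nr_ge0//; [exact: h|exact: h'].
Qed.

Lemma b10Z (V : normedModType R[i]) (c : T -> R[i]) (u : T -> V) :
  b1 (c : T -> C) -> b0 u -> b1 (fun t => c t *: u t).
Proof.
move=> [K K0 h] [K' K'0 h']; exists (K * K'); first by rewrite mulr_ge0.
by move=> t ht; rewrite nrZ mulrAC; apply: ler_pM; rewrite ?nr_ge0//; [exact: h|exact: h'].
Qed.

Lemma lo_b0l (V : normedModType R[i]) (c : T -> R[i]) (u : T -> V) :
  b0 (c : T -> C) -> lo u -> lo (fun t => c t *: u t).
Proof.
move=> [K K0 h] hu e e0.
have K1 : 0 < K + 1 by rewrite ltr_wpDl.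
have [|d d0 hd] := hu (e / (K + 1)); first by rewrite divr_gt0.
exists d => // t ht td; rewrite nrZ; have /andP[e1 _] := eta01 ht.
apply: (@le_trans _ _ (K * (e / (K + 1) * eta t))).
  by apply: ler_pM; rewrite ?nr_ge0//; [exact: h|exact: hd].
by rewrite mulrA ler_wpM2r// mulrCA ger_pMr// ler_pdivrMr//; lra.
Qed.

Lemma lo_b0r (V : normedModType R[i]) (c : T -> R[i]) (u : T -> V) :
  lo (c : T -> C) -> b0 u -> lo (fun t => c t *: u t).
Proof.
move=> hc [K K0 h] e e0.
have K1 : 0 < K + 1 by rewrite ltr_wpDl.
have [|d d0 hd] := hc (e / (K + 1)); first by rewrite divr_gt0.
exists d => // t ht td; rewrite nrZ; have /andP[e1 _] := eta01 ht.
apply: (@le_trans _ _ ((e / (K + 1) * eta t) * K)).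
  by apply: ler_pM; rewrite ?nr_ge0//; [exact: hd|exact: h].
by rewrite mulrAC ler_wpM2r// mulrC mulrCA ger_pMr// ler_pdivrMr//; lra.
Qed.

Lemma lo_b1b1 (V : normedModType R[i]) (c : T -> R[i]) (u : T -> V) :
  b1 (c : T -> C) -> b1 u -> lo (fun t => c t *: u t).
Proof.
move=> [K K0 h] [K' K'0 h'] e e0.
have K1 : 0 < K * K' + 1 by rewrite ltr_wpDl// mulr_ge0.
exists (e / (K * K' + 1)); first by rewrite divr_gt0.
move=> t ht td; rewrite nrZ; have /andP[e1 _] := eta01 ht.
apply: (@le_trans _ _ ((K * eta t) * (K' * eta t))).
  by apply: ler_pM; rewrite ?nr_ge0//; [exact: h|exact: h'].
rewrite mulrA ler_wpM2r// mulrAC.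
rewrite ler_pdivlMr// in td; apply: le_trans _ td.
by rewrite mulrC ler_wpM2l// lerDl.
Qed.

Lemma lo_lo (V : normedModType R[i]) (c : T -> R[i]) (u : T -> V) :
  lo (c : T -> C) -> lo u -> lo (fun t => c t *: u t).
Proof.
move=> hc hu e e0; have [d d0 hd] := hc _ ltr01; have [d' d'0 hd'] := hu _ e0.
exists (Num.min d d'); first by rewrite lt_min d0.
move=> t ht; rewrite le_min => /andP[t1 t2]; rewrite nrZ; have /andP[e1 e2] := eta01 ht.
rewrite -[leRHS]mul1r; apply: ler_pM; rewrite ?nr_ge0//; last exact: hd'.
by apply: le_trans (hd t ht t1) _; rewrite mul1r.
Qed.

Lemma prod_expand (V : lmodType R[i]) (c c0 c1 : R[i]) (v v0 v1 : V) :
  c *: v - c0 *: v0 - (c0 *: v1 + c1 *: v0) =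
  c0 *: (v - v0 - v1) + (c1 *: v1 + (c1 *: (v - v0 - v1) + ((c - c0 - c1) *: v0
    + ((c - c0 - c1) *: v1 + (c - c0 - c1) *: (v - v0 - v1))))).
Proof.
set w := v - v0 - v1; set d := c - c0 - c1.
have ev : v = w + (v1 + v0) by rewrite /w addrA !subrK.
have ec : c = d + (c1 + c0) by rewrite /d addrA !subrK.
clearbody w d; rewrite ev ec !scalerDl !scalerDr.
apply/eqP; rewrite !subr_eq; apply/eqP.
rewrite !addrA [LHS](ACl (7*5*4*3*2*1*8*6*9)%AC) /=.
by [].
Qed.

(** Leibniz rule for first-order expansions: what is left after the terms of order zero and one is a
    product of two first-order terms, or has a factor o(eta). *)
Lemma prod_lo (V : normedModType R[i]) (c c0 c1 : T -> R[i]) (v v0 v1 : T -> V) :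
  b0 (c0 : T -> C) -> b1 (c1 : T -> C) -> b0 v0 -> b1 v1 ->
  lo ((fun t => c t - c0 t - c1 t) : T -> C) -> lo (fun t => v t - v0 t - v1 t) ->
  lo (fun t => c t *: v t - c0 t *: v0 t - (c0 t *: v1 t + c1 t *: v0 t)).
Proof.
move=> h0 h1 g0 g1 hc hv.
apply: (@lo_ext _ _ (fun t => c0 t *: (v t - v0 t - v1 t) + (c1 t *: v1 t + (c1 t *: (v t - v0 t - v1 t) + ((c t - c0 t - c1 t) *: v0 t
    + ((c t - c0 t - c1 t) *: v1 t + (c t - c0 t - c1 t) *: (v t - v0 t - v1 t))))))).
  by move=> t _; exact: prod_expand.
apply: loD; first exact: lo_b0l.
apply: loD; first exact: lo_b1b1.
apply: loD; first exact: lo_b0l (b1_b0 h1) hv.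
apply: loD; first exact: lo_b0r.
by apply: loD; [exact: lo_b0r (b1_b0 g1) | exact: lo_lo].
Qed.

End LittleO.

Section FirstOrderExp.
Variable R : realType.

Lemma is_derive_eps (g : R -> R) (g' : R) : is_derive (0 : R) 1 g g' ->
  forall e : R, 0 < e -> exists2 d : R, 0 < d & forall s, `|s| <= d -> `|g s - g 0 - s * g'| <= e * `|s|.
Proof.
move=> [hd hg] e e0.
have h : (fun h => h^-1 *: (g (h%:A + 0) - g 0)) @ 0^' --> g'.
  by rewrite -hg; exact: hd.
have /cvgrPdist_le/(_ e e0)/near0P[d d0 hd'] := h.
exists d => // s sd; have [->|s0] := eqVneq s 0; first by rewrite subrr mul0r subr0 normr0 mulr0.
have := hd' s sd s0; rewrite addr0 [s%:A]mulr1 => H.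
have -> : g s - g 0 - s * g' = - (s * (g' - s^-1 * (g s - g 0))) by field.
by rewrite normrN normrM mulrC ler_wpM2r.
Qed.

Lemma cexp_first_order (z : R[i]) (e : R) : 0 < e -> exists2 d : R, 0 < d &
  forall s : R, `|s| <= d -> nr (cexp (s%:C * z) - 1 - s%:C * z) <= e * `|s|.
Proof.
move=> e0; case: z => x y.
pose g1 (s : R) := expR (s * x) * cos (s * y); pose g2 (s : R) := expR (s * x) * sin (s * y).
have h1 : is_derive (0 : R) 1 g1 x.
  by rewrite /g1; apply: is_derive_eq; rewrite /GRing.scale /= !mul0r expR0 cos0 sin0; ring.
have h2 : is_derive (0 : R) 1 g2 y.
  by rewrite /g2; apply: is_derive_eq; rewrite /GRing.scale /= !mul0r expR0 cos0 sin0; ring.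
have e20 : 0 < e / 2 by rewrite divr_gt0.
have [d1 d10 hd1] := is_derive_eps h1 e20; have [d2 d20 hd2] := is_derive_eps h2 e20.
exists (Num.min d1 d2); first by rewrite lt_min d10.
move=> s; rewrite le_min => /andP[s1 s2].
have -> : cexp (s%:C * Complex x y) - 1 - s%:C * Complex x y =
   Complex (g1 s - g1 0 - s * x) (g2 s - g2 0 - s * y).
  have -> : s%:C * Complex x y = Complex (s * x) (s * y).
    by apply/eqP; rewrite eq_complex /=; apply/andP; split; apply/eqP; ring.
  apply/eqP; rewrite eq_complex /cexp /g1 /g2 /= !mul0r expR0 cos0 sin0.
  by apply/andP; split; apply/eqP; ring.
apply: le_trans (nr_complex_le _ _) _.
by have := hd1 s s1; have := hd2 s s2; lra.
Qed.

Lemma cexp0 : cexp (0 : R[i]) = 1.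
Proof. by apply/eqP; rewrite eq_complex /cexp /= expR0 cos0 sin0; apply/andP; split; apply/eqP; ring. Qed.

Lemma cexpD (z w : R[i]) : cexp (z + w) = cexp z * cexp w.
Proof.
case: z w => a b [c d]; rewrite /cexp /= expRD sinD cosD.
by apply/eqP; rewrite eq_complex /=; apply/andP; split; apply/eqP; ring.
Qed.

End FirstOrderExp.

Lemma Lder_term_lin (C : comPzRingType) (V : lmodType C) (z a p d d' x0 y0 x1 y1 x2 y2 x3 y3 x4 y4 c c' : C) (u v w : V) :
  (z * ((a * x0 + y0) * c) * p + (a * d + d')) *: u
    + p *: (((a * x1 + y1 - (a * x2 + y2)) * c') *: v + ((a * x3 + y3 + (a * x4 + y4)) * c') *: w)
  = a *: ((z * (x0 * c) * p + d) *: u + p *: (((x1 - x2) * c') *: v + ((x3 + x4) * c') *: w))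
    + ((z * (y0 * c) * p + d') *: u + p *: (((y1 - y2) * c') *: v + ((y3 + y4) * c') *: w)).
Proof.
rewrite !scalerDr !scalerA.
rewrite [RHS](AC ((1*2)*(1*2)) ((1*4)*((2*5)*(3*6))))/= -!scalerDl.
by congr (_ *: _ + (_ *: _ + _ *: _)); ring.
Qed.

Lemma sub_shift (C : pzRingType) (V : lmodType C) (p u v : V) (a a' b b' : C) :
  p - ((a - a') *: u + (b - b') *: v) = p - (a *: u + b *: v) + (a' *: u + b' *: v).
Proof.
rewrite !scalerBl -[RHS]addrA; congr (_ + _).
by rewrite !opprD !opprK; rewrite [LHS](AC (2*2) ((1*3)*(2*4)))/=.
Qed.

Lemma Lder_regroup (C : comPzRingType) (V : lmodType C) (p u w : V) (c d e : C) :
  p - c *: u - ((e * c + d) *: u + c *: w) = p - 1 *: (c *: u) - (1 *: (c *: w + d *: u) + e *: (c *: u)).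
Proof. by rewrite !scale1r scalerA scalerDl; congr (_ - _); rewrite [RHS](AC (2*1) ((3*2)*1)). Qed.

Lemma nr_half (R : realType) (u : R[i]) : nr (u / 2) = nr u / 2.
Proof.
rewrite nrM; congr (_ * _).
by rewrite -(rmorph_nat (real_complex R)) -fmorphV nr_real ger0_norm.
Qed.

(** * First-order expansion of an equivariant function at K *)

Section Equivariant.
Variables (R : realType) (k : nat) (sigma : discrete_series R k) (nu : R[i]).

(** Equivariance under h of determinant 1 is what matters near the identity, the slice [mpart]
    having determinant 1. There the twist [tw] that distinguishes P_2 from P_1 is trivial, so one
    computation serves both. *)
Definition eqv1 (f : 'M[R]_3 -> sigma) := forall n s h x, Nrad P1 n -> \det h = 1 -> SL3 x ->
  f (n *m mexp (s *: Hmx R P1) *m m_emb P1 h *m x) = cexp (s%:C * (nu + rho R)) *: ds_act sigma h (f x).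

(** The complex-linear counterpart of [Spart], for the complex matrices X_j; on B - 1 it agrees with
    [Spart] by [SpartC_cmx]. *)
Definition SpartC (M : 'M[R[i]]_3) : 'M[R[i]]_3 := mx_of_rows 3 3
  [:: [:: 0; - M i1 i0; - M i2 i0];
      [:: M i1 i0; 0; (M i1 i2 - M i2 i1) / 2];
      [:: M i2 i0; (M i2 i1 - M i1 i2) / 2; 0]].

Lemma SpartC_lin a X Y : SpartC (a *: X + Y) = a *: SpartC X + SpartC Y.
Proof. by apply: mx3P; rewrite !mxE /=; field. Qed.

Lemma SpartC_cmx (B : 'M[R]_3) : SpartC (cmx B - 1%:M) = cmx (Spart B).
Proof.
have F (y : R) : (y / 2)%:C = y%:C / 2 by rewrite rmorphM fmorphV rmorph_nat.
by apply: mx3P; rewrite !mxE /= ?mulr0n ?subr0 ?rmorphN ?F ?rmorphB.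
Qed.

Variables (N : nat) (ph : 'I_N -> 'M[R]_3 -> R[i]) (D : 'I_N -> 'M[R[i]]_3 -> 'M[R]_3 -> R[i]) (e : 'I_N -> int).
Hypothesis he : forall j, chi_index k (e j).
Hypothesis hexp : forall j, isExp (ph j) (D j).

(* The derivative at [x] in [K] of a [P_1]-equivariant function along the
   right-invariant vector field of [X]. *)
Definition Lder (X : 'M[R[i]]_3) (x : 'M[R]_3) : sigma :=
  \sum_j (((nu + rho R) * (X i0 i0 / 2) * ph j x + D j (SpartC X) x) *: ds_chi sigma (e j)
    + ph j x *: (((X i1 i1 - X i2 i2) / 2) *: chiH sigma (e j)
                 + ((X i1 i2 + X i2 i1) / 2) *: chiE sigma (e j))).

Lemma Lder_lin a X Y x : SO3 x -> Lder (a *: X + Y) x = a *: Lder X x + Lder Y x.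
Proof.
move=> hx; rewrite /Lder scaler_sumr -big_split /=; apply: eq_bigr => j _.
rewrite SpartC_lin (ie_lin (hexp j))// !mxE.
exact: Lder_term_lin.
Qed.

Lemma Lder_bound : exists2 K : R, 0 <= K & forall (X : 'M[R[i]]_3) (x : 'M[R]_3), SO3 x -> nr (Lder X x) <= K * mxsz X.
Proof.
have /choice[K hK] : forall j, exists K : R, 0 <= K /\ forall (X : 'M[R[i]]_3) (x : 'M[R]_3), SO3 x ->
  nr (((nu + rho R) * (X i0 i0 / 2) * ph j x + D j (SpartC X) x) *: ds_chi sigma (e j)
    + ph j x *: (((X i1 i1 - X i2 i2) / 2) *: chiH sigma (e j)
                 + ((X i1 i2 + X i2 i1) / 2) *: chiE sigma (e j))) <= K * mxsz X.
  move=> j; have [[K1 K10 h1] [K2 K20 h2] _ _] := hexp j.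
  pose n0 := nr (nu + rho R).
  exists ((n0 * K1 + 9 * K2) * nr (ds_chi sigma (e j)) + K1 * (nr (chiH sigma (e j)) + nr (chiE sigma (e j)))).
  split; first by rewrite addr_ge0// mulr_ge0 ?addr_ge0 ?mulr_ge0 ?nr_ge0.
  move=> X x hx.
  have m0 := mxsz_ge0 X; have mE a b := mxsz_entry X a b.
  have hS : mxsz (SpartC X) <= 9 * mxsz X.
    apply: mxsz_le => a b.
    case: a => [[|[|[|a]]]] ha //; case: b => [[|[|[|b]]]] hb //; rewrite mxE /= ?nr0 ?nrN ?nr_half//.
      by apply: (@le_trans _ _ ((nr (X i1 i2) + nr (X i2 i1)) / 2)); [rewrite ler_pM2r ?invr_gt0// nrB | have := mE i1 i2; have := mE i2 i1; lra].
    by apply: (@le_trans _ _ ((nr (X i2 i1) + nr (X i1 i2)) / 2)); [rewrite ler_pM2r ?invr_gt0// nrB | have := mE i1 i2; have := mE i2 i1; lra].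
  apply: le_trans (nrD _ _) _; rewrite [leRHS]mulrDl; apply: lerD; rewrite nrZ.
    rewrite [leRHS]mulrAC ler_wpM2r ?nr_ge0//; apply: le_trans (nrD _ _) _; rewrite [leRHS]mulrDl; apply: lerD.
      rewrite 2!nrM -/n0 nr_half -!mulrA ler_wpM2l ?nr_ge0//.
      rewrite [leRHS]mulrC; apply: ler_pM; rewrite ?mulr_ge0 ?nr_ge0//.
      have := h1 x hx; have := nr_ge0 (ph j x); lra.
    apply: le_trans (h2 _ _ hx) _; rewrite [9 * _]mulrC -mulrA; rewrite ler_wpM2l//.
  rewrite -mulrA; apply: ler_pM; rewrite ?nr_ge0 ?h1//.
  move: (chiH _ _) (chiE _ _) => cH cE.
  apply: le_trans (nrD _ _) _; rewrite !nrZ !nr_half [leRHS]mulrDl [_ * mxsz X]mulrC [X in _ <= _ + X]mulrC.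
  apply: lerD; rewrite ler_wpM2r ?nr_ge0//.
    have := nrB (X i1 i1) (X i2 i2); have := mE i1 i1; have := mE i2 i2; lra.
  have := nrD (X i1 i2) (X i2 i1); have := mE i1 i2; have := mE i2 i1; lra.
exists (\sum_j K j); first by apply: sumr_ge0 => j _; have [] := hK j.
move=> X x hx; apply: le_trans (nr_sum _ _) _; rewrite mulr_suml.
by apply: ler_sum => j _; have [_ h] := hK j; exact: h.
Qed.

Variable f : 'M[R]_3 -> sigma.
Hypothesis hf : eqv1 f.
Hypothesis fK : forall x, SO3 x -> f x = \sum_j ph j x *: ds_chi sigma (e j).

(** With B = n a m k, f (B x) = exp (s (nu + rho)) sigma (m) f (k x). Each of the three factors has
    a first-order expansion in B - 1, and two applications of [prod_lo] multiply them. *)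
Lemma first_order_at_K (ep : R) : 0 < ep -> exists2 d : R, 0 < d & forall B h, SL3 B -> close1 B h -> h <= d ->
  forall x, SO3 x -> nr (f (B *m x) - f x - Lder (cmx B - 1%:M) x) <= ep * h.
Proof.
move=> ep0.
have [K K0 hK] := dec1_first_order R.
(* The point x of K is one of the parameters; every estimate on [dom] is then uniform in x. *)
pose T := ('M[R]_3 * 'M[R]_3 * 'M[R]_3 * (R * R * R) * R)%type.
pose B (t : T) := t.1.1.1.1; pose kk (t : T) := t.1.1.1.2; pose xx (t : T) := t.1.1.2.
pose s (t : T) := t.1.2.1.1; pose a (t : T) := t.1.2.1.2; pose b (t : T) := t.1.2.2.
pose eta (t : T) := t.2.
pose dom t := [/\ SO3 (kk t) /\ SO3 (xx t),
  exists2 n, Nrad P1 n & B t = n *m pdec1 (s t) (a t) (b t) *m kk t,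
  close1 (B t) (eta t) & 0 <= eta t <= 100^-1].
have e01 t : dom t -> 0 <= eta t <= 1.
  by case=> _ _ _ /andP[-> h] /=; apply: le_trans h _; lra.
have est t : dom t -> [/\ `|s t| <= K * eta t /\ `|s t - (B t i0 i0 - 1) / 2| <= K * eta t ^+ 2,
      `|a t| <= K * eta t /\ `|a t - (B t i1 i1 - B t i2 i2) / 2| <= K * eta t ^+ 2,
      `|b t| <= K * eta t /\ `|b t - (B t i1 i2 + B t i2 i1) / 2| <= K * eta t ^+ 2
    & forall c d, `|kk t c d - (c == d)%:R| <= K * eta t /\
        `|kk t c d - (c == d)%:R - Spart (B t) c d| <= K * eta t ^+ 2].
  by move=> [[h1 _] [n hn eB] hB hh]; exact: hK hn h1 eB hh hB.
pose X (t : T) := cmx (B t) - 1%:M.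
have loR (g : T -> R) : (forall t, dom t -> `|g t| <= K * eta t ^+ 2) -> lo dom eta ((fun t => (g t)%:C) : T -> GRing.regular R[i]).
  move=> hg ee ee0; have K1 : 0 < K + 1 by rewrite ltr_wpDl.
  exists (ee / (K + 1)); first by rewrite divr_gt0.
  move=> t ht te; rewrite nr_real; apply: le_trans (hg t ht) _.
  have /andP[h0 _] := e01 t ht; rewrite expr2 mulrA ler_wpM2r//.
  rewrite ler_pdivlMr// in te; apply: le_trans _ te; rewrite mulrC ler_wpM2l// lerDl//.
have b1R (g : T -> R) : (forall t, dom t -> `|g t| <= K * eta t) -> b1 dom eta ((fun t => (g t)%:C) : T -> GRing.regular R[i]).
  by move=> hg; exists K => // t ht; rewrite nr_real; exact: hg.
pose z := nu + rho R.
have loE : lo dom eta ((fun t => cexp ((s t)%:C * z) - 1 - z * (X t i0 i0 / 2)) : T -> GRing.regular R[i]).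
  apply: (@lo_ext R T dom eta (GRing.regular R[i]) _ (fun t => (cexp ((s t)%:C * z) - 1 - (s t)%:C * z) + z *: ((s t - (B t i0 i0 - 1) / 2)%:C : GRing.regular R[i]))).
    move=> t _; rewrite /X !mxE /= mulr1n rmorphB rmorphM fmorphV rmorph_nat rmorphB rmorph1 /=.
    by rewrite /GRing.scale /=; field.
  apply: loD => //; last first.
    apply: (@lo_b0l _ _ _ _ _ _ (fun=> z)) => //; first exact: b0_cst.
    by apply: loR => t ht; have [[_ h] _ _ _] := est t ht.
  move=> ee ee0; have K1 : 0 < K + 1 by rewrite ltr_wpDl.
  have [|d d0 hd] := @cexp_first_order R z (ee / (K + 1)); first by rewrite divr_gt0.
  exists (d / (K + 1)); first by rewrite divr_gt0.
  move=> t ht te; have [[h1 _] _ _ _] := est t ht; have /andP[h0 _] := e01 t ht.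
  have hs : `|s t| <= (K + 1) * eta t by apply: le_trans h1 _; rewrite ler_wpM2r// lerDl.
  apply: le_trans (hd _ _) _.
    by apply: le_trans hs _; rewrite mulrC -ler_pdivlMr.
  apply: (@le_trans _ _ (ee / (K + 1) * ((K + 1) * eta t))); last by rewrite mulrA divfK// gt_eqF.
  by rewrite ler_wpM2l// ltW// divr_gt0.
have b1X c d : b1 dom eta ((fun t => X t c d) : T -> GRing.regular R[i]).
  exists 1 => // t [_ _ hB _]; rewrite /X !mxE -(rmorph_nat (real_complex R)) -rmorphB nr_real mul1r; exact: hB.
have b1E : b1 dom eta ((fun t => z * (X t i0 i0 / 2)) : T -> GRing.regular R[i]).
  have h := @b01Z _ _ dom eta _ (fun=> z / 2) _ (b0_cst _ (z / 2 : GRing.regular R[i])) (b1X i0 i0).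
  case: h => K' K'0 h; exists K' => // t ht; rewrite (_ : z * (X t i0 i0 / 2) = (z / 2) *: (X t i0 i0 : GRing.regular R[i])) ?h//.
  by rewrite /GRing.scale /=; field.
have b0P j : b0 dom ((fun t => ph j (xx t)) : T -> GRing.regular R[i]).
  have [[K1 K10 h1] _ _ _] := hexp j; exists K1 => // t [[_ hx] _ _ _]; exact: h1.
have b1Dj j : b1 dom eta ((fun t => D j (SpartC (X t)) (xx t)) : T -> GRing.regular R[i]).
  have [_ [K2 K20 h2] _ _] := hexp j.
  exists (K2 * 9); first by rewrite mulr_ge0.
  move=> t [[_ hx] _ hB /andP[h0 _]]; apply: le_trans (h2 _ _ hx) _; rewrite -mulrA ler_wpM2l//.
  rewrite /X SpartC_cmx; apply: mxsz_le => c d; rewrite !mxE nr_real.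
  have := hB i1 i0; have := hB i2 i0; have := hB i1 i2; have := hB i2 i1; rewrite /= !subr0 => q1 q2 q3 q4.
  have q5 := ler_normB (B t i1 i2) (B t i2 i1); have q6 := ler_normB (B t i2 i1) (B t i1 i2).
  by case: c => [[|[|[|c]]]] hc //; case: d => [[|[|[|d]]]] hd //=; rewrite ?normr0 ?normrN// normrM (@ger0_norm _ (2^-1))//; lra.
have loP j : lo dom eta ((fun t => ph j (kk t *m xx t) - ph j (xx t) - D j (SpartC (X t)) (xx t)) : T -> GRing.regular R[i]).
  have [_ [K2 K20 h2] hlin hee] := hexp j.
  apply: (@lo_ext R T dom eta (GRing.regular R[i]) _ (fun t => (ph j (kk t *m xx t) - ph j (xx t) - D j (cmx (kk t) - 1%:M) (xx t)) + D j (cmx (kk t) - 1%:M - SpartC (X t)) (xx t))).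
    move=> t [[_ hx] _ _ _].
    have -> : cmx (kk t) - 1%:M - SpartC (X t) = (-1) *: SpartC (X t) + (cmx (kk t) - 1%:M) by rewrite scaleN1r addrC.
    by rewrite hlin//; ring.
  have K1 : 0 < K + 1 by rewrite ltr_wpDl.
  apply: loD => //.
    move=> ee ee0; have [|d d0 hd] := hee (ee / (K + 1)); first by rewrite divr_gt0.
    exists (d / (K + 1)); first by rewrite divr_gt0.
    move=> t ht te; have [_ _ _ h4] := est t ht; have /andP[h0 _] := e01 t ht.
    have [[hkk hx] _ _ _] := ht.
    have hc : close1 (kk t) ((K + 1) * eta t).
      by move=> c c'; have [h5 _] := h4 c c'; apply: le_trans h5 _; rewrite ler_wpM2r// lerDl.
    have := hd _ _ hkk hc _ _ hx; rewrite mulrA divfK ?gt_eqF//; apply.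
    by rewrite mulrC -ler_pdivlMr.
  move=> ee ee0; pose W := K2 * (9 * K) + 1.
  have W0 : 0 < W by rewrite ltr_wpDl// !mulr_ge0.
  exists (ee / W); first by rewrite divr_gt0.
  move=> t ht te; have [_ _ _ h4] := est t ht; have /andP[h0 _] := e01 t ht.
  have [[hkk hx] _ _ _] := ht.
  apply: le_trans (h2 _ _ hx) _.
  have hm : mxsz (cmx (kk t) - 1%:M - SpartC (X t)) <= 9 * (K * eta t ^+ 2).
    apply: mxsz_le => c c'; rewrite /X SpartC_cmx !mxE -(rmorph_nat (real_complex R)) -!rmorphB nr_real.
    by have [_ h5] := h4 c c'; move: h5; rewrite !mxE.
  apply: (@le_trans _ _ (K2 * (9 * (K * eta t ^+ 2)))); first by rewrite ler_wpM2l.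
  rewrite (_ : _ * _ = K2 * (9 * K) * eta t * eta t); last by ring.
  rewrite ler_wpM2r//; rewrite ler_pdivlMr// in te; apply: le_trans _ te.
  by rewrite mulrC ler_wpM2l// lerDl.
pose w1 j t := ((X t i1 i1 - X t i2 i2) / 2) *: chiH sigma (e j) + ((X t i1 i2 + X t i2 i1) / 2) *: chiE sigma (e j).
have b1w j : b1 dom eta (w1 j).
  have hX t c d : dom t -> nr (X t c d) <= eta t.
    by move=> [_ _ hB _]; rewrite /X !mxE -(rmorph_nat (real_complex R)) -rmorphB nr_real; exact: hB.
  apply: b1D; apply: b10Z; try exact: b0_cst; exists 1 => // t ht; rewrite nr_half.
    by have := nrB (X t i1 i1) (X t i2 i2); have := hX t i1 i1 ht; have := hX t i2 i2 ht; lra.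
  by have := nrD (X t i1 i2) (X t i2 i1); have := hX t i1 i2 ht; have := hX t i2 i1 ht; lra.
have low j : lo dom eta (fun t => ds_act sigma (mpart (a t) (b t)) (ds_chi sigma (e j)) - ds_chi sigma (e j) - w1 j t).
  set chi := ds_chi sigma (e j); set cH := chiH sigma (e j); set cE := chiE sigma (e j).
  apply: (lo_ext (v := fun t => (ds_act sigma (mpart (a t) (b t)) chi - chi - ((a t)%:C *: cH + (b t)%:C *: cE))
     + ((a t - (B t i1 i1 - B t i2 i2) / 2)%:C *: cH + (b t - (B t i1 i2 + B t i2 i1) / 2)%:C *: cE))).
    move=> t _; rewrite /w1 -/cH -/cE.
    have -> : (X t i1 i1 - X t i2 i2) / 2 = (a t)%:C - (a t - (B t i1 i1 - B t i2 i2) / 2)%:C.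
      by rewrite /X !mxE /= mulr1n -rmorphB; apply/eqP; rewrite eq_complex /=; apply/andP; split; apply/eqP; field.
    have -> : (X t i1 i2 + X t i2 i1) / 2 = (b t)%:C - (b t - (B t i1 i2 + B t i2 i1) / 2)%:C.
      by rewrite /X !mxE /= mulr0n -rmorphB; apply/eqP; rewrite eq_complex /=; apply/andP; split; apply/eqP; field.
    exact: sub_shift.
  apply: loD => //; last first.
    apply: loD => //; apply: lo_b0r => //; try exact: b0_cst; apply: loR => t ht.
      by have [_ [_ h] _ _] := est t ht.
    by have [_ _ [_ h] _] := est t ht.
  move=> ee ee0; have K1 : 0 < 2 * (K + 1) by rewrite mulr_gt0// ltr_wpDl.
  have [|d d0 hd] := @ds_second_kind R k sigma (e j) (ee / (2 * (K + 1))) (he j); first by rewrite divr_gt0.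
  exists (d / (2 * (K + 1))); first by rewrite divr_gt0.
  move=> t ht te; have [_ [h1 _] [h2 _] _] := est t ht; have /andP[h0 _] := e01 t ht.
  rewrite ler_pdivlMr// in te.
  have te' : K * eta t <= d.
    apply: le_trans te; rewrite mulrC ler_wpM2l//; lra.
  apply: le_trans (hd _ _ (le_trans h1 te') (le_trans h2 te')) _.
  apply: (@le_trans _ _ (ee / (2 * (K + 1)) * ((2 * (K + 1)) * eta t))); last by rewrite mulrA divfK// gt_eqF.
  rewrite ler_wpM2l//; first by rewrite ltW// divr_gt0.
  by rewrite mulrDr mulr1 mulrDl -mulrA; lra.
have fE t : dom t -> f (B t *m xx t) = \sum_j cexp ((s t)%:C * z) *: (ph j (kk t *m xx t) *: ds_act sigma (mpart (a t) (b t)) (ds_chi sigma (e j))).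
  move=> [[hkk hx] [n hn eB] _ _]; rewrite eB.
  have -> : n *m pdec1 (s t) (a t) (b t) *m kk t *m xx t = n *m mexp (s t *: Hmx R P1) *m m_emb P1 (mpart (a t) (b t)) *m (kk t *m xx t).
    by rewrite /pdec1 !mulmxA.
  have hkx : SO3 (kk t *m xx t) by exact: SO3_M.
  rewrite hf ?det_mpart//; last exact: SO3_SL3.
  have hm : SLpm (mpart (a t) (b t)) by left; rewrite det_mpart.
  rewrite fK// ds_act_sum// scaler_sumr; apply: eq_bigr => j _.
  by rewrite ds_actZ.
have main : lo dom eta (fun t => f (B t *m xx t) - f (xx t) - Lder (X t) (xx t)).
  pose vj j t := ph j (kk t *m xx t) *: ds_act sigma (mpart (a t) (b t)) (ds_chi sigma (e j)).
  pose v0 j t := ph j (xx t) *: ds_chi sigma (e j).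
  pose v1 j t := ph j (xx t) *: w1 j t + D j (SpartC (X t)) (xx t) *: ds_chi sigma (e j).
  have lov j : lo dom eta (fun t => vj j t - v0 j t - v1 j t).
    by apply: prod_lo => //; exact: b0_cst.
  have b0v j : b0 dom (v0 j) by apply: b0Z => //; exact: b0_cst.
  have b1v j : b1 dom eta (v1 j).
    by apply: b1D; [exact: b01Z | apply: b10Z => //; exact: b0_cst].
  have lo1 j : lo dom eta (fun t => cexp ((s t)%:C * z) *: vj j t - 1 *: v0 j t - (1 *: v1 j t + (z * (X t i0 i0 / 2)) *: v0 j t)).
    by apply: (@prod_lo R T dom eta e01 _ _ (fun=> 1)) => //; exact: (b0_cst _ (1 : GRing.regular R[i])).
  have lo2 := lo_sum e01 (index_enum 'I_N) lo1.
  apply: lo_ext lo2 => t ht.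
  rewrite (fE t ht) fK; last by case: ht => [[]].
  rewrite -sumrB /Lder -sumrB; apply: eq_bigr => j _.
  have := Lder_regroup (cexp ((s t)%:C * z) *: vj j t) (ds_chi sigma (e j)) (w1 j t) (ph j (xx t)) (D j (SpartC (X t)) (xx t)) (z * (X t i0 i0 / 2)).
  by move=> E; rewrite -E.
have [d d0 hd] := main _ ep0.
exists (Num.min d (100^-1)); first by rewrite lt_min d0 invr_gt0 ltr0n.
move=> B0 h hB0 cB; rewrite le_min => /andP[h1 h2] x hx.
have [n [s0 [a0 [b0' [k0 [hn hk0 eB]]]]]] := dec1_exists hB0.
have ht : dom (B0, k0, x, (s0, a0, b0'), h).
  by split=> //=; [exists n | rewrite (close1_ge0 cB)].
exact: hd _ ht h1.
Qed.

End Equivariant.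

Section MoreExp.
Variable R : realType.

Lemma common_delta (J : finType) (P : J -> R -> Prop) :
  (forall j d d', 0 < d' -> d' <= d -> P j d -> P j d') ->
  (forall j, exists2 d, 0 < d & P j d) -> exists2 d, 0 < d & forall j, P j d.
Proof.
move=> hP h; have /choice[d hd] : forall j, exists d, 0 < d /\ P j d.
  by move=> j; have [d d0 hd] := h j; exists d.
have S0 : 0 <= \sum_j (d j)^-1.
  by apply: sumr_ge0 => j _; rewrite invr_ge0 ltW//; case: (hd j).
exists (\sum_j (d j)^-1 + 1)^-1; first by rewrite invr_gt0 ltr_wpDl.
move=> j; have [d0 hj] := hd j; apply: hP hj; first by rewrite invr_gt0 ltr_wpDl.
rewrite -[leRHS]invrK lef_pV2 ?posrE ?invr_gt0// ?ltr_wpDl//.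
rewrite (bigD1 j)//= -addrA lerDl addr_ge0//.
by apply: sumr_ge0 => j' _; rewrite invr_ge0 ltW//; case: (hd j').
Qed.

Lemma mexp_first_order (X : 'M[R]_3) (e : R) : 0 < e -> exists2 d : R, 0 < d &
  forall t, `|t| <= d -> forall a b, `|mexp (t *: X) a b - (a == b)%:R - t * X a b| <= e * `|t|.
Proof.
move=> e0.
have [||d d0 hd] := @common_delta ('I_3 * 'I_3)%type (fun j d => forall t, `|t| <= d ->
   `|mexp (t *: X) j.1 j.2 - (j.1 == j.2)%:R - t * X j.1 j.2| <= e * `|t|).
- by move=> j d d' _ dd h t td; apply: h; exact: le_trans td dd.
- move=> [a b] /=; have [d d0 hd] := is_derive_eps (is_derive_mexp X a b 0) e0.
  exists d => // t td; have := hd t td; rewrite scale0r mexp0 !mxE.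
  congr (`|_ - _ - t * _| <= _).
  rewrite (bigD1 b)//= mxE eqxx mulr1 big1 ?addr0// => c /negPf cb.
  by rewrite mxE cb mulr0.
- by exists d => // t td a b; exact: hd (a, b) t td.
Qed.

Lemma conj_bound (x M : 'M[R]_3) (h : R) : SO3 x -> (forall a b, `|M a b| <= h) ->
  forall a b, `|(x *m M *m x^T) a b| <= 9 * h.
Proof.
move=> hx hM a b; have h0 : 0 <= h := le_trans (normr_ge0 _) (hM i0 i0).
have H c : `|(x *m M) a c| <= 3 * h.
  rewrite mxE sum3; apply: le_trans (ler_normD _ _) _.
  have T d : `|x a d * M d c| <= h.
    by rewrite normrM -[leRHS]mul1r ler_pM// SO3_le1.
  apply: le_trans (lerD (ler_normD _ _) (lexx _)) _.
  by have := T i0; have := T i1; have := T i2; lra.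
rewrite mxE sum3; apply: le_trans (ler_normD _ _) _.
have T d : `|(x *m M) a d * x^T d b| <= 3 * h.
  by rewrite normrM -[leRHS]mulr1 ler_pM// mxE SO3_le1.
apply: le_trans (lerD (ler_normD _ _) (lexx _)) _.
by have := T i0; have := T i1; have := T i2; lra.
Qed.

Lemma SL3_M (x y : 'M[R]_3) : SL3 x -> SL3 y -> SL3 (x *m y).
Proof. by rewrite /SL3 /= det_mulmx => -> ->; rewrite mulr1. Qed.

Lemma SL3_mexp (X : 'M[R]_3) t : \tr X = 0 -> SL3 (mexp (t *: X)).
Proof. by move=> h; rewrite /SL3 /= det_mexp3. Qed.

End MoreExp.

(** * A class of equivariant functions stable under derivation *)

Section Derivative.
Variables (R : realType) (k : nat) (sigma : discrete_series R k) (nu : R[i]).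

Definition isderK (f : 'M[R]_3 -> sigma) (X : 'M[R]_3) (F : 'M[R]_3 -> sigma) :=
  forall e : R, 0 < e -> exists2 d : R, 0 < d & forall t, `|t| <= d -> forall x, SO3 x ->
    nr (f (x *m mexp (t *: X)) - f x - t%:C *: F x) <= e * `|t|.

Section Family.
Variables (N : nat) (ph : 'I_N -> 'M[R]_3 -> R[i]) (D : 'I_N -> 'M[R[i]]_3 -> 'M[R]_3 -> R[i]) (e : 'I_N -> int).
Hypothesis he : forall j, chi_index k (e j).
Hypothesis hexp : forall j, isExp (ph j) (D j).
Variable f : 'M[R]_3 -> sigma.
Hypothesis hf : eqv1 nu f.
Hypothesis fK : forall x, SO3 x -> f x = \sum_j ph j x *: ds_chi sigma (e j).

(** x exp (tX) = B x with B = x exp (tX) x^-1, and B - 1 - t x X x^-1 is o(t) uniformly in x,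
    conjugation by K being bounded. *)
Lemma isderK_Lder X : \tr X = 0 ->
  isderK f X (fun x => Lder sigma nu ph D e (cmx (x *m X *m x^T)) x).
Proof.
move=> trX ep ep0; have [c c0 hc] := mx_bound X.
have [KL KL0 hKL] := @Lder_bound _ _ sigma nu _ ph D e hexp.
(* 9 c bounds the entries of x X x^T and the remainder adds at most 9 |t|, so B is within W |t| of
   the identity. *)
pose W := 9 * c + 9; have W0 : 0 < W by rewrite ltr_wpDl// mulr_ge0.
have e10 : 0 < ep / (2 * W) by rewrite divr_gt0// mulr_gt0.
have [d1 d10 h1] := @first_order_at_K _ _ sigma nu _ ph D e he hexp f hf fK _ e10.
(* 162 = 2 * 9 * 9: one 9 comes from [conj_bound], one from [mxsz_le], and the remainder is to use
   up half of [ep]. *)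
pose V := 162 * KL + 1; have V0 : 0 < V by rewrite ltr_wpDl// mulr_ge0 ?ler0n.
pose e2 := Num.min 1 (ep / V).
have e20 : 0 < e2 by rewrite lt_min ltr01 divr_gt0.
have [d2 d20 h2] := mexp_first_order X e20.
exists (Num.min d2 (d1 / W)); first by rewrite lt_min d20 divr_gt0.
move=> t; rewrite le_min => /andP[t2 t1] x hx.
set B := x *m mexp (t *: X) *m x^T; set Y := x *m X *m x^T.
have fB : f (x *m mexp (t *: X)) = f (B *m x) by rewrite /B -!mulmxA SO3_Tm// mulmx1.
have dB : SL3 B by apply: SL3_M; [apply: SL3_M; [exact: SO3_SL3 | exact: SL3_mexp] | apply: SO3_SL3; exact: SO3_T].
have eB : B - 1%:M - t *: Y = x *m (mexp (t *: X) - 1%:M - t *: X) *m x^T.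
  by rewrite !mulmxBr !mulmxBl mulmx1 -scalemxAr -scalemxAl; have [-> _] := hx.
have bB a b : `|(B - 1%:M - t *: Y) a b| <= 9 * (e2 * `|t|).
  by rewrite eB; apply: conj_bound => // a' b'; have := h2 t t2 a' b'; rewrite !mxE.
have e21 : e2 <= 1 by rewrite /e2 ge_min lexx.
have e2V : e2 * V <= ep by rewrite -ler_pdivlMr// /e2 ge_min lexx orbT.
have cB : close1 B (W * `|t|).
  move=> a b.
  have -> : B a b - (a == b)%:R = (B - 1%:M - t *: Y) a b + t * Y a b by rewrite !mxE; ring.
  apply: le_trans (ler_normD _ _) _; rewrite normrM.
  have hY : `|Y a b| <= 9 * c by exact: conj_bound.
  have : `|t| * `|Y a b| <= `|t| * (9 * c) by rewrite ler_wpM2l.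
  have : e2 * `|t| <= 1 * `|t| by rewrite ler_wpM2r.
  by have := bB a b; rewrite /W; lra.
have Wt : W * `|t| <= d1 by rewrite mulrC -ler_pdivlMr.
have r1 := h1 B _ dB cB Wt x hx.
have r2 : nr (Lder sigma nu ph D e (cmx (B - 1%:M - t *: Y)) x) <= KL * (9 * (9 * (e2 * `|t|))).
  apply: le_trans (hKL _ _ hx) _; rewrite ler_wpM2l//; apply: mxsz_le => a b.
  by rewrite mxE nr_real.
rewrite fB.
have cB1 : cmx B - 1%:M = t%:C *: cmx Y + cmx (B - 1%:M - t *: Y).
  apply/matrixP => a b; rewrite !mxE -(rmorph_nat (real_complex R)) -rmorphM -rmorphB -rmorphD /=.
  by congr (_%:C); ring.
rewrite cB1 Lder_lin// in r1.
move: (Lder _ _ _ _ _ (cmx (B - _ - _)) x) r1 r2 => L2; move: (Lder _ _ _ _ _ _ x) => L1 r1 r2.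
have -> : f (B *m x) - f x - t%:C *: L1 = (f (B *m x) - f x - (t%:C *: L1 + L2)) + L2.
  by rewrite opprD !addrA subrK.
apply: le_trans (nrD _ _) _; apply: le_trans (lerD r1 r2) _.
have -> : ep / (2 * W) * (W * `|t|) = ep / 2 * `|t| by field; rewrite gt_eqF.
have : (e2 * V) * `|t| <= ep * `|t| by rewrite ler_wpM2r.
have : 0 <= e2 * `|t| by rewrite mulr_ge0// ltW.
rewrite /V; lra.
Qed.

Lemma cont_at_K (ep : R) : 0 < ep -> exists2 d : R, 0 < d & forall B h, SL3 B -> close1 B h -> h <= d ->
  forall x, SO3 x -> nr (f (B *m x) - f x) <= ep.
Proof.
move=> ep0.
have [KL KL0 hKL] := @Lder_bound _ _ sigma nu _ ph D e hexp.
have [d1 d10 h1] := @first_order_at_K _ _ sigma nu _ ph D e he hexp f hf fK _ ltr01.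
pose V := 9 * KL + 1; have V0 : 0 < V by rewrite ltr_wpDl// mulr_ge0.
exists (Num.min d1 (ep / V)); first by rewrite lt_min d10 divr_gt0.
move=> B h hB cB; rewrite le_min => /andP[hd1 hd2] x hx.
have r1 := h1 B h hB cB hd1 x hx.
have r2 : nr (Lder sigma nu ph D e (cmx B - 1%:M) x) <= KL * (9 * h).
  by apply: le_trans (hKL _ _ hx) _; rewrite ler_wpM2l//; exact: mxsz_close.
rewrite ler_pdivlMr// in hd2; apply: le_trans _ hd2.
move: (Lder _ _ _ _ _ _ x) r1 r2 => L r1 r2.
rewrite -[f (B *m x) - f x](subrK L); apply: le_trans (nrD _ _) _.
by apply: le_trans (lerD r1 r2) _; rewrite /V; lra.
Qed.

End Family.

Inductive regV : ('M[R]_3 -> sigma) -> Prop :=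
| regV0 : regV (fun=> 0)
| regV_term ph p : reg ph -> chi_index k p -> regV (fun x => ph x *: ds_chi sigma p)
| regVD f g : regV f -> regV g -> regV (fun x => f x + g x)
| regV_ext f g : (forall x, SO3 x -> f x = g x) -> regV f -> regV g.

Lemma regV_family f : regV f -> exists (N : nat) (ph : 'I_N -> 'M[R]_3 -> R[i]) (e : 'I_N -> int),
  [/\ forall j, reg (ph j), forall j, chi_index k (e j) &
      forall x, SO3 x -> f x = \sum_j ph j x *: ds_chi sigma (e j)].
Proof.
elim=> [|ph p hph hp|g1 g2 _ [N1 [p1 [e1 [r1 c1 h1]]]] _ [N2 [p2 [e2 [r2 c2 h2]]]]|g1 g2 E _ [N [ph [e [r c h]]]]].
- exists 0%N, (fun=> fun=> 0), (fun=> 0); split; try by case.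
  by move=> x _; rewrite big_ord0.
- exists 1%N, (fun=> ph), (fun=> p); split=> // x _.
  by rewrite big_ord1.
- exists (N1 + N2)%N, (fun j => match fintype.split j with inl a => p1 a | inr b => p2 b end),
    (fun j => match fintype.split j with inl a => e1 a | inr b => e2 b end); split.
  + by move=> j; case: fintype.split.
  + by move=> j; case: fintype.split.
  + move=> x hx; rewrite h1// h2// big_split_ord /=; congr (_ + _); apply: eq_bigr => j _.
      by rewrite (unsplitK (inl j)).
    by rewrite (unsplitK (inr j)).
- by exists N, ph, e; split=> // x hx; rewrite -E// h.
Qed.

Lemma regV_sum (I : Type) (r : seq I) (f : I -> 'M[R]_3 -> sigma) :
  (forall j, regV (f j)) -> regV (fun x => \sum_(j <- r) f j x).
Proof.
move=> h; elim: r => [|j r IH].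
  by apply: regV_ext regV0 => x _; rewrite big_nil.
by apply: regV_ext (regVD (h j) IH) => x _; rewrite big_cons.
Qed.

(** The case n = 0 covers the shifts of p that leave the index set, where nothing is known about
    [ds_chi]. *)
Lemma regV_coef ph (n : int) q : reg ph -> n = 0 \/ chi_index k q ->
  regV (fun x => ph x *: (n%:~R *: ds_chi sigma q)).
Proof.
move=> hph [->|hq]; first by apply: regV_ext regV0 => x _; rewrite scale0r scaler0.
apply: regV_ext (regV_term (regM hph (reg_cst n%:~R)) hq) => x _.
by rewrite scalerA.
Qed.

Lemma regV_chi2 ph c d p : reg ph -> chi_index k p ->
  regV (fun x => ph x *: (c *: ((k%:Z + p)%:~R *: ds_chi sigma (p + 2) + d *: ((k%:Z - p)%:~R *: ds_chi sigma (p - 2))))).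
Proof.
move=> hph hp; have [h1 h2] := chi_indexP hp.
have r1 := regV_coef (regM hph (reg_cst c)) h1.
have r2 := regV_coef (regM hph (reg_cst (c * d))) h2.
apply: regV_ext (regVD r1 r2) => x _.
by rewrite -!scalerA !scalerDr.
Qed.

Lemma regV_chiH ph p : reg ph -> chi_index k p -> regV (fun x => ph x *: chiH sigma p).
Proof.
by move=> hph hp; apply: regV_ext (regV_chi2 2^-1 1 hph hp) => x _; rewrite scale1r.
Qed.

Lemma regV_chiE ph p : reg ph -> chi_index k p -> regV (fun x => ph x *: chiE sigma p).
Proof.
by move=> hph hp; apply: regV_ext (regV_chi2 (2 * 'i%C)^-1 (-1) hph hp) => x _; rewrite scaleN1r.
Qed.

Lemma reg_conj (X : 'M[R]_3) a b : reg (fun x => cmx (x *m X *m x^T) a b).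
Proof.
have h : reg (fun x : 'M[R]_3 => \sum_d (\sum_c (x a c)%:C * (X c d)%:C) * (x b d)%:C).
  apply: reg_sum => d; apply: regM; last exact: reg_entry.
  by apply: reg_sum => c; apply: regM; [exact: reg_entry | exact: reg_cst].
apply: reg_ext h => x _; rewrite !mxE rmorph_sum; apply: eq_bigr => d _.
rewrite rmorphM !mxE rmorph_sum; congr (_ * _); apply: eq_bigr => c _.
by rewrite rmorphM.
Qed.

(** The antisymmetric matrices have the basis S1, S2, S3; by linearity the derivative is a
    combination of three fixed derivatives, with coefficients that are entries of x X x^T. *)
Lemma reg_D_conj ph D (X : 'M[R]_3) : isExp ph D -> (forall Y, reg (D Y)) ->
  reg (fun x => D (SpartC (cmx (x *m X *m x^T))) x).
Proof.
move=> [_ _ hlin _] hD.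
pose S1 : 'M[R[i]]_3 := delta_mx i1 i0 - delta_mx i0 i1.
pose S2 : 'M[R[i]]_3 := delta_mx i2 i0 - delta_mx i0 i2.
pose S3 : 'M[R[i]]_3 := delta_mx i2 i1 - delta_mx i1 i2.
have h : reg (fun x => cmx (x *m X *m x^T) i1 i0 * D S1 x + (cmx (x *m X *m x^T) i2 i0 * D S2 x
    + ((cmx (x *m X *m x^T) i2 i1 + (-1) * cmx (x *m X *m x^T) i1 i2) * 2^-1 * D S3 x + 0))).
  have rc a b := reg_conj X a b.
  apply: regD; first exact: regM.
  apply: regD; first exact: regM.
  apply: regD; last exact: reg_cst.
  apply: regM => //; apply: regM; last exact: reg_cst.
  by apply: regD => //; apply: regM => //; exact: reg_cst.
apply: reg_ext h => x hx; move: (cmx _) => Y.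
have D0 : D 0 x = 0.
  have := hlin x (-1) 0 0 hx; rewrite scaler0 addr0 mulN1r addNr => ->.
  by [].
by rewrite -D0 -!hlin//; congr (D _ x); apply: mx3P; rewrite !mxE /= ?mulr1n ?mulr0n; field.
Qed.

Lemma regV_Lder (N : nat) (ph : 'I_N -> 'M[R]_3 -> R[i]) (D : 'I_N -> 'M[R[i]]_3 -> 'M[R]_3 -> R[i]) (e : 'I_N -> int) X :
  (forall j, chi_index k (e j)) -> (forall j, isExp (ph j) (D j)) ->
  (forall j, reg (ph j)) -> (forall j Y, reg (D j Y)) ->
  regV (fun x => Lder sigma nu ph D e (cmx (x *m X *m x^T)) x).
Proof.
move=> he hexp hph hD; apply: regV_sum => j.
have rc a b := reg_conj X a b.
apply: regVD.
  apply: regV_term => //; apply: regD; last exact: reg_D_conj.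
  by apply: regM => //; apply: regM; [exact: reg_cst | apply: regM => //; exact: reg_cst].
have r1 : reg (fun x => ph j x * ((cmx (x *m X *m x^T) i1 i1 + (-1) * cmx (x *m X *m x^T) i2 i2) * 2^-1)).
  apply: regM => //; apply: regM; last exact: reg_cst.
  by apply: regD => //; apply: regM => //; exact: reg_cst.
have r2 : reg (fun x => ph j x * ((cmx (x *m X *m x^T) i1 i2 + cmx (x *m X *m x^T) i2 i1) * 2^-1)).
  by apply: regM => //; apply: regM; [exact: regD | exact: reg_cst].
apply: regV_ext (regVD (regV_chiH r1 (he j)) (regV_chiE r2 (he j))) => x hx.
by rewrite -!scalerA -scalerDr mulN1r.
Qed.

Lemma scale_actB c (h : 'M[R]_2) (u v : sigma) : SLpm h ->
  c *: ds_act sigma h u - c *: ds_act sigma h v = c *: ds_act sigma h (u - v).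
Proof. by move=> hh; rewrite ds_actB// scalerBr. Qed.

Lemma scale_act_diff c t (h : 'M[R]_2) (u v w : sigma) : SLpm h ->
  c *: ds_act sigma h u - c *: ds_act sigma h v - t *: (c *: ds_act sigma h w)
  = c *: ds_act sigma h (u - v - t *: w).
Proof. by move=> hh; rewrite ds_actB// ds_actB// ds_actZ// !scalerBr !scalerA mulrC. Qed.

Section InducedClass.
Variable i : parabolic.

(* [f \o io i] (see [io] below) transforms by [sigma h] under [m_i] when [f] transforms
   by [sigma (tw h)] under [m_1]. *)
Definition tw (h : 'M[R]_2) : 'M[R]_2 := if i is P1 then h else \det h *: h.

Lemma SLpm_tw h : SLpm h -> SLpm (tw h).
Proof. by rewrite /tw; case: i => //= -[] E; rewrite E ?scale1r; [left | right; rewrite detZ E; ring]. Qed.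

Lemma tw1 h : \det h = 1 -> tw h = h.
Proof. by rewrite /tw; case: i => // ->; rewrite scale1r. Qed.

Definition eqvf (f : 'M[R]_3 -> sigma) := forall n s h x, Nrad P1 n -> SLpm h -> SL3 x ->
  f (n *m mexp (s *: Hmx R P1) *m m_emb P1 h *m x) = cexp (s%:C * (nu + rho R)) *: ds_act sigma (tw h) (f x).

Lemma eqvf_eqv1 f : eqvf f -> eqv1 nu f.
Proof.
move=> hf n s h x hn dh hx; rewrite hf//; last by left.
by rewrite tw1.
Qed.

Lemma SL3_nam n s h : Nrad P1 n -> SLpm h -> SL3 (n *m mexp (s *: Hmx R P1) *m m_emb P1 h).
Proof.
move=> /Nrad1P[u [v ->]] hh; rewrite /SL3 /=.
have dh : \det h != 0 by case: hh => ->; rewrite ?oppr_eq0 oner_eq0.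
have E : expR (2 * s) = (expR (- s))^-1 ^+ 2 by rewrite -expRN opprK -expRM_natl.
have e0 : expR (- s) != 0 by rewrite gt_eqF ?expR_gt0.
rewrite NAM1E det3 !mxE /= E; have -> : \det h = h j0 j0 * h j1 j1 - h j0 j1 * h j1 j0 by rewrite det2.
have dh' : h j0 j0 * h j1 j1 - h j0 j1 * h j1 j0 != 0 by rewrite -det2.
by field; rewrite ?dh' ?e0 ?dh'.
Qed.

(* This class is stable under the derivations along the Lie algebra, which gives
   derivatives of all orders at once. *)
Definition ind1 f := eqvf f /\ regV f.

(** Left translations commute with derivation on the right. The derivative at n a m x therefore
    exists because it exists at x in K, and it obeys the same transformation rule as f. *)
Lemma ind1_deriv f X : ind1 f -> \tr X = 0 -> exists f', [/\ ind1 f',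
  forall g, SL3 g -> diffquot (fun t => f (g *m mexp (t *: X))) @ 0^' --> f' g & isderK f X f'].
Proof.
move=> [hf rf] trX; have [N [ph [e [hph he fK]]]] := regV_family rf.
have /choice[D hD] : forall j, exists D, isExp (ph j) D /\ forall Y, reg (D Y).
  by move=> j; have [D h1 h2] := reg_isExp (hph j); exists D.
have hexp j := (hD j).1; have hDr j := (hD j).2.
have H := isderK_Lder he hexp (eqvf_eqv1 hf) fK trX.
set F := fun x => _ in H.
(* The limit is taken at g itself and involves no choice of a decomposition of g; its convergence is
   shown afterwards. *)
pose f' g := lim (diffquot (fun t => f (g *m mexp (t *: X))) @ 0^').
have key n s h x w : Nrad P1 n -> SLpm h -> SL3 x ->
    diffquot (fun t => f (x *m mexp (t *: X))) @ 0^' --> w ->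
    diffquot (fun t => f (n *m mexp (s *: Hmx R P1) *m m_emb P1 h *m x *m mexp (t *: X))) @ 0^' -->
      cexp (s%:C * (nu + rho R)) *: ds_act sigma (tw h) w.
  move=> hn hh hx /diffquot_cvgP hw; have ht := SLpm_tw hh.
  apply/diffquot_cvgP => ep ep0; pose c := cexp (s%:C * (nu + rho R)).
  have c1 : 0 < nr c + 1 by rewrite ltr_wpDl// nr_ge0.
  have [|d d0 hd] := hw (ep / (nr c + 1)); first by rewrite divr_gt0.
  exists d => // t td; rewrite -!(mulmxA _ x) !hf//; try exact: SL3_M (SL3_mexp _ _).
  rewrite -/c; have hdt := hd t td.
  rewrite scale_act_diff// nrZ ds_isometry//.
  apply: (@le_trans _ _ (nr c * (ep / (nr c + 1) * `|t|))); first by rewrite ler_wpM2l ?nr_ge0.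
  by rewrite mulrA ler_wpM2r// mulrCA ger_pMr// ler_pdivrMr// mul1r lerDl.
have dK x : SO3 x -> diffquot (fun t => f (x *m mexp (t *: X))) @ 0^' --> F x.
  move=> hx; apply/diffquot_cvgP => ep ep0; have [d d0 hd] := H _ ep0.
  by exists d => // t td; rewrite scale0r mexp0 mulmx1; exact: hd.
have d3 g : SL3 g -> diffquot (fun t => f (g *m mexp (t *: X))) @ 0^' --> f' g.
  move=> /dec1_exists[n [s [a [b [x [hn hx ->]]]]]].
  have hm : SLpm (mpart a b) by left; rewrite det_mpart.
  have h1 := key n s (mpart a b) x _ hn hm (SO3_SL3 hx) (dK x hx).
  rewrite -[pdec1 _ _ _]/(_ *m _) (mulmxA n) in h1 *; rewrite /f'.
  by rewrite (cvg_lim _ h1).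
have f'K x : SO3 x -> f' x = F x by move=> hx; apply: cvg_lim => //; exact: dK.
exists f'; split=> //.
- split.
    by move=> n s h x hn hh hx; apply: cvg_lim => //; apply: key => //; exact: d3.
  apply: regV_ext (regV_Lder X he hexp hph hDr) => x hx.
  by rewrite f'K.
- move=> ep ep0; have [d d0 hd] := H _ ep0; exists d => // t td x hx.
  by rewrite f'K// hd.
Qed.

(** Write g = B x with x in K and g' = B B' x. Equivariance under B reduces the claim to
    [cont_at_K], since B' tends to 1 as g' tends to g. *)
Lemma ind1_cont f g (ep : R) : ind1 f -> SL3 g -> 0 < ep -> exists2 d : R, 0 < d &
  forall g', SL3 g' -> (forall a b, `|g' a b - g a b| <= d) -> nr (f g' - f g) <= ep.
Proof.
move=> [hf rf] hg ep0; have [N [ph [e [hph he fK]]]] := regV_family rf.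
have /choice[D hD] : forall j, exists D, isExp (ph j) D.
  by move=> j; have [D h1 _] := reg_isExp (hph j); exists D.
have [n [s [a [b [x [hn hx eg]]]]]] := dec1_exists hg.
have hm : SLpm (mpart a b) by left; rewrite det_mpart.
have ht := SLpm_tw hm.
pose B := n *m mexp (s *: Hmx R P1) *m m_emb P1 (mpart a b).
have dB : SL3 B by exact: SL3_nam.
have uB : B \in unitmx by rewrite unitmxE (dB : \det B = 1) unitr1.
have egB : g = B *m x by rewrite eg /pdec1 /B !mulmxA.
pose c := cexp (s%:C * (nu + rho R)); have c1 : 0 < nr c + 1 by rewrite ltr_wpDl// nr_ge0.
have [|d d0 hd] := @cont_at_K N ph D e he hD f (eqvf_eqv1 hf) fK (ep / (nr c + 1)); first by rewrite divr_gt0.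
have [w w0 hw] := mx_bound (invmx B).
have W0 : 0 < 9 * w + 1 by rewrite ltr_wpDl// mulr_ge0.
exists (d / (9 * w + 1)); first by rewrite divr_gt0.
move=> g' hg' cg; pose B' := invmx B *m g' *m x^T.
have dB' : SL3 B'.
  by rewrite /SL3 /= !det_mulmx det_inv (dB : \det B = 1) (hg' : \det g' = 1) (SO3_SL3 (SO3_T hx) : \det _ = 1) invr1 !mulr1.
have eg' : g' = B *m (B' *m x).
  by rewrite /B' -(mulmxA _ x^T) SO3_Tm// mulmx1 mulmxA mulmxV// mul1mx.
have cB' : close1 B' d.
  have E : B' - 1%:M = invmx B *m (g' - g) *m x^T.
    rewrite mulmxBr mulmxBl egB mulKmx//; have [-> _] := hx; by [].
  move=> a' b'; have -> : B' a' b' - (a' == b')%:R = (B' - 1%:M) a' b' by rewrite !mxE.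
  rewrite E mxE; apply: le_trans (ler_norm_sum _ _ _) _.
  have T c' : `|(invmx B *m (g' - g)) a' c'| <= 3 * (w * (d / (9 * w + 1))).
    rewrite mxE sum3.
    have U d' : `|invmx B a' d' * (g' - g) d' c'| <= w * (d / (9 * w + 1)).
      by rewrite normrM ler_pM//; have := cg d' c'; rewrite !mxE.
    apply: le_trans (ler_normD _ _) _; apply: le_trans (lerD (ler_normD _ _) (lexx _)) _.
    by have := U i0; have := U i1; have := U i2; lra.
  have U d' : `|(invmx B *m (g' - g)) a' d' * x^T d' b'| <= 3 * (w * (d / (9 * w + 1))).
    by rewrite normrM -[leRHS]mulr1 ler_pM// mxE SO3_le1.
  rewrite sum3; have S : 9 * w * (d / (9 * w + 1)) <= d.
    by rewrite mulrCA ger_pMr// ler_pdivrMr// mul1r lerDl.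
  by have := U i0; have := U i1; have := U i2; lra.
have := hd B' d dB' cB' (lexx _) x hx.
rewrite {1}eg' {1}egB /B !hf//; last first.
- exact: SL3_M (SO3_SL3 hx).
- exact: SO3_SL3.
rewrite -/c scale_actB// nrZ ds_isometry// => h.
apply: (@le_trans _ _ (nr c * (ep / (nr c + 1)))); first by rewrite ler_wpM2l ?nr_ge0.
by rewrite mulrCA ger_pMr// ler_pdivrMr// mul1r lerDl.
Qed.

End InducedClass.

End Derivative.

(** * O(2) and the extension of functions from K to the group *)

Section OrthogonalGroup2.
Variable R : realType.

Lemma cos_sin_exists (a b : R) : a ^+ 2 + b ^+ 2 = 1 -> exists t, a = cos t /\ b = sin t.
Proof.
move=> h; have a1 : -1 <= a <= 1.
  rewrite -ler_norml -(@expr_le1 _ 2)// real_normK ?num_real// -h lerDl; exact: sqr_ge0.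
have s2 : sin (acos a) ^+ 2 = b ^+ 2.
  rewrite sin_acos// sqr_sqrtr; last by rewrite -h addrC addKr sqr_ge0.
  by rewrite -h addrC addKr.
have c1 : cos (acos a) = a by apply: acosK; rewrite in_itv.
move/eqP: s2; rewrite eqf_sqr => /orP[]/eqP e; first by exists (acos a).
exists (- acos a).
by rewrite cosN sinN c1 e opprK.
Qed.

Lemma O2_cases (o : 'M[R]_2) : O2 o -> exists t, o = kappa t \/ o = refl2 R *m kappa t.
Proof.
rewrite /O2 /= => /matrixP h; move: (h j0 j0) (h j0 j1) (h j1 j1).
rewrite !mxE !sum2 !mxE /= => h1 h2 h3.
have [t [e1 e2]] : exists t, o j0 j0 = cos t /\ o j0 j1 = sin t by apply: cos_sin_exists; rewrite !expr2.
rewrite e1 e2 in h1 h2.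
pose w := cos t * o j1 j1 - sin t * o j1 j0.
have w1 : o j1 j0 = - sin t * w.
  transitivity (- sin t * w + cos t * (cos t * o j1 j0 + sin t * o j1 j1)); last by rewrite h2; ring.
  transitivity ((cos t * cos t + sin t * sin t) * o j1 j0); first by rewrite h1 mul1r.
  by rewrite /w; ring.
have w2 : o j1 j1 = cos t * w.
  transitivity (cos t * w + sin t * (cos t * o j1 j0 + sin t * o j1 j1)); last by rewrite h2; ring.
  transitivity ((cos t * cos t + sin t * sin t) * o j1 j1); first by rewrite h1 mul1r.
  by rewrite /w; ring.
have ww : w ^+ 2 = 1.
  transitivity ((cos t * cos t + sin t * sin t) * w ^+ 2); first by rewrite h1 mul1r.
  rewrite -[RHS]h3 w1 w2; ring.
exists t; have /eqP := ww; rewrite sqrf_eq1 => /orP[]/eqP w0; [left|right];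
  by apply: mx2P; rewrite ?mxE ?sum2 ?mxE /= ?e1 ?e2 ?w1 ?w2 ?w0; ring.
Qed.

Lemma SLpm_M (g h : 'M[R]_2) : SLpm g -> SLpm h -> SLpm (g *m h).
Proof.
by rewrite /SLpm /= det_mulmx => -[]-> []->; rewrite ?mulr1 ?mul1r ?mulrNN ?mulr1; [left|right|right|left].
Qed.

Lemma SLpm_kappa (t : R) : SLpm (kappa t).
Proof. by left; rewrite det2 !mxE /= -(cos2Dsin2 t); ring. Qed.

Lemma SLpm_refl2 : SLpm (refl2 R).
Proof. by right; rewrite det2 !mxE /=; ring. Qed.

Lemma O2_SLpm (o : 'M[R]_2) : O2 o -> SLpm o.
Proof.
by move=> /O2_cases[t []] ->; [exact: SLpm_kappa | exact: SLpm_M SLpm_refl2 (SLpm_kappa _)].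
Qed.

Lemma m_emb1M (g h : 'M[R]_2) : m_emb P1 (g *m h) = m_emb P1 g *m m_emb P1 h.
Proof.
rewrite !m_emb1E det_mulmx invfM; apply: mx3P; rewrite !mxE ?sum3 ?sum2 !mxE /=; ring.
Qed.

Lemma SLpm_neq0 (h : 'M[R]_2) : SLpm h -> \det h != 0.
Proof. by case=> ->; rewrite ?oppr_eq0 oner_eq0. Qed.

Lemma nam_mul (n n' : 'M[R]_3) s s' (h h' : 'M[R]_2) : Nrad P1 n -> Nrad P1 n' -> SLpm h -> SLpm h' ->
  exists2 n'', Nrad P1 n'' & (n *m mexp (s *: Hmx R P1) *m m_emb P1 h) *m (n' *m mexp (s' *: Hmx R P1) *m m_emb P1 h')
    = n'' *m mexp ((s + s') *: Hmx R P1) *m m_emb P1 (h *m h').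
Proof.
(* Conjugation by a m multiplies the row (u', v') by exp (3 s) / (det h)^2 times the adjugate of h:
   whence [c], [w1] and [w2]. *)
move=> /Nrad1P[u [v ->]] /Nrad1P[u' [v' ->]] hh hh'; have dh := SLpm_neq0 hh; have dh' := SLpm_neq0 hh'.
pose c := expR (2 * s) * expR s / (\det h) ^+ 2.
pose w1 := c * (u' * h j1 j1 - v' * h j1 j0); pose w2 := c * (v' * h j0 j0 - u' * h j0 j1).
exists (mx_of_rows 3 3 [:: [:: 1; u + w1; v + w2]; [:: 0; 1; 0]; [:: 0; 0; 1]]).
  by apply/Nrad1P; exists (u + w1), (v + w2).
rewrite !NAM1E det_mulmx.
have E2 : expR (2 * (s + s')) = expR (2 * s) * expR (2 * s') by rewrite mulrDr expRD.
have E1 : expR (- (s + s')) = expR (- s) * expR (- s') by rewrite opprD expRD.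
have E0 : expR s = (expR (- s))^-1 by rewrite -expRN opprK.
have e0 : expR (- s) != 0 by rewrite gt_eqF ?expR_gt0.
have dhE : h j0 j0 * h j1 j1 - h j0 j1 * h j1 j0 != 0 by rewrite -det2.
rewrite /w1 /w2 /c E2 E1 E0 {w1 w2 c}.
move: (expR (2 * s)) (expR (2 * s')) (expR (- s)) (expR (- s')) e0 => a b c d e0.
move: dh' dh; rewrite (det2 h) => dh' dh.
apply: mx3P; rewrite !mxE ?sum3 ?sum2 !mxE /=; field; rewrite ?dh ?dh' ?e0 ?dhE//.
Qed.

End OrthogonalGroup2.

Section Extension.
Variables (R : realType) (k : nat) (sigma : discrete_series R k) (nu : R[i]) (i : parabolic).

Lemma twM (g h : 'M[R]_2) : tw i (g *m h) = tw i g *m tw i h.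
Proof.
rewrite /tw; case: i => //.
by rewrite det_mulmx -scalemxAl -scalemxAr scalerA.
Qed.

(** The factors in A, M and K are determined up to O(2) by [dec1_unique], and the hypothesis on t
    says exactly that the value prescribed at g does not depend on this freedom. *)
Lemma extend_K (t : 'M[R]_3 -> sigma) : regV t ->
  (forall o x, O2 o -> SO3 x -> t (m_emb P1 o *m x) = ds_act sigma (tw i o) (t x)) ->
  exists2 f, ind1 nu i f & forall x, SO3 x -> f x = t x.
Proof.
move=> ht hO.
pose S g w := exists n s h x, [/\ Nrad P1 n, SLpm h, SO3 x, g = n *m mexp (s *: Hmx R P1) *m m_emb P1 h *m x &
   w = cexp (s%:C * (nu + rho R)) *: ds_act sigma (tw i h) (t x)].
have Suniq g w w' : S g w -> S g w' -> w = w'.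
  move=> [n [s [h [x [hn hh hx eg ->]]]]] [n' [s' [h' [x' [hn' hh' hx' eg' ->]]]]].
  have E := etrans (esym eg) eg'.
  have [es [q [ho ex eh]]] := dec1_unique hn hn' hx hx' hh hh' E.
  have so := O2_SLpm ho.
  by rewrite es eh ex hO// twM ds_actM//; exact: SLpm_tw.
pose f g := xget 0 [set w | S g w].
have fE g w : S g w -> f g = w.
  move=> hw; apply: (Suniq g) => //.
  by have := @xgetPex _ 0 [set w | S g w] (ex_intro _ w hw).
have fS g : SL3 g -> S g (f g).
  move=> /dec1_exists[n [s [a [b [x [hn hx ->]]]]]].
  have hS : S (n *m pdec1 s a b *m x) (cexp (s%:C * (nu + rho R)) *: ds_act sigma (tw i (mpart a b)) (t x)).
    exists n, s, (mpart a b), x; split=> //; first by left; rewrite det_mpart.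
    by rewrite /pdec1 !mulmxA.
  by rewrite (fE _ _ hS).
have fK x : SO3 x -> f x = t x.
  move=> hx; apply: fE; exists 1%:M, 0, 1%:M, x; split=> //.
  - by apply/Nrad1P; exists 0, 0; apply: mx3P; rewrite !mxE.
  - by left; rewrite det1.
  - rewrite scale0r mexp0 mul1mx mul1mx.
    have -> : m_emb P1 1%:M = 1%:M :> 'M[R]_3 by rewrite m_emb1E det1 invr1; apply: mx3P; rewrite !mxE.
    by rewrite mul1mx.
  - have -> : tw i 1%:M = 1%:M :> 'M[R]_2 by rewrite tw1 ?det1.
    by rewrite ds_act1 mul0r cexp0 scale1r.
exists f => //; split; last by apply: regV_ext ht => x hx; rewrite fK.
move=> n s h g hn hh hg; have [n' [s' [h' [x [hn' hh' hx eg efg]]]]] := fS g hg.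
rewrite efg; apply: fE.
have [n'' hn'' e] := nam_mul s s' hn hn' hh hh'.
exists n'', (s + s'), (h *m h'), x; split=> //; first exact: SLpm_M.
  by rewrite -e {1}eg !mulmxA.
rewrite twM ds_actM ?ds_actZ ?scalerA ?rmorphD ?mulrDl ?cexpD//; exact: SLpm_tw.
Qed.

End Extension.

Lemma chi_lp (k l p : nat) : (exists a, l = (k + p + 2 * a)%N) ->
  chi_index k (l%:Z - p%:Z) /\ chi_index k (p%:Z - l%:Z).
Proof. by move=> [a ->]; split; exists a; [left|right]; lia. Qed.

Lemma ltn_p (k l p : nat) : (exists a, l = (k + p + 2 * a)%N) -> (p < (2 * l).+1)%N.
Proof. by move=> [a ->]; lia. Qed.

Lemma ltn_2lp l p : (2 * l - p < (2 * l).+1)%N.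
Proof. by lia. Qed.

(** * Elementary functions on K *)

Section Elementary.
Variables (R : realType) (k : nat) (sigma : discrete_series R k).

Lemma cexp_sum (z : R[i]) n : cexp (n%:R * z) = cexp z ^+ n.
Proof.
elim: n => [|n IH]; first by rewrite mul0r cexp0.
by rewrite -addn1 natrD mulrDl mul1r cexpD IH addn1 exprSr.
Qed.

(** Lifts of the rotations in m_1 (SO(2)): under [phi] the angle is doubled and changes sign. *)
Definition diagU (a : R) := qmx (cos a) (sin a) 0 0.

Lemma phi_diagU a : phi (diagU a) = m_emb P1 (kappa (- (a + a))).
Proof.
rewrite phi_qmx m_emb1E; have -> : \det (kappa (- (a + a))) = 1.
  by rewrite det2 !mxE /= -(cos2Dsin2 (- (a + a))); ring.
have e := cos2Dsin2 a.
apply: mx3P; rewrite !mxE /= ?cosN ?sinN ?cosD ?sinD ?invr1; try ring.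
by rewrite -e; ring.
Qed.

Lemma SU2_diagU a : SU2 (diagU a).
Proof. by apply/SU2P; exists (cos a), (sin a), 0, 0; split=> //; rewrite -(cos2Dsin2 a); ring. Qed.

Lemma cexp_i (a : R) : cexp ('i%C * a%:C) = Complex (cos a) (sin a).
Proof.
rewrite /cexp /=; have -> : 0 * a - 1 * 0 = 0 by ring.
have -> : 0 * 0 + 1 * a = a by ring.
by rewrite expR0 mul1r.
Qed.

Lemma lprod_diag (a d : R[i]) n m : lprod a 0 0 d n m = (a ^+ n * d ^+ m) *: 'X^n.
Proof. by rewrite /lprod polyC0 addr0 scale0r add0r exprZn -polyC_exp mulrC mul_polyC scalerA mulrC. Qed.

Lemma lprod_adiag (b c : R[i]) n m : lprod 0 b c 0 n m = (b ^+ n * c ^+ m) *: 'X^m.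
Proof. by rewrite /lprod polyC0 addr0 scale0r add0r exprZn -polyC_exp mul_polyC scalerA. Qed.

Lemma Complex00 : Complex 0 0 = 0 :> R[i]. Proof. by []. Qed.

(** For a diagonal lift [lprod] is a monomial, so m_1 (kappa) acts on v_r with weight r - l. This is
    the weight of chi_(r - l), and the reason for the pairing of indices in t_i. *)
Lemma Mc_kappa l (r : 'I_(2 * l).+1) q th (x : 'M[R]_3) : SO3 x ->
  Mc l r q (m_emb P1 (kappa th) *m x) = cexp ('i%C * (r%:Z - l%:Z)%:~R * th%:C) * Mc l r q x.
Proof.
move=> hx; pose a := - (th / 2).
have ea : - (a + a) = th by rewrite /a; field.
have hU := SU2_diagU a.
have -> : m_emb P1 (kappa th) = phi (diagU a) by rewrite phi_diagU ea.
have hE (e : 'I_(2 * l).+1) : Mc l r e (phi (diagU a)) =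
    (cexp (- ('i%C * a%:C)) ^+ e * cexp ('i%C * a%:C) ^+ (2 * l - e)) * (r == e)%:R.
  have he : (e <= 2 * l)%N by rewrite -ltnS.
  rewrite Mc_coef//; have [|-> -> -> ->] := @invmx_qmxE R (cos a) (sin a) 0 0.
    by rewrite -(cos2Dsin2 a); ring.
  rewrite !oppr0 !Complex00 lprod_diag coefZ coefXn -cexp_i -sinN -cosN -cexp_i.
  by rewrite rmorphN mulrN.
rewrite McM//; last exact: phi_SO3.
rewrite (bigD1 r)//= big1 ?addr0; last first.
  by move=> e er; rewrite hE eq_sym (negPf er) mulr0 mul0r.
rewrite hE eqxx mulr1 -!cexp_sum -cexpD; congr (cexp _ * _).
have hr : (r <= 2 * l)%N by rewrite -ltnS.
rewrite natrB// natrM rmorphB /= /a rmorphN rmorphM fmorphV rmorph_nat /=.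
by rewrite -!pmulrn; field.
Qed.

Lemma phi_refl : phi (qmx 0 0 1 0) = m_emb P1 (refl2 R).
Proof.
rewrite phi_qmx m_emb1E; have -> : \det (refl2 R) = -1 by rewrite det2 !mxE /=; ring.
by apply: mx3P; rewrite !mxE /= ?invrN1; ring.
Qed.

Lemma SU2_refl : SU2 (qmx 0 0 1 0 : 'M[R[i]]_2).
Proof. by apply/SU2P; exists 0, 0, 1, 0; split=> //; ring. Qed.

(** The lift is antidiagonal: it exchanges x and y up to sign, hence the indices r and 2 l - r. *)
Lemma Mc_refl l (r : 'I_(2 * l).+1) q (x : 'M[R]_3) : SO3 x ->
  Mc l r q (m_emb P1 (refl2 R) *m x) = (-1) ^+ r * Mc l (2 * l - r) q x.
Proof.
move=> hx; have hU := SU2_refl; rewrite -phi_refl.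
have hr : (r <= 2 * l)%N by rewrite -ltnS.
have hE (e : 'I_(2 * l).+1) : Mc l r e (phi (qmx 0 0 1 (0 : R))) = (-1) ^+ e * (r == 2 * l - e :> nat)%N%:R.
  have he : (e <= 2 * l)%N by rewrite -ltnS.
  rewrite Mc_coef//; have [|-> -> -> ->] := @invmx_qmxE R 0 0 1 0; first by ring.
  rewrite !oppr0 !Complex00 lprod_adiag coefZ coefXn expr1n mulr1; congr (_ ^+ _ * _).
  by apply/eqP; rewrite eq_complex /= oppr0 !eqxx.
rewrite McM//; last exact: phi_SO3.
rewrite (bigD1 (rev_ord r))//= big1 ?addr0; last first.
  move=> e er; rewrite hE; have he : (e <= 2 * l)%N by rewrite -ltnS.
  case: eqP => [h|]; last by rewrite mulr0 mul0r.
  by case/eqP: er; apply: val_inj; rewrite /= subSS h subKn.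
have hEr := hE (rev_ord r); rewrite /= in hEr; rewrite hEr subSS subKn// eqxx mulr1; congr (_ * _).
by rewrite -signr_odd oddB// oddM /= signr_odd.
Qed.

(** The elementary functions of both parabolics seen from P_1: the dual basis is the first one in
    either case, and composition with [io] gives back t_i, see [tsh_tK]. *)
Definition tsh (i : parabolic) (l p q : nat) (x : 'M[R]_3) : sigma :=
  Mc l (2 * l - p) q x *: ds_chi sigma (l%:Z - p%:Z)
  + (csign R i l p * Mc l p q x) *: ds_chi sigma (p%:Z - l%:Z).

Section Equivariance.
Variables (i : parabolic) (l p q : nat).
Hypothesis hp : exists a, l = (k + p + 2 * a)%N.
Hypothesis hq : (q <= 2 * l)%N.

Lemma regV_tsh : regV (tsh i l p q).
Proof.
have [c1 c2] := chi_lp hp; have hq' : (q < (2 * l).+1)%N by [].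
apply: regVD; apply: regV_term => //.
  exact: (reg_Mc R (Ordinal (ltn_2lp l p)) (Ordinal hq')).
by apply: regM; [exact: reg_cst | exact: (reg_Mc R (Ordinal (ltn_p hp)) (Ordinal hq'))].
Qed.

Lemma tsh_kappa th x : SO3 x -> tsh i l p q (m_emb P1 (kappa th) *m x) = ds_act sigma (kappa th) (tsh i l p q x).
Proof.
move=> hx; have [c1 c2] := chi_lp hp; have hS := SLpm_kappa th; have lp := ltn_p hp.
have E1 := @Mc_kappa l (Ordinal (ltn_2lp l p)) q th x hx; have E2 := @Mc_kappa l (Ordinal (ltn_p hp)) q th x hx.
rewrite /= in E1 E2; rewrite /tsh E1 E2; move: (Mc _ _ _ _) (Mc _ _ _ _) => A B {E1 E2}.
rewrite ds_actD// !ds_actZ// !ds_kappa// !scalerA.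
have -> : ((2 * l - p)%N%:Z - l%:Z) = l%:Z - p%:Z by lia.
by congr (_ *: _ + _ *: _); ring.
Qed.

Lemma cexp_ipi (n : nat) : cexp ('i%C * n%:R * pi%:C) = (-1) ^+ n :> R[i].
Proof.
have -> : 'i%C * n%:R * pi%:C = n%:R * ('i%C * pi%:C) :> R[i] by ring.
rewrite cexp_sum cexp_i cospi sinpi; congr (_ ^+ _).
by apply/eqP; rewrite eq_complex /= oppr0 !eqxx.
Qed.

Lemma cexp_ipiz (n : int) : cexp ('i%C * n%:~R * pi%:C) = (-1) ^+ absz n :> R[i].
Proof.
case: n => n; first exact: cexp_ipi.
rewrite NegzE rmorphN /=; set z := 'i%C * _ * _.
have e : z = - ('i%C * n.+1%:R * pi%:C) by rewrite /z; ring.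
have h := cexp_ipi n.+1; have := cexpD z ('i%C * n.+1%:R * pi%:C).
rewrite e addNr cexp0 h => h1.
have h2 : (-1) ^+ n.+1 * (-1) ^+ n.+1 = 1 :> R[i] by rewrite -expr2 sqrr_sign.
move: (cexp _) h1 => y h1; transitivity (y * ((-1) ^+ n.+1 * (-1) ^+ n.+1)); first by rewrite h2 mulr1.
by rewrite mulrA -h1 mul1r.
Qed.

(** The reflection exchanges the two terms of [tsh]; the sign c_i is what makes the sum
    equivariant. *)
Lemma tsh_refl x : SO3 x -> tsh i l p q (m_emb P1 (refl2 R) *m x) = ds_act sigma (tw i (refl2 R)) (tsh i l p q x).
Proof.
move=> hx; have [c1 c2] := chi_lp hp; have lp := ltn_p hp.
have sr : SLpm (refl2 R) := @SLpm_refl2 R.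
have e1 : (-1) ^+ (2 * l - p) = (-1) ^+ p :> R[i].
  by rewrite -signr_odd oddB; [rewrite oddM /= signr_odd | lia].
have ss n : (-1) ^+ n * (-1) ^+ n = 1 :> R[i] by rewrite -expr2 sqrr_sign.
have E1 := @Mc_refl l (Ordinal (ltn_2lp l p)) q x hx; have E2 := @Mc_refl l (Ordinal (ltn_p hp)) q x hx.
rewrite /= e1 subKn in E1; last by lia.
rewrite /= in E2; rewrite /tsh E1 E2; move: (Mc _ _ _ _) (Mc _ _ _ _) => A B {E1 E2}.
rewrite /tw; case: i => /=.
  rewrite ds_actD// !ds_actZ// !ds_refl// !opprB addrC; congr (_ + _).
    by rewrite mulrA ss mul1r.
(* For P_2 the twist turns the reflection into its opposite. The extra factor kappa (pi) = -1
   contributes (-1)^(l - p), which changes the sign (-1)^p of P_1 into (-1)^l. *)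
have -> : \det (refl2 R) *: refl2 R = kappa pi *m refl2 R.
  rewrite det2; apply: mx2P; rewrite !mxE ?sum2 !mxE /= ?cospi ?sinpi; ring.
have sk := SLpm_kappa (pi : R).
rewrite ds_actM// ds_actD// !ds_actZ// !ds_refl// !opprB ds_actD// !ds_actZ// !ds_kappa// !cexp_ipiz !scalerA.
have lpl : (p <= l)%N by have [a ->] := hp; lia.
have n1 : (-1) ^+ absz (l%:Z - p%:Z) = (-1) ^+ l * (-1) ^+ p :> R[i].
  have -> : absz (l%:Z - p%:Z) = (l - p)%N by lia.
  by rewrite -exprD -signr_odd -[RHS]signr_odd oddB ?oddD//; lia.
have n2 : (-1) ^+ absz (p%:Z - l%:Z) = (-1) ^+ l * (-1) ^+ p :> R[i].
  by rewrite -n1; congr (_ ^+ _); lia.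
rewrite n1 n2 addrC; congr (_ *: _ + _ *: _); last first.
  rewrite [RHS](_ : _ = (-1) ^+ l * (-1) ^+ l * ((-1) ^+ p * B)); last by ring.
  by rewrite ss mul1r.
by ring.
Qed.

Lemma tsh_O2 o x : O2 o -> SO3 x -> tsh i l p q (m_emb P1 o *m x) = ds_act sigma (tw i o) (tsh i l p q x).
Proof.
move=> ho hx; have tk th : tw i (kappa th) = kappa th :> 'M[R]_2.
  by apply: tw1; rewrite det2 !mxE /= -(cos2Dsin2 th); ring.
have hm th : SO3 (m_emb P1 (kappa th) *m x).
  have e : th = - (- (th / 2) + - (th / 2)) by field.
  by rewrite e -phi_diagU; exact: SO3_M (phi_SO3 (SU2_diagU _)) hx.
have [th [->|->]] := O2_cases ho; first by rewrite tk; exact: tsh_kappa.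
rewrite m_emb1M -mulmxA; apply: etrans (tsh_refl (hm th)) _; apply: etrans (congr1 _ (tsh_kappa th hx)) _.
move: (tsh _ _ _ _ x) => u; rewrite twM tk ds_actM//; last exact: SLpm_kappa.
by apply: SLpm_tw; exact: SLpm_refl2.
Qed.

Lemma tsh_extends (nu : R[i]) : exists2 f, ind1 nu i f & forall x, SO3 x -> f x = tsh i l p q x.
Proof. exact: extend_K regV_tsh tsh_O2. Qed.

End Equivariance.

End Elementary.

(** * The completed principal series *)

Section Pullback.
Variables (R : realType).

(** On SL(3) the cofactor matrix is the inverse transpose; being polynomial in the entries, it is
    continuous and multiplicative on all matrices. *)
Definition cof (g : 'M[R]_3) : 'M[R]_3 := (adj3 g)^T.

Lemma cofM g h : cof (g *m h) = cof g *m cof h.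
Proof. by apply: mx3P; rewrite !mxE /= ?mxE ?sum3 ?mxE /= ?sum3 ?mxE; ring. Qed.

Lemma cof_trK g : g^T *m cof g = (\det g)%:M.
Proof. by apply: mx3P; rewrite !mxE ?sum3 !mxE /= ?mulr1n ?mulr0n ?det3; ring. Qed.

Lemma cof_SL3 g : SL3 g -> SL3 (cof g).
Proof.
move=> dg; have h := cof_trK g; rewrite (dg : \det g = 1) in h.
by move/(congr1 determinant): h; rewrite det_mulmx det_tr (dg : \det g = 1) mul1r det1.
Qed.

Lemma cof_SO3 x : SO3 x -> cof x = x.
Proof. by move=> hx; rewrite /cof SO3_adj// trmxK. Qed.

Lemma cof_mexp (X : 'M[R]_3) t : \tr X = 0 -> cof (mexp (t *: X)) = mexp (t *: - X^T).
Proof.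
move=> trX; set E := mexp (t *: X).
have h1 : E^T *m mexp (t *: - X^T) = 1.
  apply: (mexp_unique (D := fun s => (mexp (s *: X))^T)); last by rewrite scale0r mexp0 trmx1.
  move=> s a b; under eq_fun do rewrite mxE.
  have -> : - (\sum_d (mexp (s *: X))^T a d * (- X^T) d b) = \sum_d X b d * mexp (s *: X) d a.
    by rewrite -sumrN; apply: eq_bigr => d _; rewrite !mxE mulrN opprK mulrC.
  exact: is_derive_mexp.
have h2 : E^T *m cof E = 1 by rewrite cof_trK det_mexp3.
have uE : E^T \in unitmx by case/mulmx1_unit: h1.
by rewrite -[LHS](mulKmx uE) h2 -h1 mulKmx.
Qed.

Variable i : parabolic.

(* Inverse transpose conjugates [P_2] to [P_1], so a function induced from [P_i]
   is written as [f \o io] with [f] induced from [P_1]. *)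
Definition io (g : 'M[R]_3) : 'M[R]_3 := if i is P1 then g else (uc R)^T *m cof g.
Definition Xi (X : 'M[R]_3) : 'M[R]_3 := if i is P1 then X else - X^T.

Lemma tr_Xi X : \tr X = 0 -> \tr (Xi X) = 0.
Proof. by rewrite /Xi; case: i => // h; rewrite raddfN /= mxtrace_tr h oppr0. Qed.

Lemma io_mexp g X t : \tr X = 0 -> io (g *m mexp (t *: X)) = io g *m mexp (t *: Xi X).
Proof. by rewrite /io /Xi; case: i => // h; rewrite cofM cof_mexp// mulmxA. Qed.

Lemma io_SL3 g : SL3 g -> SL3 (io g).
Proof.
rewrite /io; case: i => // h; apply: SL3_M; last exact: cof_SL3.
exact: SO3_SL3 (SO3_T (SO3_uc R)).
Qed.

Lemma io_SO3 x : SO3 x -> SO3 (io x).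
Proof. by rewrite /io; case: i => // h; rewrite cof_SO3//; apply: SO3_M => //; exact: SO3_T (SO3_uc R). Qed.

Lemma io_entry_cont a b : continuous (fun g : 'M[R]_3 => io g a b).
Proof.
rewrite /io; case: i; first exact: coord_continuous.
have -> : (fun g : 'M[R]_3 => ((uc R)^T *m cof g) a b) = fun g => \sum_d (uc R)^T a d * cof g d b.
  by apply/funext => g; rewrite mxE.
move=> g; apply: (@cvg_bigsum R R^o _ _ (nbhs_filter g)) => d; apply: cvgM; first exact: cvg_cst.
have c2 (a1 b1 a2 b2 : 'I_3) : continuous (fun x : 'M[R]_3 => x a1 b1 * x a2 b2).
  have h1 := @coord_continuous R 3 3 a1 b1; have h2 := @coord_continuous R 3 3 a2 b2.
  by move=> x; exact: (cvgM (h1 x) (h2 x)).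
have -> : (fun g => cof g d b) = (fun g => adj3 g b d) by apply/funext => x; rewrite mxE.
rewrite [cof g d b]mxE.
case: d => [[|[|[|d]]]] hd //; case: b => [[|[|[|b]]]] hb //;
 under eq_fun do rewrite mxE /=; rewrite mxE /=; try apply: cvgN; apply: cvgB; exact: c2.
Qed.

Lemma io_near g d : 0 < d -> \forall g' \near g, forall a b, `|io g' a b - io g a b| <= d.
Proof.
move=> d0; have H (ab : 'I_3 * 'I_3) : \forall g' \near g, `|io g' ab.1 ab.2 - io g ab.1 ab.2| <= d.
  by have /cvgrPdistC_le/(_ d d0) := @io_entry_cont ab.1 ab.2 g.
have := @filter_forall _ _ _ (nbhs g) (nbhs_filter g) H.
by apply: filterS => g' hg' a b; exact: (hg' (a, b)).
Qed.

Variables (k : nat) (sigma : discrete_series R k) (nu : R[i]).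

(** Induction on n: the derivative of the composite along X is the composite of the derivative along
    [Xi X], and the latter stays in the class. *)
Lemma ind1_C_n n (f : 'M[R]_3 -> sigma) : ind1 nu i f -> C_n n (fun g => f (io g)).
Proof.
elim: n f => [|n IH] f hf.
  split=> //; apply/subspace_continuousP => g hg; apply/cvg_nrP => e e0.
  have [d d0 hd] := ind1_cont hf (io_SL3 hg) e0.
  rewrite near_withinE; have := io_near g d0; apply: filterS => g' hg' sg'.
  by rewrite nrBC; apply: hd => //; exact: io_SL3.
split; first by case: (n) (IH _ hf) => [|?] [].
move=> X trX; have [f' [hf' hd _]] := ind1_deriv hf (tr_Xi trX).
exists (fun g => f' (io g)); split; last exact: IH.
move=> g hg; have := hd _ (io_SL3 hg).
by under eq_fun do rewrite -io_mexp//.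
Qed.

(** Inverse transpose followed by conjugation with u_c sends exp (s H) of P_2 to exp (s H) of P_1
    with the same s, and m_2 (h) to m_1 (h det h). The twist [tw] undoes the factor det h. *)
Lemma ind1_smooth_induced (f : 'M[R]_3 -> sigma) : ind1 nu i f -> smooth_induced i nu (fun g => f (io g)).
Proof.
move=> hf; split; first by move=> n; exact: ind1_C_n.
have [he _] := hf.
move=> n s h x hn hh hx; have hix := io_SL3 hx.
move: hn hix he; rewrite /io; case: i => hn hix he; first exact: he.
have [u [v en]] := (Nrad2P _).1 hn.
(* The image of n under inverse transpose and conjugation by u_c. *)
pose n' : 'M[R]_3 := mx_of_rows 3 3 [:: [:: 1; - v; u]; [:: 0; 1; 0]; [:: 0; 0; 1]].
have hn' : Nrad P1 n' by apply/Nrad1P; exists (- v), u.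
have dh := SLpm_neq0 hh.
have d2 : \det h ^+ 2 = 1 by case: hh => ->; rewrite ?sqrrN expr1n.
have sh : SLpm (\det h *: h) by apply: (@SLpm_tw _ P2).
have E : (uc R)^T *m cof (n *m mexp (s *: Hmx R P2) *m m_emb P2 h *m x)
     = n' *m mexp (s *: Hmx R P1) *m m_emb P1 (\det h *: h) *m ((uc R)^T *m cof x).
  rewrite cofM [RHS]mulmxA mulmxA; congr (_ *m _); rewrite en m_emb2E mexp_H2 NAM1E.
  have ef : expR (- s) * expR s = 1 := expRNK s.
  have -> : expR (2 * s) = expR s * expR s by rewrite -expRD; congr expR; ring.
  have -> : expR (- (2 * s)) = expR (- s) * expR (- s) by rewrite -expRD; congr expR; ring.
  move: (expR s) (expR (- s)) ef => e f' ef; rewrite detZ d2 mul1r.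
  have dV : (\det h)^-1 = \det h by apply: (mulfI dh); rewrite mulfV// -expr2 d2.
  rewrite dV !cofM.
  have -> : cof (mx_of_rows 3 3 [:: [:: 1; 0; u]; [:: 0; 1; v]; [:: 0; 0; 1]]) =
      mx_of_rows 3 3 [:: [:: 1; 0; 0]; [:: 0; 1; 0]; [:: - u; - v; 1]].
    by apply: mx3P; rewrite !mxE /= ?mxE /=; ring.
  have -> : cof (mx_of_rows 3 3 [:: [:: e; 0; 0]; [:: 0; e; 0]; [:: 0; 0; f' * f']]) =
      mx_of_rows 3 3 [:: [:: f'; 0; 0]; [:: 0; f'; 0]; [:: 0; 0; e * e]].
    by apply: mx3P; rewrite !mxE /= ?mxE /=; ring: ef.
  have dE := det2 h; move: (\det h) dE dV d2 => D dE dV d2.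
  have -> : cof (mx_of_rows 3 3 [:: [:: h j0 j0; h j0 j1; 0]; [:: h j1 j0; h j1 j1; 0]; [:: 0; 0; D]]) =
      mx_of_rows 3 3 [:: [:: D * h j1 j1; - D * h j1 j0; 0]; [:: - D * h j0 j1; D * h j0 j0; 0]; [:: 0; 0; D]].
    by apply: mx3P; rewrite !mxE /= ?mxE /= ; first [ring | rewrite [RHS]dE; ring].
  rewrite -!mulmxA [X in _ *m X = _](_ : _ = mx_of_rows 3 3 [:: [:: f' * (D * h j1 j1); - f' * (D * h j1 j0); 0];
      [:: - f' * (D * h j0 j1); f' * (D * h j0 j0); 0];
      [:: f' * D * (v * h j0 j1 - u * h j1 j1); f' * D * (u * h j1 j0 - v * h j0 j0); e * e * D]]); last first.
    rewrite mulmxA; apply: mx3P; rewrite !mxE !sum3 !mxE /= ?sum3 ?mxE /= ?(mulr0, mul0r, addr0, add0r, mulr1, mul1r); ring.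
  apply: mx3P; rewrite !mxE !sum3 !mxE /= ?(mulr0, mul0r, addr0, add0r, mulr1, mul1r); ring.
rewrite E he//; congr (_ *: ds_act sigma _ _).
by rewrite /tw detZ scalerA d2 mul1r -expr2 d2 scale1r.
Qed.

End Pullback.

(** * Smooth induced functions: linearity, translation, measurability *)

Section Induced.
Variables (R : realType) (i : parabolic) (nu : R[i]) (k : nat) (sigma : discrete_series R k).
Notation SI := (@smooth_induced R i nu k sigma).

Lemma C_n_lin n a (f g : 'M[R]_3 -> sigma) : C_n n f -> C_n n g -> C_n n (fun x => a *: f x + g x).
Proof.
have cont (f' g' : 'M[R]_3 -> sigma) : {within @SL3 R, continuous f'} -> {within @SL3 R, continuous g'} ->
    {within @SL3 R, continuous (fun x => a *: f' x + g' x)}.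
  move=> /subspace_continuousP cf /subspace_continuousP cg; apply/subspace_continuousP => x hx.
  by apply: cvgD; [apply: cvgZ; [exact: cvg_cst | exact: cf] | exact: cg].
elim: n f g => [|n IH] f g; first by move=> [cf _] [cg _]; split=> //; exact: cont.
move=> [cf hf] [cg hg]; split; first exact: cont.
move=> X trX; have [f' [df hf']] := hf X trX; have [g' [dg hg']] := hg X trX.
exists (fun x => a *: f' x + g' x); split; last exact: IH.
move=> x hx.
have -> : diffquot (fun t => a *: f (x *m mexp (t *: X)) + g (x *m mexp (t *: X))) =
   fun t => a *: diffquot (fun t => f (x *m mexp (t *: X))) t + diffquot (fun t => g (x *m mexp (t *: X))) t.
  apply/funext => t; rewrite /diffquot scalerA mulrC -scalerA -scalerDr; congr (_ *: _).
  by rewrite opprD addrACA scalerBr.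
by apply: cvgD; [apply: cvgZ; [exact: cvg_cst | exact: df] | exact: dg].
Qed.

(** [is_derive_mexp] puts X on the left of the exponential and [mexp_unique] asks for it on the
    right; the transpose of exp (-t X^T), which is exp (-t X), moves it to the other side. *)
Lemma mexp_inv (X : 'M[R]_3) t : (mexp (t *: - X^T))^T *m mexp (t *: X) = 1.
Proof.
apply: (mexp_unique (D := fun s => (mexp (s *: - X^T))^T)); last by rewrite scale0r mexp0 trmx1.
move=> s a b; under eq_fun do rewrite mxE.
have -> : - (\sum_d (mexp (s *: - X^T))^T a d * X d b) = \sum_d (- X^T) b d * mexp (s *: - X^T) d a.
  by rewrite -sumrN; apply: eq_bigr => d _; rewrite !mxE mulrC mulNr.
exact: is_derive_mexp.
Qed.

(** Both sides are inverse to y^-1 exp (-t X) y, the left one by [mexp_unique]. *)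
Lemma mexp_conj (y X : 'M[R]_3) t : y \in unitmx ->
  mexp (t *: (invmx y *m X *m y)) = invmx y *m mexp (t *: X) *m y.
Proof.
move=> uy; pose D s := (mexp (s *: - X^T))^T; pose Y := invmx y *m X *m y.
have yy : y *m invmx y = 1%:M by rewrite mulmxV.
have h : (invmx y *m D t *m y) *m mexp (t *: Y) = 1.
  apply: (mexp_unique (D := fun s => invmx y *m D s *m y)); last first.
    by rewrite /D scale0r mexp0 trmx1 mulmx1 mulVmx.
  move=> s a b.
  have E s' a' b' : (invmx y *m D s' *m y) a' b' = \sum_c \sum_d invmx y a' d * mexp (s' *: - X^T) c d * y c b'.
    rewrite mxE; apply: eq_bigr => c _; rewrite mxE mulr_suml; apply: eq_bigr => d _.
    by rewrite mxE.
  under eq_fun do rewrite E.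
  have -> : - (\sum_d (invmx y *m D s *m y) a d * Y d b) =
     \sum_c \sum_d invmx y a d * (\sum_e (- X^T) c e * mexp (s *: - X^T) e d) * y c b.
    transitivity (- ((invmx y *m D s *m y) *m Y) a b); first by rewrite mxE.
    have -> : invmx y *m D s *m y *m Y = invmx y *m (D s *m X) *m y.
      by rewrite /Y !mulmxA -(mulmxA _ y) yy mulmx1.
    rewrite mxE -sumrN; apply: eq_bigr => c _; rewrite mxE -mulNr -sumrN mulr_suml.
    apply: eq_bigr => d _; rewrite mxE -mulrN -sumrN; congr (_ * _ * _); apply: eq_bigr => e _.
    by rewrite !mxE mulrC mulNr.
  have dE c d : is_derive s 1 (fun s' => mexp (s' *: - X^T) c d) (\sum_e (- X^T) c e * mexp (s *: - X^T) e d) by exact: is_derive_mexp.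
  have -> : (fun s' => \sum_c \sum_d invmx y a d * mexp (s' *: - X^T) c d * y c b) =
     \sum_c \sum_d (fun s' => invmx y a d * mexp (s' *: - X^T) c d * y c b).
    by apply/funext => s'; rewrite !fct_sumE; apply: eq_bigr => c _; rewrite fct_sumE.
  apply: is_derive_sum => c; apply: is_derive_sum => d.
  by apply: is_derive_eq; rewrite /GRing.scale /=; ring.
have hX := mexp_inv X t; rewrite -/(D t) in hX.
have uD : D t \in unitmx by case/mulmx1_unit: hX.
have e1 : D t *m (y *m mexp (t *: Y) *m invmx y) = 1.
  have -> : D t *m (y *m mexp (t *: Y) *m invmx y) = y *m (invmx y *m D t *m y *m mexp (t *: Y)) *m invmx y.
    by rewrite !mulmxA yy mul1mx.
  by rewrite h mulmx1.
have e2 : y *m mexp (t *: Y) *m invmx y = mexp (t *: X).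
  by rewrite -[LHS](mulKmx uD) e1 -hX mulKmx.
by rewrite -/Y -e2 -!mulmxA mulVmx// mulmx1 mulKmx.
Qed.

Lemma SL3_unit (y : 'M[R]_3) : SL3 y -> y \in unitmx.
Proof. by move=> hy; rewrite unitmxE (hy : \det y = 1) unitr1. Qed.

Lemma C_n_translate n y (f : 'M[R]_3 -> sigma) : SL3 y -> C_n n f -> C_n n (fun x => f (x *m y)).
Proof.
move=> hy; have uy := SL3_unit hy.
have mc : continuous (fun x : 'M[R]_3 => x *m y).
  move=> x; apply: (@cvg_mxP R _ _ (nbhs_filter x)) => a b.
  have -> : (fun t : 'M[R]_3 => (t *m y) a b) = fun t => \sum_c t a c * y c b.
    by apply/funext => t; rewrite mxE.
  rewrite mxE; apply: (@cvg_bigsum R R^o _ _ (nbhs_filter x)) => c; apply: cvgM; last exact: cvg_cst.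
  exact: coord_continuous.
have cont (f' : 'M[R]_3 -> sigma) : {within @SL3 R, continuous f'} ->
    {within @SL3 R, continuous (fun x => f' (x *m y))}.
  move=> /subspace_continuousP cf; apply/subspace_continuousP => x hx A /(cf _ (SL3_M hx hy)) h.
  change (nbhs x [set z | SL3 z -> A (f' (z *m y))]).
  apply: (@filterS _ _ (nbhs_filter x) _ _ _ (mc x _ h)) => z hz sz; apply: hz; exact: SL3_M.
elim: n f => [|n IH] f; first by move=> [cf _]; split=> //; exact: cont.
move=> [cf hf]; split; first exact: cont.
move=> X trX.
(* x exp (tX) y = x y exp (t y^-1 X y): a translate is differentiated along the conjugate direction,
   which is again of trace 0. *)
have trY : \tr (invmx y *m X *m y) = 0 by rewrite mxtrace_mulC mulmxA mulmxV// mul1mx.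
have [f' [df hf']] := hf _ trY.
exists (fun x => f' (x *m y)); split; last exact: IH.
move=> x hx; have := df _ (SL3_M hx hy); under eq_fun do rewrite mexp_conj// !mulmxA -(mulmxA x) mulmxV// mulmx1.
by [].
Qed.

Lemma SI_lin a f g : SI f -> SI g -> SI (fun x => a *: f x + g x).
Proof.
move=> [sf ef] [sg eg]; split; first by move=> n; exact: C_n_lin.
move=> n s h x hn hh hx; rewrite ef// eg// ds_actD// ds_actZ//.
by rewrite scalerA mulrC -scalerA -scalerDr.
Qed.

Lemma SI_translate y f : SL3 y -> SI f -> SI (fun x => f (x *m y)).
Proof.
move=> hy [sf ef]; split; first by move=> n; exact: C_n_translate.
by move=> n s h x hn hh hx; rewrite -mulmxA ef//; exact: SL3_M.
Qed.

Lemma C_n_cont n (f : 'M[R]_3 -> sigma) : C_n n f -> {within @SL3 R, continuous f}.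
Proof. by case: n => [|n] []. Qed.

Lemma closed_SO3 : closed (@SO3 R).
Proof.
have cl (f : 'M[R]_3 -> R) c : continuous f -> closed (f @^-1` [set c]).
  by move=> cf; apply: closed_comp => // x _; exact: cf.
have ce a b : continuous (fun x : 'M[R]_3 => x a b) by exact: coord_continuous.
have -> : @SO3 R = (\bigcap_(ab in [set: 'I_3 * 'I_3])
     ((fun x : 'M[R]_3 => \sum_c x ab.1 c * x ab.2 c) @^-1` [set (ab.1 == ab.2)%:R])) `&`
     ((fun x : 'M[R]_3 => x i0 i0 * (x i1 i1 * x i2 i2 - x i1 i2 * x i2 i1)
          - x i0 i1 * (x i1 i0 * x i2 i2 - x i1 i2 * x i2 i0)
          + x i0 i2 * (x i1 i0 * x i2 i1 - x i1 i1 * x i2 i0)) @^-1` [set 1]).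
  apply/seteqP; split=> x.
    move=> [h d]; split; last by rewrite /= -d det3.
    move=> [a b] _ /=; move/matrixP/(_ a b): h; rewrite !mxE => <-.
    by apply: eq_bigr => c _; rewrite mxE.
  move=> [h d]; split; last by rewrite -d det3.
  apply/matrixP => a b; have := h (a, b) Logic.I; rewrite /= !mxE => <-.
  by apply: eq_bigr => c _; rewrite mxE.
apply: closedI.
  apply: closed_bigI => -[a b] _; apply: cl => x.
  by apply: (@cvg_bigsum R R^o _ _ (nbhs_filter x)) => c; apply: cvgM; exact: ce.
have cM (f g : 'M[R]_3 -> R) : continuous f -> continuous g -> continuous (fun x => f x * g x).
  by move=> cf cg x; exact: (cvgM (cf x) (cg x)).
have cB (f g : 'M[R]_3 -> R) : continuous f -> continuous g -> continuous (fun x => f x - g x).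
  by move=> cf cg x; exact: (cvgB (cf x) (cg x)).
have cD (f g : 'M[R]_3 -> R) : continuous f -> continuous g -> continuous (fun x => f x + g x).
  by move=> cf cg x; exact: (cvgD (cf x) (cg x)).
apply: cl; apply: (cD _ _ (cB _ _ _ _) _); apply: (cM _ _ _ _) => //; apply: (cB _ _ _ _); apply: (cM _ _ _ _); apply: (ce _ _).
Qed.

Lemma open_borel (U : set 'M[R]_3) : open U -> measurable (U : set (borel_M3 R)).
Proof. by move=> oU; exact: sub_sigma_algebra. Qed.

Lemma measurable_SO3 : measurable (@SO3 R : set (borel_M3 R)).
Proof.
rewrite -[@SO3 R]setCK; apply: measurableC; apply: open_borel.
exact: closed_openC closed_SO3.
Qed.

Lemma within_measurable (f : 'M[R]_3 -> R) : {within @SO3 R, continuous f} ->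
  measurable_fun (@SO3 R : set (borel_M3 R)) f.
Proof.
move=> /continuousP cf; apply: (measurability _ (RGenOpens.measurableE R)).
move=> _ [_ [a [b ->] <-]].
have /open_subspaceP[V oV VD] := cf `]a, b[%classic (@interval_open R (BRight a) (BLeft b) isT isT).
rewrite setIC -VD; apply: measurableI; [exact: open_borel | exact: measurable_SO3].
Qed.

Lemma SI_measurable f : SI f ->
  measurable_fun (@SO3 R : set (borel_M3 R)) (fun x => nr (f x) ^+ 2).
Proof.
move=> [sf _]; apply: measurable_funX; apply: within_measurable.
have /(continuous_subspaceW (@SO3_SL3 R)) /subspace_continuousP cf := C_n_cont (sf 0%N).
apply/subspace_continuousP => x hx; apply/cvgrPdist_le => e e0.
have /cvg_nrP/(_ e e0) := cf x hx; apply: filterS => y hy.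
apply: le_trans hy; rewrite ler_norml; apply/andP; split.
  by rewrite lerNl opprB lerBlDr nrBC; apply: le_trans (nrD _ _); rewrite subrK.
by rewrite lerBlDr; apply: le_trans (nrD _ _); rewrite subrK.
Qed.

End Induced.

Lemma sub2_rearr (C : pzRingType) (V : lmodType C) (a b c : V) (t : C) :
  a - b - t *: c = (-1) *: b + (- t *: c + a).
Proof. by rewrite scaleN1r scaleNr [- (t *: c) + a]addrC addrA [- b + a]addrC. Qed.

(** * Norm estimates in the completion *)

Section PrincipalSeries.
Variables (R : realType) (i : parabolic) (nu : R[i]) (k : nat) (sigma : discrete_series R k)
  (mu : haar_SO3 R) (pi : principal_series i nu sigma mu).
Notation SI := (@smooth_induced R i nu k sigma).

Lemma incl_normE f : SI f -> ((nr (ps_incl pi f) ^+ 2)%:E = \int[mu]_(x in @SO3 R) (nr (f x) ^+ 2)%:E)%E.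
Proof. exact: ps_incl_norm. Qed.

Lemma incl_eq0 f : SI f -> (forall x, SO3 x -> f x = 0) -> ps_incl pi f = 0.
Proof.
move=> hf f0; apply: nr_eq0; have := incl_normE hf.
rewrite (eq_integral (cst 0%E)); last by move=> x /set_mem hx; rewrite f0// nr0 expr0n.
by rewrite integral0 => -[] /eqP; rewrite sqrf_eq0 => /eqP.
Qed.

Lemma incl_lin a f g : SI f -> SI g ->
  ps_incl pi (fun x => a *: f x + g x) = a *: ps_incl pi f + ps_incl pi g.
Proof. exact: ps_incl_linear. Qed.

(** The norm is an integral over K, so the inclusion sees the values on K only. This makes the
    choice in [t_fun] harmless. *)
Lemma incl_ext f g : SI f -> SI g -> (forall x, SO3 x -> f x = g x) -> ps_incl pi f = ps_incl pi g.
Proof.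
move=> hf hg E; apply/eqP; rewrite -subr_eq0 addrC -scaleN1r -incl_lin//; apply/eqP.
apply: incl_eq0; first exact: SI_lin.
by move=> x hx; rewrite E// scaleN1r addNr.
Qed.

Lemma haar_fineE : mu (@SO3 R) = (fine (mu (@SO3 R)))%:E.
Proof.
rewrite fineK// ge0_fin_numE//; first exact: haar_fin.
Qed.

Lemma integral_cst_SO3 (c : R) : (\int[mu]_(x in @SO3 R) c%:E = (c * fine (mu (@SO3 R)))%:E)%E.
Proof. by rewrite integral_cst; [rewrite {1}haar_fineE EFinM | exact: measurable_SO3]. Qed.

Lemma haar_fine_gt0 : 0 < fine (mu (@SO3 R)).
Proof. by rewrite -lte_fin -haar_fineE; exact: haar_gt0. Qed.

Lemma incl_norm_le f (e : R) : SI f -> 0 <= e -> (forall x, SO3 x -> nr (f x) <= e) ->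
  nr (ps_incl pi f) <= e * Num.sqrt (fine (mu (@SO3 R))).
Proof.
move=> hf e0 hle; have m0 := ltW haar_fine_gt0.
have h : ((nr (ps_incl pi f) ^+ 2)%:E <= (e ^+ 2 * fine (mu (@SO3 R)))%:E)%E.
  rewrite incl_normE// -integral_cst_SO3; apply: ge0_le_integral.
  - exact: measurable_SO3.
  - by move=> x _; rewrite lee_fin sqr_ge0.
  - by apply/measurable_EFinP; exact: SI_measurable hf.
  - exact: measurable_cst.
  - by move=> x hx; rewrite lee_fin ler_sqr ?nnegrE ?nr_ge0// hle.
rewrite lee_fin in h.
rewrite -(ler_pXn2r (n := 2))// ?nnegrE ?nr_ge0 ?mulr_ge0 ?sqrtr_ge0//.
by rewrite exprMn sqr_sqrtr.
Qed.

(** Integrated over K, the constant gives c times a positive measure and the sum gives 0. It stands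
    in for the fact that a continuous function of norm 0 vanishes on K. *)
Lemma incl_separated n (F : 'I_n -> 'M[R]_3 -> sigma) (c : R) :
  (forall q, SI (F q)) -> (forall q, ps_incl pi (F q) = 0) ->
  (forall x, SO3 x -> c <= \sum_q nr (F q x) ^+ 2) -> c <= 0.
Proof.
move=> hF F0 hc; rewrite leNgt; apply/negP => c0.
have h : (\int[mu]_(x in @SO3 R) c%:E <= \int[mu]_(x in @SO3 R) (\sum_q (nr (F q x) ^+ 2)%:E))%E.
  apply: ge0_le_integral.
  - exact: measurable_SO3.
  - by move=> x _; rewrite lee_fin ltW.
  - exact: measurable_cst.
  - by apply: emeasurable_sum => q; apply/measurable_EFinP; exact: SI_measurable (hF q).
  - by move=> x hx; rewrite sumEFin lee_fin hc.
move: h; rewrite ge0_integral_sum; first last.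
- by move=> q x _; rewrite lee_fin sqr_ge0.
- by move=> q; apply/measurable_EFinP; exact: SI_measurable (hF q).
- exact: measurable_SO3.
rewrite big1 ?integral_cst_SO3; last by move=> q _; rewrite -incl_normE// F0 nr0 expr0n.
by rewrite lee_fin leNgt mulr_gt0// haar_fine_gt0.
Qed.

(* Uniform convergence on [K] of the difference quotients implies convergence in the
   [L^2]-norm. *)
Lemma incl_derive (f f' : 'M[R]_3 -> sigma) X : \tr X = 0 -> SI f -> SI f' -> isderK f X f' ->
  diffquot (orbit_curve (ps_act pi) X (ps_incl pi f)) @ 0^' --> ps_incl pi f'.
Proof.
move=> trX hf hf' hd; apply/diffquot_cvgP => e e0.
pose W := Num.sqrt (fine (mu (@SO3 R))) + 1.
have W0 : 0 < W by rewrite ltr_wpDl// sqrtr_ge0.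
have [|d d0 H] := hd (e / W); first by rewrite divr_gt0.
exists d => // t td; rewrite /orbit_curve.
have ht : SL3 (mexp (t *: X)) by exact: SL3_mexp.
have h0 : SL3 (mexp ((0 : R) *: X)) by exact: SL3_mexp.
have hft := SI_translate ht hf.
have e0X : ps_act pi (mexp ((0 : R) *: X)) (ps_incl pi f) = ps_incl pi f.
  rewrite (ps_act_incl pi h0 hf); apply: incl_ext; [exact: (SI_translate h0 hf) | exact: hf |].
  by move=> x _; rewrite scale0r mexp0 mulmx1.
rewrite e0X ps_act_incl//.
have hF1 : SI (fun x => - t%:C *: f' x + f (x *m mexp (t *: X))) by exact: SI_lin.
have -> : ps_incl pi (fun x => f (x *m mexp (t *: X))) - ps_incl pi f - t%:C *: ps_incl pi f'
   = ps_incl pi (fun x => (-1) *: f x + (- t%:C *: f' x + f (x *m mexp (t *: X)))).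
  by rewrite incl_lin// incl_lin// -sub2_rearr.
apply: le_trans (@incl_norm_le _ (e / W * `|t|) _ _ _) _.
- exact: SI_lin.
- by rewrite mulr_ge0// ltW// divr_gt0.
- move=> x hx; have := H t td x hx; by rewrite -sub2_rearr.
rewrite mulrAC ler_wpM2r// mulrAC ler_pdivrMr// ler_wpM2l ?ltW// /W.
by rewrite ltrDl.
Qed.

End PrincipalSeries.

(** * The action of the Lie algebra in the completion *)

Section InclusionOfK.
Variables (R : realType) (i : parabolic) (nu : R[i]) (k : nat) (sigma : discrete_series R k)
  (mu : haar_SO3 R) (pi : principal_series i nu sigma mu).
Notation ind := (ind1 nu i).

Definition inclI (F : 'M[R]_3 -> sigma) : pi := ps_incl pi (fun g => F (io i g)).

Lemma regV_scale a (F : 'M[R]_3 -> sigma) : regV F -> regV (fun x => a *: F x).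
Proof.
elim=> [|ph p hph hp|F1 F2 _ h1 _ h2|F1 F2 E _ h].
- by apply: regV_ext (regV0 sigma) => x _; rewrite scaler0.
- by apply: regV_ext (regV_term sigma (regM (reg_cst a) hph) hp) => x _; rewrite scalerA.
- by apply: regV_ext (regVD h1 h2) => x _; rewrite scalerDr.
- by apply: regV_ext h => x hx; rewrite E.
Qed.

Lemma ind1_lin a (F G : 'M[R]_3 -> sigma) : ind F -> ind G -> ind (fun x => a *: F x + G x).
Proof.
move=> [hF rF] [hG rG]; split; last exact: regVD (regV_scale a rF) rG.
move=> n s h x hn hh hx; rewrite hF// hG//; have ht := SLpm_tw i hh.
by rewrite ds_actD// ds_actZ// scalerA mulrC -scalerA -scalerDr.
Qed.

Lemma ind1_0 : ind (fun=> 0 : sigma).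
Proof.
split; last exact: regV0.
by move=> n s h x hn hh hx; rewrite ds_act0 ?scaler0//; exact: SLpm_tw.
Qed.

Lemma ind1_sum (I : Type) (r : seq I) (c : I -> R[i]) (F : I -> 'M[R]_3 -> sigma) :
  (forall j, ind (F j)) -> ind (fun x => \sum_(j <- r) c j *: F j x).
Proof.
move=> h; elim: r => [|j r IH].
  by rewrite (_ : (fun x => _) = (fun=> 0)); [exact: ind1_0 | apply/funext => x; rewrite big_nil].
rewrite (_ : (fun x => _) = fun x => c j *: F j x + \sum_(j <- r) c j *: F j x); first exact: ind1_lin.
by apply/funext => x; rewrite big_cons.
Qed.

Lemma inclI_lin a F G : ind F -> ind G -> inclI (fun x => a *: F x + G x) = a *: inclI F + inclI G.
Proof. by move=> hF hG; apply: incl_lin; exact: ind1_smooth_induced. Qed.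

Lemma inclI_ext F G : ind F -> ind G -> (forall x, SO3 x -> F x = G x) -> inclI F = inclI G.
Proof.
move=> hF hG E; apply: incl_ext; try exact: ind1_smooth_induced.
by move=> x hx; rewrite E//; exact: io_SO3.
Qed.

Lemma inclI_0 : inclI (fun=> 0) = 0.
Proof. by apply: incl_eq0 => //; exact: (ind1_smooth_induced ind1_0). Qed.

Lemma inclI_sum (I : Type) (r : seq I) (c : I -> R[i]) (F : I -> 'M[R]_3 -> sigma) :
  (forall j, ind (F j)) -> inclI (fun x => \sum_(j <- r) c j *: F j x) = \sum_(j <- r) c j *: inclI (F j).
Proof.
move=> h; elim: r => [|j r IH].
  by rewrite big_nil -inclI_0; congr inclI; apply/funext => x; rewrite big_nil.
rewrite big_cons -IH -inclI_lin//; last exact: ind1_sum.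
by congr inclI; apply/funext => x; rewrite big_cons.
Qed.

(** [ind1_deriv] supplies a derivative within the class and [isderK_Lder] its formula on K;
    uniqueness joins the two. *)
Lemma isderK_unique (f F F' : 'M[R]_3 -> sigma) X : isderK f X F -> isderK f X F' ->
  forall x, SO3 x -> F x = F' x.
Proof.
move=> h h' x hx; apply/eqP; rewrite -subr_eq0; apply/eqP/nr_eq0/eqP.
rewrite eq_le nr_ge0 andbT; apply/ler_addgt0Pr => e e0; rewrite add0r.
have e20 : 0 < e / 2 by rewrite divr_gt0.
have [d d0 hd] := h _ e20; have [d' d'0 hd'] := h' _ e20.
pose t := Num.min d d'; have t0 : 0 < t by rewrite lt_min d0.
have at' : `|t| = t by rewrite gtr0_norm.
have t_elz : `|t| <= d by rewrite at' ge_min lexx.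
have tl' : `|t| <= d' by rewrite at' ge_min lexx orbT.
have := hd' t tl' x hx; have := hd t t_elz x hx; rewrite at'.
move: (f (x *m _) - f x) => u h1 h2; rewrite -(ler_pM2l t0).
have -> : t * nr (F x - F' x) = nr (t%:C *: (F x - F' x)) by rewrite nrZ nr_real at'.
have -> : t%:C *: (F x - F' x) = (u - t%:C *: F' x) - (u - t%:C *: F x).
  by rewrite scalerBr opprB [RHS]addrC addrA subrK.
apply: le_trans (nrB _ _) _; apply: le_trans (lerD h2 h1) _.
by rewrite -mulrDl -splitr mulrC.
Qed.

Lemma ind1_dact (F F' : 'M[R]_3 -> sigma) X : \tr X = 0 -> ind F -> ind F' -> isderK F (Xi i X) F' ->
  diffquot (orbit_curve (ps_act pi) X (inclI F)) @ 0^' --> inclI F'.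
Proof.
move=> trX hF hF' hd; apply: incl_derive => //; try exact: ind1_smooth_induced.
move=> e e0; have [d d0 h] := hd _ e0; exists d => // t td x hx.
by rewrite io_mexp//; apply: h => //; exact: io_SO3.
Qed.

(** [dact] is a limit and behaves linearly only where the difference quotients converge; these
    vectors form a subspace containing the elementary functions. *)
Definition diffable (v : pi) := forall X, \tr X = 0 ->
  exists w : pi, diffquot (orbit_curve (ps_act pi) X v) @ 0^' --> w.

Lemma diffable_incl F : ind F -> diffable (inclI F).
Proof.
move=> hF X trX; have [F' [hF' _ hd]] := ind1_deriv hF (tr_Xi i trX).
by exists (inclI F'); exact: ind1_dact.
Qed.

Lemma orbit_lin X a v w : \tr X = 0 -> diffquot (orbit_curve (ps_act pi) X (a *: v + w)) =
  fun t => a *: diffquot (orbit_curve (ps_act pi) X v) t + diffquot (orbit_curve (ps_act pi) X w) t.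
Proof.
move=> trX; apply/funext => t; rewrite /diffquot /orbit_curve.
have ht s := SL3_mexp s trX; have L s := @ps_act_linear _ _ _ _ _ _ pi _ (ht s).
rewrite !L scalerA mulrC -scalerA -scalerDr; congr (_ *: _).
by rewrite opprD addrACA scalerBr.
Qed.

Lemma dact_lin X a v w : \tr X = 0 -> diffable v -> diffable w ->
  dact (ps_act pi) X (a *: v + w) = a *: dact (ps_act pi) X v + dact (ps_act pi) X w.
Proof.
move=> trX hv hw; have [v' dv] := hv X trX; have [w' dw] := hw X trX.
rewrite /dact (cvg_lim _ dv)// (cvg_lim _ dw)//; apply: cvg_lim => //.
by rewrite orbit_lin//; apply: cvgD => //; apply: cvgZ => //; exact: cvg_cst.
Qed.

Lemma diffable_lin a v w : diffable v -> diffable w -> diffable (a *: v + w).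
Proof.
move=> hv hw X trX; have [v' dv] := hv X trX; have [w' dw] := hw X trX.
exists (a *: v' + w'); rewrite orbit_lin//; apply: cvgD => //; apply: cvgZ => //; exact: cvg_cst.
Qed.

Lemma tr_ReIm (Z : 'M[R[i]]_3) : \tr Z = 0 ->
  \tr (map_mx (@complex.Re R) Z) = 0 /\ \tr (map_mx (@complex.Im R) Z) = 0.
Proof.
rewrite /mxtrace !sum3 !mxE; case: (Z _ _) (Z _ _) (Z _ _) => a b [c d] [e f] /eqP.
by rewrite eq_complex /= => /andP[/eqP h1 /eqP h2].
Qed.

Lemma cdact_lin Z a v w : \tr Z = 0 -> diffable v -> diffable w ->
  cdact (ps_act pi) Z (a *: v + w) = a *: cdact (ps_act pi) Z v + cdact (ps_act pi) Z w.
Proof.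
move=> /tr_ReIm[t1 t2] hv hw; rewrite /cdact !dact_lin//.
by rewrite !scalerDr !scalerA [a * _]mulrC addrACA.
Qed.

Lemma diffable0 : diffable 0.
Proof. by rewrite -inclI_0; apply: diffable_incl; exact: ind1_0. Qed.

Lemma cdact0 Z : \tr Z = 0 -> cdact (ps_act pi) Z 0 = 0.
Proof.
move=> tz; have := cdact_lin (-1) tz diffable0 diffable0.
by rewrite scaler0 addr0 => e; rewrite e scaleN1r addNr.
Qed.

Lemma diffable_sum (I : Type) (r : seq I) (c : I -> R[i]) (v : I -> pi) :
  (forall j, diffable (v j)) -> diffable (\sum_(j <- r) c j *: v j).
Proof.
move=> h; elim: r => [|j r IH]; first by rewrite big_nil; exact: diffable0.
by rewrite big_cons; exact: diffable_lin.
Qed.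

Lemma cdact_sum Z (I : Type) (r : seq I) (c : I -> R[i]) (v : I -> pi) : \tr Z = 0 ->
  (forall j, diffable (v j)) ->
  cdact (ps_act pi) Z (\sum_(j <- r) c j *: v j) = \sum_(j <- r) c j *: cdact (ps_act pi) Z (v j).
Proof.
move=> tz h; elim: r => [|j r IH]; first by rewrite !big_nil cdact0.
by rewrite !big_cons cdact_lin//; [rewrite IH | exact: diffable_sum].
Qed.

Definition XiC (Z : 'M[R[i]]_3) : 'M[R[i]]_3 := if i is P1 then Z else - Z^T.

(** [cdact] treats the real and imaginary parts of Z apart; the two conjugates recombine, by
    linearity, into the conjugate of Z itself. *)
Lemma cmx_Xi (Z : 'M[R[i]]_3) (x : 'M[R]_3) :
  'i%C *: cmx (x *m Xi i (map_mx (@complex.Im R) Z) *m x^T) + cmx (x *m Xi i (map_mx (@complex.Re R) Z) *m x^T)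
  = cmx x *m XiC Z *m (cmx x)^T.
Proof.
rewrite /cmx !map_mxM map_trmx [_ *: (_ *m _)]scalemxAl [_ *: (_ *m _)]scalemxAr -mulmxDl -mulmxDr; congr (_ *m _ *m _).
rewrite /Xi /XiC; case: i; apply/matrixP => a b; rewrite !mxE;
  case: (Z _ _) => u v; apply/eqP; rewrite eq_complex /=; apply/andP; split; apply/eqP; ring.
Qed.

Section Family.
Variables (N : nat) (ph : 'I_N -> 'M[R]_3 -> R[i]) (D : 'I_N -> 'M[R[i]]_3 -> 'M[R]_3 -> R[i]) (e : 'I_N -> int).
Hypothesis he : forall j, chi_index k (e j).
Hypothesis hexp : forall j, isExp (ph j) (D j).
Variable F : 'M[R]_3 -> sigma.
Hypothesis hF : ind F.
Hypothesis FK : forall x, SO3 x -> F x = \sum_j ph j x *: ds_chi sigma (e j).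

Lemma cdact_incl Z : \tr Z = 0 -> exists G, [/\ ind G, cdact (ps_act pi) Z (inclI F) = inclI G &
  forall x, SO3 x -> G x = Lder sigma nu ph D e (cmx x *m XiC Z *m (cmx x)^T) x].
Proof.
move=> tz; have [t1 t2] := tr_ReIm tz.
have H X : \tr X = 0 -> exists G, [/\ ind G, dact (ps_act pi) X (inclI F) = inclI G &
    forall x, SO3 x -> G x = Lder sigma nu ph D e (cmx (x *m Xi i X *m x^T)) x].
  move=> trX; have trXi := tr_Xi i trX; have [F' [hF' _ hd]] := ind1_deriv hF trXi.
  exists F'; split=> //; first by apply: cvg_lim => //; exact: ind1_dact.
  exact: isderK_unique hd (isderK_Lder he hexp (eqvf_eqv1 hF.1) FK trXi).
have [G1 [h1 e1 k1]] := H _ t1; have [G2 [h2 e2 k2]] := H _ t2.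
exists (fun x => 'i%C *: G2 x + G1 x); split; first exact: ind1_lin.
  by rewrite /cdact e1 e2 inclI_lin// addrC.
move=> x hx; rewrite k1// k2// -(@Lder_lin R k sigma nu N ph D e hexp)//.
by rewrite cmx_Xi.
Qed.

End Family.

End InclusionOfK.

(** * The elementary functions as vectors of the completion *)

Section ElementaryInclusion.
Variables (R : realType) (i : parabolic) (nu : R[i]) (k : nat) (sigma : discrete_series R k)
  (mu : haar_SO3 R) (pi : principal_series i nu sigma mu).

(** Right translation by y acts on the index q through tau (y) and leaves p alone. K-finiteness and
    the independence argument both rest on this. *)
Lemma tsh_M l p q (x y : 'M[R]_3) : (exists a, l = (k + p + 2 * a)%N) -> SO3 x -> SO3 y ->
  tsh sigma i l p q (x *m y) = \sum_(e < (2 * l).+1) Mc l e q y *: tsh sigma i l p e x.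
Proof.
move=> hp hx hy.
have E1 := @McM R l x y (Ordinal (ltn_2lp l p)) q hx hy; have E2 := @McM R l x y (Ordinal (ltn_p hp)) q hx hy.
rewrite /= in E1 E2; rewrite /tsh E1 E2 {E1 E2} scaler_suml mulr_sumr scaler_suml -big_split /=.
apply: eq_bigr => e _; move: (Mc l (2 * l - p) e x) (Mc l p e x) (Mc l e q y) => A B C.
by rewrite scalerDr !scalerA [C * A]mulrC [C * _]mulrC mulrA.
Qed.

Lemma tsh_tK l p q x : (exists a, l = (k + p + 2 * a)%N) -> SO3 x ->
  tsh sigma i l p q (io i x) = t_K i sigma l p q x.
Proof.
move=> hp hx; case: i; first by rewrite /tsh /t_K /Mc.
rewrite /io (cof_SO3 hx); have hu : SO3 (uc R)^T := SO3_T (SO3_uc R).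
have hux : SO3 ((uc R)^T *m x) by exact: SO3_M.
have ex : x = uc R *m ((uc R)^T *m x) by rewrite mulmxA; have [-> _] := SO3_uc R; rewrite mul1mx.
have E (r : 'I_(2 * l).+1) : Mc l r q ((uc R)^T *m x) = vdual P2 r (tauK x (vq R (2 * l) q%:Z)).
  have h := vdual2E r (vq R (2 * l) q%:Z) hux; rewrite -ex in h; exact: esym h.
have E1 : Mc l (2 * l - p) q ((uc R)^T *m x) = vdual P2 (2 * l - p) (tauK x (vq R (2 * l) q%:Z)).
  exact: (E (Ordinal (ltn_2lp l p))).
have E2 : Mc l p q ((uc R)^T *m x) = vdual P2 p (tauK x (vq R (2 * l) q%:Z)).
  exact: (E (Ordinal (ltn_p hp))).
by rewrite /tsh E1 E2.
Qed.

(** [t_fun] is a choice in a set that contains F composed with [io]; both have the same values on K,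
    hence the same inclusion. *)
Lemma t_elE l p q F : (exists a, l = (k + p + 2 * a)%N) -> (q <= 2 * l)%N ->
  ind1 nu i F -> (forall x, SO3 x -> F x = tsh sigma i l p q x) ->
  t_el pi l p q = inclI pi F.
Proof.
move=> hp hq hF FK.
pose S := [set f : 'M[R]_3 -> sigma | [/\ smooth_induced i nu f,
        finite_vector (@SO3 R) (ps_act pi) (ps_incl pi f) &
        forall x, SO3 x -> f x = t_K i sigma l p q x]].
have hS : S (fun g => F (io i g)).
  split; first exact: ind1_smooth_induced.
    have /choice[G hG] : forall e : 'I_(2 * l).+1, exists G, ind1 nu i G /\ forall x, SO3 x -> G x = tsh sigma i l p e x.
      move=> e; have he : (e <= 2 * l)%N by rewrite -ltnS.
      by have [G h1 h2] := @tsh_extends R k sigma i l p e hp he nu; exists G.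
    exists (2 * l).+1, (fun e => inclI pi (G e)) => x hx; exists (fun e => Mc l e q x).
    have hG1 e := (hG e).1; have hG2 e := (hG e).2.
    rewrite -inclI_sum// ps_act_incl; last exact: ind1_smooth_induced; last exact: SO3_SL3.
    apply: incl_ext.
    - exact: (SI_translate (SO3_SL3 hx) (ind1_smooth_induced hF)).
    - by apply: (@ind1_smooth_induced R i k sigma nu (fun y => \sum_(j < (2 * l).+1) Mc l j q x *: G j y)); exact: ind1_sum.
    - move=> y hy; have -> : io i (y *m x) = io i y *m x by rewrite /io; case: i => //; rewrite cofM (cof_SO3 hx) mulmxA.
      have hiy := io_SO3 i hy; rewrite FK ?tsh_M//; last exact: SO3_M.
      by apply: eq_bigr => e _; rewrite hG2.
  by move=> x hx; rewrite FK ?tsh_tK//; exact: io_SO3.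
have [h1 _ h3] : S (t_fun pi l p q) by apply: (@xgetPex _ (fun=> 0) S); exists (fun g => F (io i g)).
apply: incl_ext => //; first exact: ind1_smooth_induced.
by move=> x hx; rewrite h3// FK ?tsh_tK//; exact: io_SO3.
Qed.

Lemma tsh1 l p q : (exists a, l = (k + p + 2 * a)%N) -> (q <= 2 * l)%N ->
  tsh sigma i l p q 1%:M = (2 * l - p == q)%N%:R *: ds_chi sigma (l%:Z - p%:Z)
    + (csign R i l p * (p == q)%:R) *: ds_chi sigma (p%:Z - l%:Z).
Proof.
move=> hp hq; have E1 := @Mc1 R l (Ordinal (ltn_2lp l p)) q hq; have E2 := @Mc1 R l (Ordinal (ltn_p hp)) q hq.
by rewrite /= in E1 E2; rewrite /tsh E1 E2.
Qed.

(* The values at [1] separate the [p]; they are bounded by the values at any point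
   of [K], since right translation mixes the [q] by bounded coefficients, hence by
   the [L^2]-norms. *)
Lemma t_el_indep l n (p : 'I_n -> nat) (c : 'I_n -> R[i]) : injective p -> (0 < k)%N ->
  (forall a, exists b, l = (k + p a + 2 * b)%N) ->
  (forall q : 'I_(2 * l).+1, \sum_a c a *: t_el pi l (p a) q = 0) -> forall a, c a = 0.
Proof.
move=> injp k0 hp h0 b.
have /choice[F hF] : forall aq : 'I_n * 'I_(2 * l).+1, exists G, ind1 nu i G /\ forall x, SO3 x -> G x = tsh sigma i l (p aq.1) aq.2 x.
  move=> [a q]; have hq : (q <= 2 * l)%N by rewrite -ltnS.
  by have [G h1 h2] := @tsh_extends R k sigma i l (p a) q (hp a) hq nu; exists G.
pose G (q : 'I_(2 * l).+1) x := \sum_a c a *: F (a, q) x.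
have hG q : ind1 nu i (G q) by apply: ind1_sum => a; exact: (hF (a, q)).1.
have G0 q : inclI pi (G q) = 0.
  have hq : (q <= 2 * l)%N by rewrite -ltnS.
  rewrite inclI_sum; last by move=> a; exact: (hF (a, q)).1.
  rewrite -[RHS](h0 q); apply: eq_bigr => a _; congr (_ *: _); apply: esym.
  apply: t_elE (hp a) hq (hF (a, q)).1 _; exact: (hF (a, q)).2.
have GM e (x : 'M[R]_3) : SO3 x -> G e 1%:M = \sum_(q < (2 * l).+1) Mc l q e x^T *: G q x.
  move=> hx; have hxT := SO3_T hx; have [xx _] := hx.
  transitivity (\sum_a c a *: \sum_(q < (2 * l).+1) Mc l q e x^T *: F (a, q) x).
    apply: eq_bigr => a _; congr (_ *: _); rewrite (hF (a, e)).2/=; last exact: SO3_1.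
    rewrite -xx tsh_M//; apply: eq_bigr => q _; rewrite (hF (a, q)).2//.
  under eq_bigr do rewrite scaler_sumr; rewrite exchange_big /=; apply: eq_bigr => q _.
  by rewrite scaler_sumr; apply: eq_bigr => a _; rewrite !scalerA mulrC.
pose B : R := 2 ^+ (2 * l); have B0 : 0 < B by rewrite exprn_gt0.
have N0 : 0 < (2 * l).+1%:R :> R by rewrite ltr0n.
have G1 e : G e 1%:M = 0.
  apply: nr_eq0; apply/eqP; rewrite eq_le nr_ge0 andbT leNgt; apply/negP => c0.
  (* If every G q y had norm below d, the expansion [GM], with 2 l + 1 coefficients of modulus at
     most B, would make the norm of G e 1 less than itself. *)
  pose d := nr (G e 1%:M) / (B * (2 * l).+1%:R); have d0 : 0 < d by rewrite divr_gt0// mulr_gt0.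
  have := @incl_separated R i nu k sigma mu pi _ (fun q g => G q (io i g)) (d ^+ 2).
  rewrite leNgt exprn_gt0//; move/(_ _ _ _)/negP; apply => //; first by move=> q; exact: ind1_smooth_induced.
  move=> x hx; have hy := io_SO3 i hx; move: (io i x) hy => y hy.
  have [q hq] : exists q, d <= nr (G q y).
    apply: contrapT => /forallNP hlt.
    have : nr (G e 1%:M) < nr (G e 1%:M).
      rewrite {1}(GM e y hy); apply: le_lt_trans (nr_sum _ _) _.
      apply: (@lt_le_trans _ _ (\sum_(q < (2 * l).+1) (B * d))).
        apply: ltr_sum; first by apply/hasP; exists ord0; rewrite ?mem_index_enum.
        move=> q _; rewrite nrZ; apply: (@le_lt_trans _ _ (B * nr (G q y))).
          rewrite ler_wpM2r ?nr_ge0//; apply: Mc_bound; [by rewrite -ltnS | exact: SO3_T].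
        by rewrite ltr_pM2l// ltNge; apply/negP; exact: hlt.
      rewrite sumr_const card_ord -mulr_natl /d.
      by rewrite (_ : _ * _ = nr (G e 1%:M)); [| field; rewrite ?gt_eqF].
    by rewrite ltxx.
  rewrite (bigD1 q)//=; apply: (@le_trans _ _ (nr (G q y) ^+ 2)).
    by rewrite ler_sqr ?nnegrE ?nr_ge0// ltW.
  by rewrite lerDl sumr_ge0// => ? _; rewrite sqr_ge0.
have pl a : (p a < l)%N by have [b' ->] := hp a; lia.
(* At the identity, the entry 2 l - p b of the function of index p b is chi_(l - p b), and that
   entry of the others is 0. Since k > 0, all these indices p are less than l, so no p equals some 2
   l - p'. *)
pose e := Ordinal (ltn_2lp l (p b)).
have := G1 e; rewrite /G (bigD1 b)//= big1 ?addr0.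
  rewrite (hF (b, e)).2/=; last exact: SO3_1.
  rewrite (tsh1 (hp b)) ?leq_subr//.
  rewrite eqxx (_ : (p b == 2 * l - p b)%N = false); last by have := pl b; lia.
  rewrite mulr0 scale0r addr0 scale1r => /eqP; rewrite scaler_eq0 => /orP[/eqP//|/eqP c0].
  by have [c1 _] := chi_lp (hp b); have := ds_chi_neq0 sigma c1; rewrite c0 eqxx.
move=> a ab; rewrite (hF (a, e)).2/=; last exact: SO3_1.
rewrite (tsh1 (hp a)) ?leq_subr//.
have pab : p a != p b by apply: contra ab => /eqP/injp ->.
rewrite (_ : (2 * l - p a == 2 * l - p b)%N = false); last by have := pl a; have := pl b; lia.
rewrite (_ : (p a == 2 * l - p b)%N = false); last by have := pl a; have := pl b; lia.
by rewrite mulr0 !scale0r addr0 scaler0.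
Qed.

End ElementaryInclusion.

(** * Clebsch-Gordan coefficients *)

Section ClebschGordan.
Variable R : realType.
Notation C := R[i].

Lemma binpow_coef (a b : C) n t : ((a *: 'X + b%:P) ^+ n)`_t = 'C(n, t)%:R * a ^+ t * b ^+ (n - t).
Proof.
rewrite addrC exprDn coef_sum.
have E (j : 'I_n.+1) : (b%:P ^+ (n - j) * (a *: 'X) ^+ j *+ 'C(n, j))`_t =
    'C(n, j)%:R * a ^+ j * b ^+ (n - j) * (t == j)%:R.
  rewrite coefMn exprZn -polyC_exp mul_polyC coefZ coefZ coefXn -mulr_natl; ring.
under eq_bigr do rewrite E.
have [tn|tn] := ltnP t n.+1; last first.
  rewrite bin_small// !mul0r big1// => j _.
  by rewrite (_ : (t == j) = false) ?mulr0//; apply/eqP => tj; have := ltn_ord j; lia.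
rewrite (bigD1 (Ordinal tn))//= eqxx mulr1 big1 ?addr0// => j jt.
by rewrite (_ : (t == j) = false) ?mulr0//; apply: contraNF jt => /eqP tj; apply/eqP/val_inj.
Qed.

Lemma lprod_coef (a b c d : C) n M s : (lprod a b c d n M)`_s =
  \sum_(t < s.+1) ('C(n, t)%:R * a ^+ t * b ^+ (n - t)) * ('C(M, s - t)%:R * c ^+ (s - t) * d ^+ (M - (s - t))).
Proof. by rewrite coefM; apply: eq_bigr => t _; rewrite !binpow_coef. Qed.

(* Coefficients, in the bases of [V_L] and [V_4], of [det(v, v')^n1] times the
   coefficient of [s^n2] in [f(v + s v')], for [f = x^q y^(N - q)]: up to a scalar this
   polarization is the only equivariant map. *)
Definition Bq (n1 n2 N q j : nat) : C := \sum_(t < n2.+1) \sum_(u < n1.+1)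
  (t + u == j)%N%:R * ((-1) ^+ u * 'C(n1, u)%:R * ('C(q, t)%:R * 'C(N - q, n2 - t)%:R)).

(** Where the truncated subtractions q - t or N - q - (n2 - t) would be wrong, a binomial
    coefficient vanishes; it is therefore kept on both sides. *)
Lemma bin_ev_vq L N n1 n2 q t u (x y : C) : (L + n2 = N + n1)%N -> (q <= N)%N -> (t <= n2)%N -> (u <= n1)%N ->
  ('C(q, t)%:R * 'C(N - q, n2 - t)%:R) * ev (vq R L (q%:Z + n1%:Z - (t + u)%N%:Z)) x y
  = ('C(q, t)%:R * 'C(N - q, n2 - t)%:R) * (x ^+ (q - t) * x ^+ (n1 - u) * (y ^+ (N - q - (n2 - t)) * y ^+ u)).
Proof.
move=> hL hq ht hu.
have [tq|tq] := leqP t q; last by rewrite bin_small// !mul0r.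
have [tN|tN] := leqP (n2 - t) (N - q); last by rewrite [X in _ * X%:R]bin_small// mulr0 !mul0r.
have -> : q%:Z + n1%:Z - (t + u)%N%:Z = ((q - t) + (n1 - u))%N%:Z by lia.
rewrite ev_vq; last by lia.
by rewrite -!exprD; congr (_ * (_ ^+ _ * _ ^+ _)); lia.
Qed.

(** The index u counts the factors y x' taken from the determinant, t the factors x' taken from the
    first power; the total degree in x', y' is n1 + n2 = 4, so that the exponent of x' is j = t +
    u. *)
Lemma Bq_ev L N n1 n2 q (x y x' y' : C) : (L + n2 = N + n1)%N -> (n1 + n2 = 4)%N -> (q <= N)%N ->
  \sum_(j < 5) Bq n1 n2 N q j * ev (vq R L (q%:Z + n1%:Z - j%:Z)) x y * (x' ^+ j * y' ^+ (4 - j))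
  = (x * y' - y * x') ^+ n1 * (lprod x' x y' y q (N - q))`_n2.
Proof.
move=> hL h4 hq; rewrite lprod_coef exprBn mulr_sumr.
pose G j := ev (vq R L (q%:Z + n1%:Z - j%:Z)) x y * (x' ^+ j * y' ^+ (4 - j)).
transitivity (\sum_(t < n2.+1) \sum_(u < n1.+1)
   ((-1) ^+ u * 'C(n1, u)%:R * ('C(q, t)%:R * 'C(N - q, n2 - t)%:R)) * G (t + u)%N).
  under eq_bigr do rewrite -mulrA -/(G _) mulr_suml.
  rewrite exchange_big /=; apply: eq_bigr => t _.
  under eq_bigr do rewrite mulr_suml.
  rewrite exchange_big /=; apply: eq_bigr => u _.
  have tu : (t + u < 5)%N by have := ltn_ord t; have := ltn_ord u; lia.
  rewrite (bigD1 (Ordinal tu))//= eqxx mul1r big1 ?addr0// => j jt.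
  rewrite (_ : (t + u == j)%N = false) ?mul0r//.
  by apply: contraNF jt => /eqP tj; apply/eqP/val_inj.
apply: eq_bigr => t _; rewrite mulr_suml; apply: eq_bigr => u _.
have ht : (t <= n2)%N by rewrite -ltnS. have hu : (u <= n1)%N by rewrite -ltnS.
rewrite /G; move: (bin_ev_vq x y hL hq ht hu); move: (ev _ _ _) => V hV.
rewrite [LHS](_ : _ = (-1) ^+ u * 'C(n1, u)%:R * (x' ^+ (t + u) * y' ^+ (4 - (t + u))) *
   ('C(q, t)%:R * 'C(N - q, n2 - t)%:R * V)); last by ring.
rewrite hV.
rewrite (_ : 4 - (t + u) = (n1 - u) + (n2 - t))%N; last by lia.
rewrite !exprD !exprMn -mulr_natr; ring.
Qed.

Lemma invmx_SU2_det (g : 'M[C]_2) : SU2 g -> invmx g 0 0 * invmx g 1 1 - invmx g 0 1 * invmx g 1 0 = 1.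
Proof.
move=> [_ dg]; have := det_inv g; rewrite dg invr1 det2.
have e0 : j0 = 0 by exact: val_inj.
have e1 : j1 = 1 by exact: val_inj.
by rewrite e0 e1.
Qed.

Lemma ev_tau_Mc l (g : 'M[C]_2) q (a b : C) : (q <= 2 * l)%N -> SU2 g ->
  (invmx g 0 0 * a + invmx g 0 1 * b) ^+ q * (invmx g 1 0 * a + invmx g 1 1 * b) ^+ (2 * l - q)
  = \sum_(r < (2 * l).+1) Mc l r q (phi g) * (a ^+ r * b ^+ (2 * l - r)).
Proof.
move=> hq hg; rewrite -ev_vq//; apply: etrans (esym (ev_tau g (vq R (2 * l) q%:Z) a b)) _.
have E (r : 'I_(2 * l).+1) : vdual P1 r (tau g (vq R (2 * l) q%:Z)) = Mc l r q (phi g).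
  by rewrite /Mc; apply: congr1; apply: esym; exact: tauK_phi.
have X := vdual1_expand (tau g (vq R (2 * l) q%:Z)); move: (tau g _) E X => f E ->.
rewrite ev_sum; apply: eq_bigr => r _; have hr : (r <= 2 * l)%N by rewrite -ltnS.
by rewrite evZ E ev_vq.
Qed.

(** [lprod] is v_q evaluated at the moving point (x, y) + s (x', y'); a linear substitution applied
    to both vectors is one applied to this point, for every s. *)
Lemma lprod_tau l (g : 'M[C]_2) q (x y x' y' : C) : (q <= 2 * l)%N -> SU2 g ->
  lprod (invmx g 0 0 * x' + invmx g 0 1 * y') (invmx g 0 0 * x + invmx g 0 1 * y)
        (invmx g 1 0 * x' + invmx g 1 1 * y') (invmx g 1 0 * x + invmx g 1 1 * y) q (2 * l - q)
  = \sum_(r < (2 * l).+1) Mc l r q (phi g) *: lprod x' x y' y r (2 * l - r).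
Proof.
move=> hq hg; apply/eqP; rewrite -subr_eq0; apply/eqP; apply: poly_eq0_of_horner => s.
have H (a b c d : C) n M : (lprod a b c d n M).[s] = (a * s + b) ^+ n * (c * s + d) ^+ M.
  by rewrite /lprod hornerM !horner_exp !hornerD !hornerZ !hornerX !hornerC.
rewrite hornerD hornerN horner_sum H; apply/eqP; rewrite subr_eq0; apply/eqP.
under eq_bigr do rewrite hornerZ H.
rewrite -ev_tau_Mc//; move: (invmx g 0 0) (invmx g 0 1) (invmx g 1 0) (invmx g 1 1) => a b c d.
by congr (_ ^+ _ * _ ^+ _); ring.
Qed.

Lemma vdual1_vqz l (b : 'I_(2 * l).+1) (c : int) : vdual P1 b (vq R (2 * l) c) = (b%:Z == c)%:R.
Proof.
have [hc|hc] := boolP (0 <= c <= (2 * l)%N%:Z); last first.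
  rewrite vq_out//; have := vdual1_lin b (-1) (0 : hpoly R (2 * l)) 0.
  rewrite scaler0 addr0 mulN1r addNr => ->.
  by rewrite (_ : (b%:Z == c) = false)//; apply/negP => /eqP bc; have := ltn_ord b; lia.
have -> : c = (absz c)%:Z by lia.
by rewrite vdual1_vq; last lia.
Qed.

(** Comparison of coefficients for polynomials homogeneous in two pairs of variables, one pair after
    the other. *)
Lemma bilinear_coef l l' (I J : finType) (B : I -> C) (T : I -> hpoly R (2 * l)) (S : I -> hpoly R (2 * l'))
    (c : J -> C) (z : J -> int) (w : J -> int) :
  (forall x y x' y', \sum_j B j * ev (T j) x y * ev (S j) x' y' =
     \sum_j c j * ev (vq R (2 * l) (z j)) x y * ev (vq R (2 * l') (w j)) x' y') ->
  forall (b : 'I_(2 * l).+1) (r : 'I_(2 * l').+1),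
    \sum_j B j * vdual P1 b (T j) * vdual P1 r (S j) = \sum_j c j * (b%:Z == z j)%:R * (r%:Z == w j)%:R.
Proof.
move=> h b r.
have h1 x' y' : \sum_j (B j * vdual P1 b (T j)) * ev (S j) x' y' =
    \sum_j (c j * (b%:Z == z j)%:R) * ev (vq R (2 * l') (w j)) x' y'.
  have e : \sum_j (B j * ev (S j) x' y') *: T j = \sum_j (c j * ev (vq R (2 * l') (w j)) x' y') *: vq R (2 * l) (z j).
    apply: ev_inj => x y; rewrite !ev_sum.
    under eq_bigr do rewrite evZ mulrAC. under [RHS]eq_bigr do rewrite evZ mulrAC.
    exact: h.
  have := congr1 (vdual P1 b) e; rewrite !vdual1_sum.
  under eq_bigr do rewrite mulrAC. under [in X in _ = X]eq_bigr do rewrite vdual1_vqz mulrAC.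
  by [].
have e : \sum_j (B j * vdual P1 b (T j)) *: S j = \sum_j (c j * (b%:Z == z j)%:R) *: vq R (2 * l') (w j).
  by apply: ev_inj => x y; rewrite !ev_sum; under eq_bigr do rewrite evZ; under [RHS]eq_bigr do rewrite evZ; exact: h1.
have := congr1 (vdual P1 r) e; rewrite !vdual1_sum.
by under [in X in _ = X]eq_bigr do rewrite vdual1_vqz.
Qed.

(** [Mc] with an integer second index, zero outside the range as v_c is. *)
Definition Mcz l (b : nat) (c : int) (x : 'M[R]_3) : C := vdual P1 b (tauK x (vq R (2 * l) c)).

(** Both sides are coefficients of one bihomogeneous form: the polarization at the transformed
    vectors, rewritten by invariance of the determinant under a matrix of determinant 1 and by
    [lprod_tau] for the other factor. *)
Lemma Bq_intertwines l l' n1 n2 q (b : 'I_(2 * l).+1) (r : 'I_5) (x : 'M[R]_3) :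
  (2 * l + n2 = 2 * l' + n1)%N -> (n1 + n2 = 4)%N -> (q <= 2 * l')%N -> SO3 x ->
  \sum_(j < 5) Bq n1 n2 (2 * l') q j * Mcz l b (q%:Z + n1%:Z - j%:Z) x * Mc 2 r j x
  = \sum_(q' < (2 * l').+1) Mc l' q' q x * Bq n1 n2 (2 * l') q' r * (b%:Z == q'%:Z + n1%:Z - r%:Z)%:R.
Proof.
move=> hL h4 hq /phi_lift[g hg <-].
have E1 j : Mcz l b (q%:Z + n1%:Z - j%:Z) (phi g) = vdual P1 b (tau g (vq R (2 * l) (q%:Z + n1%:Z - j%:Z))).
  by rewrite /Mcz; apply: congr1; exact: tauK_phi.
have E2 (j : nat) : Mc 2 r j (phi g) = vdual P1 r (tau g (vq R (2 * 2) j%:Z)).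
  by rewrite /Mc; apply: congr1; exact: tauK_phi.
under eq_bigr do rewrite E1 E2.
pose c (u : 'I_(2 * l').+1 * 'I_5) := Mc l' u.1 q (phi g) * Bq n1 n2 (2 * l') u.1 u.2.
have H := @bilinear_coef l 2 _ _ (fun j : 'I_5 => Bq n1 n2 (2 * l') q j)
  (fun j : 'I_5 => tau g (vq R (2 * l) (q%:Z + n1%:Z - j%:Z)))
  (fun j : 'I_5 => tau g (vq R (2 * 2) j%:Z)) c (fun u => u.1%:Z + n1%:Z - u.2%:Z) (fun u => u.2%:Z) _ b r.
apply: etrans (H _) _ => {H}.
  move=> x1 y1 x' y'.
  have F1 j := ev_tau g (vq R (2 * l) (q%:Z + n1%:Z - j%:Z)) x1 y1.
  have F2 (j : 'I_5) := etrans (ev_tau g (vq R (2 * 2) j%:Z) x' y') (ev_vq _ _ (ltn_ord j : (j <= 2 * 2)%N)).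
  transitivity (\sum_(j < 5) Bq n1 n2 (2 * l') q j *
      ev (vq R (2 * l) (q%:Z + n1%:Z - j%:Z)) (invmx g 0 0 * x1 + invmx g 0 1 * y1) (invmx g 1 0 * x1 + invmx g 1 1 * y1) *
      ((invmx g 0 0 * x' + invmx g 0 1 * y') ^+ j * (invmx g 1 0 * x' + invmx g 1 1 * y') ^+ (4 - j))).
    apply: eq_bigr => j _; move: (F1 j) (F2 j); move: (ev (tau _ _) x1 _) (ev (tau _ _) x' _) => u v -> ->.
    by [].
  rewrite (Bq_ev _ _ _ _ hL h4 hq).
  rewrite lprod_tau// coef_sum mulr_sumr.
  have -> : (invmx g 0 0 * x1 + invmx g 0 1 * y1) * (invmx g 1 0 * x' + invmx g 1 1 * y') -
   (invmx g 1 0 * x1 + invmx g 1 1 * y1) * (invmx g 0 0 * x' + invmx g 0 1 * y') = x1 * y' - y1 * x'.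
    by rewrite -[RHS]mul1r -(invmx_SU2_det hg); ring.
  rewrite -(pair_big xpredT xpredT (fun (a : 'I_(2 * l').+1) (d : 'I_5) => c (a, d) * ev (vq R (2 * l) (a%:Z + n1%:Z - d%:Z)) x1 y1 * ev (vq R (2 * 2) d%:Z) x' y')) /=.
  apply: eq_bigr => a _; have ha : (a <= 2 * l')%N by rewrite -ltnS.
  rewrite coefZ mulrCA -(Bq_ev _ _ _ _ hL h4 ha) mulr_sumr; apply: eq_bigr => d _.
  have -> : c (a, d) = Mc l' a q (phi g) * Bq n1 n2 (2 * l') a d by [].
  have hev := ev_vq x' y' (ltn_ord d : (d <= 2 * 2)%N).
  by rewrite hev !mulrA.
rewrite -(pair_big xpredT xpredT (fun (a : 'I_(2 * l').+1) (d : 'I_5) => c (a, d) * (b%:Z == a%:Z + n1%:Z - d%:Z)%:R * (r%:Z == d%:Z)%:R)) /=.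
apply: eq_bigr => a _; rewrite (bigD1 r)//= eqxx mulr1 big1 ?addr0// => d dr.
by rewrite (_ : (r%:Z == d%:Z) = false) ?mulr0//; apply: contraNF dr => /eqP[e]; apply/eqP/val_inj.
Qed.

(** As polynomial identities in q these hold for small q as well, where both sides vanish. *)
Lemma bin_poly (q : nat) : [/\ 'C(q, 0)%:R = 1 :> C, 'C(q, 1)%:R = q%:R :> C, 'C(q, 2)%:R = q%:R * (q%:R - 1) / 2 :> C,
   'C(q, 3)%:R = q%:R * (q%:R - 1) * (q%:R - 2) / 6 :> C & 'C(q, 4)%:R = q%:R * (q%:R - 1) * (q%:R - 2) * (q%:R - 3) / 24 :> C].
Proof.
elim: q => [|q [h0 h1 h2 h3 h4]]; first by rewrite !bin0n /=; split=> //; rewrite ?mul0r.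
rewrite !binS !natrD h0 h1 h2 h3 h4 -addn1 natrD; split=> //; try by field.
by rewrite bin0.
Qed.

End ClebschGordan.

(** * The coefficients A and the adjoint action on p_C *)

Section Coefficients.
Variable R : realType.
Notation C := R[i].

(** With m = n2 - 2, the listed polynomials are the polarization coefficients with the denominators
    of the binomials cleared by n2!. *)
Lemma acoef_Bq L N n1 n2 q j : (L + n2 = N + n1)%N -> (n1 + n2 = 4)%N -> (q <= N)%N -> (j < 5)%N ->
  (nth 0 (acoef L%:Z (n2%:Z - 2) q%:Z) j)%:~R = n2`!%:R * Bq R n1 n2 N q j :> C.
Proof.
move=> hL h4 hq hj; have eN : N = (q + (N - q))%N by lia.
rewrite /Bq; move: (N - q)%N eN => M eN; subst N.
have [a0 a1 a2 a3 a4] := bin_poly R q; have [b0 b1 b2 b3 b4] := bin_poly R M.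
have Lr : L%:~R = q%:R + M%:R + n1%:R - n2%:R :> C.
  by apply/eqP; rewrite eq_sym subr_eq -pmulrn -!natrD -hL.
have qr : q%:~R = q%:R :> C by rewrite -pmulrn.
have en1 : n1 = (4 - n2)%N by lia. subst n1.
have : (n2 < 5)%N by lia.
have c42 : 'C(4, 2) = 6%N by []. have c43 : 'C(4, 3) = 4%N by []. have c32 : 'C(3, 2) = 3%N by [].
have f0 : 0`! = 1%N by []. have f1 : 1`! = 1%N by []. have f2 : 2`! = 2%N by []. have f3 : 3`! = 6%N by []. have f4 : 4`! = 24%N by [].
move: Lr; clear - hj c42 c43 c32 f0 f1 f2 f3 f4 a0 a1 a2 a3 a4 b0 b1 b2 b3 b4 qr.
case: n2 => [|[|[|[|[|//]]]]] Lr _ /=; rewrite !big_ord_recl !big_ord0 /=;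
  case: j hj => [|[|[|[|[|//]]]]] _ /=.
all: rewrite ?subSS ?subn0 in Lr; rewrite /bump /= ?addn0 ?add1n ?subSS ?subn0 ?bin0 ?bin1 ?binn ?c42 ?c43 ?c32 ?f0 ?f1 ?f2 ?f3 ?f4 ?a0 ?a1 ?a2 ?a3 ?a4 ?b0 ?b1 ?b2 ?b3 ?b4.
all: by rewrite ?(rmorphM, rmorphD, rmorphB, rmorphN, rmorphXn) /= ?Lr ?qr; field.
Qed.

Lemma tr_Xp j : (j < 5)%N -> \tr (Xp R j) = 0.
Proof.
by case: j => [|[|[|[|[|//]]]]] _; rewrite /mxtrace sum3 !mxE /=; ring.
Qed.

Lemma Xp_sym j : (j < 5)%N -> (Xp R j)^T = Xp R j.
Proof. by case: j => [|[|[|[|[|//]]]]] _; apply: mx3P; rewrite !mxE. Qed.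

(** An isotropic vector of C^3, quadratic in (x, y); it transforms under [phi] (g) as (x, y) does
    under g^-1. *)
Definition uvec (x y : C) : 'rV[C]_3 :=
  \row_(a < 3) [:: 'i%C * x * y; (x ^+ 2 + y ^+ 2) / 2; - 'i%C * (x ^+ 2 - y ^+ 2) / 2]`_a.

(* [X_j |-> x^j y^(4-j)] identifies [p_C] with [V_4]: a symmetric matrix [Y] is sent to
   the quadratic form [u Y u^T], where [u] spans the highest weight vectors of [C^3 = V_2]. *)
Definition Qf (Y : 'M[C]_3) (x y : C) : C := (uvec x y *m Y *m (uvec x y)^T) 0 0.

Lemma QfE Y x y : Qf Y x y = \sum_b (\sum_a uvec x y 0 a * Y a b) * uvec x y 0 b.
Proof. by rewrite /Qf mxE; apply: eq_bigr => b _; rewrite !mxE. Qed.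

Lemma mulCii : 'i%C * 'i%C = -1 :> C. Proof. by rewrite -expr2 sqr_i. Qed.

Lemma Qf_Xp j x y : (j < 5)%N -> Qf (Xp R j) x y = x ^+ j * y ^+ (4 - j).
Proof.
have i2 := mulCii; case: j => [|[|[|[|[|//]]]]] _; by rewrite QfE !sum3 !mxE /=; field: i2.
Qed.

Definition Xcoord (Y : 'M[C]_3) (r : nat) : C :=
  nth 0 [:: ((Y i1 i1 - Y i2 i2) / 2 + 'i%C * Y i1 i2) / 2; 'i%C * Y i0 i1 - Y i0 i2;
            - 3 / 2 * Y i0 i0; 'i%C * Y i0 i1 + Y i0 i2; ((Y i1 i1 - Y i2 i2) / 2 - 'i%C * Y i1 i2) / 2] r.

Lemma Xcoord_expand (Y : 'M[C]_3) : Y^T = Y -> \tr Y = 0 -> Y = \sum_(r < 5) Xcoord Y r *: Xp R r.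
Proof.
move=> sY; rewrite /mxtrace sum3 => tY.
have s01 : Y i1 i0 = Y i0 i1 by rewrite -[in RHS]sY mxE.
have s02 : Y i2 i0 = Y i0 i2 by rewrite -[in RHS]sY mxE.
have s12 : Y i2 i1 = Y i1 i2 by rewrite -[in RHS]sY mxE.
have y22 : Y i2 i2 = - Y i0 i0 - Y i1 i1 by apply/eqP; rewrite -subr_eq0 opprD !opprK addrC tY.
have i2' := mulCii.
rewrite !big_ord_recl big_ord0 addr0.
apply: mx3P; rewrite !mxE /=.
all: rewrite /Xcoord /= ?s01 ?s02 ?s12 ?y22; by field: i2'.
Qed.

Lemma Qf_expand (Y : 'M[C]_3) x y : Y^T = Y -> \tr Y = 0 ->
  Qf Y x y = \sum_(r < 5) Xcoord Y r * (x ^+ r * y ^+ (4 - r)).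
Proof.
move=> sY tY; rewrite {1}(Xcoord_expand sY tY).
elim/big_rec2: _ => [|r u Z _ IH]; first by rewrite QfE !sum3 ![(0 : 'M[C]_3) _ _]mxE; ring.
rewrite -IH -(Qf_Xp _ _ (ltn_ord r)); move: (Xcoord Y r) (Xp R r) => c X.
have E a b : (c *: X + Z) a b = c * X a b + Z a b by rewrite !mxE.
by rewrite !QfE !sum3 !E; ring.
Qed.

(** Multiplying the row vector u by [phi] (g) gives u at the transformed point, by a computation in
    quaternion coordinates modulo i^2 = -1. *)
Lemma Qf_conj (g : 'M[C]_2) (Y : 'M[C]_3) x y : SU2 g ->
  Qf (cmx (phi g) *m Y *m (cmx (phi g))^T) x y =
  Qf Y (invmx g 0 0 * x + invmx g 0 1 * y) (invmx g 1 0 * x + invmx g 1 1 * y).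
Proof.
move=> /SU2P[p [q [r [s [e ->]]]]]; have [-> -> -> ->] := invmx_qmxE e.
have i2 := mulCii.
have CE (a b : R) : Complex a b = a%:C + 'i%C * b%:C.
  by apply/eqP; rewrite eq_complex /=; apply/andP; split; apply/eqP; ring.
set x' := (X in Qf Y X _); set y' := Qf Y x' _.
suff E : uvec x y *m cmx (phi (qmx p q r s)) = uvec x' (Complex r (- s) * x + Complex p q * y).
  rewrite /y' /Qf -E trmx_mul; congr (_ _ 0 0); rewrite !mulmxA //.
rewrite phi_qmx /x' (CE p (- q)) (CE (- r) (- s)) (CE r (- s)) (CE p q) {x' y'}.
apply/rowP => a; rewrite mxE sum3; case: a => [[|[|[|a]]]] ha //=; rewrite !mxE /=;
  rewrite ?(rmorphN, rmorphB, rmorphD, rmorphM, rmorphXn, rmorph_nat) /=;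
  move: p%:C q%:C r%:C s%:C => P Q S T; by field: i2.
Qed.

Lemma quartic_coef_inj (c c' : 'I_5 -> C) :
  (forall a b, \sum_(r < 5) c r * (a ^+ r * b ^+ (4 - r)) = \sum_(r < 5) c' r * (a ^+ r * b ^+ (4 - r))) ->
  forall r, c r = c' r.
Proof.
move=> h r.
have E (d : 'I_5 -> C) a b : ev (\sum_(j < 5) d j *: vq R (2 * 2) j%:Z) a b = \sum_(j < 5) d j * (a ^+ j * b ^+ (4 - j)).
  by rewrite ev_sum; apply: eq_bigr => j _; rewrite evZ (ev_vq a b (ltn_ord j : (j <= 2 * 2)%N)).
have e : \sum_(j < 5) c j *: vq R (2 * 2) j%:Z = \sum_(j < 5) c' j *: vq R (2 * 2) j%:Z.
  by apply: ev_inj => a b; rewrite !E.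
have h1 := @vdual1_coef R 2 _ c erefl r; have h2 := @vdual1_coef R 2 _ c' erefl r.
by rewrite -h1 -h2 e.
Qed.

(** The quartic form of the conjugate is x^j y^(4-j) at the transformed point, whose coefficients
    are the matrix coefficients of V_4; a symmetric traceless matrix is determined by its form. *)
Lemma conj_Xp (x : 'M[R]_3) j : SO3 x -> (j < 5)%N ->
  cmx x *m Xp R j *m (cmx x)^T = \sum_(r < 5) Mc 2 r j x *: Xp R r.
Proof.
move=> hx hj; have [xx _] := hx; have xTx := SO3_Tm hx; have [g hg eg] := phi_lift hx.
set Y := _ *m _ *m _.
have sY : Y^T = Y by rewrite /Y !trmx_mul trmxK Xp_sym// mulmxA.
have tY : \tr Y = 0.
  by rewrite /Y mxtrace_mulC mulmxA /cmx map_trmx -map_mxM xTx map_mx1 mul1mx tr_Xp.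
have hQ a b : \sum_(r < 5) Xcoord Y r * (a ^+ r * b ^+ (4 - r)) = \sum_(r < 5) Mc 2 r j x * (a ^+ r * b ^+ (4 - r)).
  rewrite -Qf_expand// /Y -eg Qf_conj// Qf_Xp//.
  by rewrite (@ev_tau_Mc R 2 g j a b).
have h := quartic_coef_inj hQ.
by rewrite {1}(Xcoord_expand sY tY); apply: eq_bigr => r _; rewrite (h r).
Qed.

(** The linear relation that absorbs X_1 and X_3 into the middle term. For L = 2 l, half of the
    factor on the right is l m - 3 + m (m + 1) / 2, the constant added to nu + rho in [gam0]. *)
Lemma acoef_main (L m a : int) : -2 <= m <= 2 ->
  3 * (a + 1) * (acoef L m (a + m))`_1 + 3 * (L - a + 1) * (acoef L m (a + m))`_3
  = (L * m - 6 + m * (m + 1)) * (acoef L m (a + m))`_2.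
Proof.
move=> hm; have [->|[->|[->|[->|->]]]] : m = -2 \/ m = -1 \/ m = 0 \/ m = 1 \/ m = 2 by lia.
all: by rewrite /acoef /=; ring.
Qed.

(** The effect of exchanging x and y, which multiplies the polarization by a sign. It matches the
    two terms of an elementary function. *)
Lemma acoef_sym (L m z : int) j : -2 <= m <= 2 -> (j < 5)%N ->
  (acoef L m (L + 2 * m - z))`_(4 - j) = (-1) ^+ absz m * (acoef L m z)`_j.
Proof.
move=> hm hj; have [->|[->|[->|[->|->]]]] : m = -2 \/ m = -1 \/ m = 0 \/ m = 1 \/ m = 2 by lia.
all: by case: j hj => [|[|[|[|[|//]]]]] _; rewrite /acoef /=; ring.
Qed.

Section FixedType.
Variables (l : nat) (m : int).
Hypothesis hm : -2 <= m <= 2.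
Hypothesis hlm : 0 <= l%:Z + m.
Notation l' := (lplus l m).
Notation A := (Acoef R (2 * l)%N%:Z m).

Lemma m_cases : m = -2 \/ m = -1 \/ m = 0 \/ m = 1 \/ m = 2.
Proof. by lia. Qed.

Lemma lplusE : l'%:Z = l%:Z + m.
Proof. by rewrite /lplus; lia. Qed.

Lemma Acoef_main (a : nat) : (a <= 2 * l)%N ->
  3 * (a.+1)%:R * A (a%:Z + m) 1 + 3 * ((2 * l - a).+1)%:R * A (a%:Z + m) 3
  = ((2 * l%:Z * m - 6 + m * (m + 1))%:~R) * A (a%:Z + m) 2.
Proof.
move=> ha; rewrite /Acoef; case: ifP => hr; last by rewrite !mulr0 addr0.
have := congr1 (intr : int -> C) (acoef_main (2 * l)%N%:Z a%:Z hm).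
rewrite rmorphD !(rmorphM _ _ (_`_ _)) /=.
have -> : 3 * (a%:Z + 1) = (3 * a.+1)%N%:Z by lia.
have -> : 3 * ((2 * l)%N%:Z - a%:Z + 1) = (3 * (2 * l - a).+1)%N%:Z by lia.
rewrite -!pmulrn !natrM -[(2 * l%:Z)]/((2 * l)%N%:Z) => h.
by rewrite !mulrA -mulrDl -h.
Qed.

Lemma Acoef_sym (z : int) j : (j < 5)%N -> A (2 * l'%:Z - z) (4 - j) = (-1) ^+ absz m * A z j.
Proof.
move=> hj; rewrite /Acoef lplusE.
have -> : (0 <= 2 * (l%:Z + m) - z <= (2 * l)%N%:Z + 2 * m) = (0 <= z <= (2 * l)%N%:Z + 2 * m) by lia.
case: ifP => hr; last by rewrite mulr0.
have -> : 2 * (l%:Z + m) = (2 * l)%N%:Z + 2 * m by lia.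
by rewrite acoef_sym// rmorphM rmorphXn rmorphN rmorph1 /= mulrA.
Qed.

(** At the ends a = 2 l and a = 0 of the range, the neighbour a + 1 or a - 1 of the weight a is
    missing; this lemma and the next show that the general formula stays correct there. *)
Lemma Acoef_edge1 : A ((2 * l)%N%:Z + m) 1 = 0.
Proof.
rewrite /Acoef; case: ifP => // hr; apply/eqP; rewrite mulf_eq0; apply/orP; left.
rewrite intr_eq0; apply/eqP.
by have [E|[E|[E|[E|E]]]] := m_cases; rewrite E in hr *; rewrite /acoef /=; try ring; lia.
Qed.

Lemma Acoef_edge3 : A m 3 = 0.
Proof.
rewrite /Acoef; case: ifP => // hr; apply/eqP; rewrite mulf_eq0; apply/orP; left.
rewrite intr_eq0; apply/eqP.
by have [E|[E|[E|[E|E]]]] := m_cases; rewrite E in hr *; rewrite /acoef /=; try ring; lia.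
Qed.

(* The component along [v_b (x) X_r] of [I(tau(x) v_q)], computed before and after
   [I]; by weights a single term survives on the right. *)
Lemma Acoef_CG q (b : 'I_(2 * l).+1) (r : 'I_5) (x : 'M[R]_3) : (q <= 2 * l')%N -> SO3 x ->
  \sum_(j < 5) A q%:Z j * Mcz l b (q%:Z + 2 - m - j%:Z) x * Mc 2 r j x
  = A (b%:Z - 2 + m + r%:Z) r * Mc l' (absz (b%:Z - 2 + m + r%:Z)) q x.
Proof.
move=> hq hx; have el := lplusE.
pose n2 := absz (m + 2); pose n1 := absz (2 - m).
have en2 : n2%:Z = m + 2 by rewrite /n2; lia.
have en1 : n1%:Z = 2 - m by rewrite /n1; lia.
have hL : (2 * l + n2 = 2 * l' + n1)%N by lia.
have h4 : (n1 + n2 = 4)%N by lia.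
pose d : C := (dcoef (2 * l)%N%:Z m)%:~R.
have AE q' (j : 'I_5) : (q' <= 2 * l')%N -> A q'%:Z j = n2`!%:R / d * Bq R n1 n2 (2 * l') q' j.
  move=> hq'; rewrite /Acoef (_ : (0 <= _ <= _)); last by lia.
  have -> : m = n2%:Z - 2 by lia.
  rewrite (acoef_Bq hL h4 hq' (ltn_ord j)) /d.
  have -> : n2%:Z - 2 = m by lia.
  by rewrite mulrAC.
transitivity (n2`!%:R / d * \sum_(j < 5) Bq R n1 n2 (2 * l') q j * Mcz l b (q%:Z + n1%:Z - j%:Z) x * Mc 2 r j x).
  rewrite mulr_sumr; apply: eq_bigr => j _; rewrite (AE q j hq) !mulrA.
  by rewrite (_ : q%:Z + 2 - m - j%:Z = q%:Z + n1%:Z - j%:Z)//; lia.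
rewrite (Bq_intertwines b r hL h4 hq hx).
set z := b%:Z - 2 + m + r%:Z.
have [/andP[z0 zl]|hz] := boolP (0 <= z <= (2 * l)%N%:Z + 2 * m); last first.
  rewrite /Acoef (negPf hz) mul0r big1 ?mulr0// => q' _.
  rewrite (_ : (b%:Z == _) = false) ?mulr0//; apply: contraNF hz => /eqP e; rewrite /z.
  by have := ltn_ord q'; lia.
have zq : (absz z < (2 * l').+1)%N by lia.
rewrite (bigD1 (Ordinal zq))//= big1 ?addr0; last first.
  move=> q' hq'; rewrite (_ : (b%:Z == _) = false) ?mulr0//; apply: contraNF hq' => /eqP e.
  by apply/eqP/val_inj => /=; rewrite /z; lia.
rewrite (_ : (b%:Z == _) = true) ?mulr1; last by apply/eqP; rewrite /z in z0 *; lia.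
have ez : z = (absz z)%:Z by lia.
rewrite [in RHS]ez [in A _ _]ez AE// [Mc _ _ _ _ * _]mulrC mulrA.
by [].
Qed.

End FixedType.

End Coefficients.

(** * The operators [Gam] on the elementary functions *)

Lemma scale_regroup (C : comPzRingType) (V : lmodType C) (I J : finType) (A B : J -> C) (M : I -> J -> C)
    (d : I -> C) (a : I) (u w : V) :
  \sum_j (A j * B j) *: ((\sum_e d e * M e j) *: u + M a j *: w)
  = (\sum_e d e * \sum_j A j * M e j * B j) *: u + (\sum_j A j * M a j * B j) *: w.
Proof.
have -> : \sum_e d e * (\sum_j A j * M e j * B j) = \sum_j (A j * B j) * \sum_e d e * M e j.
  under eq_bigr do rewrite mulr_sumr. under [RHS]eq_bigr do rewrite mulr_sumr.
  by rewrite exchange_big /=; apply: eq_bigr => j _; apply: eq_bigr => e _; ring.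
rewrite !scaler_suml -big_split /=; apply: eq_bigr => j _.
by rewrite scalerDr !scalerA; congr (_ + _ *: _); ring.
Qed.

Lemma family_term (C : comPzRingType) (V : lmodType C) (z c M S : C) (u w : V) :
  (z * (c * M) + (0 * M + c * S)) *: u + (c * M) *: w = c *: (S *: u + M *: (z *: u + w)).
Proof.
by rewrite !scalerDr !scalerA [RHS]addrA -[in RHS]scalerDl; congr (_ *: _ + _); ring.
Qed.

Lemma two_by_three (C : comPzRingType) (V : lmodType C) (s c x0 x1 x2 y0 y1 y2 : C) (u0 u1 u2 v0 v1 v2 : V) :
  s *: (1 *: (x2 *: u2 + x1 *: u1 + x0 *: u0) + c *: (y0 *: v0 + y1 *: v1 + y2 *: v2))
  = ((s * x0) *: u0 + (s * (c * y0)) *: v0) + ((s * x1) *: u1 + (s * (c * y1)) *: v1)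
    + ((s * x2) *: u2 + (s * (c * y2)) *: v2).
Proof.
rewrite scale1r !scalerDr !scalerA [RHS](AC ((2*2)*2) ((5*3*1)*(2*4*6)))/=.
by congr (_ + _ + _ + (_ + _ + _)); congr (_ *: _); ring.
Qed.

Lemma triple_exchange (C : comPzRingType) (V : lmodType C) (I J K : finType) (s : C) (A : J -> C)
    (M : I -> J -> C) (c : K -> C) (v : K -> J -> I -> V) :
  \sum_j A j *: (s *: \sum_r M r j *: \sum_b c b *: v b j r)
  = s *: \sum_b c b *: \sum_r \sum_j (A j * M r j) *: v b j r.
Proof.
transitivity (\sum_j \sum_r \sum_b (s * (c b * (A j * M r j))) *: v b j r).
  apply: eq_bigr => j _; rewrite !scaler_sumr; apply: eq_bigr => r _.
  by rewrite !scaler_sumr; apply: eq_bigr => b _; rewrite !scalerA; congr (_ *: _); ring.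
under eq_bigr do rewrite exchange_big /=.
rewrite exchange_big /= scaler_sumr; apply: eq_bigr => b _.
rewrite exchange_big /= !scaler_sumr; apply: eq_bigr => r _.
by rewrite !scaler_sumr; apply: eq_bigr => j _; rewrite !scalerA !mulrA.
Qed.

Lemma sum2n (V : nmodType) (F : nat -> V) : \sum_(r < 2) F r = F 0%N + F 1%N.
Proof. by rewrite !big_ord_recl big_ord0 addr0. Qed.

Lemma sum3n (V : nmodType) (F : nat -> V) : \sum_(r < 3) F r = F 0%N + F 1%N + F 2%N.
Proof. by rewrite !big_ord_recl big_ord0 addr0 addrA. Qed.

Lemma sum5 (V : nmodType) (F : nat -> V) : \sum_(r < 5) F r = F 0%N + F 1%N + F 2%N + F 3%N + F 4%N.
Proof. by rewrite !big_ord_recl big_ord0 addr0 !addrA. Qed.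

Section ShiftOnK.
Variables (R : realType) (i : parabolic) (nu : R[i]) (k : nat) (sigma : discrete_series R k).
Variables (l : nat) (m : int).
Hypothesis hm : -2 <= m <= 2.
Hypothesis hlm : 0 <= l%:Z + m.
Notation C := R[i].
Notation l' := (lplus l m).
Notation A := (Acoef R (2 * l)%N%:Z m).

(** [SpartC] vanishes on X_0, X_2 and X_4, while X_1 and X_3 act through K and relate neighbouring
    weights. *)
Lemma dMc_Xp (a e r : nat) : (e <= 2 * l)%N -> (r < 5)%N -> dMc l a e (SpartC (Xp R r)) =
  nth 0 [:: 0; - (e%:R / 2) * (a.+1 == e)%:R; 0; - ((2 * l - e)%:R / 2) * (a == e.+1)%:R; 0] r.
Proof.
have i2 := mulCii R.
by case: r => [|[|[|[|[|//]]]]] he _; rewrite /dMc /lfirst /SpartC !mxE /=; field: i2.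
Qed.

(** The part of the derivative along X_r that goes through A and M, for a term with vector chi_n;
    the part through K is in [dMc]. *)
Definition wgt (r : nat) (n : int) : sigma := ((nu + rho R) * (Xp R r i0 i0 / 2)) *: ds_chi sigma n
  + (((Xp R r i1 i1 - Xp R r i2 i2) / 2) *: chiH sigma n + ((Xp R r i1 i2 + Xp R r i2 i1) / 2) *: chiE sigma n).

Lemma wgtE (r : nat) n : wgt r n = ((nu + rho R) * (Xp R r i0 i0 / 2)) *: ds_chi sigma n
  + (((Xp R r i1 i1 - Xp R r i2 i2) / 2 - 'i%C * ((Xp R r i1 i2 + Xp R r i2 i1) / 2)) / 2 * (k%:Z + n)%:~R) *: ds_chi sigma (n + 2)
  + (((Xp R r i1 i1 - Xp R r i2 i2) / 2 + 'i%C * ((Xp R r i1 i2 + Xp R r i2 i1) / 2)) / 2 * (k%:Z - n)%:~R) *: ds_chi sigma (n - 2).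
Proof.
have hh : (2 * 'i%C)^-1 = - ('i%C / 2) :> C.
  have i2 := mulCii R; have i0 : ('i%C : C) != 0.
    by apply/eqP => e0; move: i2; rewrite e0 mul0r => /esym/eqP; rewrite oppr_eq0 oner_eq0.
  have h20 : 2 * 'i%C != 0 :> C by rewrite mulf_neq0// pnatr_eq0.
  by apply: (mulfI h20); rewrite mulfV//; field: i2.
rewrite /wgt /chiH /chiE hh -addrA; congr (_ + _).
move: ((k%:Z + n)%:~R) ((k%:Z - n)%:~R) (ds_chi sigma (n + 2)) (ds_chi sigma (n - 2)) => a b P M.
move: ((Xp R r i1 i1 - Xp R r i2 i2) / 2) ((Xp R r i1 i2 + Xp R r i2 i1) / 2) => u v.
rewrite !scalerDr !scalerN !scalerA addrACA -scalerDl -scalerBl.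
by congr (_ *: _ + _ *: _); field.
Qed.

(** The source of the factors in gamma: X_0 lowers and X_4 raises n by 2 with the coefficients of
    x_- and x_+, X_2 acts by - (nu + rho) / 3. *)
Lemma wgt_Xp (r : nat) n : (r < 5)%N -> wgt r n =
  nth 0 [:: (k%:Z - n)%:~R *: ds_chi sigma (n - 2); 0; (- ((nu + rho R) / 3)) *: ds_chi sigma n; 0;
     (k%:Z + n)%:~R *: ds_chi sigma (n + 2)] r.
Proof.
have i2 := mulCii R.
have H (a b c a' b' c' : C) (u P M : sigma) : a = a' -> b = b' -> c = c' ->
   a *: u + b *: P + c *: M = a' *: u + b' *: P + c' *: M by move=> -> -> ->.
rewrite wgtE => hr; move: (ds_chi sigma n) (ds_chi sigma (n + 2)) (ds_chi sigma (n - 2)) => u P M.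
move: ((k%:Z + n)%:~R) ((k%:Z - n)%:~R) => a b; move: (nu + rho R) => z.
transitivity (nth 0 [:: 0; 0; - (z / 3); 0; 0] r *: u + nth 0 [:: 0; 0; 0; 0; a] r *: P + nth 0 [:: b; 0; 0; 0; 0] r *: M).
  by apply: H; case: r hr => [|[|[|[|[|//]]]]] _; rewrite !mxE /=; field: i2.
by case: r hr => [|[|[|[|[|//]]]]] _; rewrite /= !scale0r ?addr0 ?add0r.
Qed.

Definition shift_term (a : nat) (c : int) (x : 'M[R]_3) (r : nat) : sigma :=
  (\sum_(e < (2 * l).+1) dMc l a e (SpartC (Xp R r)) * Mcz l e c x) *: ds_chi sigma (a%:Z - l%:Z)
  + Mcz l a c x *: wgt r (a%:Z - l%:Z).

(** By [Acoef_CG] the sum over j collapses to one value of A times one matrix coefficient of V_2l'.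
    Over r, the terms 0, 2, 4 act on chi, and 1, 3 join the term 2 through [Acoef_main]. *)
Lemma shift_value q (a : nat) (x : 'M[R]_3) : (a <= 2 * l)%N -> (q <= 2 * l')%N -> SO3 x ->
  let n : int := a%:Z - l%:Z in let z : int := a%:Z + m in
  \sum_(r < 5) \sum_(j < 5) (A q%:Z j * Mc 2 r j x) *: shift_term a (q%:Z + 2 - m - j%:Z) x r
  = ((k%:Z - n)%:~R * (A (z - 2) 0 * Mc l' (absz (z - 2)) q x)) *: ds_chi sigma (n - 2)
  + (- ((nu + rho R + (l%:Z * m)%:~R - 3 + (m * (m + 1))%:~R / 2) / 3) * (A z 2 * Mc l' (absz z) q x)) *: ds_chi sigma n
  + ((k%:Z + n)%:~R * (A (z + 2) 4 * Mc l' (absz (z + 2)) q x)) *: ds_chi sigma (n + 2).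
Proof.
move=> ha hq hx n z.
pose S (r e : nat) := A (e%:Z - 2 + m + r%:Z) r * Mc l' (absz (e%:Z - 2 + m + r%:Z)) q x.
transitivity (\sum_(r < 5) ((\sum_(e < (2 * l).+1) dMc l a e (SpartC (Xp R r)) * S r e) *: ds_chi sigma n
    + S r a *: wgt r n)).
  apply: eq_bigr => r _.
  have E (e : 'I_(2 * l).+1) : S r e = \sum_(j < 5) A q%:Z j * Mcz l e (q%:Z + 2 - m - j%:Z) x * Mc 2 r j x.
    by apply: esym; exact: Acoef_CG.
  rewrite (E (Ordinal (ha : (a < (2 * l).+1)%N))) /=; under [in X in _ = X]eq_bigr do rewrite E.
  exact: (scale_regroup (fun j : 'I_5 => A q%:Z j) (fun j : 'I_5 => Mc 2 r j x)
    (fun (e : 'I_(2 * l).+1) (j : 'I_5) => Mcz l e (q%:Z + 2 - m - j%:Z) x) _ (Ordinal (ha : (a < (2 * l).+1)%N))).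
have ez (r e : nat) : e%:Z - 2 + r%:Z = a%:Z -> S r e = A z r * Mc l' (absz z) q x.
  by move=> h; rewrite /S (_ : e%:Z - 2 + m + r%:Z = z)// /z; lia.
have d0 (r : nat) : (r < 5)%N -> nth true [:: true; false; true; false; true] r ->
    \sum_(e < (2 * l).+1) dMc l a e (SpartC (Xp R r)) * S r e = 0.
  move=> hr h; apply: big1 => e _; have he : (e <= 2 * l)%N by rewrite -ltnS.
  by rewrite dMc_Xp//; case: r hr h => [|[|[|[|[|//]]]]] //= _ _; rewrite mul0r.
(* Only e = a + 1 contributes; for a = 2 l there is no such e, and the right side vanishes by
   [Acoef_edge1]. *)
have d1 : \sum_(e < (2 * l).+1) dMc l a e (SpartC (Xp R 1)) * S 1%N e
    = - (a.+1%:R / 2) * (A z 1 * Mc l' (absz z) q x).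
  have [al|al] := ltnP a (2 * l).
    have al' : (a.+1 < (2 * l).+1)%N by [].
    rewrite (bigD1 (Ordinal al'))//= big1 ?addr0; last first.
      move=> e ea; have he : (e <= 2 * l)%N by rewrite -ltnS.
      rewrite dMc_Xp//= (_ : (a.+1 == e) = false) ?mulr0 ?mul0r//.
      by apply: contraNF ea => /eqP h; apply/eqP/val_inj.
    by rewrite dMc_Xp//= eqxx mulr1 ez//; lia.
  rewrite big1; last first.
    move=> e _; have he : (e <= 2 * l)%N by rewrite -ltnS.
    by rewrite dMc_Xp//= (_ : (a.+1 == e) = false) ?mulr0 ?mul0r//; apply/eqP => h; lia.
  have -> : z = (2 * l)%N%:Z + m by rewrite /z; lia.
  by rewrite Acoef_edge1// mul0r mulr0.
have d3 : \sum_(e < (2 * l).+1) dMc l a e (SpartC (Xp R 3)) * S 3%N e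
    = - ((2 * l - a).+1%:R / 2) * (A z 3 * Mc l' (absz z) q x).
  have [al|al] := ltnP 0 a.
    have al' : (a.-1 < (2 * l).+1)%N by lia.
    rewrite (bigD1 (Ordinal al'))//= big1 ?addr0; last first.
      move=> e ea; have he : (e <= 2 * l)%N by rewrite -ltnS.
      rewrite dMc_Xp//= (_ : (a == e.+1 :> nat) = false) ?mulr0 ?mul0r//.
      by apply: contraNF ea => /eqP h; apply/eqP/val_inj; rewrite /= h.
    rewrite dMc_Xp//=.
    rewrite prednK// eqxx mulr1 ez//; last by lia.
    by congr (- (_%:R / _) * _); lia.
  rewrite big1; last first.
    move=> e _; have he : (e <= 2 * l)%N by rewrite -ltnS.
    by rewrite dMc_Xp//= (_ : (a == e.+1 :> nat) = false) ?mulr0 ?mul0r//; apply/eqP => h; lia.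
  have -> : z = m by rewrite /z; lia.
  by rewrite Acoef_edge3// mul0r mulr0.
have S0 : S 0%N a = A (z - 2) 0 * Mc l' (absz (z - 2)) q x.
  by rewrite /S (_ : a%:Z - 2 + m + 0%N%:Z = z - 2)// /z; lia.
have S4 : S 4%N a = A (z + 2) 4 * Mc l' (absz (z + 2)) q x.
  by rewrite /S (_ : a%:Z - 2 + m + 4%N%:Z = z + 2)// /z; lia.
have H := Acoef_main R hm hlm ha; rewrite -/z in H.
pose T r := \sum_(e < (2 * l).+1) dMc l a e (SpartC (Xp R r)) * S r e.
rewrite (sum5 (fun r => T r *: ds_chi sigma n + S r a *: wgt r n)) !wgt_Xp//=.
rewrite {}/T (d0 0%N)// d1 (d0 2%N)// d3 (d0 4%N)// S0 (ez 2%N a) ?S4; last by lia.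
move: (Mc l' (absz (z - 2)) q x) (Mc l' (absz z) q x) (Mc l' (absz (z + 2)) q x).
move: (ds_chi sigma (n - 2)) (ds_chi sigma n) (ds_chi sigma (n + 2)).
move: (A z 1) (A z 2) (A z 3) H (A (z - 2) 0) (A (z + 2) 4) => A1 A2 A3 H A0 A4 c0 c1 c2 M0 M1 M2.
rewrite !scaler0 !scale0r !add0r !addr0 !scalerA -[in LHS]addrA -[in LHS]addrA.
rewrite [in LHS](AC (1*1*(1*(1*1)))%AC (1*(2*3*4)*5)%AC) /= -!scalerDl.
congr (_ *: _ + _ *: _ + _ *: _); [exact: mulrC| |exact: mulrC].
transitivity (- (3 * a.+1%:R * A1 + 3 * (2 * l - a).+1%:R * A3) / 6 * M1 - (nu + rho R) / 3 * (A2 * M1)).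
  by field.
by rewrite H !rmorphD rmorphN /= !rmorphM /=; field.
Qed.

(** The two terms of an elementary function as a family over b = 0, 1: [tidx] gives their indices,
    [tsgn] their signs. *)
Definition tidx p (b : nat) : nat := nth 0%N [:: (2 * l - p)%N; p] b.
Definition tsgn p (b : nat) : C := nth 0 [:: 1; csign R i l p] b.

Lemma tsh_sum2 p q x : (p <= 2 * l)%N -> tsh sigma i l p q x =
  \sum_(b < 2) (tsgn p b * Mc l (tidx p b) q x) *: ds_chi sigma ((tidx p b)%:Z - l%:Z).
Proof.
move=> hp; rewrite !big_ord_recl big_ord0 addr0 /tsh /tidx /tsgn /= mul1r.
by rewrite (_ : (2 * l - p)%N%:Z - l%:Z = l%:Z - p%:Z)//; lia.
Qed.

Lemma ltn_tidx p (b : 'I_2) : (p <= 2 * l)%N -> (tidx p b < (2 * l).+1)%N.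
Proof. by case: b => [[|[|b]]] hb //= hp; rewrite /tidx /=; lia. Qed.

Lemma XiC_Xp j : (j < 5)%N -> XiC i (Xp R j) = (-1) ^+ (pnum i).+1 *: Xp R j.
Proof.
move=> hj; rewrite /XiC; case: i => /=; first by rewrite sqrrN expr1n scale1r.
by rewrite Xp_sym// -signr_odd /= expr1 scaleN1r.
Qed.

Lemma Mcz_out b c x : SO3 x -> ~~ (0 <= c <= (2 * l)%N%:Z) -> Mcz l b c x = 0 :> C.
Proof.
move=> hx hc; rewrite /Mcz vq_out//.
by apply: etrans (congr1 (vdual P1 b) (tauK0 l hx)) _; rewrite /vdual linear0.
Qed.

Variables (mu : haar_SO3 R) (pi : principal_series i nu sigma mu).

(** Zero outside the range, following the convention v_q = 0 for the entries of a vector. *)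
Definition t_elz p (c : int) : pi := if 0 <= c <= (2 * l)%N%:Z then t_el pi l p (absz c) else 0.

(** The sign (-1)^(i+1) of the gammas arises here: for P_2, inverse transpose turns the symmetric
    X_j into - X_j. *)
Lemma cdact_t_elz p (c : int) j : (exists a, l = (k + p + 2 * a)%N) -> (j < 5)%N ->
  exists G, [/\ ind1 nu i G, cdact (ps_act pi) (Xp R j) (t_elz p c) = inclI pi G &
    forall x, SO3 x -> G x = (-1) ^+ (pnum i).+1 *: \sum_(r < 5) Mc 2 r j x *:
      \sum_(b < 2) tsgn p b *: shift_term (tidx p b) c x r].
Proof.
move=> hp hj; rewrite /t_elz; case: ifP => hc; last first.
  exists (fun=> 0); split; first exact: ind1_0.
    by rewrite cdact0 ?inclI_0//; exact: tr_Xp.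
  move=> x hx; rewrite big1 ?scaler0// => r _; rewrite big1 ?scaler0// => b _.
  rewrite /shift_term Mcz_out ?hc// scale0r addr0 big1 ?scale0r ?scaler0// => e _.
  by rewrite Mcz_out ?hc// mulr0.
case: c hc => [q|q] hc; last by lia.
have hq : (q <= 2 * l)%N by lia.
have hp2 : (p <= 2 * l)%N by have := ltn_p hp; lia.
have [F hF FK] := @tsh_extends R k sigma i l p q hp hq nu.
rewrite (t_elE pi hp hq hF FK).
pose e (b : 'I_2) : int := (tidx p b)%:Z - l%:Z.
have he b : chi_index k (e b).
  have [c1 c2] := chi_lp hp; rewrite /e; case: b => [[|[|b]]] hb //=.
  by rewrite /tidx /= (_ : (2 * l - p)%N%:Z - l%:Z = l%:Z - p%:Z)//; lia.
have hexp (b : 'I_2) := isExpM (isExp_cst (tsgn p b)) (isExp_Mc R (Ordinal (ltn_tidx b hp2)) (Ordinal (hq : (q < (2 * l).+1)%N))).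
have FK' x : SO3 x -> F x = \sum_(b < 2) (tsgn p b * Mc l (tidx p b) q x) *: ds_chi sigma (e b).
  by move=> hx; rewrite FK// tsh_sum2.
have [G [hG eG GK]] := cdact_incl pi he hexp hF FK' (tr_Xp R hj).
exists G; split=> // x hx; rewrite GK// XiC_Xp// -scalemxAr -scalemxAl conj_Xp//.
have LL a X Y := @Lder_lin R k sigma nu _ _ _ e hexp a X Y x hx.
move: LL; set L := Lder _ _ _ _ _ => LL.
have L0 : L 0 x = 0 by have := LL (-1) 0 0; rewrite scaler0 addr0 scaleN1r addNr.
have LZ a X : L (a *: X) x = a *: L X x by have := LL a X 0; rewrite L0 !addr0.
have Lsum (d : 'I_5 -> C) (X : 'I_5 -> 'M[C]_3) : L (\sum_r d r *: X r) x = \sum_r d r *: L (X r) x.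
  by elim/big_rec2: _ => // r u v _ <-; rewrite LL.
rewrite LZ Lsum; congr (_ *: _); apply: eq_bigr => r _; congr (_ *: _).
rewrite /L /Lder; apply: eq_bigr => b _; rewrite /shift_term /wgt.
exact: family_term.
Qed.

(** For P_1 the parity of p changes with m, for P_2 that of l; either way c_i is multiplied by
    (-1)^m, the sign of [Acoef_sym]. *)
Lemma csign_shift p p' (t : int) : p'%:Z = p%:Z + m + 2 * t -> csign R i l' p' = (-1) ^+ absz m * csign R i l p.
Proof.
move=> h; have el := lplusE hm hlm; rewrite /csign; case: i; rewrite -exprD -[LHS]signr_odd -[RHS]signr_odd; congr (_ ^+ (nat_of_bool _)); lia.
Qed.

(** The contributions of the two terms to one target p' = p + m + 2 t recombine into an elementary
    function, the signs of [Acoef_sym] and [csign_shift] cancelling. Where p' is out of range A is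
    0, so the absolute values do no harm. *)
Lemma shift_piece p q (j : nat) (t w : int) (d : C) x : (j < 5)%N -> w = 2 * l'%:Z - (p%:Z + m + 2 * t) ->
  let p' : int := p%:Z + m + 2 * t in
  (d * (A w j * Mc l' (absz w) q x)) *: ds_chi sigma (w - l'%:Z)
    + (d * (csign R i l p * (A p' (4 - j) * Mc l' (absz p') q x))) *: ds_chi sigma (p' - l'%:Z)
  = (d * A w j) *: tsh sigma i l' (absz p') q x.
Proof.
move=> hj hw p'; have el := lplusE hm hlm.
have -> : A p' (4 - j) = (-1) ^+ absz m * A w j.
  by rewrite -(Acoef_sym R hm hlm _ hj); congr (Acoef _ _ _ _ _); lia.
have [hr|hr] := boolP (0 <= w <= (2 * l)%N%:Z + 2 * m); last first.
  have -> : A w j = 0 by rewrite /Acoef (negPf hr).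
  by rewrite !(mulr0, mul0r, scale0r) addr0.
have ep : (absz p')%:Z = p' by lia.
rewrite /tsh (csign_shift (t := t) ep).
have -> : absz w = (2 * l' - absz p')%N by lia.
have -> : w - l'%:Z = l'%:Z - (absz p')%:Z by lia.
rewrite ep scalerDr !scalerA.
move: (Mc l' (2 * l' - absz p') q x) (Mc l' (absz p') q x) => M N.
by congr (_ *: _ + _ *: _); ring.
Qed.

Lemma gam_ind q p' (g : C) : (q <= 2 * l')%N -> g = 0 \/ (exists a, l' = (k + p' + 2 * a)%N) ->
  exists F, [/\ ind1 nu i F, g *: t_el pi l' p' q = inclI pi F & forall x, SO3 x -> F x = g *: tsh sigma i l' p' q x].
Proof.
move=> hq [->|hp].
  by exists (fun=> 0); split; [exact: ind1_0 | rewrite scale0r inclI_0 | move=> x _; rewrite scale0r].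
have [F hF FK] := @tsh_extends R k sigma i l' p' q hp hq nu.
exists (fun x => g *: F x + 0); split; first exact: (ind1_lin g hF (ind1_0 _ _ _)).
  by rewrite (inclI_lin pi g hF (ind1_0 _ _ _)) inclI_0 addr0 (t_elE pi hp hq hF FK).
by move=> x hx; rewrite addr0 FK.
Qed.

(** Numbered by the shift downwards: t = 0, 1, 2 leads from p to p + m - 2, p + m, p + m + 2. *)
Definition gam p (t : nat) : C := nth 0 [:: gamN1 R i k l m p; gam0 i nu l m p; gam1 R i k l m p] t.

(* Below the range, [A] vanishes by its range of indices; above it, only [gam1] can
   occur, and then [p = l - k], so that its factor [k - l + p] vanishes. *)
Lemma gam_range p t : (exists a, l = (k + p + 2 * a)%N) -> (t < 3)%N ->
  gam p t = 0 \/ (0 <= p%:Z + m + 2 * (t%:Z - 1) /\ exists a, l' = (k + absz (p%:Z + m + 2 * (t%:Z - 1))%R + 2 * a)%N).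
Proof.
move=> [a ha] ht; have el := lplusE hm hlm.
have [->|h] := eqVneq (gam p t) 0; [by left | right].
suff [h1 h2] : p%:Z + m + 2 * (t%:Z - 1) <= l'%:Z - k%:Z /\ 0 <= p%:Z + m + 2 * (t%:Z - 1).
  (* l' - k - p' is l - k - p diminished by 2 (t - 1). *)
  by split=> //; exists (a + 1 - t)%N; lia.
case: t ht h => [|[|[|//]]] _; rewrite /gam /= /gamN1 /gam0 /gam1 /Acoef => h.
- split; first by lia.
  by move: h; case: ifP => [?|]; [lia | rewrite mulr0 eqxx].
- split; first by lia.
  by move: h; case: ifP => [?|]; [lia | rewrite mulr0 eqxx].
- split; last by move: h; case: ifP => [?|]; [lia | rewrite mulr0 eqxx].
  case: a ha => [|a] ha; last by lia.
  by move: h; rewrite (_ : k%:Z - l%:Z + p%:Z = 0) ?mulr0 ?mul0r ?eqxx//; lia.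
Qed.

Lemma C_entry p q : (exists a, l = (k + p + 2 * a)%N) -> (q <= 2 * l')%N ->
  \sum_(j < 5) A q%:Z j *: cdact (ps_act pi) (Xp R j) (t_elz p (q%:Z + 2 - m - j%:Z))
  = \sum_(t < 3) gam p t *: t_el pi l' (absz (p%:Z + m + 2 * (t%:Z - 1))%R) q.
Proof.
move=> hp hq; have el := lplusE hm hlm.
have /choice[G hG] : forall j : 'I_5, exists G, [/\ ind1 nu i G, cdact (ps_act pi) (Xp R j) (t_elz p (q%:Z + 2 - m - j%:Z)) = inclI pi G &
    forall x, SO3 x -> G x = (-1) ^+ (pnum i).+1 *: \sum_(r < 5) Mc 2 r j x *:
      \sum_(b < 2) tsgn p b *: shift_term (tidx p b) (q%:Z + 2 - m - j%:Z) x r].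
  by move=> j; exact: cdact_t_elz.
have /choice[F hF] : forall t : 'I_3, exists F, [/\ ind1 nu i F, gam p t *: t_el pi l' (absz (p%:Z + m + 2 * (t%:Z - 1))%R) q = inclI pi F &
   forall x, SO3 x -> F x = gam p t *: tsh sigma i l' (absz (p%:Z + m + 2 * (t%:Z - 1))%R) q x].
  move=> t; apply: gam_ind => //.
  by have [h|[_ h]] := gam_range hp (ltn_ord t); [left|right].
under eq_bigr => j _ do rewrite (let: And3 _ e _ := hG j in e).
under [RHS]eq_bigr => t _ do rewrite (let: And3 _ e _ := hF t in e) -[inclI _ _]scale1r.
rewrite -!inclI_sum; try by move=> j; have [] := hG j.
  2: by move=> j; have [] := hF j.
apply: inclI_ext.
- by apply: ind1_sum => j; have [] := hG j.
- by apply: (ind1_sum (index_enum 'I_3) (fun=> 1)) => j; have [] := hF j.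
move=> x hx.
under eq_bigr => j _ do rewrite (let: And3 _ _ e := hG j in e x hx).
under [RHS]eq_bigr => t _ do rewrite (let: And3 _ _ e := hF t in e x hx) scale1r.
transitivity ((-1) ^+ (pnum i).+1 *: \sum_(b < 2) tsgn p b *:
    \sum_(r < 5) \sum_(j < 5) (A q%:Z j * Mc 2 r j x) *: shift_term (tidx p b) (q%:Z + 2 - m - j%:Z) x r).
  exact: (triple_exchange _ (fun j : 'I_5 => A q%:Z j) (fun r j : 'I_5 => Mc 2 r j x) (fun b : 'I_2 => tsgn p b)
    (fun (b : 'I_2) (j r : 'I_5) => shift_term (tidx p b) (q%:Z + 2 - m - j%:Z) x r)).
have hp2 : (p <= 2 * l)%N by have := ltn_p hp; lia.
set s : C := (-1) ^+ (pnum i).+1; set kap := csign R i l p.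
(* The index 2 l' - p' for the target p' = p + m + 2 t. [shift_value] at 2 l - p yields the terms of
   index w, at p those of index p'; [P0], [P1], [P2] pair them. *)
pose w (t : int) : int := 2 * l'%:Z - (p%:Z + m + 2 * t).
have P0 := @shift_piece p q 4 (-1) (w (-1)) (s * (k%:Z + l%:Z - p%:Z)%:~R) x erefl erefl.
have P1 := @shift_piece p q 2 0 (w 0) (s * - ((nu + rho R + (l%:Z * m)%:~R - 3 + (m * (m + 1))%:~R / 2) / 3)) x erefl erefl.
have P2 := @shift_piece p q 0 1 (w 1) (s * (k%:Z - l%:Z + p%:Z)%:~R) x erefl erefl.
have S0 := shift_value (leq_subr p (2 * l)) hq hx.
have S1 := shift_value hp2 hq hx.
pose B b := \sum_(r < 5) \sum_(j < 5) (A q%:Z j * Mc 2 r j x) *: shift_term (tidx p b) (q%:Z + 2 - m - j%:Z) x r.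
pose Q t := gam p t *: tsh sigma i l' (absz (p%:Z + m + 2 * (t%:Z - 1))%R) q x.
transitivity (s *: (1 *: B 0%N + kap *: B 1%N)).
  by congr (_ *: _); exact: (sum2n (fun b => tsgn p b *: B b)).
transitivity (Q 0%N + Q 1%N + Q 2%N); last by apply: esym; exact: (sum3n Q).
have E0 : B 0%N = _ := S0; have E1 : B 1%N = _ := S1.
have q0 : Q 0%N = (s * (k%:Z + l%:Z - p%:Z)%:~R * A (w (-1)) 4) *: tsh sigma i l' (absz (p%:Z + m + 2 * (-1))%R) q x.
  rewrite /Q (_ : 0%N%:Z - 1 = -1)//; congr (_ *: _); rewrite /gam /= /gamN1; congr (_ * Acoef _ _ _ _ _); rewrite /w; lia.
have q1 : Q 1%N = (s * - ((nu + rho R + (l%:Z * m)%:~R - 3 + (m * (m + 1))%:~R / 2) / 3) * A (w 0) 2) *: tsh sigma i l' (absz (p%:Z + m + 2 * 0)%R) q x.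
  rewrite /Q (_ : 1%N%:Z - 1 = 0)//; congr (_ *: _); rewrite /gam /= /gam0.
  have -> : 2 * l%:Z - p%:Z + m = w 0 by rewrite /w; lia.
  by congr (_ * _); rewrite /s exprS; field.
have q2 : Q 2%N = (s * (k%:Z - l%:Z + p%:Z)%:~R * A (w 1) 0) *: tsh sigma i l' (absz (p%:Z + m + 2 * 1)%R) q x.
  rewrite /Q (_ : 2%N%:Z - 1 = 1)//; congr (_ *: _); rewrite /gam /= /gam1; congr (_ * Acoef _ _ _ _ _); rewrite /w; lia.
rewrite q0 q1 q2 -P0 -P1 -P2 E0 E1.
rewrite -[(4 - 4)%N]/0%N -[(4 - 2)%N]/2%N -[(4 - 0)%N]/4%N.
have -> : p%:Z + m + 2 * (-1) = p%:Z + m - 2 by lia.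
have -> : p%:Z + m + 2 * 0 = p%:Z + m by lia.
have -> : p%:Z + m + 2 * 1 = p%:Z + m + 2 by lia.
have -> : (2 * l - p)%N%:Z + m - 2 = w 1 by rewrite /w; lia.
have -> : (2 * l - p)%N%:Z + m + 2 = w (-1) by rewrite /w; lia.
have -> : (2 * l - p)%N%:Z + m = w 0 by rewrite /w; lia.
have -> : (2 * l - p)%N%:Z - l%:Z - 2 = w 1 - l'%:Z by rewrite /w; lia.
have -> : (2 * l - p)%N%:Z - l%:Z + 2 = w (-1) - l'%:Z by rewrite /w; lia.
have -> : k%:Z - ((2 * l - p)%N%:Z - l%:Z) = k%:Z - l%:Z + p%:Z by lia.
have -> : k%:Z + ((2 * l - p)%N%:Z - l%:Z) = k%:Z + l%:Z - p%:Z by lia.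
have -> : (2 * l - p)%N%:Z - l%:Z = w 0 - l'%:Z by rewrite /w; lia.
have -> : k%:Z - (p%:Z - l%:Z) = k%:Z + l%:Z - p%:Z by lia.
have -> : k%:Z + (p%:Z - l%:Z) = k%:Z - l%:Z + p%:Z by lia.
have -> : p%:Z - l%:Z - 2 = p%:Z + m - 2 - l'%:Z by lia.
have -> : p%:Z - l%:Z + 2 = p%:Z + m + 2 - l'%:Z by lia.
have -> : p%:Z - l%:Z = p%:Z + m - l'%:Z by lia.
apply: etrans (two_by_three _ _ _ _ _ _ _ _ _ _ _ _ _ _) _.
rewrite -!mulrA -/kap.
by rewrite ![kap * (_ * (_ * _))]mulrCA.
Qed.

End ShiftOnK.

(** * Lists of indices and the explicit matrix *)

Lemma plist_iota (c : nat) (d : bool) :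
  [seq p <- iota 0 (2 * c + d).+1 | odd p == d] = [seq (2 * a + d)%N | a <- iota 0 c.+1].
Proof.
elim: c => [|c IH]; first by case: d.
rewrite (_ : (2 * c.+1 + d).+1 = (2 * c + d).+1 + 2)%N; last by lia.
rewrite iotaD filter_cat IH -[in RHS](addn1 c.+1) [in RHS]iotaD map_cat !add0n; congr cat.
rewrite /=.
rewrite negbK (_ : odd (2 * c + d) = d) ?eqxx; last by lia.
by case: d {IH} => /=; congr [:: _]; lia.
Qed.

Lemma dsig_gt0 k l : (0 < dsig k l)%N -> (k <= l)%N.
Proof.
rewrite /dsig /plist; have [//|h] := leqP k l.
by rewrite (_ : (l.+1 - k)%N = 0%N)//; lia.
Qed.

Lemma plistE k l : (k <= l)%N ->
  plist k l = [seq (2 * a + odd (l - k))%N | a <- iota 0 (l - k)./2.+1].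
Proof.
move=> kl; rewrite -plist_iota /plist; congr [seq _ <- iota 0 _ | _].
by have := odd_double_half (l - k); lia.
Qed.

Lemma dsigE k l : (k <= l)%N -> dsig k l = (l - k)./2.+1.
Proof. by move=> kl; rewrite /dsig plistE// size_map size_iota. Qed.

Lemma pvalE k l a : (k <= l)%N -> (a < dsig k l)%N -> pval k l a = (2 * a + odd (l - k))%N.
Proof.
move=> kl; rewrite dsigE// => ha; rewrite /pval plistE// (nth_map 0%N) ?size_iota//.
by rewrite nth_iota.
Qed.

Lemma pval_hp k l a : (k <= l)%N -> (a < dsig k l)%N -> exists b, l = (k + pval k l a + 2 * b)%N.
Proof.
move=> kl ha; exists ((l - k)./2 - a)%N; rewrite pvalE//; move: ha; rewrite dsigE//.
by have := odd_double_half (l - k); lia.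
Qed.

Section ExplicitMatrix.
Variables (R : realType) (i : parabolic) (nu : R[i]) (k l : nat) (m : int).
Notation delta := (nat_of_bool (odd (l - k))).
Notation G := (gam i nu k l m).

Lemma lower_blockE (g : nat -> R[i]) d (a : 'I_d.+1) (b : 'I_d) :
  lower_block (Dmx g delta) d a b = g (2 * b + delta)%N *+ (a == b + 2 :> nat)%N.
Proof.
case: d a b => [|d] a b; first by case: b.
rewrite /lower_block castmxE /= mxE.
case: splitP => u eu; rewrite mxE; case: splitP => v ev; rewrite ?mxE; rewrite /= in eu ev;
  have hu := ltn_ord u; have hv := ltn_ord v.
- by have -> : (a == (b + 2)%N :> nat) = false by lia.
- by have -> : (a == (b + 2)%N :> nat) = false by lia.
- have -> : (a == (b + 2)%N :> nat) = (u == v) by rewrite -[RHS]/(u == v :> nat); lia.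
  by rewrite ev; case: eqP => [->|].
- by have -> : (a == (b + 2)%N :> nat) = false by lia.
Qed.

(** The three blocks are one sum over t, the diagonal number t being moved down by t rows. *)
Lemma explicit_mxE a b : explicit_mx i nu k l m a b =
  \sum_(t < 3) G (2 * b + delta)%N t *+ (a == b + t :> nat)%N.
Proof.
rewrite (sum3n (fun t => G (2 * b + delta)%N t *+ (a == b + t :> nat)%N)) /explicit_mx !mxE lower_blockE.
congr (_ + _ + _).
- rewrite castmxE mxE; case: splitP => u eu; rewrite ?mxE; rewrite /= in eu; have hu := ltn_ord u; have hb := ltn_ord b.
    set v := cast_ord _ b; have -> : (a == (b + 0)%N :> nat) = (u == v) by rewrite -[RHS]/(u == b :> nat); lia.
    by case: eqP => [->|].
  by have -> : (a == (b + 0)%N :> nat) = false by lia.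
- case: splitP => u eu; have hu := ltn_ord u; rewrite ?mxE.
    have {}eu : a = u :> nat := eu; by have -> : (a == (b + 1)%N :> nat) = false by lia.
  have {}eu : a = (1 + u)%N :> nat := eu.
  have -> : (a == (b + 1)%N :> nat) = (u == b) by rewrite -[RHS]/(u == b :> nat); lia.
  by case: eqP => [->|].
Qed.

Hypothesis hm : -2 <= m <= 2.
Hypothesis hlm : 0 <= l%:Z + m.
Notation l' := (lplus l m).
Hypothesis kl : (k <= l)%N.
Hypothesis kl' : (k <= l')%N.

(** The defining property of n. With p = 2 b + delta, the target p + m + 2 (t - 1) becomes 2 (b + t
    - n) + delta', delta' being the parity of l' - k: n counts the rows above the first admissible
    target. *)
Lemma nzeroE : 2 * (nzero k l m)%:Z + (odd (l - k))%:Z + m - 2 = (odd (l' - k))%:Z.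
Proof.
have el := lplusE hm hlm; have hk : (l' - k)%N%:Z = (l - k)%N%:Z + m by lia.
by have [E|[E|[E|[E|E]]]] := m_cases hm hlm; rewrite /nzero E /= in hk *; case: (boolP (odd (l - k))); rewrite ?E /=; lia.
Qed.

Lemma nzero_dsig : (nzero k l m + dsig k l' = (dsig k l).+1)%N.
Proof.
have el := lplusE hm hlm; have := nzeroE; rewrite !dsigE//.
by have := odd_double_half (l - k); have := odd_double_half (l' - k); lia.
Qed.

End ExplicitMatrix.

(** * The matrix of the operators in the induced bases *)

Section Assembly.
Variables (R : realType) (i : parabolic) (nu : R[i]) (k : nat) (sigma : discrete_series R k)
  (mu : haar_SO3 R) (pi : principal_series i nu sigma mu) (l : nat) (m : int).
Hypothesis hm : -2 <= m <= 2.
Hypothesis hlm : 0 <= l%:Z + m.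
Notation l' := (lplus l m).
Hypothesis kl : (k <= l)%N.
Hypothesis kl' : (k <= l')%N.
Notation n0 := (nzero k l m).

(** The explicit matrix without its first n rows: row e corresponds to row n + e. *)
Definition Gam_mx : 'M[R[i]]_(dsig k l', dsig k l) := \matrix_(e, b)
  \sum_(t < 3) gam i nu k l m (pval k l b) t *+ (n0 + e == b + t :> nat)%N.

(** Each t contributes to the single row e = b + t - n; when that row does not exist, the
    coefficient is 0 by [gam_range]. *)
Lemma Gam_mx_sum (V : lmodType R[i]) (f : nat -> V) (b : 'I_(dsig k l)) :
  \sum_(t < 3) gam i nu k l m (pval k l b) t *: f (absz ((pval k l b)%:Z + m + 2 * (t%:Z - 1))%R)
  = \sum_e Gam_mx e b *: f (pval k l' e).
Proof.
have el := lplusE hm hlm; have hn := nzeroE hm hlm kl kl'.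
have hb := pvalE kl (ltn_ord b); have hp := pval_hp kl (ltn_ord b).
transitivity (\sum_(e < dsig k l') \sum_(t < 3) (gam i nu k l m (pval k l b) t *+ (n0 + e == b + t :> nat)%N) *: f (pval k l' e)); last first.
  by apply: eq_bigr => e _; rewrite mxE scaler_suml.
rewrite exchange_big /=; apply: eq_bigr => t _.
have [->|[p0 [a ha]]] := gam_range i nu hm hlm hp (ltn_ord t).
  by rewrite scale0r big1// => e _; rewrite mul0rn scale0r.
have d' := dsigE kl'; have od := odd_double_half (l' - k).
have he : (b + t - n0 < dsig k l')%N by rewrite d'; lia.
rewrite (bigD1 (Ordinal he))//= big1 ?addr0; last first.
  move=> e ne; have -> : (n0 + e == b + t :> nat)%N = false.
    by apply: contraNF ne => /eqP h; apply/eqP/val_inj => /=; lia.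
  by rewrite mulr0n scale0r.
have -> : (n0 + (b + t - n0) == b + t)%N by lia.
rewrite mulr1n (pvalE kl' he); congr (_ *: f _); lia.
Qed.

Lemma entry_T_mx (b : 'I_(dsig k l)) (c : int) : @entry (ps_space pi) _ (col b (T_mx pi l)) c = t_elz l pi (pval k l b) c.
Proof.
case: c => c; rewrite /entry /t_elz //.
case: insubP => [u _ eu|hc]; last by rewrite ifF//; lia.
have hc : (c < (2 * l).+1)%N by rewrite -eu; exact: ltn_ord.
by rewrite !mxE ifT; [congr t_el; exact: eu | lia].
Qed.

Lemma C_op_T_mx (b : 'I_(dsig k l)) (q : 'I_(2 * l').+1) :
  \sum_(j < 5) Acoef R (2 * l)%N%:Z m q j *: cdact (ps_act pi) (Xp R j) (t_elz l pi (pval k l b) (q%:Z + 2 - m - j%:Z))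
  = \sum_e Gam_mx e b *: t_el pi l' (pval k l' e) q.
Proof.
have hq : (q <= 2 * l')%N by rewrite -ltnS.
rewrite (C_entry hm hlm pi (pval_hp kl (ltn_ord b)) hq).
exact: (Gam_mx_sum (fun p => t_el pi l' p q)).
Qed.

Lemma diffable_t_elz p c : (exists a, l = (k + p + 2 * a)%N) -> diffable (t_elz l pi p c).
Proof.
move=> hp; rewrite /t_elz; case: ifP => hc; last exact: diffable0.
have hq : (absz c <= 2 * l)%N by lia.
have [F hF FK] := @tsh_extends R k sigma i l p (absz c) hp hq nu.
by rewrite (t_elE pi hp hq hF FK); exact: diffable_incl.
Qed.

Lemma T_hom_sum L p (I : finType) (c : I -> R[i]) (f : I -> hpoly R (2 * L)) :
  T_hom pi p (\sum_j c j *: f j) = \sum_j c j *: T_hom pi p (f j).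
Proof.
rewrite /T_hom; under eq_bigr do rewrite vdual1_sum scaler_suml.
rewrite exchange_big /=; apply: eq_bigr => j _; rewrite scaler_sumr.
by apply: eq_bigr => q _; rewrite scalerA.
Qed.

Lemma T_hom_vq L p c : T_hom pi p (vq R (2 * L) c) = t_elz L pi p c.
Proof.
rewrite /T_hom /t_elz; under eq_bigr do rewrite vdual1_vqz.
case: ifP => hc; last first.
  rewrite big1// => q _; rewrite (_ : (q%:Z == c) = false) ?scale0r//.
  by have := ltn_ord q; lia.
have hq : (absz c < (2 * L).+1)%N by lia.
rewrite (bigD1 (Ordinal hq))//= big1 ?addr0 => [|q ne].
  by rewrite (_ : (_ == _)) ?scale1r//=; lia.
rewrite (_ : (q%:Z == c) = false) ?scale0r//; apply: contraNF ne => /eqP h.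
by apply/eqP/val_inj => /=; lia.
Qed.

(** Expanding w in the basis v_q and exchanging sums, which uses linearity of [cdact] on
    differentiable vectors, leaves for each q the sum already computed for the entries of C. *)
Lemma Gam_T_hom (b : 'I_(dsig k l)) (w : hpoly R (2 * l')) :
  Gam (T_hom pi (pval k l b)) w = \sum_e Gam_mx e b *: T_hom pi (pval k l' e) w.
Proof.
have hp := pval_hp kl (ltn_ord b).
transitivity (\sum_(j < 5) \sum_(q < (2 * l').+1) (vdual P1 q w * Acoef R (2 * l)%N%:Z m q j) *:
   cdact (ps_act pi) (Xp R j) (t_elz l pi (pval k l b) (q%:Z + 2 - m - j%:Z))).
  apply: eq_bigr => j _; rewrite -cdact_sum; last by move=> q; exact: diffable_t_elz.
    congr cdact; rewrite ffunE T_hom_sum; apply: eq_bigr => q _.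
    rewrite -scalerA; congr (_ *: _).
    have := T_hom_sum (pval k l b) (fun _ : 'I_1 => Acoef R (2 * l)%N%:Z m q j) (fun _ : 'I_1 => vq R (2 * l) (q%:Z + 2 - m - j%:Z)).
    by rewrite !big_ord1 T_hom_vq.
  by apply: tr_Xp.
rewrite exchange_big /=.
transitivity (\sum_(q < (2 * l').+1) vdual P1 q w *: \sum_e Gam_mx e b *: t_el pi l' (pval k l' e) q).
  by apply: eq_bigr => q _; rewrite -C_op_T_mx scaler_sumr; apply: eq_bigr => j _; rewrite scalerA.
under eq_bigr do rewrite scaler_sumr.
rewrite exchange_big /=; apply: eq_bigr => e _; rewrite /T_hom scaler_sumr.
by apply: eq_bigr => q _; rewrite !scalerA mulrC.
Qed.

(** At w = v_q, the difference of two representing matrices gives a linear relation between the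
    elementary functions, valid for all q at once; [t_el_indep] excludes it. *)
Lemma represents_unique (hk : (0 < k)%N) (A : 'M[R[i]]_(dsig k l', dsig k l)) :
  represents_Gam pi A <-> A = Gam_mx.
Proof.
split=> [hA|->]; last exact: Gam_T_hom.
apply/matrixP => e b; apply/eqP; rewrite -subr_eq0; apply/eqP.
apply: (@t_el_indep R i nu k sigma mu pi l' _ (fun a : 'I_(dsig k l') => pval k l' a)
   (fun a => A a b - Gam_mx a b)) => //.
- by move=> x y; rewrite !pvalE// => h; apply: val_inj => /=; lia.
- by move=> a; exact: pval_hp.
move=> q; have := hA b (vq R (2 * l') q%:Z); rewrite Gam_T_hom.
have hq : (q <= 2 * l')%N by rewrite -ltnS.
have E e' : T_hom pi (pval k l' e') (vq R (2 * l') q%:Z) = t_el pi l' (pval k l' e') q.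
  by rewrite T_hom_vq /t_elz ifT//; lia.
under eq_bigr do rewrite E. under [in X in _ = X -> _]eq_bigr do rewrite E.
move=> h; under eq_bigr do rewrite scalerBl.
by rewrite sumrB h subrr.
Qed.

Lemma C_op_mx_T : C_op_mx m (T_mx pi l) = mulmx_scal (T_mx pi l') Gam_mx.
Proof.
apply/matrixP => q b; rewrite !mxE.
under eq_bigr do rewrite entry_T_mx.
rewrite C_op_T_mx; apply: eq_bigr => e _; by rewrite [T_mx _ _ _ _]mxE.
Qed.

(** The first n rows of the explicit matrix belong to negative targets p', for which [gam] is 0. *)
Lemma col_mx_Gam_mx (e : (n0 + dsig k l' = (dsig k l).+1)%N) :
  castmx (e, erefl (dsig k l)) (col_mx (0 : 'M[R[i]]_(n0, dsig k l)) Gam_mx) = explicit_mx i nu k l m.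
Proof.
have hn := nzeroE hm hlm kl kl'.
apply/matrixP => a b; rewrite castmxE explicit_mxE cast_ord_id mxE.
have hb := pvalE kl (ltn_ord b); have hp := pval_hp kl (ltn_ord b).
case: splitP => u eu; have {}eu : a = _ :> nat := eu; last first.
  by rewrite mxE; apply: eq_bigr => t _; rewrite hb eu.
rewrite mxE big1// => t _; rewrite -hb.
have [->|[p0 _]] := gam_range i nu hm hlm hp (ltn_ord t); first by rewrite mul0rn.
have -> : (a == b + t :> nat)%N = false; last by rewrite mulr0n.
by have := ltn_ord u; lia.
Qed.

End Assembly.

Theorem theorem6p5 (R : realType) (i : parabolic) (nu : R[i]) (k : nat) (hk : (2 <= k)%N)
    (sigma : discrete_series R k) (mu : haar_SO3 R)
    (pi : principal_series i nu sigma mu)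
    (l : nat) (m : int) (hm : -2 <= m <= 2) (hlm : 0 <= l%:Z + m)
    (hd : (0 < dsig k l)%N) (hd' : (0 < dsig k (lplus l m))%N) :
  exists RG : 'M[R[i]]_(dsig k (lplus l m), dsig k l),
    [/\ forall A : 'M[R[i]]_(dsig k (lplus l m), dsig k l),
          represents_Gam pi A <-> A = RG,
        C_op_mx m (T_mx pi l) = mulmx_scal (T_mx pi (lplus l m)) RG
      & exists e : (nzero k l m + dsig k (lplus l m) = (dsig k l).+1)%N,
          castmx (e, erefl (dsig k l))
            (col_mx (0 : 'M[R[i]]_(nzero k l m, dsig k l)) RG)
          = explicit_mx i nu k l m].
Proof.
have kl := dsig_gt0 hd; have kl' := dsig_gt0 hd'.
exists (Gam_mx i nu k l m); split.
- by move=> A; apply: represents_unique => //; exact: ltnW.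
- exact: C_op_mx_T.
- by exists (nzero_dsig hm hlm kl kl'); exact: col_mx_Gam_mx.
Qed.
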